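(* Let $h$, $g$, $V$ be as in the context, let $\sigma=0$, i.e. $H(x,p,M,m,\theta)=\frac{|p|^2}{2}-V(x,m,\theta)$, and suppose that (h-regularity), ($h$-Lipschitz), (g-structure) and (V1), (V2), (V3), all formulated in the context, hold. If $d\ge8$, assume further that the exponent $\alpha$ in (V2) satisfies $\alpha>\frac{d-4}{2}$. Then there exists a weak solution $(m,u)\in\mathcal{D}'(\mathbb{T}^d)\times\mathcal{D}'(\mathbb{T}^d)$ with $m\ge0$, $(m^{\frac{\alpha+1}{2}},u)\in W^{1,2}(\mathbb{T}^d)\times W^{1,2}(\mathbb{T}^d)$ and $\int_{\mathbb{T}^d}m\,dx=1$, to $$-u-\frac{|Du|^2}{2}+V(x,m,h(m))=0,\qquad m-\operatorname{div}(mDu)-1=0,$$ such that $-u-\frac{|Du|^2}{2}+V(x,m,h(m))\ge0$ in the sense of distributions and $$\begin{cases}\Big(-u-\frac{|Du|^2}{2}+V(x,m,h(m))\Big)m=0,\\ m-\operatorname{div}(mDu)-1=0,\end{cases}$$ a.e. in $\mathbb{T}^d$.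
   Context: Setting. $\mathbb{T}^d=\mathbb{R}^d/\mathbb{Z}^d$, $d\ge1$; $\mathbb{E}$ is a fixed set, either $(0,\infty)$ or $[0,\infty)$. $\mathcal{M}_{ac}(\mathbb{T}^d)$ is the space of positive measures on $\mathbb{T}^d$ absolutely continuous with respect to Lebesgue measure; such a measure is identified with its density $m\in L^1(\mathbb{T}^d)$, $m\ge0$ a.e. $h:\mathcal{M}_{ac}(\mathbb{T}^d)\to C(\mathbb{T}^d)$ is a (possibly nonlinear) operator ($h(m)$ is its value at the measure with density $m$), $g:\mathbb{T}^d\times\mathbb{E}\times\mathbb{R}\to\mathbb{R}$ is continuous, $V:\mathbb{T}^d\times\mathbb{E}\times\mathbb{R}\to\mathbb{R}$ is $C^\infty$. $V(x,m,h(m))$ denotes $x\mapsto V(x,m(x),h(m)(x))$, similarly for $g,g_1,g_2$. Repeated indices are summed over $\{1,\dots,d\}$. Conditions over $m\in\mathcal{M}_{ac}(\mathbb{T}^d)$ involving $g$ or $V$ are understood for densities with values in $\mathbb{E}$ a.e. Weak solution. For $(\eta,v)\in C^\infty(\mathbb{T}^d;\mathbb{E})\times C^\infty(\mathbb{T}^d)$ let $A(\eta,v)$ be the pair with components $-v-\frac{|Dv|^2}{2}+V(x,\eta,h(\eta))$ and $\eta-\operatorname{div}(\eta Dv)-1$. A pair $(m,u)\in\mathcal{D}'(\mathbb{T}^d)\times\mathcal{D}'(\mathbb{T}^d)$ with $m\ge0$ is a weak solution of the system if $\langle(\eta,v)-(m,u),A(\eta,v)\rangle\ge0$ for all $(\eta,v)\in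 C^\infty(\mathbb{T}^d;\mathbb{E})\times C^\infty(\mathbb{T}^d)$ (distributional duality). The a.e. equality $m-\operatorname{div}(mDu)-1=0$ means that the distribution $\operatorname{div}(mDu)$ is represented by a function and the identity holds a.e. (h-regularity) For all $\kappa>\frac d2+1$: $h(m)\in W^{\kappa,2}(\mathbb{T}^d)$ for every $m\in W^{\kappa,2}(\mathbb{T}^d)$ ($m\geq 0$), and $m\mapsto h(m)$ is a Fréchet differentiable map from (nonnegative elements of) $W^{\kappa,2}(\mathbb{T}^d)$ to $W^{\kappa,2}(\mathbb{T}^d)$. ($h$-Lipschitz) There is $C>0$ with $\|h(m)-h(\bar m)\|_{L^1(\mathbb{T}^d)}\le C\|m-\bar m\|_{L^1(\mathbb{T}^d)}$ for all $m,\bar m\in\mathcal{M}_{ac}(\mathbb{T}^d)$. (g-structure) (1) There are functions $g_1,g_2$ with $g=g_1+g_2$ on $\mathbb{T}^d\times\mathbb{E}\times\mathbb{R}$ and $g_2(x,m(x),h(m)(x))\ge0$ for all $m\in\mathcal{M}_{ac}(\mathbb{T}^d)$. (2) There is $c>0$ with $\int_{\mathbb{T}^d} g_2(x,m,h(m))\,dx\le c\,(1+\int_{\mathbb{T}^d} m\,dx)$ for all $m\in\mathcal{M}_{ac}(\mathbb{T}^d)$. (3) For all $\delta>0$ there is $C_\delta>0$ with $\max\{\int_{\mathbb{T}^d} g_1(x,m,h(m))\,dx,\int_{\mathbb{T}^d} m\,dx\}\le\delta\int_{\mathbb{T}^d} m g_1(x,m,h(m))\,dx+C_\delta$ for all $m\in\mathcal{M}_{ac}(\mathbb{T}^d)$.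 (4) There is $R\ge0$ with $\int_{\mathbb{T}^d} mg_1(x,m,h(m))\,dx\ge-R$ for all $m\in\mathcal{M}_{ac}(\mathbb{T}^d)$. (V1) There are constants $c_1,c_2,c_3>0$ such that, with the given continuous function $g:\mathbb{T}^d\times\mathbb{E}\times\mathbb{R}\to\mathbb{R}$ (the same $g=g_1+g_2$ as in (g-structure)): $V(x,m,\theta)\ge c_1g(x,m,\theta)-\frac1{c_2}$ for all $(x,m,\theta)\in\mathbb{T}^d\times\mathbb{E}\times\mathbb{R}$; $\int_{\mathbb{T}^d}V(x,m,h(m))\,dx\le c_2+c_3\int_{\mathbb{T}^d}g(x,m,h(m))\,dx$ for all $m\in\mathcal{M}_{ac}(\mathbb{T}^d)$; and $\int_{\mathbb{T}^d}[V(x,\eta,h(\eta))-V(x,\bar\eta,h(\bar\eta))](\eta-\bar\eta)\,dx\ge0$ for all $\eta,\bar\eta\in C^\infty(\mathbb{T}^d;\mathbb{E})$. (V2) There are constants $\alpha>0$, $\kappa_1>0$ such that $g_1(x,m,\theta)\ge\frac1{\kappa_1}m^\alpha-\kappa_1$ for all $(x,m,\theta)\in\mathbb{T}^d\times\mathbb{E}\times\mathbb{R}$, and $\int_{\mathbb{T}^d}(V(x,\eta,h(\eta)))_{x_i}\eta_{x_i}\,dx\ge\frac1{\kappa_1}\int_{\mathbb{T}^d}\eta^{\alpha-1}|D\eta|^2\,dx-\kappa_1$ for all $\eta\in C^\infty(\mathbb{T}^d;\mathbb{E})$. (V3) With the same $\alpha,\kappa_1$: $V(x,m,\theta)\le\kappa_1(1+m^\alpha+|\theta|)$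 for all $(x,m,\theta)\in\mathbb{T}^d\times\mathbb{E}\times\mathbb{R}$. *)

(* Defs.v *)
From HB Require Import structures.
From mathcomp Require Import all_boot all_order all_algebra.
From mathcomp Require Import all_classical all_reals all_analysis.
Set Implicit Arguments.
Unset Strict Implicit.
Unset Printing Implicit Defensive.
Import Order.TTheory GRing.Theory Num.Theory.
Import numFieldNormedType.Exports.
Local Open Scope classical_set_scope.
Local Open Scope ring_scope.

(* Functions on the torus R^d / Z^d are Z^d-periodic functions on 'rV[R]_d,    *)
(* and the Lebesgue measure of the torus is the Lebesgue measure of the unit   *)
(* cube [0,1]^d, a fundamental domain.                                         *)

(* The Borel sigma-algebra of 'rV[R]_d, generated by the coordinates. *)
Section row_measurable.
Context {R : realType} {d : nat}.

Let coord (i : 'I_d) (x : 'rV[R]_d) : R := x ord0 i.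

Let row_set0 : g_sigma_preimage coord set0.
Proof. exact: sigma_algebra0. Qed.

Let row_setC A : g_sigma_preimage coord A -> g_sigma_preimage coord (~` A).
Proof. exact: sigma_algebraC. Qed.

Let row_bigcup (F : (set 'rV[R]_d)^nat) :
  (forall i, g_sigma_preimage coord (F i)) ->
  g_sigma_preimage coord (\bigcup_i (F i)).
Proof. exact: sigma_algebra_bigcup. Qed.

HB.instance Definition _ :=
  @isMeasurable.Build (measure_tuple_display default_measure_display)
    'rV[R]_d (g_sigma_preimage coord) row_set0 row_setC row_bigcup.

Lemma measurable_coord (j : 'I_d) :
  measurable_fun setT (fun y : 'rV[R]_d => y ord0 j).
Proof.
move=> _ B mB; rewrite setTI; apply: sub_sigma_algebra.
rewrite -bigcup_seq; exists j => /=; first by rewrite mem_index_enum.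
by exists B => //; rewrite setTI.
Qed.

Lemma measurable_fun_rowP dX (X : measurableType dX) (f : X -> 'rV[R]_d) :
  (forall i, measurable_fun setT (fun x => f x ord0 i)) ->
  measurable_fun setT f.
Proof.
move=> mf; apply: (@measurability _ _ _ _ _ _
  (\big[setU/set0]_(i < d) preimage_set_system setT (coord i) measurable)) => //.
move=> _ [A + <-]; rewrite -bigcup_seq => -[i /= _ [B mB <-]].
by rewrite !setTI; have := mf i measurableT B mB; rewrite setTI.
Qed.

End row_measurable.

Section torus_measure.
Context {R : realType}.

Definition row_cons d (z : measurableTypeR R * 'rV[R]_d) : 'rV[R]_d.+1 :=
  row_mx (const_mx z.1 : 'rV_1) z.2.

Lemma measurable_row_cons d : measurable_fun setT (@row_cons d).
Proof.
apply: measurable_fun_rowP => i; rewrite /row_cons.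
case: (@split_ordP 1 d i) => j ->.
  rewrite (_ : (fun z => _) = fst); first exact: measurable_fst.
  by apply/funext => z; rewrite (@row_mxEl _ 1 1 d) mxE.
rewrite (_ : (fun z => _) = (fun z : measurableTypeR R * 'rV[R]_d => z.2 ord0 j)).
  exact: (measurableT_comp (measurable_coord j) measurable_snd).
by apply/funext => z; rewrite (@row_mxEr _ 1 1 d).
Qed.

HB.instance Definition _ d :=
  isMeasurableFun.Build _ _ _ _ (@row_cons d) (@measurable_row_cons d).

(* d-fold product of the Lebesgue measure on [0,1]. *)
Fixpoint torus_measure (d : nat) : probability 'rV[R]_d R :=
  if d is d'.+1 return probability 'rV[R]_d R then
    distribution (uniform_prob (@ltr01 R) \x torus_measure d')%E (@row_cons d')
  else dirac (0 : 'rV[R]_0).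

End torus_measure.

Section smooth.
Context {R : realType} {W : normedModType R}.

Definition iter_derive (vs : seq W) (f : W -> R) : W -> R :=
  foldr (fun v (F : W -> R) x => 'D_v F x) f vs.

(* Used with W finite-dimensional and U open. *)
Definition smooth_on (U : set W) (f : W -> R) : Prop :=
  forall vs x, U x ->
    {for x, continuous (iter_derive vs f)} /\
    forall v, derivable (iter_derive vs f) x v.

(* Smoothness on a set that need not be open: existence of a smooth extension *)
(* to an open neighbourhood (for open A this is smooth_on A f).               *)
Definition smooth_up_to (A : set W) (f : W -> R) : Prop :=
  exists (U : set W) (F : W -> R),
    [/\ open U, A `<=` U, smooth_on U F & forall x, A x -> F x = f x].

End smooth.

Section torus.
Context {R : realType} {d : nat}.
Local Notation Rd := 'rV[R]_d.
Local Notation mu := (@torus_measure R d).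
Implicit Types (f u v m eta phi : Rd -> R) (E : set R).

Definition basis_vec (i : 'I_d) : Rd := delta_mx ord0 i.

Definition periodic f : Prop := forall x i, f (x + basis_vec i) = f x.

Definition partial (s : seq 'I_d) f : Rd -> R :=
  iter_derive (map basis_vec s) f.

Definition Cinf f : Prop := periodic f /\ smooth_on setT f.

Definition CinfE E f : Prop := Cinf f /\ forall x, E (f x).

Definition L1 f : Prop := periodic f /\ mu.-integrable setT (EFin \o f).

(* Extended-real integral over the torus, so that the value +oo is allowed. *)
Definition Int f : \bar R := (\int[mu]_x (f x)%:E)%E.

(* Densities of elements of M_ac. *)
Definition Mac m : Prop := L1 m /\ {ae mu, forall x, 0 <= m x}.

(* Densities with values in E; a class that is E-valued a.e. has a            *)
(* representative that is E-valued everywhere.                                *)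
Definition MacE E m : Prop := L1 m /\ forall x, E (m x).

Definition is_weak_partial (s : seq 'I_d) u v : Prop :=
  [/\ L1 u, L1 v &
      forall phi, Cinf phi ->
        \int[mu]_x (u x * partial s phi x) =
        (-1) ^+ size s * \int[mu]_x (v x * phi x)].

(* The weak derivative, unique up to a.e. equality when it exists. *)
Definition weak_partial (s : seq 'I_d) u : Rd -> R :=
  xget (fun=> 0) [set v | is_weak_partial s u v].

Definition weak_grad u (i : 'I_d) : Rd -> R := weak_partial [:: i] u.

(* Euclidean distance from z to Z^d. *)
Definition torus_dist (z : Rd) : R :=
  Num.sqrt (\sum_(i < d)
    (inf (range (fun n : int => `|z ord0 i - n%:~R|))) ^+ 2).

(* Squared Gagliardo seminorm of order s, 0 < s < 1. *)
Definition gagliardo (s : R) (v : Rd -> R) : \bar R :=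
  (\int[mu \x mu]_z
     ((v z.1 - v z.2) ^+ 2 /
        (torus_dist (z.1 - z.2)) `^ (d%:R + 2 * s))%R%:E)%E.

(* Squared W^{kappa,2} norm, kappa >= 0: with k the integer part of kappa, the *)
(* L^2 norms of the tensors D^j u, j <= k, plus, for fractional kappa, the     *)
(* Gagliardo seminorm of D^k u (Sobolev-Slobodeckij).                          *)
Definition sobolev_sqnorm (kappa : R) u : \bar R :=
  let k := Num.truncn kappa in
  (\sum_(j < k.+1) \sum_(s : j.-tuple 'I_d)
       Int (fun x => (weak_partial s u x ^+ 2)%R) +
   if (kappa == k%:R)%R then 0
   else \sum_(s : k.-tuple 'I_d) gagliardo (kappa - k%:R)%R (weak_partial s u))%E.

Definition sobolev (kappa : R) u : Prop :=
  [/\ L1 u,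
      forall s : seq 'I_d, (size s <= Num.truncn kappa)%N ->
        exists v, is_weak_partial s u v
    & (sobolev_sqnorm kappa u < +oo)%E].

Definition sobolev_norm (kappa : R) u : R :=
  Num.sqrt (fine (sobolev_sqnorm kappa u)).

Definition sobolev_nonneg (kappa : R) m : Prop :=
  sobolev kappa m /\ {ae mu, forall x, 0 <= m x}.

Definition is_operator (h : (Rd -> R) -> Rd -> R) : Prop :=
  (forall m, Mac m -> periodic (h m) /\ continuous (h m)) /\
  (forall m m', Mac m -> Mac m' ->
     {ae mu, forall x, m x = m' x} -> h m = h m').

(* Frechet differentiability at m relative to the cone of nonnegative         *)
(* elements of W^{kappa,2}, with a bounded linear L : W^{kappa,2} ->          *)
(* W^{kappa,2} (well defined on a.e.-classes, being bounded).                 *)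
Definition frechet_at (kappa : R) (h : (Rd -> R) -> Rd -> R) m : Prop :=
  exists L : (Rd -> R) -> Rd -> R,
  [/\ forall u, sobolev kappa u -> sobolev kappa (L u),
      forall (a : R) u v, sobolev kappa u -> sobolev kappa v ->
        {ae mu, forall x, L (fun y => a * u y + v y) x = a * L u x + L v x},
      exists C : R, forall u, sobolev kappa u ->
        sobolev_norm kappa (L u) <= C * sobolev_norm kappa u
    & forall eps : R, 0 < eps -> exists2 delta : R, 0 < delta &
        forall m', sobolev_nonneg kappa m' ->
          sobolev_norm kappa (m' \- m) <= delta ->
          sobolev_norm kappa ((h m' \- h m) \- L (m' \- m)) <=
            eps * sobolev_norm kappa (m' \- m)].

Definition h_regularity (h : (Rd -> R) -> Rd -> R) : Prop :=
  forall kappa : R, d%:R / 2 + 1 < kappa ->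
    (forall m, sobolev_nonneg kappa m -> sobolev kappa (h m)) /\
    (forall m, sobolev_nonneg kappa m -> frechet_at kappa h m).

Definition h_lipschitz (h : (Rd -> R) -> Rd -> R) : Prop :=
  exists2 C : R, 0 < C & forall m m', Mac m -> Mac m' ->
    (Int (fun x => `|h m x - h m' x|%R) <=
       C%:E * Int (fun x => `|m x - m' x|%R))%E.

Definition dom E : set (Rd * R * R) := [set p | E p.1.2].

Definition uncurry3 (F : Rd -> R -> R -> R) (p : Rd * R * R) : R :=
  F p.1.1 p.1.2 p.2.

Definition periodic3 E (F : Rd -> R -> R -> R) : Prop :=
  forall (t theta : R), E t -> periodic (fun x => F x t theta).

Definition continuous3 E (F : Rd -> R -> R -> R) : Prop :=
  periodic3 E F /\ {within dom E, continuous (uncurry3 F)}.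

Definition smooth3 E (F : Rd -> R -> R -> R) : Prop :=
  periodic3 E F /\ smooth_up_to (dom E) (uncurry3 F).

Definition along (F : Rd -> R -> R -> R) (h : (Rd -> R) -> Rd -> R) m :
  Rd -> R := fun x => F x (m x) (h m x).

Definition g_structure E (h : (Rd -> R) -> Rd -> R)
    (g g1 g2 : Rd -> R -> R -> R) : Prop :=
  [/\ [/\ periodic3 E g1, periodic3 E g2,
          (forall x t theta, E t -> g x t theta = g1 x t theta + g2 x t theta),
          (* implicit in writing the integrals below *)
          (forall m, MacE E m -> measurable_fun setT (along g1 h m) /\
                                 measurable_fun setT (along g2 h m))
        & forall m, MacE E m -> {ae mu, forall x, 0 <= along g2 h m x}],
      exists2 c : R, 0 < c & forall m, MacE E m ->
        (Int (along g2 h m) <= c%:E * (1 + Int m))%E,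
      forall delta : R, 0 < delta -> exists2 C : R, 0 < C &
        forall m, MacE E m ->
        (maxe (Int (along g1 h m)) (Int m) <=
           delta%:E * Int (fun x => (m x * along g1 h m x)%R) + C%:E)%E
    & exists2 r : R, 0 <= r & forall m, MacE E m ->
        ((- r)%:E <= Int (fun x => (m x * along g1 h m x)%R))%E].

Definition V1 E (h : (Rd -> R) -> Rd -> R) (g V : Rd -> R -> R -> R) : Prop :=
  (exists c1 c2 c3 : R,
    [/\ [/\ 0 < c1, 0 < c2 & 0 < c3],
        forall x t theta, E t -> c1 * g x t theta - c2^-1 <= V x t theta
      & forall m, MacE E m ->
          (Int (along V h m) <= c2%:E + c3%:E * Int (along g h m))%E]) /\
  (forall eta eta', CinfE E eta -> CinfE E eta' ->
     0 <= \int[mu]_x ((along V h eta x - along V h eta' x) *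
                      (eta x - eta' x))).

Definition V2 (alpha kappa1 : R) E (h : (Rd -> R) -> Rd -> R)
    (g1 V : Rd -> R -> R -> R) : Prop :=
  [/\ 0 < alpha, 0 < kappa1,
      forall x t theta, E t ->
        kappa1^-1 * t `^ alpha - kappa1 <= g1 x t theta
    & forall eta, CinfE E eta ->
        kappa1^-1 * \int[mu]_x (eta x `^ (alpha - 1) *
                      \sum_(i < d) (partial [:: i] eta x) ^+ 2) - kappa1 <=
        \int[mu]_x (\sum_(i < d) partial [:: i] (along V h eta) x *
                                 partial [:: i] eta x)].

Definition V3 (alpha kappa1 : R) E (V : Rd -> R -> R -> R) : Prop :=
  forall x t theta, E t -> V x t theta <= kappa1 * (1 + t `^ alpha + `|theta|).

Definition is_distribution (T : (Rd -> R) -> R) : Prop :=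
  (forall (a : R) phi psi, Cinf phi -> Cinf psi ->
     T (fun x => a * phi x + psi x) = a * T phi + T psi) /\
  (exists (N : nat) (C : R), forall phi (B : R), Cinf phi ->
     (forall s x, (size s <= N)%N -> `|partial s phi x| <= B) ->
     `|T phi| <= C * B).

Definition distr_ge0 (T : (Rd -> R) -> R) : Prop :=
  forall phi, Cinf phi -> (forall x, 0 <= phi x) -> 0 <= T phi.

Definition distr_of f : (Rd -> R) -> R := fun phi => \int[mu]_x (f x * phi x).

Definition A1 (V : Rd -> R -> R -> R) (h : (Rd -> R) -> Rd -> R) eta v :
  Rd -> R := fun x =>
  - v x - (\sum_(i < d) (partial [:: i] v x) ^+ 2) / 2 + along V h eta x.

Definition A2 eta v : Rd -> R := fun x =>
  eta x
  - \sum_(i < d) partial [:: i] (fun y => eta y * partial [:: i] v y) x - 1.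

Definition weak_solution E (V : Rd -> R -> R -> R) (h : (Rd -> R) -> Rd -> R)
    (m u : (Rd -> R) -> R) : Prop :=
  [/\ is_distribution m, is_distribution u, distr_ge0 m &
      forall eta v, CinfE E eta -> Cinf v ->
        0 <= (distr_of eta (A1 V h eta v) - m (A1 V h eta v)) +
             (distr_of v (A2 eta v) - u (A2 eta v))].

(* The distribution div F is represented by the function w. *)
Definition weak_div (F : 'I_d -> Rd -> R) (w : Rd -> R) : Prop :=
  [/\ forall i, L1 (F i), L1 w &
      forall phi, Cinf phi ->
        \int[mu]_x (w x * phi x) =
        - \sum_(i < d) \int[mu]_x (F i x * partial [:: i] phi x)].

(* -u - |Du|^2/2 + V(x,m,h(m)) with Du the weak gradient *)
Definition HJ (V : Rd -> R -> R -> R) (h : (Rd -> R) -> Rd -> R) m u :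
  Rd -> R := fun x =>
  - u x - (\sum_(i < d) (weak_grad u i x) ^+ 2) / 2 + along V h m x.

End torus.

(* Main.v *)
From Pilot Require Import Defs.
From HB Require Import structures.
From mathcomp Require Import all_boot all_order all_algebra.
From mathcomp Require Import all_classical all_reals all_analysis.
From mathcomp Require Import measurable_realfun.
From mathcomp Require Import ring lra.
Import Pilot.Defs.
Import Order.TTheory GRing.Theory Num.Theory.
Import numFieldNormedType.Exports.
Local Open Scope classical_set_scope.
Local Open Scope ring_scope.
Set Implicit Arguments.
Unset Strict Implicit.
Unset Printing Implicit Defensive.

(* The system is the variational inequality of a monotone operator, and it is
   solved by Galerkin approximation in spaces of trigonometric polynomials: m is
   bounded below by r > 0, all coefficients are bounded, and the finite-dimensional
   inequality is solved by a minimax argument and Minty's trick.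

   Constant densities as tests, together with (V1)-(V3), bound the integrals of
   m^(alpha+1) and (1+m)|Du|^2.  The averages of the translates of a solution by
   +-s e_i are admissible tests because the spaces and the constraints are translation
   invariant; letting s tend to 0 and using (V2) bounds the integrals of
   m^(alpha-1)|Dm|^2 and m|D^2 u|^2.  Testing the Fokker-Planck equation with (a
   regularisation of) log m then bounds the integral of (m-1) log m, which makes the
   limit density positive a.e. and hence E-valued even when E = (0,oo).

   Rellich's theorem for m^((alpha+1)/2) and for u gives strong limits of m and u and,
   by the Lipschitz property of h and the growth of V, of V(x,m,h(m)); Du and
   m^(1/2) Du converge weakly.  The Fokker-Planck equation, the sign of
   -u-|Du|^2/2+V and Minty's inequality pass to the limit.  Finally, let K_n be
   convolution with the kernel prod_i (1+cos(2 pi x_i))^n, normalised.  Testing the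
   Fokker-Planck equation with K_n u and using Jensen's inequality and Fatou's lemma
   bounds the integral of m(-u-|Du|^2/2+V) from above by the energy inequality, that is
   by 0; as the integrand is nonnegative, it vanishes a.e. *)

(** * Integration on a probability space *)

(** Two obstacles shape the proof. First, [log m] is the test that yields positivity, but it is not
    a trigonometric polynomial. So m and u get separate degrees and coefficient bounds. Once those
    of m and the lower bound r are fixed, all admissible densities and their first two derivatives
    obey a common bound, and one kernel approximates [log m] and its gradient for all of them; only
    then are the degree and the coefficient bound of u chosen, large enough to admit that
    convolution as a test. Secondly, Du converges only weakly, so the products m(-u-|Du|^2/2+V) of
    the approximations have no evident limit, and the limit u is not regular enough to be a test in
    its own Fokker-Planck equation. The energy inequality says that the integral of mV-u+m|Du|^2/2
    is at most 0, and formally this is the integral of m(-u-|Du|^2/2+V). The kernel makes the formal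
    step rigorous: it is positive, symmetric and commutes with derivatives, so it can be moved from
    u to m, and K_n m, being continuous, may multiply functions that are merely integrable. *)

Definition sq_integrable {dT : measure_display} {T : measurableType dT} {R : realType}
    (P : probability T R) (f : T -> R) :=
  measurable_fun setT f /\ P.-integrable setT (EFin \o (fun x => f x ^+ 2)).

Section prob_integral.
Context {dT : measure_display} {T : measurableType dT} {R : realType}.
Context {P : probability T R}.
Local Notation L2 := (sq_integrable P).
Implicit Types f g h : T -> R.

Local Notation mf f := (measurable_fun setT (f : T -> R)).
Local Notation itg f := (P.-integrable setT (EFin \o f)).

Lemma itg_mf f : itg f -> mf f.
Proof. by move=> /measurable_int/measurable_EFinP. Qed.

Lemma itg_aele f g : mf f -> {ae P, forall x, `|f x| <= g x} -> itg g -> itg f.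
Proof.
move=> mF fg ig; apply/integrableP; split; first exact/measurable_EFinP.
have mg := itg_mf ig.
apply: (@le_lt_trans _ _ (\int[P]_x `|(g x)%:E|)%E).
  apply: ae_ge0_le_integral => //.
  - by apply/measurableT_comp => //; exact/measurable_EFinP.
  - by apply/measurableT_comp => //; exact/measurable_EFinP.
  - apply: filterS fg => x fgx _ /=; rewrite lee_fin.
    exact: le_trans fgx (ler_norm _).
by move/integrableP : ig => [].
Qed.

Lemma itg_le f g : mf f -> (forall x, `|f x| <= g x) -> itg g -> itg f.
Proof. by move=> mF fg; apply: itg_aele => //; apply: aeW. Qed.

Lemma itg_cst (c : R) : itg (fun=> c).
Proof. exact: finite_measure_integrable_cst. Qed.

Lemma itg_bnd (B : R) f : mf f -> (forall x, `|f x| <= B) -> itg f.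
Proof. by move=> mF fB; apply: (itg_le mF fB); exact: itg_cst. Qed.

Lemma itg_aebnd (B : R) f : mf f -> {ae P, forall x, `|f x| <= B} -> itg f.
Proof. by move=> mF fB; apply: (itg_aele mF fB); exact: itg_cst. Qed.

Lemma itgD f g : itg f -> itg g -> itg (fun x => f x + g x).
Proof. by move=> F G; have := integrableD measurableT F G. Qed.

Lemma itgB f g : itg f -> itg g -> itg (fun x => f x - g x).
Proof. by move=> F G; have := integrableB measurableT F G. Qed.

Lemma itgN f : itg f -> itg (fun x => - f x).
Proof. by move=> F; have := integrableN F. Qed.

Lemma itgZ (k : R) f : itg f -> itg (fun x => k * f x).
Proof. by move=> F; have := integrableZl measurableT k F. Qed.

Lemma itgZr (k : R) f : itg f -> itg (fun x => f x * k).
Proof.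
by move=> F; under [X in _.-integrable _ (_ \o X)]eq_fun do rewrite mulrC;
  exact: itgZ.
Qed.

Lemma itg_abs f : itg f -> itg (fun x => `|f x|).
Proof. by move=> F; have := integrable_abse F. Qed.

Lemma itg_sum (I : Type) (s : seq I) (F : I -> T -> R) :
  (forall i, itg (F i)) -> itg (fun x => \sum_(i <- s) F i x).
Proof.
move=> iF; elim: s => [|a s IH].
  by under [X in _.-integrable _ (_ \o X)]eq_fun do rewrite big_nil; exact: itg_cst.
under [X in _.-integrable _ (_ \o X)]eq_fun do rewrite big_cons.
exact: itgD.
Qed.

Lemma itgM_bnd (B : R) f g : mf f -> (forall x, `|f x| <= B) -> itg g ->
  itg (fun x => f x * g x).
Proof.
move=> mF fB ig; apply: (@itg_le _ (fun x => B * `|g x|)).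
- by apply: measurable_funM => //; exact: itg_mf.
- by move=> x; rewrite normrM ler_wpM2r.
- by apply/itgZ/itg_abs.
Qed.

Lemma itgMr_bnd (B : R) f g : mf f -> (forall x, `|f x| <= B) -> itg g ->
  itg (fun x => g x * f x).
Proof.
move=> mF fB ig; under [X in _.-integrable _ (_ \o X)]eq_fun do rewrite mulrC.
exact: itgM_bnd fB ig.
Qed.

Lemma integralD_R f g : itg f -> itg g ->
  \int[P]_x (f x + g x) = \int[P]_x f x + \int[P]_x g x.
Proof. by move=> F G; exact: RintegralD. Qed.

Lemma integralB_R f g : itg f -> itg g ->
  \int[P]_x (f x - g x) = \int[P]_x f x - \int[P]_x g x.
Proof. by move=> F G; exact: RintegralB. Qed.

Lemma integralZ_R (k : R) f : itg f -> \int[P]_x (k * f x) = k * \int[P]_x f x.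
Proof. by move=> F; exact: RintegralZl. Qed.

Lemma integralN_R f : itg f -> \int[P]_x (- f x) = - \int[P]_x f x.
Proof.
move=> F; rewrite -mulN1r -integralZ_R//.
by apply: eq_Rintegral => x _; rewrite mulN1r.
Qed.

Lemma integral_cst_R (k : R) : \int[P]_x k = k.
Proof.
rewrite Rintegral_cst//; have /= -> : P [set: T] = 1%E := probability_setT P.
by rewrite mulr1.
Qed.

Lemma integral_sum_R (I : Type) (s : seq I) (F : I -> T -> R) :
  (forall i, itg (F i)) ->
  \int[P]_x (\sum_(i <- s) F i x) = \sum_(i <- s) \int[P]_x F i x.
Proof.
move=> iF; elim: s => [|a s IH].
  by rewrite big_nil; under eq_Rintegral do rewrite big_nil; rewrite integral_cst_R.
rewrite big_cons -IH -integralD_R//; last exact: itg_sum.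
by apply: eq_Rintegral => x _; rewrite big_cons.
Qed.

Lemma eint_fin f : itg f -> (\int[P]_x (f x)%:E)%E = (\int[P]_x f x)%:E.
Proof. by move=> F; rewrite fineK//; exact: integrable_fin_num. Qed.

(** The difference agrees a.e. with its absolute value, whose integral is nonnegative without any
    further hypothesis. *)
Lemma integral_ae_le f g : itg f -> itg g -> {ae P, forall x, f x <= g x} ->
  \int[P]_x f x <= \int[P]_x g x.
Proof.
move=> F G fg; rewrite -subr_ge0 -integralB_R//.
have mgf : mf (fun x => g x - f x) by apply: measurable_funB; exact: itg_mf.
have -> : \int[P]_x (g x - f x) = \int[P]_x `|g x - f x|.
  congr fine; apply: ae_eq_integral => //.
  - exact/measurable_EFinP.
  - by apply/measurable_EFinP/measurableT_comp.
  - by apply: filterS fg => x fgx _; rewrite ger0_norm// subr_ge0.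
by apply: Rintegral_ge0 => x _.
Qed.

Lemma integral_le_R f g : itg f -> itg g -> (forall x, f x <= g x) ->
  \int[P]_x f x <= \int[P]_x g x.
Proof. by move=> F G fg; apply: integral_ae_le => //; apply: aeW. Qed.

Lemma integral_aege0 f : {ae P, forall x, 0 <= f x} -> itg f ->
  0 <= \int[P]_x f x.
Proof.
by move=> f0 F; rewrite -(integral_cst_R 0); apply: integral_ae_le => //; exact: itg_cst.
Qed.

Lemma integral_ge0_R f : (forall x, 0 <= f x) -> 0 <= \int[P]_x f x.
Proof. by move=> f0; apply: Rintegral_ge0. Qed.

Lemma integral_abs_R f : itg f -> `|\int[P]_x f x| <= \int[P]_x `|f x|.
Proof. by move=> F; exact: le_normr_Rintegral. Qed.

Lemma integral_le_bnd f (B : R) : itg f -> (forall x, f x <= B) -> \int[P]_x f x <= B.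
Proof.
move=> F fB; rewrite -[leRHS]integral_cst_R.
by apply: integral_le_R => //; exact: itg_cst.
Qed.

Lemma integral_abs_bnd f (B : R) : mf f -> (forall x, `|f x| <= B) ->
  `|\int[P]_x f x| <= B.
Proof.
move=> mF fB; apply: (le_trans (integral_abs_R (itg_bnd mF fB))).
by apply: integral_le_bnd => //; apply/itg_abs/(itg_bnd mF fB).
Qed.

Lemma itg_aeeq f g : mf g -> {ae P, forall x, f x = g x} -> itg f -> itg g.
Proof.
move=> mg fg F; apply: (@itg_aele _ (fun x => `|f x|)) => //; last exact: itg_abs.
by apply: filterS fg => x ->.
Qed.

Lemma integral_aeeq f g : mf f -> mf g -> {ae P, forall x, f x = g x} ->
  \int[P]_x f x = \int[P]_x g x.
Proof.
move=> mF mg fg; congr fine; apply: ae_eq_integral => //.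
- exact/measurable_EFinP.
- exact/measurable_EFinP.
- by apply: filterS fg => x -> _.
Qed.

Lemma integral_eq0_ae f : itg f -> {ae P, forall x, 0 <= f x} ->
  \int[P]_x f x <= 0 -> {ae P, forall x, f x = 0}.
Proof.
move=> F f0 If0; have mF := itg_mf F.
have : (\int[P]_(x in setT) `|(f x)%:E|)%E = 0.
  rewrite -[LHS]/(\int[P]_(x in setT) (`|f x|%R)%:E)%E eint_fin; last exact: itg_abs.
  congr EFin; apply/eqP; rewrite eq_le integral_ge0_R// andbT.
  apply: le_trans If0; rewrite le_eqVlt; apply/orP; left; apply/eqP.
  apply: integral_aeeq => //; first exact/measurableT_comp.
  by apply: filterS f0 => x /ger0_norm.
move=> /(ae_eq_integral_abs P measurableT); rewrite -/(measurable_fun _ _).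
move=> /(_ (proj2 (measurable_EFinP _ _) mF)).
by apply: filterS => x /(_ I) /= [].
Qed.

Lemma cvg_geid (s : nat -> nat) : (forall k, (k <= s k)%N) -> s k @[k --> \oo] --> \oo.
Proof.
move=> hs A [N _ NA]; exists N => // k /= Nk; apply: NA => /=.
exact: leq_trans Nk (hs k).
Qed.

(** Fatou's lemma in the form used for all passages to the limit: the limit is shown to be
    integrable, and the bounds [b n] may vary with n. Absolute values are inserted because
    positivity is known only a.e. *)
Lemma fatou_R (f : nat -> T -> R) g (b : nat -> R) (c : R) :
  (forall n, itg (f n)) -> (forall n, {ae P, forall x, 0 <= f n x}) -> mf g ->
  {ae P, forall x, f n x @[n --> \oo] --> g x} ->
  (forall n, \int[P]_x f n x <= b n) -> b n @[n --> \oo] --> c ->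
  itg g /\ \int[P]_x g x <= c.
Proof.
move=> fi f0 mg fg fb bc.
have g0 : {ae P, forall x, 0 <= g x}.
  have := ae_foralln f0; apply: filterS2 fg => x fx h.
  by apply: (cvgr_to_ge fx); exact: nearW.
have absE n : (\int[P]_x (`|f n x|%:E))%E = (\int[P]_x f n x)%:E.
  rewrite eint_fin; last exact: itg_abs.
  congr EFin; apply: integral_aeeq => //; last by apply: filterS (f0 n) => x /ger0_norm.
  - by apply: measurableT_comp => //; exact: itg_mf.
  - exact: itg_mf.
have key : (\int[P]_x (`|g x|%:E) <= c%:E)%E.
  have mfn n : measurable_fun setT (fun x => (`|f n x|%:E)).
    by apply/measurable_EFinP/measurableT_comp => //; exact: itg_mf.
  have h := @fatou _ _ _ P _ measurableT (fun n x => (`|f n x|%:E)) mfn _.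
  have -> : (\int[P]_x `|g x|%:E)%E =
      (\int[P]_x limn_einf (fun n => `|f n x|%:E))%E.
    apply: ae_eq_integral => //.
    - by apply/measurable_EFinP/measurableT_comp.
    - under eq_fun do rewrite -[limn_einf _]oppeK -limn_esupN.
      apply: measurableT_comp => //; apply: measurable_fun_limn_esup => n.
      exact: measurableT_comp.
    - apply: filterS fg => x fx _; apply/esym.
      suff /cvg_limn_einf_sup[->] : `|f n x|%:E @[n --> \oo] --> `|g x|%:E by [].
      by apply/fine_cvgP; split; [exact: nearW|apply: cvg_norm].
  apply: le_trans (h _) _; first by move=> n x _; rewrite lee_fin.
  have bl : (b n)%:E @[n --> \oo] --> c%:E by apply/fine_cvgP; split; [exact: nearW|].
  have [<- _] := cvg_limn_einf_sup bl.
  rewrite !limn_einf_lim; apply: lee_lim; [exact: is_cvg_einfs|exact: is_cvg_einfs|].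
  apply: nearW => n; apply: le_ereal_inf_tmp => _ [m nm <-].
  apply: (@le_trans _ _ (\int[P]_x `|f m x|%:E)%E); last by rewrite absE lee_fin.
  by apply: ereal_inf_lbound; exists m.
have ig : itg g.
  apply/integrableP; split; first exact/measurable_EFinP.
  by apply: le_lt_trans key _; rewrite ltry.
split => //; rewrite -lee_fin -eint_fin//; apply: le_trans key.
rewrite le_eqVlt; apply/orP; left; apply/eqP; apply: ae_eq_integral => //.
- exact/measurable_EFinP.
- by apply/measurable_EFinP/measurableT_comp.
- by apply: filterS g0 => x gx0 _; rewrite ger0_norm.
Qed.

(** The sum of the series has integral at most 1, hence is finite a.e. *)
Lemma ae_cvg_series (f : nat -> T -> R) : (forall n, itg (f n)) ->
  (forall n x, 0 <= f n x) -> (forall n, \int[P]_x f n x <= 1 / (2 ^ n.+1)%:R) ->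
  {ae P, forall x, cvgn (series (f ^~ x))}.
Proof.
move=> fi f0 fb.
have mfn n : measurable_fun setT (EFin \o f n) by apply/measurable_EFinP; exact: itg_mf.
pose S x := (\sum_(0 <= k <oo) (f k x)%:E)%E.
have S0 x : (0 <= S x)%E by apply: nneseries_ge0 => k _ _; rewrite lee_fin.
have mS : measurable_fun setT S.
  by apply: ge0_emeasurable_sum => [k x _ _|k _]; [rewrite lee_fin|exact: mfn].
have iS : P.-integrable setT S.
  apply/integrableP; split => //.
  under eq_integral do rewrite gee0_abs//.
  rewrite integral_nneseries//; last by move=> n x _; rewrite lee_fin.
  apply: (@le_lt_trans _ _ (1%:E)); last by rewrite ltry.
  have := @epsilon_trick R (fun=> 0%E) 1 xpredT (fun=> lexx _) ler01.
  rewrite [X in (_ <= X + _)%E]eseries0// add0e; apply: le_trans; apply: lee_nneseries.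
    by move=> n _ _; apply: integral_ge0 => x _; rewrite lee_fin.
  by move=> n _; rewrite eint_fin// add0e lee_fin.
have := integrable_ae measurableT iS; apply: filterS => x /(_ I) Sx.
apply: nondecreasing_is_cvgn.
  by apply: nondecreasing_series => n _ _.
exists (fine (S x)) => _ [n _ <-]; rewrite -lee_fin fineK//.
rewrite /series/= -sumEFin; apply: nneseries_lim_ge => k _ _; by rewrite lee_fin.
Qed.

Lemma ae_measurable_limit (f : nat -> T -> R) : (forall n, mf (f n)) ->
  {ae P, forall x, cvgn (f ^~ x)} ->
  exists2 g, mf g & {ae P, forall x, f n x @[n --> \oo] --> g x}.
Proof.
(* The upper limit is measurable also where the sequence diverges. *)
move=> mF fc; exists (fun x => fine (limn_esup (fun n => (f n x)%:E))).
  apply: (measurableT_comp (fine_measurable measurableT)).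
  by apply: measurable_fun_limn_esup => n; exact/measurable_EFinP.
apply: filterS fc => x /cvg_ex[l fl].
have /cvg_limn_einf_sup[_ ->] : (f n x)%:E @[n --> \oo] --> l%:E.
  by apply/fine_cvgP; split; [exact: nearW|].
exact: fl.
Qed.

Lemma pow2_inv_gt0 n : 0 < 1 / (2 ^ n.+1)%:R :> R.
Proof. by rewrite divr_gt0// ltr0n expn_gt0. Qed.

(** Along indices where the integrals are at most [1 / 2 ^ k.+1] the functions are the terms of an
    a.e. convergent series. *)
Lemma ae_subseq (f : nat -> T -> R) : (forall n, itg (f n)) ->
  (forall n x, 0 <= f n x) -> \int[P]_x f n x @[n --> \oo] --> 0 ->
  exists2 s : nat -> nat, (forall k, (k <= s k)%N) &
    {ae P, forall x, f (s k) x @[k --> \oo] --> 0}.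
Proof.
move=> fi f0 fc.
have ex k : exists m, (k <= m)%N /\ \int[P]_x f m x <= 1 / (2 ^ k.+1)%:R.
  have /cvgrPdist_le/(_ _ (pow2_inv_gt0 k)) := fc.
  move=> [N _ hN]; exists (maxn k N); split; first exact: leq_maxl.
  have /= := hN (maxn k N) (leq_maxr _ _); rewrite sub0r normrN.
  exact: le_trans (ler_norm _).
have [s hs] := choice ex; exists s; first by move=> k; have [] := hs k.
have := @ae_cvg_series (fun k => f (s k)) (fun k => fi _) (fun k x => f0 _ x)
  (fun k => (hs k).2).
by apply: filterS => x /cvg_series_cvg_0.
Qed.

Lemma L1_complete (f : nat -> T -> R) : (forall n, itg (f n)) ->
  (forall n, \int[P]_x `|f n.+1 x - f n x| <= 1 / (2 ^ n.+1)%:R) ->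
  exists2 g, mf g & {ae P, forall x, f n x @[n --> \oo] --> g x}.
Proof.
move=> fi fb; apply: ae_measurable_limit; first by move=> n; exact: itg_mf.
have := @ae_cvg_series (fun n x => `|f n.+1 x - f n x|)
  (fun n => itg_abs (itgB (fi _) (fi _))) (fun n x => normr_ge0 _) fb.
apply: filterS => x cx.
have : cvgn (series (telescope (f ^~ x))) by apply: normed_cvg.
rewrite telescopeK => /cvg_ex[l hl]; apply/cvg_ex; exists (l + f 0%N x).
rewrite (_ : f ^~ x = fun n => (f n x - f 0%N x) + f 0%N x).
  by apply: cvgD => //; exact: cvg_cst.
by apply/funext => n; rewrite subrK.
Qed.

(** Dominated convergence with a varying majorant (Pratt). If the distance stayed above e along a
    subsequence, Fatou's lemma for the nonnegative functions [g n + g0 - |f n - f0|], which tend to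
    [2 g0], would lose e in the limit. *)
Lemma pratt (f g : nat -> T -> R) f0 g0 : (forall n, itg (f n)) -> itg f0 ->
  (forall n, itg (g n)) -> itg g0 ->
  (forall n, {ae P, forall x, `|f n x| <= g n x}) ->
  {ae P, forall x, f n x @[n --> \oo] --> f0 x} ->
  {ae P, forall x, g n x @[n --> \oo] --> g0 x} ->
  \int[P]_x g n x @[n --> \oo] --> \int[P]_x g0 x ->
  \int[P]_x `|f n x - f0 x| @[n --> \oo] --> 0.
Proof.
move=> fi f0i gi g0i fg fc gc Ig; apply: contrapT => ncv.
have [e e0 he] : exists2 e : R, 0 < e &
    forall N, exists n, (N <= n)%N /\ e < \int[P]_x `|f n x - f0 x|.
  apply: contrapT => H; apply: ncv; apply/cvgrPdist_le => e e0.
  have /existsNP[N hN] : ~ (forall N, exists n, (N <= n)%N /\ e < \int[P]_x `|f n x - f0 x|).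
    by move=> h; apply: H; exists e.
  exists N => // n /= Nn; rewrite sub0r normrN ger0_norm ?integral_ge0_R//.
  by rewrite leNgt; apply/negP => en; apply: hN; exists n.
have [s hs] := choice he.
have s_oo : s k @[k --> \oo] --> \oo by apply: cvg_geid => k; have [] := hs k.
pose h k x := g (s k) x + g0 x - `|f (s k) x - f0 x|.
have hi k : itg (h k) by apply: itgB; [exact: itgD|exact/itg_abs/itgB].
have F0 : {ae P, forall x, `|f0 x| <= g0 x}.
  have := ae_foralln fg; apply: filterS3 fc gc => x fx gx hx.
  by apply: (ler_cvg_to (cvg_norm fx) gx); exact: nearW.
have h0 k : {ae P, forall x, 0 <= h k x}.
  apply: filterS2 (fg (s k)) F0 => x a b; rewrite /h subr_ge0.
  by apply: le_trans (ler_normB _ _) _; exact: lerD.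
have [||//||_] := @fatou_R h (fun x => g0 x + g0 x)
    (fun k => \int[P]_x g (s k) x + \int[P]_x g0 x - e)
    (\int[P]_x g0 x + \int[P]_x g0 x - e) hi h0.
- by apply: measurable_funD; exact: itg_mf.
- apply: filterS2 fc gc => x fx gx.
  rewrite (_ : g0 x + g0 x = g0 x + g0 x - `|f0 x - f0 x|); last by rewrite subrr normr0 subr0.
  apply: cvgB; first by apply: cvgD; [exact: (cvg_comp _ _ s_oo gx)|exact: cvg_cst].
  by apply: cvg_norm; apply: cvgB; [exact: (cvg_comp _ _ s_oo fx)|exact: cvg_cst].
- move=> k; rewrite /h integralB_R; last 2 first.
  + exact: itgD.
  + exact/itg_abs/itgB.
  by rewrite integralD_R// lerD2l lerN2 ltW//; have [] := hs k.
- apply: cvgB; last exact: cvg_cst.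
  by apply: cvgD; [exact: (cvg_comp _ _ s_oo Ig)|exact: cvg_cst].
by rewrite integralD_R// => hh; lra.
Qed.

Lemma integral_cvg_of_L1 (f : nat -> T -> R) f0 : (forall n, itg (f n)) -> itg f0 ->
  \int[P]_x `|f n x - f0 x| @[n --> \oo] --> 0 ->
  \int[P]_x f n x @[n --> \oo] --> \int[P]_x f0 x.
Proof.
move=> fi f0i fc; apply/cvgrPdist_le => e e0.
have /cvgrPdist_le/(_ _ e0) := fc; apply: filterS => n.
rewrite sub0r normrN ger0_norm ?integral_ge0_R// distrC -integralB_R//.
by apply: le_trans; apply: integral_abs_R; exact: itgB.
Qed.

Lemma dct_R (f : nat -> T -> R) f0 g : (forall n, itg (f n)) -> itg f0 -> itg g ->
  (forall n, {ae P, forall x, `|f n x| <= g x}) ->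
  {ae P, forall x, f n x @[n --> \oo] --> f0 x} ->
  \int[P]_x `|f n x - f0 x| @[n --> \oo] --> 0.
Proof.
move=> fi f0i gi fg fc; apply: (@pratt f (fun=> g) f0 g) => //; last exact: cvg_cst.
by apply: aeW => x; exact: cvg_cst.
Qed.

Lemma dct_bnd (f : nat -> T -> R) f0 (B : R) : (forall n, mf (f n)) -> mf f0 ->
  (forall n x, `|f n x| <= B) ->
  {ae P, forall x, f n x @[n --> \oo] --> f0 x} ->
  \int[P]_x `|f n x - f0 x| @[n --> \oo] --> 0.
Proof.
move=> fi f0i fg fc.
have F0 : {ae P, forall x, `|f0 x| <= B}.
  apply: filterS fc => x fx; apply: (cvgr_to_le (cvg_norm fx)); exact: nearW.
apply: (@dct_R f f0 (fun=> B)) => //.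
- by move=> n; apply: itg_bnd.
- exact: itg_aebnd F0.
- exact: itg_cst.
- by move=> n; apply: aeW.
Qed.

(** Vitali's theorem, with uniform integrability stated as smallness of the excess over the
    truncation at level k. The truncations converge by bounded convergence, and Fatou's lemma bounds
    the excess of the limit. *)
Lemma vitali_ui (f : nat -> T -> R) f0 : (forall n, itg (f n)) -> mf f0 ->
  (forall n x, 0 <= f n x) ->
  {ae P, forall x, f n x @[n --> \oo] --> f0 x} ->
  (forall e : R, 0 < e -> exists2 k : R, 0 < k &
     forall n, \int[P]_x (f n x - Num.min (f n x) k) <= e) ->
  itg f0 /\ \int[P]_x `|f n x - f0 x| @[n --> \oo] --> 0.
Proof.
move=> fi mf0 f0p fc ui.
have mmin (g : T -> R) k : mf g -> mf (fun x => Num.min (g x) k).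
  by move=> mg; exact: measurable_minr.
have imin (g : T -> R) k : 0 < k -> mf g -> (forall x, 0 <= g x) -> itg (fun x => Num.min (g x) k).
  move=> k0 mg g0; apply: (@itg_bnd k); first exact: mmin.
  by move=> x; rewrite ger0_norm ?ge_min ?lexx ?orbT// le_min g0 ltW.
have F0 : {ae P, forall x, 0 <= f0 x}.
  by apply: filterS fc => x fx; apply: (cvgr_to_ge fx); exact: nearW.
have [k1 k10 h1] := ui 1 ltr01.
have [||if0 _] := @fatou_R f f0 (fun=> 1 + k1) (1 + k1) fi (fun n => aeW _ (f0p n)) mf0 fc.
- move=> n; rewrite (_ : \int[P]_x f n x =
    \int[P]_x (f n x - Num.min (f n x) k1) + \int[P]_x Num.min (f n x) k1); last first.
    rewrite -integralD_R; last 2 first.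
    + by apply: itgB => //; apply: imin => //; exact: itg_mf.
    + by apply: imin => //; exact: itg_mf.
    by apply: eq_Rintegral => x _; rewrite subrK.
  apply: lerD => //; apply: integral_le_bnd; first by apply: imin => //; exact: itg_mf.
  by move=> x; rewrite ge_min lexx orbT.
- exact: cvg_cst.
split => //; apply/cvgrPdist_le => e e0.
have e3 : 0 < e / 3 by rewrite divr_gt0.
have [k k0 hk] := ui _ e3.
have mincvg x : f n x @[n --> \oo] --> f0 x ->
    Num.min (f n x) k @[n --> \oo] --> Num.min (f0 x) k.
  move=> fx; rewrite minr_absE.
  rewrite (_ : (fun n => _) = (fun n => (f n x + k - `|f n x - k|) / 2)).
    apply: cvgM; last exact: cvg_cst.
    apply: cvgB; first by apply: cvgD => //; exact: cvg_cst.
    by apply: cvg_norm; apply: cvgB => //; exact: cvg_cst.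
  by apply/funext => n; rewrite minr_absE.
have imk n : itg (fun x => Num.min (f n x) k) by apply: imin => //; exact: itg_mf.
have imk0 : itg (fun x => Num.min (f0 x) k).
  apply: (@itg_aebnd k); first exact: mmin.
  by apply: filterS F0 => x p; rewrite ger0_norm ?ge_min ?lexx ?orbT// le_min p ltW.
have hk0 : \int[P]_x (f0 x - Num.min (f0 x) k) <= e / 3.
  have [||||||//] := @fatou_R (fun n x => f n x - Num.min (f n x) k)
    (fun x => f0 x - Num.min (f0 x) k) (fun=> e / 3) (e / 3).
  - by move=> n; exact: itgB.
  - by move=> n; apply: aeW => x; rewrite subr_ge0 ge_min lexx.
  - by apply: measurable_funB => //; exact: mmin.
  - by apply: filterS fc => x fx; apply: cvgB => //; exact: mincvg.
  - exact: hk.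
  - exact: cvg_cst.
have Bc : \int[P]_x `|Num.min (f n x) k - Num.min (f0 x) k| @[n --> \oo] --> 0.
  apply: (@dct_bnd (fun n x => Num.min (f n x) k) (fun x => Num.min (f0 x) k) k).
  - by move=> n; exact: mmin (itg_mf (fi n)).
  - exact: mmin.
  - by move=> n x; rewrite ger0_norm ?ge_min ?lexx ?orbT// le_min f0p ltW.
  - by apply: filterS fc => x; exact: mincvg.
have /cvgrPdist_le/(_ _ e3) := Bc.
apply: filterS => n; rewrite !sub0r !normrN !ger0_norm ?integral_ge0_R// => hn.
have := hk n => hkn.
apply: (@le_trans _ _ (\int[P]_x (f n x - Num.min (f n x) k) +
  \int[P]_x `|Num.min (f n x) k - Num.min (f0 x) k| +
  \int[P]_x (f0 x - Num.min (f0 x) k))); last by lra.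
have i1 : itg (fun x => f n x - Num.min (f n x) k) by exact: itgB.
have i2 : itg (fun x => `|Num.min (f n x) k - Num.min (f0 x) k|) by exact/itg_abs/itgB.
have i3 : itg (fun x => f0 x - Num.min (f0 x) k) by exact: itgB.
rewrite -integralD_R// -integralD_R//; last exact: itgD.
apply: integral_ae_le; [exact/itg_abs/itgB|by apply: itgD => //; exact: itgD|].
apply: filterS F0 => x p.
set a := Num.min (f n x) k; set b := Num.min (f0 x) k.
have a0 : 0 <= f n x - a by rewrite subr_ge0 ge_min lexx.
have b0 : 0 <= f0 x - b by rewrite subr_ge0 ge_min lexx.
rewrite (_ : f n x - f0 x = (f n x - a) + (a - b) - (f0 x - b)); last by ring.
apply: le_trans (ler_normB _ _) _; rewrite (ger0_norm b0) lerD2r.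
by apply: le_trans (ler_normD _ _) _; rewrite (ger0_norm a0).
Qed.

Lemma powR_ui (x k q : R) : 0 <= x -> 0 < k -> 0 < q ->
  x - Num.min x k <= k `^ (- q) * x `^ (1 + q).
Proof.
move=> x0 k0 q0; have [xk|kx] := leP x k.
  by rewrite subrr mulr_ge0 ?powR_ge0.
have xp : 0 < x by exact: lt_trans kx.
apply: (@le_trans _ _ x); first by rewrite gerBl ltW.
rewrite powRD; last by rewrite gt_eqF ?implybT// addr_gt0.
rewrite powRr1// mulrCA ler_peMr// powRN mulrC ler_pdivlMr ?powR_gt0// mul1r.
by rewrite ge0_ler_powR ?nnegrE ?ltW.
Qed.

(** A bound in L^(1+q) makes the excess over level k at most [k^(-q)] times a constant. *)
Lemma vitali_powR (f : nat -> T -> R) f0 (q C : R) : 0 < q -> (forall n, itg (f n)) -> mf f0 ->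
  (forall n x, 0 <= f n x) ->
  {ae P, forall x, f n x @[n --> \oo] --> f0 x} ->
  (forall n, itg (fun x => f n x `^ (1 + q))) ->
  (forall n, \int[P]_x (f n x `^ (1 + q)) <= C) ->
  itg f0 /\ \int[P]_x `|f n x - f0 x| @[n --> \oo] --> 0.
Proof.
move=> q0 fi mf0 f0p fc fqi fq; apply: vitali_ui => // e e0.
have C0 : 0 <= C by apply: le_trans (fq 0%N); apply: integral_ge0_R => x; exact: powR_ge0.
(* Chosen so that [k^(-q) (C + 1) = e]. *)
pose k := ((C + 1) / e) `^ q^-1.
have k0 : 0 < k by rewrite powR_gt0// divr_gt0// ltr_wpDl.
exists k => // n.
apply: (@le_trans _ _ (k `^ (- q) * \int[P]_x (f n x `^ (1 + q)))).
  rewrite -integralZ_R//; apply: integral_le_R => [||x].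
  - apply: itgB => //; apply: (@itg_le _ (fun=> k)); last exact: itg_cst.
      by apply: measurable_minr => //; exact: itg_mf.
    by move=> x; rewrite ger0_norm ?ge_min ?lexx ?orbT// le_min f0p ltW.
  - exact: itgZ.
  - exact: powR_ui.
apply: (@le_trans _ _ (k `^ (- q) * (C + 1))).
  by rewrite ler_wpM2l ?powR_ge0//; apply: le_trans (fq n) _; rewrite lerDl.
rewrite powRN /k -powRrM mulVf ?gt_eqF// powRr1; last by rewrite divr_ge0 ?ltW// ltr_wpDl.
by rewrite invf_div mulfVK// gt_eqF// ltr_wpDl.
Qed.

Lemma L2_mf f : L2 f -> mf f. Proof. by case. Qed.

Lemma L2_bnd (B : R) f : mf f -> (forall x, `|f x| <= B) -> L2 f.
Proof.
move=> mF fB; split => //; apply: (@itg_bnd (B ^+ 2)); first exact: measurable_funX.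
by move=> x; rewrite normrX lerXn2r ?nnegrE ?(le_trans _ (fB x)).
Qed.

Lemma L2_itgM f g : L2 f -> L2 g -> itg (fun x => f x * g x).
Proof.
move=> [mF f2] [mg g2]; apply: (@itg_le _ (fun x => f x ^+ 2 + g x ^+ 2)); last exact: itgD.
  exact: measurable_funM.
move=> x; rewrite normrM.
have h1 : `|f x| ^+ 2 = f x ^+ 2 by rewrite -normrX ger0_norm// sqr_ge0.
have h2 : `|g x| ^+ 2 = g x ^+ 2 by rewrite -normrX ger0_norm// sqr_ge0.
have := sqr_ge0 (`|f x| - `|g x|); have := normr_ge0 (f x); have := normr_ge0 (g x).
by nra.
Qed.

Lemma L2_cst (c : R) : L2 (fun=> c).
Proof. by apply: (@L2_bnd `|c|) => // x; exact: measurable_cst. Qed.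

Lemma L2_itg f : L2 f -> itg f.
Proof.
move=> /(L2_itgM (L2_cst 1)).
by under [X in _.-integrable _ (_ \o X) -> _]eq_fun do rewrite mul1r.
Qed.

Lemma L2Z (c : R) f : L2 f -> L2 (fun x => c * f x).
Proof.
move=> [mF f2]; split; first exact: measurable_funM.
by under [X in _.-integrable _ (_ \o X)]eq_fun do rewrite exprMn; exact: itgZ.
Qed.

Lemma L2D f g : L2 f -> L2 g -> L2 (fun x => f x + g x).
Proof.
move=> F G; have fg := L2_itgM F G; case: F G => [mF f2] [mg g2].
split; first exact: measurable_funD.
under [X in _.-integrable _ (_ \o X)]eq_fun do rewrite sqrrD mulr2n.
by apply: itgD => //; apply: itgD => //; apply: itgD.
Qed.

Lemma L2B f g : L2 f -> L2 g -> L2 (fun x => f x - g x).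
Proof.
move=> F G; have -> : (fun x => f x - g x) = (fun x => f x + -1 * g x).
  by apply/funext => x; rewrite mulN1r.
by apply: L2D => //; exact: L2Z.
Qed.

Lemma L2M_bnd (B : R) f g : mf f -> (forall x, `|f x| <= B) -> L2 g -> L2 (fun x => f x * g x).
Proof.
move=> mF fB [mg g2]; split; first exact: measurable_funM.
under [X in _.-integrable _ (_ \o X)]eq_fun do rewrite exprMn.
apply: (@itgM_bnd (B ^+ 2)) => //; first exact: measurable_funX.
by move=> x; rewrite normrX lerXn2r ?nnegrE ?(le_trans _ (fB x)).
Qed.

Lemma L2_aeeq f g : mf g -> {ae P, forall x, f x = g x} -> L2 f -> L2 g.
Proof.
move=> mg fg [mF f2]; split => //; apply: itg_aeeq f2; first exact: measurable_funX.
by apply: filterS fg => x ->.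
Qed.

Lemma cauchy_schwarz f g : L2 f -> L2 g ->
  (\int[P]_x (f x * g x)) ^+ 2 <= \int[P]_x (f x ^+ 2) * \int[P]_x (g x ^+ 2).
Proof.
move=> F G; set A := \int[P]_x (f x ^+ 2); set B := \int[P]_x _; set C := \int[P]_x (g x ^+ 2).
have key t : 0 <= A - 2 * t * B + t ^+ 2 * C.
  have -> : A - 2 * t * B + t ^+ 2 * C = \int[P]_x ((f x - t * g x) ^+ 2).
    rewrite (_ : \int[P]_x _ = \int[P]_x (f x ^+ 2 - 2 * t * (f x * g x) + t ^+ 2 * (g x ^+ 2))).
      rewrite integralD_R; last 2 first.
      - by apply: itgB; [exact: F.2|exact/itgZ/L2_itgM].
      - by apply: itgZ; exact: G.2.
      rewrite integralB_R; [|exact: F.2|exact/itgZ/L2_itgM].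
      by rewrite !integralZ_R//; [exact: G.2|exact: L2_itgM].
    by apply: eq_Rintegral => x _; ring.
  by apply: integral_ge0_R => x; exact: sqr_ge0.
have A0 : 0 <= A by apply: integral_ge0_R => x; exact: sqr_ge0.
have C0 : 0 <= C by apply: integral_ge0_R => x; exact: sqr_ge0.
have [C00|Cn0] := eqVneq C 0.
  have [->|Bn0] := eqVneq B 0; first by rewrite expr0n mulr_ge0.
  (* If C vanishes the quadratic is affine in t, and this t gives it the value -1. *)
  have := key ((A + 1) / (2 * B)); rewrite C00 mulr0 addr0.
  rewrite (_ : 2 * _ * B = A + 1); last by field.
  by rewrite opprD addrA subrr sub0r lerNr oppr0 ler10.
have Cp : 0 < C by rewrite lt_neqAle eq_sym Cn0.
have := key (B / C); rewrite (_ : A - _ + _ = (A * C - B ^+ 2) / C); last by field.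
by rewrite pmulr_lge0 ?invr_gt0// subr_ge0.
Qed.

Lemma L2_integral_norm f : L2 f -> (\int[P]_x `|f x|) ^+ 2 <= \int[P]_x (f x ^+ 2).
Proof.
move=> F; have Fa : L2 (fun x => `|f x|).
  split; first by apply: measurableT_comp => //; exact: L2_mf.
  under [X in _.-integrable _ (_ \o X)]eq_fun do rewrite -normrX ger0_norm ?sqr_ge0//.
  exact: F.2.
have := cauchy_schwarz Fa (L2_cst 1); rewrite expr1n integral_cst_R mulr1.
under eq_Rintegral do rewrite mulr1.
by under [X in _ <= X -> _]eq_Rintegral do rewrite -normrX ger0_norm ?sqr_ge0//.
Qed.

Lemma pow2_inv_cvg0 : (fun n => 1 / (2 ^ n.+1)%:R : R) n @[n --> \oo] --> 0.
Proof.
apply: (@squeeze_cvgr _ _ _ _ (fun=> 0) (@harmonic R)); last exact: cvg_harmonic; last exact: cvg_cst.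
apply: nearW => n; rewrite ltW ?pow2_inv_gt0//= /harmonic/= div1r.
by rewrite lef_pV2 ?posrE ?ltr0n ?expn_gt0// ler_nat ltnW// ltn_expl.
Qed.

(** The representer is the minimiser of [J f], the squared norm minus twice the functional.
    Minimising sequences are Cauchy by the parallelogram inequality [para], and L^2 completeness
    enters through fast a.e. convergence and Fatou's lemma. *)
Lemma riesz_L2 (l : (T -> R) -> R) (C : R) : 0 <= C ->
  (forall a f g, L2 f -> L2 g -> l (fun x => a * f x + g x) = a * l f + l g) ->
  (forall f, L2 f -> l f ^+ 2 <= C * \int[P]_x (f x ^+ 2)) ->
  exists2 G, L2 G & forall f, L2 f -> l f = \int[P]_x (G x * f x).
Proof.
move=> Cge0 lin lC.
have nn f : 0 <= \int[P]_x (f x ^+ 2) by apply: integral_ge0_R => x; exact: sqr_ge0.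
pose J f := \int[P]_x (f x ^+ 2) - 2 * l f.
have Jexp f g t : L2 f -> L2 g -> J (fun x => t * g x + f x) =
    J f + 2 * t * (\int[P]_x (f x * g x) - l g) + t ^+ 2 * \int[P]_x (g x ^+ 2).
  move=> F G; rewrite /J lin//.
  rewrite (_ : \int[P]_x ((t * g x + f x) ^+ 2) =
    \int[P]_x (f x ^+ 2 + 2 * t * (f x * g x) + t ^+ 2 * (g x ^+ 2))); last first.
    by apply: eq_Rintegral => x _; ring.
  have fg := L2_itgM F G.
  rewrite integralD_R; last 2 first.
  - by apply: itgD; [exact: F.2|exact: itgZ].
  - by apply: itgZ; exact: G.2.
  rewrite integralD_R; [|exact: F.2|exact: itgZ].
  by rewrite !integralZ_R//; [ring|exact: G.2].
have Jlb f : L2 f -> - C <= J f.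
  move=> F; have := lC f F; have := nn f; rewrite /J.
  set A := \int[P]_x _; set b := l f => A0 h.
  rewrite leNgt; apply/negP => H.
  have h1 : 0 < (2 * b - (A + C)) * (2 * b + (A + C)) by apply: mulr_gt0; lra.
  by have := sqr_ge0 (A - C); nra.
pose S := [set J f | f in [set f | L2 f]].
have Sinf : has_inf S.
  split; first by exists (J (fun=> 0)), (fun=> 0) => //; exact: L2_cst.
  by exists (- C) => _ [f F <-]; exact: Jlb.
pose I := inf S.
have JI f : L2 f -> I <= J f by move=> F; apply: ge_inf; [exact: Sinf.2|exists f].
have para f g : L2 f -> L2 g ->
    \int[P]_x ((f x - g x) ^+ 2) <= 2 * (J f - I) + 2 * (J g - I).
  move=> F G; have H := L2B F G.
  have := JI _ (L2D (L2Z (1/2) H) G); rewrite (Jexp _ _ (1/2))//.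
  have E1 : J f = J (fun x => 1 * (f x - g x) + g x).
    by congr J; apply/funext => x; rewrite mul1r subrK.
  rewrite Jexp// in E1; rewrite E1; lra.
pose eta n : R := 1 / (2 ^ n.+1)%:R.
have eta0 n : 0 < eta n := pow2_inv_gt0 n.
have ex n : exists f, L2 f /\ J f <= I + eta n ^+ 2 / 4.
  have e0 : 0 < eta n ^+ 2 / 4 by rewrite divr_gt0// exprn_gt0.
  have [_ [f F <-] h] := inf_adherent e0 Sinf.
  by exists f; split => //; rewrite ltW.
have [g hg] := choice ex.
have gL n : L2 (g n) by have [] := hg n.
have gJ n : J (g n) - I <= eta n ^+ 2 / 4 by have [_ h] := hg n; lra.
have etaS n m : (n <= m)%N -> eta m ^+ 2 <= eta n ^+ 2.
  move=> nm; rewrite lerXn2r ?nnegrE ?(ltW (eta0 _))// /eta !div1r.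
  by rewrite lef_pV2 ?posrE ?ltr0n ?expn_gt0// ler_nat leq_exp2l.
have gd n m : (n <= m)%N -> \int[P]_x ((g m x - g n x) ^+ 2) <= eta n ^+ 2.
  move=> nm; apply: le_trans (para _ _ (gL m) (gL n)) _.
  by have := gJ n; have := gJ m; have := etaS _ _ nm; lra.
have [G mG gG] : exists2 G, mf G & {ae P, forall x, g n x @[n --> \oo] --> G x}.
  apply: L1_complete => [n|n]; first exact: L2_itg.
  rewrite -(@ler_pXn2r _ 2)// ?nnegrE ?integral_ge0_R ?(ltW (pow2_inv_gt0 _))//.
  apply: le_trans (L2_integral_norm (L2B (gL _) (gL _))) _.
  exact: (gd n n.+1).
have Gg n : itg (fun x => (G x - g n x) ^+ 2) /\ \int[P]_x ((G x - g n x) ^+ 2) <= eta n ^+ 2.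
  apply: (@fatou_R (fun k x => (g (k + n)%N x - g n x) ^+ 2) _ (fun=> eta n ^+ 2)).
  - by move=> k; apply: (L2B (gL _) (gL _)).2.
  - by move=> k; apply: aeW => x; exact: sqr_ge0.
  - by apply: measurable_funX; apply: measurable_funB => //; exact: L2_mf.
  - apply: filterS gG => x gx.
    have h : g (k + n)%N x - g n x @[k --> \oo] --> G x - g n x.
      by apply: cvgB; [rewrite (cvg_shiftn n (g ^~ x))|exact: cvg_cst].
    by under eq_cvg do rewrite expr2; rewrite expr2; exact: cvgM.
  - by move=> k; apply: gd; rewrite leq_addl.
  - exact: cvg_cst.
have LG : L2 G.
  have := L2D (conj (measurable_funB mG (L2_mf (gL 0%N))) (Gg 0%N).1) (gL 0%N).
  by rewrite (_ : (fun x => _) = G)//; apply/funext => x; rewrite subrK.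
exists G => // f F.
set A := \int[P]_x (f x ^+ 2).
have A0 : 0 <= A by exact: nn.
have xn n : `|\int[P]_x (g n x * f x) - \int[P]_x (G x * f x)| <= (A + 1) * eta n.
  rewrite distrC -integralB_R; [|exact: L2_itgM..].
  rewrite (_ : \int[P]_x _ = \int[P]_x ((G x - g n x) * f x)); last first.
    by apply: eq_Rintegral => x _; ring.
  rewrite -(@ler_pXn2r _ 2)// ?nnegrE// ?mulr_ge0 ?addr_ge0 ?(ltW (eta0 n))//.
  rewrite -normrX ger0_norm ?sqr_ge0//.
  apply: le_trans (cauchy_schwarz (L2B LG (gL n)) F) _; rewrite -/A.
  apply: (@le_trans _ _ (eta n ^+ 2 * A)); first by rewrite ler_wpM2r//; have [] := Gg n.
  rewrite [leRHS](_ : _ = eta n ^+ 2 * (A + 1) ^+ 2); last by ring.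
  by apply: ler_wpM2l; [exact: sqr_ge0|nra].
(* Compare [J (t f + g n)] with the infimum and let n tend to infinity: this is optimality of the
   limit G in the direction f. *)
have key t : 0 <= 2 * t * (\int[P]_x (G x * f x) - l f) + t ^+ 2 * A.
  have h n : - (eta n ^+ 2 / 4) - 2 * `|t| * ((A + 1) * eta n) <=
      2 * t * (\int[P]_x (G x * f x) - l f) + t ^+ 2 * A.
    have := JI _ (L2D (L2Z t F) (gL n)); rewrite Jexp// -/A.
    have h1 := gJ n; have h2 := xn n.
    set y := \int[P]_x (g n x * f x) in h2 *.
    set z := \int[P]_x (G x * f x) in h2 *.
    have h3 : t * (y - z) <= `|t| * ((A + 1) * eta n).
      by apply: le_trans (ler_norm _) _; rewrite normrM ler_wpM2l.
    nra.
  have lim : - (eta n ^+ 2 / 4) - 2 * `|t| * ((A + 1) * eta n) @[n --> \oo] --> (0:R).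
    have e0 : eta n @[n --> \oo] --> 0 by exact: pow2_inv_cvg0.
    rewrite [X in _ --> X](_ : 0 = - (0 * 0 / 4) - 2 * `|t| * ((A + 1) * 0)); last by ring.
    apply: cvgB.
      by apply: cvgN; apply: cvgM; [under eq_cvg do rewrite expr2; exact: cvgM|exact: cvg_cst].
    by apply: cvgM; [exact: cvg_cst|apply: cvgM => //; exact: cvg_cst].
  by apply: (cvgr_to_le lim); exact: nearW.
set b := \int[P]_x (G x * f x) - l f in key.
suff : b = 0 by move=> /eqP; rewrite /b subr_eq0 => /eqP ->.
apply/eqP; rewrite -sqrf_eq0 eq_le sqr_ge0 andbT.
(* At this t the quadratic equals [b ^ 2] times a negative number, which forces [b = 0]. *)
have := key (- b / (A + 1)).
rewrite (_ : _ + _ = b ^+ 2 * (- (A + 2) / (A + 1) ^+ 2)); last by field; rewrite gt_eqF// ltr_wpDl.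
rewrite nmulr_lge0// mulNr oppr_lt0 divr_gt0//; first by rewrite ltr_wpDl.
by rewrite exprn_gt0// ltr_wpDl.
Qed.

End prob_integral.

(** * Ultrafilter limits of bounded sequences *)

Section ultralimit.
Context {R : realType}.

(** One ultrafilter makes all bounded sequences converge at once, so weak limits need neither
    separability nor diagonal extraction. *)
Lemma ultra_bounded_cvg (T : Type) (U : set_system T) (f : T -> R) (B : R) :
  UltraFilter U -> (forall n, `|f n| <= B) -> exists2 l : R, f n @[n --> U] --> l & `|l| <= B.
Proof.
move=> UU fB.
have PF : ProperFilter U by exact: ultra_proper.
have [|l [lB cl]] := @segment_compact R (- B) B (f @ U) _.
  by apply: (@filterS _ U _ setT _ _ filterT) => n _ /=; rewrite in_itv/= -ler_norml.
exists l; last by move: lB => /=; rewrite in_itv/= -ler_norml.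
move=> A nA; have [//|UnA] := in_ultra_setVsetC (f @^-1` A) UU.
have [y [/= Ay Ny]] := cl (~` A) A UnA nA.
by [].
Qed.

Lemma ultra_eventually : exists2 U : set_system nat, UltraFilter U & \oo `<=` U.
Proof. by have [U [UU h]] := ultraFilterLemma (@eventually_filter); exists U. Qed.

End ultralimit.

Notation L2 := sq_integrable.

(** * Weak convergence in L^2 along an ultrafilter *)

Section weak_convergence.
Context {dT : measure_display} {T : measurableType dT} {R : realType}.
Context (P : probability T R) (U : set_system nat) (UU : UltraFilter U).
Implicit Types f g h : nat -> T -> R.

Let PU : ProperFilter U. Proof. exact: ultra_proper. Qed.

Definition wcvg f (G : T -> R) := L2 P G /\ forall psi, L2 P psi ->
  \int[P]_x (f n x * psi x) @[n --> U] --> \int[P]_x (G x * psi x).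

(** The limits of the pairings with test functions form a bounded linear functional, and [riesz_L2]
    represents it. *)
Lemma weak_L2_limit f (C : R) : (forall n, L2 P (f n)) ->
  (forall n, \int[P]_x (f n x ^+ 2) <= C) -> exists G, wcvg f G.
Proof.
move=> fL fC.
have C0 : 0 <= C by apply: le_trans (fC 0%N); apply: integral_ge0_R => x; exact: sqr_ge0.
pose l psi := xget 0 [set l : R | \int[P]_x (f n x * psi x) @[n --> U] --> l].
have lbnd psi n : L2 P psi -> (\int[P]_x (f n x * psi x)) ^+ 2 <= C * \int[P]_x (psi x ^+ 2).
  move=> L; apply: le_trans (cauchy_schwarz (fL n) L) _.
  by rewrite ler_wpM2r// integral_ge0_R// => x; exact: sqr_ge0.
have lP psi : L2 P psi -> \int[P]_x (f n x * psi x) @[n --> U] --> l psi.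
  move=> L; rewrite /l; case: xgetP => [y _ //|none].
  have [|y yl _] := @ultra_bounded_cvg _ _ U (fun n => \int[P]_x (f n x * psi x))
    (C * \int[P]_x (psi x ^+ 2) + 1) UU; last by have := none y yl.
  move=> n; have := lbnd psi n L; set a := \int[P]_x _; set b := C * _ => ab.
  rewrite ler_norml; apply/andP; split; nra.
have uniq (u : nat -> R) (a b : R) : u n @[n --> U] --> a -> u n @[n --> U] --> b -> a = b.
  by move=> ua ub; exact: (cvg_unique (@norm_hausdorff _ R^o) ua ub).
have [||G LG Gl] := @riesz_L2 _ _ _ P l C C0.
- move=> a u v Lu Lv; apply: (uniq (fun n => \int[P]_x (f n x * (a * u x + v x)))).
    by apply: lP; apply: L2D => //; exact: L2Z.
  rewrite (_ : (fun n => _) = (fun n => a * \int[P]_x (f n x * u x) + \int[P]_x (f n x * v x))).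
    by apply: cvgD; [apply: cvgM; [exact: cvg_cst|exact: lP]|exact: lP].
  apply/funext => n; rewrite -integralZ_R; last exact: L2_itgM.
  rewrite -integralD_R; [|by apply/itgZ/L2_itgM|exact: L2_itgM].
  by apply: eq_Rintegral => x _; ring.
- move=> psi L; have h := lP _ L.
  have h2 : (\int[P]_x (f n x * psi x)) ^+ 2 @[n --> U] --> l psi ^+ 2.
    by under eq_cvg do rewrite expr2; rewrite expr2; exact: cvgM.
  by apply: (cvgr_to_le h2); apply: (@filterS _ U _ setT _ _ filterT) => n _; exact: lbnd.
by exists G; split => // psi L; rewrite -Gl//; exact: lP.
Qed.

(** Integrate [2 f G - G^2 <= f^2] against the weight w: the left side is linear in f, so it passes
    to the weak limit. *)
Lemma wcvg_lsc f G (w : T -> R) (B : R) (b : nat -> R) (c : R) :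
  (forall n, L2 P (f n)) -> wcvg f G ->
  measurable_fun setT w -> (forall x, 0 <= w x <= B) ->
  (forall n, \int[P]_x (w x * f n x ^+ 2) <= b n) -> b n @[n --> U] --> c ->
  \int[P]_x (w x * G x ^+ 2) <= c.
Proof.
move=> fL [LG fG] mw wB fb bc.
have wb x : `|w x| <= B by have /andP[w0] := wB x; rewrite ger0_norm.
have LwG : L2 P (fun x => w x * G x) by apply: L2M_bnd wb LG.
have := fG _ LwG; set I := (X in _ --> X) => fI.
have IE : I = \int[P]_x (w x * G x ^+ 2) by apply: eq_Rintegral => x _; ring.
have iw (u : T -> R) : L2 P u -> P.-integrable setT (EFin \o (fun x => w x * u x ^+ 2)).
  by move=> L; apply: itgM_bnd wb _ => //; exact: L.2.
have key n : 2 * \int[P]_x (f n x * (w x * G x)) - I <= b n.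
  apply: le_trans (fb n); rewrite IE.
  rewrite -integralZ_R; last exact: L2_itgM.
  rewrite -integralB_R; [|by apply/itgZ/L2_itgM|exact: iw].
  apply: integral_le_R => [||x]; [|exact: iw|].
    by apply: itgB; [apply/itgZ/L2_itgM|exact: iw].
  have /andP[w0 _] := wB x.
  rewrite -subr_ge0 (_ : _ - _ = w x * (f n x - G x) ^+ 2); last by ring.
  by rewrite mulr_ge0// sqr_ge0.
have lim : 2 * \int[P]_x (f n x * (w x * G x)) - I @[n --> U] --> 2 * I - I.
  by apply: cvgB; [apply: cvgM => //; exact: cvg_cst|exact: cvg_cst].
rewrite -IE (_ : I = 2 * I - I); last by ring.
by apply: (ler_cvg_to lim bc); apply: (@filterS _ U _ setT _ _ filterT) => n _; exact: key.
Qed.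

(** Weak times strong convergence: the error [f n (a n - a0)] is small by Cauchy-Schwarz, and the
    rest is the weak convergence tested with [psi a0]. *)
Lemma wcvg_strong f G (a : nat -> T -> R) a0 (C B : R) (psi : T -> R) :
  (forall n, L2 P (f n)) -> (forall n, \int[P]_x (f n x ^+ 2) <= C) -> wcvg f G ->
  (forall n, L2 P (a n)) -> L2 P a0 ->
  \int[P]_x ((a n x - a0 x) ^+ 2) @[n --> U] --> 0 ->
  measurable_fun setT psi -> (forall x, `|psi x| <= B) ->
  \int[P]_x (a n x * f n x * psi x) @[n --> U] --> \int[P]_x (a0 x * G x * psi x).
Proof.
move=> fL fC [LG fG] aL a0L ac mpsi psiB.
have C0 : 0 <= C by apply: le_trans (fC 0%N); apply: integral_ge0_R => x; exact: sqr_ge0.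
have Lb u : L2 P u -> L2 P (fun x => psi x * u x) by move=> L; apply: L2M_bnd psiB L.
have h1 := fG _ (Lb _ a0L).
rewrite (_ : \int[P]_x (a0 x * G x * psi x) = 0 + \int[P]_x (G x * (psi x * a0 x))); last first.
  by rewrite add0r; apply: eq_Rintegral => x _; ring.
rewrite (_ : (fun n => _) = (fun n => \int[P]_x (f n x * (psi x * (a n x - a0 x))) +
   \int[P]_x (f n x * (psi x * a0 x)))); last first.
  apply/funext => n; rewrite -integralD_R.
  - by apply: eq_Rintegral => x _; ring.
  - by apply: L2_itgM => //; apply: Lb; exact: L2B.
  - by apply: L2_itgM => //; exact: Lb.
apply: cvgD => //.
have B0 : 0 <= B^+2 by exact: sqr_ge0.
have bnd n : (\int[P]_x (f n x * (psi x * (a n x - a0 x)))) ^+ 2 <=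
    C * (B ^+ 2 * \int[P]_x ((a n x - a0 x) ^+ 2)).
  have Lan := L2B (aL n) a0L.
  apply: le_trans (cauchy_schwarz (fL n) (Lb _ Lan)) _.
  apply: ler_pM => //.
  - by apply: integral_ge0_R => x; exact: sqr_ge0.
  - by apply: integral_ge0_R => x; exact: sqr_ge0.
  - rewrite -integralZ_R; last exact: Lan.2.
    apply: integral_le_R => [||x]; [exact: (Lb _ Lan).2|apply: itgZ; exact: Lan.2|].
    rewrite exprMn ler_wpM2r ?sqr_ge0// -[psi x ^+ 2]ger0_norm ?sqr_ge0// normrX.
    by rewrite lerXn2r ?nnegrE// (le_trans _ (psiB x)).
apply/cvgrPdist_lt => e e0.
have e2 : 0 < e ^+ 2 / (C * B ^+ 2 + 1) by rewrite divr_gt0 ?exprn_gt0// ltr_wpDl// mulr_ge0.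
have /cvgrPdist_lt/(_ _ e2) := ac; apply: filterS => n.
rewrite !sub0r !normrN => h; rewrite -(@ltr_pXn2r _ 2)// ?nnegrE ?(ltW e0)//.
rewrite -normrX ger0_norm ?sqr_ge0//; apply: le_lt_trans (bnd n) _.
move: h; rewrite ger0_norm; last by apply: integral_ge0_R => x; exact: sqr_ge0.
rewrite ltr_pdivlMr; last by rewrite ltr_wpDl// mulr_ge0.
have : 0 <= \int[P]_x ((a n x - a0 x) ^+ 2) by apply: integral_ge0_R => x; exact: sqr_ge0.
by nra.
Qed.

End weak_convergence.

(** * Calculus on the torus *)

Lemma measurable_countable_factor dX (X : measurableType dX) dY (Y : measurableType dY)
    (K : countType) (z : X -> K) (g : K -> Y) :
  (forall k, measurable (z @^-1` [set k])) -> measurable_fun setT (g \o z).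
Proof.
move=> mz _ B mB; rewrite setTI.
have -> : (g \o z) @^-1` B = \bigcup_(k in g @^-1` B) (z @^-1` [set k]).
  apply/seteqP; split => x /=; first by move=> Bx; exists (z x).
  by move=> [k /= Bk zk]; rewrite zk.
rewrite bigcup_mkcond; apply: countable_bigcupT_measurable => [|k]; first exact: countableP.
by case: ifP => _; [exact: mz|exact: measurable0].
Qed.

Section measurable_row.
Context {R : realType} {d : nat}.
Local Notation Rd := 'rV[R]_d.

Definition upd (i : 'I_d) (t : R) (x : Rd) : Rd :=
  \row_j (if j == i then t else x ord0 j).

Lemma updE i t x : upd i t x = x + (t - x ord0 i) *: basis_vec i.
Proof.
apply/rowP => j; rewrite !mxE eqxx/=; case: eqVneq => [->|ji].
  by rewrite mulr1 addrC subrK.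
by rewrite mulr0 addr0.
Qed.

Lemma updD i s t x : upd i (s + t) x = s *: basis_vec i + upd i t x.
Proof.
apply/rowP => j; rewrite !mxE eqxx/=; case: eqVneq => _.
  by rewrite mulr1.
by rewrite mulr0 add0r.
Qed.

Lemma measurable_upd i :
  measurable_fun setT (fun z : Rd * measurableTypeR R => upd i z.2 z.1).
Proof.
apply: measurable_fun_rowP => j; under eq_fun do rewrite mxE.
case: (j == i); first exact: measurable_snd.
exact: (measurableT_comp (measurable_coord j) measurable_fst).
Qed.

Lemma measurable_upd2 i (x : Rd) :
  measurable_fun setT (fun t : measurableTypeR R => upd i t x).
Proof.
apply: measurable_fun_rowP => j; under eq_fun do rewrite mxE.
by case: (j == i); [exact: measurable_id|exact: measurable_cst].
Qed.

Lemma continuous_upd i (x : Rd) : continuous (fun t => upd i t x).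
Proof.
move=> t; under [X in continuous_at _ X]eq_fun do rewrite updE.
apply: cvgD; first exact: cvg_cst.
apply: cvgZr_tmp; apply: cvgB; [exact: cvg_id|exact: cvg_cst].
Qed.

Lemma is_derive_upd i (f : Rd -> R) x t l :
  is_derive (upd i t x) (basis_vec i) f l -> is_derive t 1 (fun s => f (upd i s x)) l.
Proof.
move=> [df dl].
have E : (fun h : R => h^-1 *: (f (h *: basis_vec i + upd i t x) - f (upd i t x))) =
         (fun h : R => h^-1 *: (f (upd i (h *: 1 + t) x) - f (upd i t x))).
  by apply/funext => h; rewrite updD /GRing.scale/= mulr1.
by split; [move: df; rewrite /derivable E|move: dl; rewrite /derive E].
Qed.

End measurable_row.

Section torus_fubini.
Context {R : realType}.
Local Notation unif := (uniform_prob (@ltr01 R)).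

Lemma tonelli_cons d (f : 'rV[R]_d.+1 -> \bar R) : measurable_fun setT f ->
  (forall x, (0 <= f x)%E) ->
  (\int[torus_measure d.+1]_x f x =
   \int[unif]_s \int[torus_measure d]_y f (row_cons (s, y)))%E.
Proof.
move=> mf f0; rewrite /= ge0_integral_distribution// fubini_tonelli1//=.
by apply: measurableT_comp => //; exact: measurable_row_cons.
Qed.

Lemma row_cons0 d s (y : 'rV[R]_d) : row_cons (s, y) ord0 ord0 = s.
Proof.
rewrite /row_cons (_ : ord0 = lshift d (ord0 : 'I_1)); last exact: val_inj.
by rewrite (@row_mxEl _ 1 1 d) mxE.
Qed.

Lemma row_consS d s (y : 'rV[R]_d) (a : 'I_1) i : row_cons (s, y) a (rshift 1 i) = y a i.
Proof. by rewrite /row_cons (@row_mxEr _ 1 1 d). Qed.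

Variant ordS_spec d : 'I_d.+1 -> Type :=
| OrdS0 : ordS_spec ord0
| OrdSS (i : 'I_d) : ordS_spec (rshift 1 i : 'I_d.+1).

Lemma ordSP d (i : 'I_d.+1) : ordS_spec i.
Proof.
case: (@split_ordP 1 d i) => k ->; last exact: OrdSS.
by rewrite (_ : lshift d k = ord0); [exact: OrdS0|apply: val_inj; rewrite ord1].
Qed.

Lemma rshift1_neq0 d (i : 'I_d) : (rshift 1 i == ord0 :> 'I_d.+1) = false.
Proof. by []. Qed.

Lemma upd_cons0 d t s (y : 'rV[R]_d) : upd ord0 t (row_cons (s, y)) = row_cons (t, y).
Proof.
apply/rowP => j; rewrite mxE; case: (ordSP j) => [|k]; first by rewrite eqxx row_cons0.
by rewrite rshift1_neq0 !row_consS.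
Qed.

Lemma upd_consS d (i : 'I_d) t s (y : 'rV[R]_d) :
  upd (rshift 1 i : 'I_d.+1) t (row_cons (s, y)) = row_cons (s, upd i t y).
Proof.
apply/rowP => j; rewrite mxE; case: (ordSP j) => [|k].
  by rewrite eq_sym rshift1_neq0 !row_cons0.
by rewrite !row_consS mxE (_ : (rshift 1 k == rshift 1 i :> 'I_d.+1) = (k == i))//; exact: eq_rshift.
Qed.

(** Fubini's theorem for an arbitrary coordinate: redrawing coordinate i from the uniform law does
    not change the integral. The recursion of [torus_measure] exposes only the first coordinate,
    hence the induction on d. *)
Lemma resample d (i : 'I_d) (f : 'rV[R]_d -> \bar R) : measurable_fun setT f ->
  (forall x, (0 <= f x)%E) ->
  (\int[torus_measure d]_x f x = \int[torus_measure d]_x \int[unif]_t f (upd i t x))%E.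
Proof.
elim: d i f => [[]//|d IH] i f mf f0.
have m2 (x : 'rV[R]_d.+1) : measurable_fun setT (fun t : measurableTypeR R => f (upd i t x)).
  by apply: measurableT_comp => //; exact: measurable_upd2.
have mg : measurable_fun setT (fun x => \int[unif]_t f (upd i t x))%E.
  apply: (@measurable_fun_fubini_tonelli_F _ _ _ _ _ unif (fun z => f (upd i z.2 z.1))).
  - by apply: measurableT_comp => //; exact: measurable_upd.
  - by move=> z.
rewrite (tonelli_cons mf f0) (tonelli_cons mg); last by move=> x; apply: integral_ge0.
have mc : measurable_fun setT (fun z : measurableTypeR R * 'rV[R]_d => f (row_cons z)).
  by apply: measurableT_comp => //; exact: measurable_row_cons.
case: (ordSP i) => [|k].
  under [in RHS]eq_integral do under eq_integral do under eq_integral do rewrite upd_cons0.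
  rewrite integral_cst// [X in (_ * X)%E](_ : _ = 1%E) ?mule1; last exact: probability_setT.
  exact: (@fubini_tonelli _ _ _ _ _ unif (torus_measure d) (fun z => f (row_cons z))).
apply: eq_integral => s _.
under [in RHS]eq_integral do under eq_integral do rewrite upd_consS.
apply: (IH k (fun y => f (row_cons (s, y)))) => //.
apply: measurableT_comp => //.
exact: (measurableT_comp (@measurable_row_cons R d) (@pair1_measurable _ _ _ _ s)).
Qed.

End torus_fubini.

Section continuous_measurable.
Context {R : realType}.

Lemma measurable_floorM (k : R) (z : int) : measurable [set t : R | Num.floor (k * t) = z].
Proof.
rewrite (_ : [set _ | _] = (fun t => k * t) @^-1` `[z%:~R, (z + 1)%:~R[); last first.
  apply/seteqP; split => t /=.
    by move=> <-; rewrite in_itv/=; exact: floor_itv.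
  by rewrite in_itv/= => h; apply: floor_def.
by rewrite -[X in measurable X]setTI; apply: measurable_funM.
Qed.

Lemma floorM_itv (n : nat) (t : R) :
  (Num.floor (n.+1%:R * t))%:~R / n.+1%:R <= t < (Num.floor (n.+1%:R * t))%:~R / n.+1%:R + n.+1%:R^-1.
Proof.
have n0 : (0 : R) < n.+1%:R by [].
have /andP[h1 h2] := floor_itv (n.+1%:R * t); rewrite intrD in h2.
apply/andP; split; first by rewrite ler_pdivrMr// [leRHS]mulrC.
by rewrite -[X in _ + X]div1r -mulrDl ltr_pdivlMr// [ltLHS]mulrC.
Qed.

Lemma floorM_cvg (t : R) : ((Num.floor (n.+1%:R * t))%:~R / n.+1%:R) @[n --> \oo] --> t.
Proof.
apply: (@squeeze_cvgr _ _ _ _ (fun n => t - n.+1%:R^-1) (fun=> t)); last exact: cvg_cst.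
  apply: nearW => n; have /andP[h1 h2] := floorM_itv n t.
  by apply/andP; split => //; rewrite lerBlDr ltW.
by rewrite -[X in _ --> X]subr0; apply: cvgB; [exact: cvg_cst|exact: cvg_harmonic].
Qed.

Lemma cvg_rowP d (F : set_system nat) {FF : Filter F} (x : nat -> 'rV[R]_d) (y : 'rV[R]_d) :
  (forall i, x n ord0 i @[n --> F] --> y ord0 i) -> x n @[n --> F] --> y.
Proof.
move=> h; apply/cvg_ballP => e e0.
have : \forall n \near F, forall i : 'I_d, ball (y ord0 i) e (x n ord0 i).
  apply: filter_forall => i.
  have := h i; move/cvg_ballP => /(_ e e0); by [].
by apply: filterS => n hn; split => // i j; rewrite !ord1; exact: hn.
Qed.

(** The sigma-algebra is generated by the coordinates, not by the open sets. A continuous function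
    is the limit of its values at the grid points below x, and these take countably many values on
    measurable cells. *)
Lemma continuous_measurable_row d (f : 'rV[R]_d -> R) : continuous f -> measurable_fun setT f.
Proof.
move=> cf.
pose z n (x : 'rV[R]_d) : 'rV[int]_d := \row_j Num.floor (n.+1%:R * x ord0 j).
pose q n (k : 'rV[int]_d) : 'rV[R]_d := \row_j ((k ord0 j)%:~R / n.+1%:R).
apply: (@measurable_realfun.measurable_fun_cvg _ _ _ _ (fun n => (f \o q n) \o z n)).
  move=> n; apply: measurable_countable_factor => k.
  rewrite (_ : _ @^-1` _ = \big[setI/setT]_(j < d) [set x : 'rV[R]_d | Num.floor (n.+1%:R * x ord0 j) = k ord0 j]).
    apply: bigsetI_measurable => j _.
    rewrite (_ : [set x | _] = (fun x : 'rV[R]_d => x ord0 j) @^-1` [set t : R | Num.floor (n.+1%:R * t) = k ord0 j])//.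
    by rewrite -[X in measurable X]setTI; apply: (@measurable_coord R d j) => //; exact: measurable_floorM.
  rewrite -bigcap_seq; apply/seteqP; split => x /=.
    by move=> zk j _ /=; rewrite -zk mxE.
  by move=> h; apply/rowP => j; rewrite mxE; apply: h; rewrite /= mem_index_enum.
move=> x _; apply: (cvg_comp (fun n => q n (z n x)) f _ (cf x)).
apply: cvg_rowP => i; under eq_cvg do rewrite !mxE; exact: floorM_cvg.
Qed.

End continuous_measurable.

Section periodic_functions.
Context {R : realType} {d : nat}.
Local Notation Rd := 'rV[R]_d.
Local Notation mu := (@torus_measure R d).
Implicit Types f g : Rd -> R.

Lemma periodic_shift f (i : 'I_d) (z : int) x : periodic f ->
  f (x + z%:~R *: basis_vec i) = f x.
Proof.
move=> pf.
have pn n y : f (y + n%:R *: basis_vec i) = f y.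
  elim: n y => [|n IH] y; first by rewrite scale0r addr0.
  by rewrite -natr1 scalerDl scale1r addrA pf IH.
case: z => n; first exact: pn.
rewrite NegzE mulrNz scaleNr -[in RHS](subrK (n.+1%:R *: basis_vec i) x).
by rewrite pn.
Qed.

Lemma periodic_shift_sum f (s : seq 'I_d) (z : 'I_d -> int) x : periodic f ->
  f (x + \sum_(i <- s) (z i)%:~R *: basis_vec i) = f x.
Proof.
move=> pf; elim: s x => [|a s IH] x; first by rewrite big_nil addr0.
by rewrite big_cons addrA IH periodic_shift.
Qed.

Lemma row_basis (x : Rd) : \sum_i x ord0 i *: basis_vec i = x.
Proof. by rewrite [RHS]row_sum_delta. Qed.

Definition frac (x : Rd) : Rd := \row_j (x ord0 j - (Num.floor (x ord0 j))%:~R).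

Lemma frac_itv x i : 0 <= frac x ord0 i < 1.
Proof.
rewrite mxE; have /andP[h1 h2] := floor_itv (x ord0 i).
by rewrite subr_ge0 h1/= ltrBlDl; move: h2; rewrite intrD.
Qed.

Lemma periodic_row f (z : 'I_d -> int) (x : Rd) : periodic f ->
  f (\row_j (x ord0 j + (z j)%:~R)) = f x.
Proof.
move=> pf; rewrite -[RHS](periodic_shift_sum (index_enum _) z _ pf); congr f.
apply/rowP => j; rewrite !mxE summxE (bigD1 j)//= big1.
  by rewrite addr0 !mxE !eqxx/= mulr1.
by move=> k kj; rewrite !mxE eqxx/= eq_sym (negbTE kj) mulr0.
Qed.

Lemma periodic_frac f x : periodic f -> f (frac x) = f x.
Proof.
move=> pf; rewrite -(periodic_row (fun j => - Num.floor (x ord0 j)) x pf).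
by congr f; apply/rowP => j; rewrite !mxE intrN.
Qed.

Lemma frac_periodic f : periodic (f \o frac).
Proof.
move=> x i /=; congr f; apply/rowP => j; rewrite !mxE eqxx/=.
case: (j == i) => /=; last by rewrite addr0.
by rewrite floorDrz ?rpred1// floor1 intrD; lra.
Qed.

Definition cube : set Rd := [set x | forall i, `[0, 1]%classic (x ord0 i)].

Lemma compact_cube : compact cube.
Proof.
have := @rV_compact R d (fun=> `[0, 1]%classic).
by apply => i; exact: segment_compact.
Qed.

Lemma frac_cube x : cube (frac x).
Proof. by move=> i /=; rewrite in_itv/=; have /andP[-> /ltW ->] := frac_itv x i. Qed.

Definition cper f := periodic f /\ continuous f.

Lemma cper_bnd f : cper f -> exists2 B : R, 0 <= B & forall x, `|f x| <= B.
Proof.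
move=> [pf cf].
have : compact (f @` cube) by apply: continuous_compact compact_cube; exact: continuous_subspaceT.
move=> /compact_bounded[M [Mr hM]]; exists (`|M| + 1); first by rewrite addr_ge0.
move=> x; rewrite -(periodic_frac _ pf); apply: hM.
  by apply: le_lt_trans (ler_norm _) _; rewrite ltrDl.
by exists (frac x) => //; exact: frac_cube.
Qed.

Lemma cper_mf f : cper f -> measurable_fun setT f.
Proof. by case=> _; exact: continuous_measurable_row. Qed.

Lemma cper_itg f : cper f -> mu.-integrable setT (EFin \o f).
Proof. by move=> F; have [B _ hB] := cper_bnd F; apply: itg_bnd hB; exact: cper_mf. Qed.

Lemma cper_L2 f : cper f -> L2 mu f.
Proof. by move=> F; have [B _ hB] := cper_bnd F; apply: L2_bnd hB; exact: cper_mf. Qed.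

Lemma cper_cst (c : R) : cper (fun=> c).
Proof. by split => //; exact: cst_continuous. Qed.

Lemma cperD f g : cper f -> cper g -> cper (fun x => f x + g x).
Proof.
by move=> [pf cf] [pg cg]; split => [x i|x]; [rewrite pf pg|exact: (cvgD (cf x) (cg x))].
Qed.

Lemma cperB f g : cper f -> cper g -> cper (fun x => f x - g x).
Proof.
by move=> [pf cf] [pg cg]; split => [x i|x]; [rewrite pf pg|exact: (cvgB (cf x) (cg x))].
Qed.

Lemma cperM f g : cper f -> cper g -> cper (fun x => f x * g x).
Proof.
by move=> [pf cf] [pg cg]; split => [x i|x]; [rewrite pf pg|exact: (cvgM (cf x) (cg x))].
Qed.

Lemma cperX n f : cper f -> cper (fun x => f x ^+ n).
Proof.
move=> F; elim: n => [|n IH].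
  by under eq_fun do rewrite expr0; exact: cper_cst.
by under eq_fun do rewrite exprS; exact: cperM.
Qed.

Lemma cper_sum (I : Type) (s : seq I) (F : I -> Rd -> R) :
  (forall i, cper (F i)) -> cper (fun x => \sum_(i <- s) F i x).
Proof.
move=> iF; elim: s => [|a s IH].
  by under eq_fun do rewrite big_nil; exact: cper_cst.
by under eq_fun do rewrite big_cons; exact: cperD.
Qed.

Lemma cper_comp (h : R -> R) f : cper f -> (forall x, {for f x, continuous h}) -> cper (h \o f).
Proof.
move=> [pf cf] ch; split => [x i|x] /=; first by rewrite pf.
exact: (continuous_comp (cf x) (ch x)).
Qed.

End periodic_functions.

Section unif_integral.
Context {R : realType}.
Local Notation unif := (uniform_prob (@ltr01 R)).
Local Notation leb := (@lebesgue_measure R).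

Lemma integral_unifE (f : R -> R) : measurable_fun setT f ->
  \int[unif]_t f t = \int[leb]_(t in `[0, 1]) f t.
Proof.
move=> mf; rewrite /Rintegral; congr fine; rewrite [LHS]integralE [RHS]integralE.
have h (g : R -> \bar R) : measurable_fun setT g -> (forall x, (0 <= g x)%E) ->
    (\int[unif]_t g t = \int[leb]_(t in `[0%R, 1%R]) g t)%E.
  by move=> mg g0; rewrite (@integral_uniform _ _ _ ltr01)// subr0 invr1 mul1e.
have mE : measurable_fun setT (EFin \o f) by exact/measurable_EFinP.
by rewrite !h//; [exact: measurable_funeneg|exact: measurable_funepos].
Qed.

Lemma derivable_continuous1 (F : R -> R) (f : R -> R) : (forall t, is_derive (t : R) (1 : R) F (f t)) ->
  continuous F.
Proof.
move=> dF t; apply: differentiable_continuous; apply/derivable1_diffP.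
by have [] := dF t.
Qed.

Lemma ftc_itv (F f : R -> R) (a b : R) : a < b -> (forall t, is_derive (t : R) (1 : R) F (f t)) ->
  continuous f -> \int[leb]_(t in `[a, b]) f t = F b - F a.
Proof.
move=> ab dF cf; rewrite /Rintegral (@continuous_FTC2 _ f F)//.
- exact: continuous_subspaceT.
- have cF := derivable_continuous1 dF.
  split => [t _||]; first by have [] := dF t.
  + exact: cvg_at_right_filter (cF a).
  + exact: cvg_at_left_filter (cF b).
- by move=> t _; rewrite derive1E; have [_ ->] := dF t.
Qed.

Lemma ftc_unif (F f : R -> R) : (forall t, is_derive (t : R) (1 : R) F (f t)) -> continuous f ->
  \int[unif]_t f t = F 1 - F 0.
Proof.
move=> dF cf; rewrite integral_unifE ?(ftc_itv ltr01 dF cf)//.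
exact: continuous_measurable_fun.
Qed.

Lemma tonelli_cons_R d (f : 'rV[R]_d.+1 -> R) (B : R) : measurable_fun setT f ->
  (forall x, `|f x| <= B) ->
  \int[torus_measure d.+1]_x f x = \int[unif]_s \int[torus_measure d]_y f (row_cons (s, y)).
Proof.
move=> mf fB.
have mc s : measurable_fun setT (fun y : 'rV[R]_d => f (row_cons (s, y))).
  apply: measurableT_comp => //.
  exact: (measurableT_comp (@measurable_row_cons R d) (@pair1_measurable _ _ _ _ s)).
(* Adding B makes Tonelli's theorem available; B is removed at the end. *)
have f0 x : 0 <= f x + B by have := fB x; rewrite ler_norml => /andP[]; lra.
have mfB : measurable_fun setT (fun x => (f x + B)%:E).
  by apply/measurable_EFinP; apply: measurable_funD.
have key := tonelli_cons mfB (fun x => f0 x).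
have ifB : (torus_measure d.+1).-integrable setT (EFin \o f) := itg_bnd mf fB.
have inner s : (\int[torus_measure d]_y (f (row_cons (s, y)) + B)%:E)%E =
    (\int[torus_measure d]_y f (row_cons (s, y)) + B)%:E.
  have i1 : (torus_measure d).-integrable setT (EFin \o (fun y => f (row_cons (s, y)))).
    exact: itg_bnd (mc s) (fun x => fB _).
  rewrite eint_fin; last by apply: itgD => //; exact: itg_cst.
  by rewrite integralD_R//; [rewrite integral_cst_R|exact: itg_cst].
have mo : measurable_fun setT (fun s : measurableTypeR R => \int[torus_measure d]_y f (row_cons (s, y))).
  have := @measurable_fun_fubini_tonelli_F _ _ _ _ _ (torus_measure d) (fun z => (f (row_cons z) + B)%:E) _ (fun z => f0 _).
  move=> H; have {}H := H (measurableT_comp mfB (@measurable_row_cons R d)).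
  rewrite (_ : (fun s => _) = (fun s => (\int[torus_measure d]_y f (row_cons (s, y)) + B) - B)); last first.
    by apply/funext => s; rewrite addrK.
  apply: measurable_funB => //; apply/measurable_EFinP.
  by apply: eq_measurable_fun H => s _; rewrite /fubini_F/= inner.
have oB s : `|\int[torus_measure d]_y f (row_cons (s, y))| <= B.
  exact: integral_abs_bnd (mc s) (fun x => fB _).
have io : unif.-integrable setT (EFin \o (fun s => \int[torus_measure d]_y f (row_cons (s, y)))).
  exact: itg_bnd mo oB.
move: key; under [X in _ = X -> _]eq_integral do rewrite inner.
rewrite eint_fin; last by apply: itgD => //; exact: itg_cst.
rewrite eint_fin; last by apply: itgD => //; exact: itg_cst.
move=> []; rewrite integralD_R//; last exact: itg_cst.
rewrite [X in _ = X -> _]integralD_R//; last exact: itg_cst.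
by rewrite !integral_cst_R => /addIr.
Qed.

Lemma resample_R d (i : 'I_d) (f : 'rV[R]_d -> R) (B : R) : measurable_fun setT f ->
  (forall x, `|f x| <= B) ->
  \int[torus_measure d]_x f x = \int[torus_measure d]_x \int[unif]_t f (upd i t x).
Proof.
move=> mf fB.
have mc x : measurable_fun setT (fun t : measurableTypeR R => f (upd i t x)).
  by apply: measurableT_comp => //; exact: measurable_upd2.
have f0 x : 0 <= f x + B by have := fB x; rewrite ler_norml => /andP[]; lra.
have mfB : measurable_fun setT (fun x => (f x + B)%:E).
  by apply/measurable_EFinP; apply: measurable_funD.
have key := resample i mfB (fun x => f0 x).
have ifB : (torus_measure d).-integrable setT (EFin \o f) := itg_bnd mf fB.
have inner x : (\int[unif]_t (f (upd i t x) + B)%:E)%E =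
    (\int[unif]_t f (upd i t x) + B)%:E.
  have i1 : unif.-integrable setT (EFin \o (fun t => f (upd i t x))).
    exact: itg_bnd (mc x) (fun x => fB _).
  rewrite eint_fin; last by apply: itgD => //; exact: itg_cst.
  by rewrite integralD_R//; [rewrite integral_cst_R|exact: itg_cst].
have mo : measurable_fun setT (fun x => \int[unif]_t f (upd i t x)).
  have := @measurable_fun_fubini_tonelli_F _ _ _ _ _ unif (fun z => (f (upd i z.2 z.1) + B)%:E) _ (fun z => f0 _).
  move=> H; have {}H := H (measurableT_comp mfB (@measurable_upd R d i)).
  rewrite (_ : (fun s => _) = (fun x => (\int[unif]_t f (upd i t x) + B) - B)); last first.
    by apply/funext => s; rewrite addrK.
  apply: measurable_funB => //; apply/measurable_EFinP.
  by apply: eq_measurable_fun H => s _; rewrite /fubini_F/= inner.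
have oB x : `|\int[unif]_t f (upd i t x)| <= B.
  exact: integral_abs_bnd (mc x) (fun x => fB _).
have io : (torus_measure d).-integrable setT (EFin \o (fun x => \int[unif]_t f (upd i t x))).
  exact: itg_bnd mo oB.
move: key; under [X in _ = X -> _]eq_integral do rewrite inner.
rewrite eint_fin; last by apply: itgD => //; exact: itg_cst.
rewrite eint_fin; last by apply: itgD => //; exact: itg_cst.
move=> []; rewrite integralD_R//; last exact: itg_cst.
rewrite [X in _ = X -> _]integralD_R//; last exact: itg_cst.
by rewrite !integral_cst_R => /addIr.
Qed.

Lemma upd10_periodic d (f : 'rV[R]_d -> R) i x : periodic f -> f (upd i 1 x) = f (upd i 0 x).
Proof. by move=> pf; rewrite -[1]addr0 updD scale1r addrC pf. Qed.

(** After resampling coordinate i, the fundamental theorem of calculus leaves a difference of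
    endpoint values, which vanishes by periodicity. *)
Lemma integral_partial0 d (f df : 'rV[R]_d -> R) i : periodic f -> cper df ->
  (forall x, is_derive x (basis_vec i) f (df x)) -> \int[torus_measure d]_x df x = 0.
Proof.
move=> pf cdf dfx; have [B _ hB] := cper_bnd cdf.
rewrite (resample_R i (cper_mf cdf) hB).
rewrite -[RHS](@integral_cst_R _ _ _ (torus_measure d) 0); apply: eq_Rintegral => x _.
have H t : is_derive (t : R) (1 : R) (fun t => f (upd i t x)) (df (upd i t x)).
  by apply: is_derive_upd; exact: dfx.
rewrite (ftc_unif H); first by rewrite upd10_periodic// subrr.
move=> t; apply: (@continuous_comp _ _ _ (fun t => upd i t x) df).
  exact: continuous_upd.
exact: cdf.2.
Qed.

Lemma integration_by_parts_torus d (f g df dg : 'rV[R]_d -> R) i :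
  cper f -> cper g -> cper df -> cper dg ->
  (forall x, is_derive x (basis_vec i) f (df x)) ->
  (forall x, is_derive x (basis_vec i) g (dg x)) ->
  \int[torus_measure d]_x (f x * dg x) = - \int[torus_measure d]_x (df x * g x).
Proof.
move=> cf cg cdf cdg df_ dg_; apply/eqP; rewrite -subr_eq0 opprK; apply/eqP.
rewrite -integralD_R; [|apply: cper_itg; exact: cperM..].
apply: (@integral_partial0 _ (fun x => f x * g x) _ i).
- by move=> x j; rewrite cf.1 cg.1.
- by apply: cperD; exact: cperM.
- move=> x; have := is_deriveM (df_ x) (dg_ x); rewrite /GRing.scale/=.
  by rewrite (mulrC (g x)).
Qed.

End unif_integral.

Lemma is_derive_powX {R : realType} (V : normedModType R) (f : V -> R) (n : nat) (x v : V) (df : R) :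
  is_derive x v f df -> is_derive x v (fun y => f y ^+ n) (n%:R * f x ^+ n.-1 * df).
Proof.
move=> h; have := is_deriveX n h; rewrite (_ : f ^+ n = fun y => f y ^+ n)//.
by apply/funext => y; rewrite exprfctE.
Qed.

Lemma continuous_prodr {R : realType} (T : topologicalType) (I : Type) (s : seq I) (F : I -> T -> R) :
  (forall i, continuous (F i)) -> continuous (fun x => \prod_(i <- s) F i x).
Proof.
move=> cF; elim: s => [|a s IH].
  by under [X in continuous X]eq_fun do rewrite big_nil; exact: cst_continuous.
under [X in continuous X]eq_fun do rewrite big_cons.
by move=> x; apply: cvgM; [exact: cF|exact: IH].
Qed.

Lemma continuous_sumr {R : realType} (T : topologicalType) (I : Type) (s : seq I) (F : I -> T -> R) :
  (forall i, continuous (F i)) -> continuous (fun x => \sum_(i <- s) F i x).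
Proof.
move=> cF; elim: s => [|a s IH].
  by under [X in continuous X]eq_fun do rewrite big_nil; exact: cst_continuous.
under [X in continuous X]eq_fun do rewrite big_cons.
by move=> x; apply: cvgD; [exact: cF|exact: IH].
Qed.

Lemma continuous_mulcst {R : realType} (T : topologicalType) (c : R) (f : T -> R) :
  continuous f -> continuous (fun x => c * f x).
Proof. by move=> cf x; exact: (cvgM (cvg_cst c) (cf x)). Qed.

Lemma continuous_cstB {R : realType} (T : topologicalType) (V : normedModType R) (c : V) (f : T -> V) :
  continuous f -> continuous (fun x => c - f x).
Proof. by move=> cf x; exact: (cvgB (cvg_cst c) (cf x)). Qed.

(** * Trigonometric kernels *)

Section one_dim.
Context {R : realType}.
Local Notation unif := (uniform_prob (@ltr01 R)).
Local Notation leb := (@lebesgue_measure R).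

Lemma primitive_exists (f : R -> R) : continuous f ->
  exists F : R -> R, forall t : R, is_derive (t : R) (1 : R) F (f t).
Proof.
move=> cf.
have fi (a b : R) : leb.-integrable `[a, b] (EFin \o f).
  apply: continuous_compact_integrable; first exact: segment_compact.
  exact: continuous_subspaceT.
(* One of the two integrals is over an empty interval, so this single formula is the signed integral
   from 0 to x. Near x it is compared with the integral started at c, to the left of both x and
   0. *)
exists (fun x => \int[leb]_(t in `]0, x]) f t - \int[leb]_(t in `]x, 0]) f t) => x.
pose c := Num.min x 0 - 1.
have h1 : Num.min x 0 <= x by rewrite ge_min lexx.
have h2 : Num.min x 0 <= 0 by rewrite ge_min lexx orbT.
have cx : c < x by rewrite /c; lra.
have c0 : c < 0 by rewrite /c; lra.
have x1 : x < x + 1 by rewrite ltrDl.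
have [d1 d2] := @continuous_FTC1_closed R f c x (x + 1) x1 (fi _ _) cx (cf x).
set G := (fun _ => _) in d1 d2.
have dG : is_derive (x : R) (1 : R) G (f x).
  by split; [exact: d1|rewrite -derive1E; exact: d2].
have key : \forall y \near x, G y - G 0 =
    \int[leb]_(t in `]0, y]) f t - \int[leb]_(t in `]y, 0]) f t.
  have : \forall y \near x, c < y by exact: lt_nbhsr.
  apply: filterS => y cy; have [y0|y0] := leP 0 y.
    rewrite /G (Rintegral_itvB (fi c y)); [|by rewrite bnd_simp ltW|by rewrite bnd_simp].
    rewrite [X in _ = _ - X](_ : _ = 0) ?subr0//.
    by rewrite set_itv_ge ?Rintegral_set0// bnd_simp -leNgt.
  rewrite /G -[LHS]opprB (Rintegral_itvB (fi c 0)); [|by rewrite bnd_simp ltW|by rewrite bnd_simp ltW].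
  rewrite [X in _ = X - _](_ : _ = 0) ?sub0r//.
  by rewrite set_itv_ge ?Rintegral_set0// bnd_simp -leNgt ltW.
apply: (near_eq_is_derive key).
have := is_deriveB dG (is_derive_cst (G 0) x 1).
by rewrite subr0.
Qed.

(** For a primitive F of f, the function [F (1 + t) - F t] has zero derivative by periodicity of f,
    hence is constant. *)
Lemma integral_unif_shift (f : R -> R) (a : R) : continuous f ->
  (forall t, f (t + 1) = f t) -> \int[unif]_t f (a + t) = \int[unif]_t f t.
Proof.
move=> cf fp; have [F dF] := primitive_exists cf.
have dD b (t : R) : is_derive t (1:R) (fun t => F (b + t)) (f (b + t)).
  have := @is_derive1_comp R F (fun t => b + t) t (f (b + t)) 1 (dF _).
  rewrite mulr1; apply.
  by have := is_deriveD (is_derive_cst b t 1) (is_derive_id t 1); rewrite add0r.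
have ca : continuous (fun t => f (a + t)).
  move=> t; apply: (@continuous_comp _ _ _ (fun t => a + t) f); last exact: cf.
  by apply: cvgD; [exact: cvg_cst|exact: cvg_id].
rewrite (ftc_unif (dD a) ca) (ftc_unif dF cf) addr0.
pose H t := F (1 + t) - F t.
have dH (t : R) : is_derive t (1:R) H 0.
  have := is_deriveB (dD 1 t) (dF t).
  by rewrite (addrC 1 t) fp subrr.
have := @is_derive_0_is_cst R H a 0 dH; rewrite /H addr0.
by rewrite (addrC a).
Qed.

Lemma integral_unif_opp (f : R -> R) (a : R) : continuous f ->
  (forall t, f (t + 1) = f t) -> \int[unif]_t f (a - t) = \int[unif]_t f t.
Proof.
move=> cf fp; rewrite -(integral_unif_shift (a - 1) cf fp).
have [F dF] := primitive_exists cf.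
have dD b (t : R) : is_derive t (1:R) (fun t => F (b + t)) (f (b + t)).
  have := @is_derive1_comp R F (fun t => b + t) t (f (b + t)) 1 (dF _).
  rewrite mulr1; apply.
  by have := is_deriveD (is_derive_cst b t 1) (is_derive_id t 1); rewrite add0r.
have dN (t : R) : is_derive t (1:R) (fun t => - F (a - t)) (f (a - t)).
  have := @is_derive1_comp R F (fun t => a - t) t (f (a - t)) (-1) (dF _).
  rewrite mulrN1 => h; rewrite -[f _]opprK; apply: is_deriveN; apply: h.
  by have := is_deriveB (is_derive_cst a t 1) (is_derive_id t 1); rewrite sub0r.
rewrite (ftc_unif (dD _)); last first.
  move=> t; apply: (@continuous_comp _ _ _ (fun t => a - 1 + t) f); last exact: cf.
  by apply: cvgD; [exact: cvg_cst|exact: cvg_id].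
rewrite (ftc_unif dN); last first.
  move=> t; apply: (@continuous_comp _ _ _ (fun t => a - t) f); last exact: cf.
  by apply: cvgB; [exact: cvg_cst|exact: cvg_id].
by rewrite subrK subr0 addr0 opprK addrC.
Qed.

Definition c2 (t : R) : R := cos (2 * pi * t).
Definition s2 (t : R) : R := sin (2 * pi * t).

Lemma is_derive_2pi (t : R) : is_derive t (1:R) (fun t => 2 * pi * t) (2 * pi).
Proof.
have := is_deriveM (is_derive_cst (2 * pi : R) t 1) (is_derive_id t 1).
by rewrite /GRing.scale/= mulr0 addr0 mulr1.
Qed.

Lemma is_derive_c2 (t : R) : is_derive t (1:R) c2 (- (2 * pi * s2 t)).
Proof.
have := @is_derive1_comp R cos (fun t => 2 * pi * t) t _ _ (is_derive_cos _) (is_derive_2pi t).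
by move=> h; apply: (is_derive_eq h); rewrite mulNr mulrC.
Qed.

Lemma is_derive_s2 (t : R) : is_derive t (1:R) s2 (2 * pi * c2 t).
Proof.
have := @is_derive1_comp R sin (fun t => 2 * pi * t) t _ _ (is_derive_sin _) (is_derive_2pi t).
by move=> h; apply: (is_derive_eq h); rewrite mulrC.
Qed.

Lemma continuous_c2 : continuous c2.
Proof. exact: derivable_continuous1 is_derive_c2. Qed.

Lemma c2D1 t : c2 (t + 1) = c2 t.
Proof. by rewrite /c2 mulrDr mulr1 mulr_natl cosD2pi. Qed.

Lemma c2N t : c2 (- t) = c2 t.
Proof. by rewrite /c2 mulrN cosN. Qed.

Lemma c2_le1 t : -1 <= c2 t <= 1. Proof. by rewrite cos_geN1 cos_le1. Qed.

Lemma c2s2 t : s2 t ^+ 2 = 1 - c2 t ^+ 2.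
Proof. by rewrite /s2 /c2 sin2cos2. Qed.

Lemma continuous_itg_unif (f : R -> R) (B : R) : continuous f -> (forall t, `|f t| <= B) ->
  unif.-integrable setT (EFin \o f).
Proof.
move=> cf fB; apply: (@itg_bnd _ (measurableTypeR R) R unif B f) => //.
exact: continuous_measurable_fun.
Qed.

Lemma continuous_1c2X n : continuous (fun t => (1 + c2 t) ^+ n).
Proof.
elim: n => [|n IH].
  by under [X in continuous X]eq_fun do rewrite expr0; exact: cst_continuous.
under [X in continuous X]eq_fun do rewrite exprS.
move=> t; apply: cvgM; last exact: IH.
by apply: cvgD; [exact: cvg_cst|exact: continuous_c2].
Qed.

Lemma bnd_1c2X n t : 0 <= (1 + c2 t) ^+ n <= 2 ^+ n.
Proof.
have /andP[h1 h2] := c2_le1 t.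
rewrite exprn_ge0 ?lerXn2r ?nnegrE//=; lra.
Qed.

Definition Jc n : R := \int[unif]_t (1 + c2 t) ^+ n.

Lemma itg_1c2X n : unif.-integrable setT (EFin \o (fun t => (1 + c2 t) ^+ n)).
Proof.
apply: (@continuous_itg_unif _ (2 ^+ n)); first exact: continuous_1c2X.
by move=> t; have /andP[h1 h2] := bnd_1c2X n t; rewrite ger0_norm.
Qed.

Lemma itg_1c2X_c2 n : unif.-integrable setT (EFin \o (fun t => (1 + c2 t) ^+ n * c2 t)).
Proof.
apply: (@continuous_itg_unif _ (2 ^+ n)).
  by move=> t; apply: cvgM; [exact: continuous_1c2X|exact: continuous_c2].
move=> t; have /andP[h1 h2] := bnd_1c2X n t; rewrite normrM ger0_norm//.
have : `|c2 t| <= 1 by rewrite ler_norml c2_le1.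
by move=> h; apply: le_trans h2; rewrite ler_piMr.
Qed.

(** Integrate the derivative of [(1 + c2)^n s2] over a period, using [s2^2 = (1 - c2)(1 + c2)]. This
    gives the recursion for [Jc] and the exact moment of the kernel. *)
Lemma integral_1c2X_c2 n :
  \int[unif]_t ((1 + c2 t) ^+ n * c2 t) = n%:R / n.+1%:R * Jc n.
Proof.
have dF (t : R) : is_derive t (1:R) (fun t => (1 + c2 t) ^+ n * s2 t)
    (2 * pi * (n.+1%:R * ((1 + c2 t) ^+ n * c2 t) - n%:R * (1 + c2 t) ^+ n)).
  have d1 : is_derive t (1:R) (fun t => 1 + c2 t) (- (2 * pi * s2 t)).
    by have := is_deriveD (is_derive_cst (1:R) t 1) (is_derive_c2 t); rewrite add0r.
  apply: (is_derive_eq (is_deriveM (is_derive_powX n d1) (is_derive_s2 t))).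
  rewrite /GRing.scale/=.
  transitivity ((1 + c2 t) ^+ n * (2 * pi * c2 t) -
    2 * pi * n%:R * (1 + c2 t) ^+ n.-1 * (s2 t ^+ 2)); first by ring.
  rewrite c2s2 -natr1; case: n {d1} => [|m] /=; first by ring.
  by rewrite exprS; ring.
have cf : continuous (fun t => 2 * pi * (n.+1%:R * ((1 + c2 t) ^+ n * c2 t) - n%:R * (1 + c2 t) ^+ n)).
  move=> t; apply: cvgM; first exact: cvg_cst.
  apply: cvgB; (apply: cvgM; first exact: cvg_cst); last exact: continuous_1c2X.
  by apply: cvgM; [exact: continuous_1c2X|exact: continuous_c2].
have := ftc_unif dF cf.
rewrite /s2 mulr1 mulr0 sin0 mulr0 mulr_natl sin2pi mulr0 subr0.
have i1 := itg_1c2X n; have i2 := itg_1c2X_c2 n.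
rewrite integralZ_R; last by apply: itgB; exact: itgZ.
rewrite integralB_R; [|exact: itgZ..].
rewrite !integralZ_R// -/(Jc n) => /eqP.
rewrite mulf_eq0 gt_eqF/=; last by rewrite pmulrn_lgt0// pi_gt0.
rewrite subr_eq0 => /eqP h.
have n1 : n.+1%:R != 0 :> R by rewrite pnatr_eq0.
by apply: (mulfI n1); rewrite h mulrA (mulrC n.+1%:R) divfK.
Qed.

Lemma JcS n : Jc n.+1 = (1 + n%:R / n.+1%:R) * Jc n.
Proof.
rewrite mulrDl mul1r -integral_1c2X_c2 -integralD_R; [|exact: itg_1c2X|exact: itg_1c2X_c2].
by apply: eq_Rintegral => t _; rewrite exprSr mulrDr mulr1.
Qed.

Lemma Jc_gt0 n : 0 < Jc n.
Proof.
elim: n => [|n IH].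
  by rewrite /Jc; under eq_Rintegral do rewrite expr0; rewrite integral_cst_R.
by rewrite JcS mulr_gt0// ltr_wpDr// divr_ge0.
Qed.

(** The de la Vallée Poussin kernel, a nonnegative even trigonometric polynomial of mass 1. *)
Definition kap n (t : R) : R := (1 + c2 t) ^+ n / Jc n.

Lemma kap_ge0 n t : 0 <= kap n t.
Proof. by rewrite /kap divr_ge0// ?(ltW (Jc_gt0 n))//; have /andP[] := bnd_1c2X n t. Qed.

Lemma kap_bnd n t : `|kap n t| <= 2 ^+ n / Jc n.
Proof.
rewrite ger0_norm ?kap_ge0// /kap ler_wpM2r ?invr_ge0 ?(ltW (Jc_gt0 n))//.
by have /andP[] := bnd_1c2X n t.
Qed.

Lemma kapD1 n t : kap n (t + 1) = kap n t. Proof. by rewrite /kap c2D1. Qed.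

Lemma kapN n t : kap n (- t) = kap n t. Proof. by rewrite /kap c2N. Qed.

Lemma continuous_kap n : continuous (kap n).
Proof. by move=> t; apply: cvgM; [exact: continuous_1c2X|exact: cvg_cst]. Qed.

Lemma itg_kap n : unif.-integrable setT (EFin \o kap n).
Proof. exact: (continuous_itg_unif (continuous_kap (n := n)) (kap_bnd n)). Qed.

Lemma integral_kap n : \int[unif]_t kap n t = 1.
Proof.
rewrite /kap; under eq_Rintegral do rewrite mulrC.
by rewrite integralZ_R ?mulVf//; [rewrite gt_eqF ?Jc_gt0|exact: itg_1c2X].
Qed.

(** [1 - c2] plays the part of a squared distance to the integers, so this is the second moment of
    the kernel and fixes the rate of all approximations. *)
Lemma integral_kap1c2 n : \int[unif]_t (kap n t * (1 - c2 t)) = n.+1%:R^-1.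
Proof.
rewrite (_ : \int[unif]_t _ = \int[unif]_t (kap n t - (Jc n)^-1 * ((1 + c2 t) ^+ n * c2 t))).
  rewrite integralB_R; [|exact: itg_kap|exact/itgZ/itg_1c2X_c2].
  rewrite integral_kap integralZ_R; last exact: itg_1c2X_c2.
  rewrite integral_1c2X_c2 mulrCA mulVf ?gt_eqF ?Jc_gt0// mulr1.
  have n1 : n.+1%:R != 0 :> R by rewrite pnatr_eq0.
  rewrite -{1}(mulfV n1) -mulrBl -natr1.
  by rewrite addrAC subrr add0r mul1r.
by apply: eq_Rintegral => t _; rewrite /kap; ring.
Qed.

(** Outside an e-neighbourhood of the integers [1 - c2] has a positive minimum; C is its inverse. *)
Lemma dist_le_c2 (e : R) : 0 < e -> exists2 C : R, 0 <= C &
  forall t, 0 <= t <= 1 -> Num.min t (1 - t) <= e + C * (1 - c2 t).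
Proof.
move=> e0; have [he|he] := leP (1 / 2) e.
  exists 0 => // t _; rewrite mul0r addr0; apply: le_trans he.
  by rewrite ge_min; have [|h] := leP t (1/2) => //=; lra.
have e1 : e <= 1 - e by lra.
have [|c cin hc] := @EVT_min R (fun t => 1 - c2 t) e (1 - e) e1.
  by apply: continuous_subspaceT => t; apply: cvgB; [exact: cvg_cst|exact: continuous_c2].
have cpos : 0 < 1 - c2 c.
  move: cin; rewrite in_itv/= => /andP[ec ce].
  rewrite subr_gt0 lt_neqAle; have /andP[_ ->] := c2_le1 c; rewrite andbT.
  apply/negP => /eqP; rewrite /c2 (_ : 2 * pi * c = (pi * c) *+ 2); last by rewrite -mulr_natl; ring.
  rewrite cos_mulr2n => h.
  have : sin (pi * c) ^+ 2 = 0 by rewrite sin2cos2; lra.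
  move/eqP; rewrite sqrf_eq0 gt_eqF// sin_gt0_pi//.
  by rewrite mulr_gt0 ?pi_gt0 ?(lt_le_trans e0)//= gtr_pMr ?pi_gt0//; lra.
exists (1 - c2 c)^-1; first by rewrite invr_ge0 ltW.
move=> t /andP[t0 t1]; have c0 : 0 <= (1 - c2 c)^-1 * (1 - c2 t).
  by rewrite mulr_ge0 ?invr_ge0 ?(ltW cpos)//; have /andP[] := c2_le1 t; lra.
have [te|te] := leP t e; first by rewrite ge_min (le_trans te) ?lerDl.
have [te2|te2] := leP (1 - t) e; first by rewrite ge_min (le_trans te2) ?lerDl// orbT.
apply: (@le_trans _ _ 1); first by rewrite ge_min t1.
apply: (@le_trans _ _ ((1 - c2 c)^-1 * (1 - c2 t))); last by rewrite lerDr ltW.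
by rewrite mulrC ler_pdivlMr// mul1r hc// in_itv/=; lra.
Qed.

End one_dim.

(** * The product kernel on the torus *)

Section kernel.
Context {R : realType}.
Local Notation unif := (uniform_prob (@ltr01 R)).

Lemma integral_prod d (g : 'I_d -> R -> R) (B : 'I_d -> R) : (forall i, continuous (g i)) ->
  (forall i t, `|g i t| <= B i) ->
  \int[torus_measure d]_x \prod_i g i (x ord0 i) = \prod_i \int[unif]_t g i t.
Proof.
elim: d g B => [|d IH] g B cg gB.
  by under eq_Rintegral do rewrite big_ord0; rewrite integral_cst_R big_ord0.
have cprod : continuous (fun x : 'rV[R]_d.+1 => \prod_i g i (x ord0 i)).
  apply: continuous_prodr => i x.
  by apply: (@continuous_comp _ _ _ (fun x : 'rV[R]_d.+1 => x ord0 i) (g i));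
    [exact: coord_continuous|exact: cg].
have bprod (x : 'rV[R]_d.+1) : `|\prod_i g i (x ord0 i)| <= \prod_i B i.
  by rewrite normr_prod; apply: ler_prod => i _; rewrite normr_ge0/=.
rewrite (tonelli_cons_R (continuous_measurable_row cprod) bprod) big_ord_recl.
rewrite (_ : \int[unif]_s _ = \int[unif]_s (\prod_(i < d) \int[unif]_t g (lift ord0 i) t * g ord0 s)).
  by rewrite integralZ_R 1?mulrC//; exact: continuous_itg_unif (cg ord0) (gB ord0).
apply: eq_Rintegral => s _.
rewrite mulrC -(IH (fun i => g (lift ord0 i)) (fun i => B (lift ord0 i)))//.
rewrite -integralZ_R.
  apply: eq_Rintegral => y _; rewrite big_ord_recl row_cons0; congr (_ * _).
  by apply: eq_bigr => i _; rewrite (_ : lift ord0 i = rshift 1 i) ?row_consS//; exact: val_inj.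
have cprod' : continuous (fun x : 'rV[R]_d => \prod_i g (lift ord0 i) (x ord0 i)).
  apply: continuous_prodr => i x.
  by apply: (@continuous_comp _ _ _ (fun x : 'rV[R]_d => x ord0 i) (g (lift ord0 i)));
    [exact: coord_continuous|exact: cg].
apply: (@itg_bnd _ _ _ _ (\prod_i B (lift ord0 i))).
  exact: continuous_measurable_row.
by move=> x; rewrite normr_prod; apply: ler_prod => i _; rewrite normr_ge0/=.
Qed.

Definition Kern d n (x : 'rV[R]_d) : R := \prod_i kap n (x ord0 i).

Lemma Kern_ge0 d n (x : 'rV[R]_d) : 0 <= Kern n x.
Proof. by apply: prodr_ge0 => i _; exact: kap_ge0. Qed.

Lemma KernN d n (x : 'rV[R]_d) : Kern n (- x) = Kern n x.
Proof. by apply: eq_bigr => i _; rewrite mxE kapN. Qed.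

Definition kbnd d n : R := (2 ^+ n / Jc n) ^+ d.

Lemma Kern_bnd d n (x : 'rV[R]_d) : `|Kern n x| <= kbnd d n.
Proof.
rewrite /Kern normr_prod; apply: (@le_trans _ _ (\prod_(i < d) (2 ^+ n / Jc n))).
  by apply: ler_prod => i _; rewrite normr_ge0 kap_bnd.
by rewrite big_const_ord iter_mulr_1.
Qed.

Lemma integral_unif_kap_sub n (a : R) : \int[unif]_t kap n (a - t) = 1.
Proof. by rewrite (integral_unif_opp a (continuous_kap (n := n)) (kapD1 n)) integral_kap. Qed.

Lemma integral_Kern d n (x : 'rV[R]_d) : \int[torus_measure d]_y Kern n (x - y) = 1.
Proof.
rewrite /Kern; under eq_Rintegral => y _.
  under eq_bigr do rewrite !mxE.
  over.
rewrite (@integral_prod _ (fun i t => kap n (x ord0 i - t)) (fun=> 2 ^+ n / Jc n)).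
- by apply: big1 => i _; exact: integral_unif_kap_sub.
- move=> i t; apply: (@continuous_comp _ _ _ (fun t => x ord0 i - t) (kap n)).
    by apply: cvgB; [exact: cvg_cst|exact: cvg_id].
  exact: continuous_kap.
- by move=> i t; exact: kap_bnd.
Qed.

Lemma integral_Kern_c2 d n (x : 'rV[R]_d) (i : 'I_d) :
  \int[torus_measure d]_y (Kern n (x - y) * (1 - c2 (x ord0 i - y ord0 i))) = n.+1%:R^-1.
Proof.
(* The weight is placed in coordinate i only; all other factors integrate to 1. *)
pose g j t := kap n (x ord0 j - t) * (if j == i then 1 - c2 (x ord0 i - t) else 1).
have csub (h : R -> R) j : continuous h -> continuous (fun t => h (x ord0 j - t)).
  move=> ch t; apply: (@continuous_comp _ _ _ (fun t => x ord0 j - t) h); last exact: ch.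
  by apply: cvgB; [exact: cvg_cst|exact: cvg_id].
have c1c : continuous (fun t : R => 1 - c2 t).
  by move=> t; apply: cvgB; [exact: cvg_cst|exact: continuous_c2].
rewrite (_ : \int[_]_y _ = \int[torus_measure d]_y \prod_j g j (y ord0 j)); last first.
  apply: eq_Rintegral => y _; rewrite /g big_split/=; congr (_ * _).
    by apply: eq_bigr => j _; rewrite !mxE.
  by rewrite -big_mkcond/= big_pred1_eq.
rewrite (@integral_prod _ g (fun=> 2 ^+ n / Jc n * 2)).
- rewrite (bigD1 i)//= big1 ?mulr1.
    rewrite /g eqxx (integral_unif_opp (x ord0 i) (f := fun t => kap n t * (1 - c2 t))).
    + exact: integral_kap1c2.
    + by move=> t; apply: cvgM; [exact: continuous_kap|exact: c1c].
    + by move=> t; rewrite kapD1 c2D1.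
  move=> j ji; rewrite /g (negbTE ji); under eq_Rintegral do rewrite mulr1.
  exact: integral_unif_kap_sub.
- move=> j; rewrite /g; case: (j == i) => t.
    apply: cvgM; first exact: (csub _ _ (@continuous_kap _ n)).
    exact: (csub _ _ c1c).
  by apply: cvgM; [exact: (csub _ _ (@continuous_kap _ n))|exact: cvg_cst].
- move=> j t; rewrite /g normrM ler_pM// ?kap_bnd//; case: ifP => _; last by rewrite normr1; lra.
  by have /andP[h1 h2] := c2_le1 (x ord0 i - t); rewrite ger0_norm; lra.
Qed.

End kernel.

(** * Fourier modes and trigonometric polynomials *)

Section modes.
Context {R : realType} {d : nat}.
Local Notation Rd := 'rV[R]_d.
Local Notation mu := (@torus_measure R d).
Implicit Types (k : 'rV[int]_d) (x v : Rd) (b : bool).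

Definition ang k x : R := 2 * pi * \sum_i (k ord0 i)%:~R * x ord0 i.

Definition md b k x : R := if b then sin (ang k x) else cos (ang k x).

(** The sign that differentiation produces when it exchanges sine ([true]) and cosine ([false]). *)
Definition msgn b : R := if b then 1 else -1.

Lemma angD k x v : ang k (x + v) = ang k x + ang k v.
Proof.
rewrite /ang -mulrDr -big_split/=; congr (_ * _); apply: eq_bigr => i _.
by rewrite mxE mulrDr.
Qed.

Lemma angZ k (c : R) x : ang k (c *: x) = c * ang k x.
Proof.
rewrite /ang [RHS]mulrCA [in RHS]mulr_sumr; congr (_ * _); apply: eq_bigr => i _.
by rewrite mxE mulrCA.
Qed.

Lemma angB k x v : ang k (x - v) = ang k x - ang k v.
Proof. by rewrite angD -scaleN1r angZ mulN1r. Qed.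

Lemma ang_basis k i : ang k (basis_vec i) = 2 * pi * (k ord0 i)%:~R.
Proof.
rewrite /ang (bigD1 i)//= big1 ?addr0; first by rewrite mxE !eqxx mulr1.
by move=> j ji; rewrite mxE eqxx/= (negbTE ji) mulr0.
Qed.

Lemma cos_sin_int (z : int) (a : R) :
  cos (a + 2 * pi * z%:~R) = cos a /\ sin (a + 2 * pi * z%:~R) = sin a.
Proof.
have h (n : nat) (c : R) : cos (c + 2 * pi * n%:R) = cos c /\ sin (c + 2 * pi * n%:R) = sin c.
  have -> : 2 * pi * n%:R = (pi *+ 2) *+ n :> R by rewrite -[RHS]mulr_natr -(mulr_natl pi 2).
  by rewrite (periodicn (@cosD2pi R)) (periodicn (@sinD2pi R)).
case: z => n; first exact: h.
have [h1 h2] := h n.+1 (a + 2 * pi * (Negz n)%:~R).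
move: h1 h2; rewrite NegzE mulrNz mulrN.
by rewrite -[X in X - _ + _]/(a) subrK => <- <-.
Qed.

Lemma md_periodic b k : periodic (md b k).
Proof.
move=> x i; rewrite /md angD ang_basis.
by have [h1 h2] := cos_sin_int (k ord0 i) (ang k x); case: b; rewrite ?h1 ?h2.
Qed.

Lemma is_derive_ang k x v : is_derive (0 : R) (1 : R) (fun t => ang k (t *: v + x)) (ang k v).
Proof.
under eq_fun do rewrite angD angZ.
have := is_deriveD (is_deriveM (is_derive_id (0:R) (1:R)) (is_derive_cst (ang k v) (0:R) (1:R))) (is_derive_cst (ang k x) (0:R) (1:R)).
move=> h; apply: (is_derive_eq h); rewrite /GRing.scale/=; ring.
Qed.

Lemma is_derive_line (f : Rd -> R) x v l :
  is_derive (0 : R) (1 : R) (fun t => f (t *: v + x)) l -> is_derive x v f l.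
Proof.
move=> [df dl].
have E : (fun h : R => h^-1 *: (f (h *: v + x) - f x)) =
         (fun h : R => h^-1 *: (f ((h *: 1 + 0) *: v + x) - f (0 *: v + x))).
  by apply/funext => h; rewrite scale0r add0r addr0 /GRing.scale/= mulr1.
by split; [move: df; rewrite /derivable -E|move: dl; rewrite /derive -E].
Qed.

Lemma is_derive_md b k x v :
  is_derive x v (md b k) (msgn b * ang k v * md (~~ b) k x).
Proof.
apply: is_derive_line; rewrite /md; case: b => /=.
  have := @is_derive1_comp R sin (fun t => ang k (t *: v + x)) 0 _ _ (is_derive_sin _) (is_derive_ang k x v).
  by move=> h; apply: (is_derive_eq h); rewrite /msgn scale0r add0r mul1r mulrC.
have := @is_derive1_comp R cos (fun t => ang k (t *: v + x)) 0 _ _ (is_derive_cos _) (is_derive_ang k x v).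
by move=> h; apply: (is_derive_eq h); rewrite /msgn scale0r add0r; ring.
Qed.

Lemma continuous_ang k : continuous (ang k).
Proof.
apply: continuous_mulcst; apply: continuous_sumr => i.
by apply: continuous_mulcst; exact: coord_continuous.
Qed.

Lemma continuous_md b k : continuous (md b k).
Proof.
move=> x; rewrite /md; case: b.
  by apply: (@continuous_comp _ _ _ (ang k) sin); [exact: continuous_ang|exact: continuous_sin].
by apply: (@continuous_comp _ _ _ (ang k) cos); [exact: continuous_ang|exact: continuous_cos].
Qed.

Lemma cper_md b k : cper (md b k).
Proof. by split; [exact: md_periodic|exact: continuous_md]. Qed.

Lemma md_bnd b k x : `|md b k x| <= 1.
Proof. by rewrite /md; case: b; rewrite ler_norml ?sin_geN1 ?sin_le1 ?cos_geN1 ?cos_le1. Qed.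

(** Averaging two opposite translates acts diagonally on the modes, with factors of absolute value
    at most 1. Hence such averages stay in the Galerkin spaces and respect the coefficient
    bounds. *)
Lemma md_avg b k x i (s : R) :
  (md b k (x + s *: basis_vec i) + md b k (x - s *: basis_vec i)) / 2 =
  cos (2 * pi * (k ord0 i)%:~R * s) * md b k x.
Proof.
rewrite /md angB angD angZ ang_basis [s * _]mulrC.
by case: b => /=; rewrite ?sinD ?cosD ?sinN ?cosN; field.
Qed.

Lemma md_cos0 x : md false 0 x = 1.
Proof. by rewrite /md /ang big1 ?mulr0 ?cos0// => i _; rewrite mxE mul0r. Qed.

(* Trigonometric polynomials, as lists of (coefficient, (sine or cosine, frequency)). *)
Definition tp (a : seq (R * (bool * 'rV[int]_d))) x : R :=
  \sum_(p <- a) p.1 * md p.2.1 p.2.2 x.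

Definition dtp v (a : seq (R * (bool * 'rV[int]_d))) :=
  [seq (p.1 * (msgn p.2.1 * ang p.2.2 v), (~~ p.2.1, p.2.2)) | p <- a].

Lemma is_derive_tp a x v : is_derive x v (tp a) (tp (dtp v a) x).
Proof.
rewrite /tp big_map /=; elim: a => [|p a IH].
  under eq_fun do rewrite big_nil; rewrite big_nil; exact: is_derive_cst.
under eq_fun do rewrite big_cons; rewrite big_cons.
have := is_deriveM (is_derive_cst p.1 x v) (is_derive_md p.2.1 p.2.2 x v).
rewrite /GRing.scale/= mulr0 addr0 => h.
by apply: (is_derive_eq (is_deriveD h IH)); congr (_ + _); ring.
Qed.

Lemma cper_tp a : cper (tp a).
Proof.
apply: cper_sum => p; apply: cperM; first exact: cper_cst.
exact: cper_md.
Qed.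

Lemma iter_derive_tp vs a : iter_derive vs (tp a) = tp (foldr dtp a vs).
Proof.
elim: vs => [//|v vs IH] /=; rewrite IH; apply/funext => x.
by have [_ ->] := is_derive_tp (foldr dtp a vs) x v.
Qed.

Lemma Cinf_tp a : Cinf (tp a).
Proof.
split; first exact: (cper_tp a).1.
move=> vs x _; rewrite iter_derive_tp; split; first exact: (cper_tp _).2.
by move=> v; have [] := is_derive_tp (foldr dtp a vs) x v.
Qed.

Lemma partial_tp i a : partial [:: i] (tp a) = tp (dtp (basis_vec i) a).
Proof. exact: (iter_derive_tp [:: basis_vec i]). Qed.

(* Even trigonometric polynomials: the kernel belongs to this class. *)
Definition ctp (L : seq (R * 'rV[int]_d)) x : R := \sum_(p <- L) p.1 * cos (ang p.2 x).

Lemma ctp_cst (c : R) : exists L, forall x, ctp L x = c.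
Proof.
exists [:: (c, 0)] => x; rewrite /ctp big_seq1/=.
by have := md_cos0 x; rewrite /md => ->; rewrite mulr1.
Qed.

Lemma ctpD L1 L2 : exists L, forall x, ctp L x = ctp L1 x + ctp L2 x.
Proof. by exists (L1 ++ L2) => x; rewrite /ctp big_cat. Qed.

Lemma ang_addk k1 k2 x : ang (k1 + k2) x = ang k1 x + ang k2 x.
Proof.
rewrite /ang -mulrDr -big_split/=; congr (_ * _); apply: eq_bigr => i _.
by rewrite mxE intrD mulrDl.
Qed.

Lemma ang_subk k1 k2 x : ang (k1 - k2) x = ang k1 x - ang k2 x.
Proof.
rewrite /ang -mulrBr -sumrB; congr (_ * _); apply: eq_bigr => i _.
by rewrite !mxE intrD intrN mulrDl mulNr.
Qed.

Lemma ctp1M (p : R * 'rV[int]_d) L : exists L', forall x, ctp L' x = p.1 * cos (ang p.2 x) * ctp L x.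
Proof.
exists ([seq (p.1 * q.1 / 2, p.2 + q.2) | q <- L] ++ [seq (p.1 * q.1 / 2, p.2 - q.2) | q <- L]) => x.
rewrite /ctp big_cat !big_map/= -big_split/= mulr_sumr; apply: eq_bigr => q _.
by rewrite ang_addk ang_subk cosD cosB; field.
Qed.

Lemma ctpM L1 L2 : exists L, forall x, ctp L x = ctp L1 x * ctp L2 x.
Proof.
elim: L1 => [|p L1 [L IH]].
  by exists [::] => x; rewrite /ctp !big_nil mul0r.
have [L' hL'] := ctp1M p L2; have [L'' hL''] := ctpD L' L.
by exists L'' => x; rewrite hL'' hL' IH [ctp (p :: L1) x]/ctp big_cons mulrDl.
Qed.

Lemma ctp_c2 i : exists L, forall x, ctp L x = c2 (x ord0 i).
Proof.
exists [:: (1, delta_mx ord0 i)] => x; rewrite /ctp big_seq1/= mul1r /c2 /ang.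
congr (cos (_ * _)); rewrite (bigD1 i)//= big1 ?addr0; first by rewrite mxE !eqxx mul1r.
by move=> j ji; rewrite mxE eqxx/= (negbTE ji) mul0r.
Qed.

Lemma ctp_kap n i : exists L, forall x, ctp L x = kap n (x ord0 i).
Proof.
rewrite /kap; have [L0 h0] := ctp_cst (Jc n)^-1.
have [L1 h1] := ctp_cst 1; have [L2 h2] := ctp_c2 i; have [L3 h3] := ctpD L1 L2.
have [L4 h4] : exists L, forall x, ctp L x = (1 + c2 (x ord0 i)) ^+ n.
  elim: n {h0 L0} => [|n [L IH]].
    by have [L hL] := ctp_cst 1; exists L => x; rewrite hL expr0.
  by have [L' hL'] := ctpM L3 L; exists L' => x; rewrite hL' IH h3 h1 h2 exprS.
by have [L5 h5] := ctpM L4 L0; exists L5 => x; rewrite h5 h4 h0.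
Qed.

Lemma ctp_Kern n : exists L, forall x, ctp L x = Kern n x.
Proof.
rewrite /Kern; elim: (index_enum _) => [|i s [L IH]].
  by have [L hL] := ctp_cst 1; exists L => x; rewrite hL big_nil.
have [L1 h1] := ctp_kap n i; have [L2 h2] := ctpM L1 L.
by exists L2 => x; rewrite h2 h1 IH big_cons.
Qed.

Definition KL n := projT1 (cid (ctp_Kern n)).

Lemma KLE n x : ctp (KL n) x = Kern n x.
Proof. by rewrite /KL; case: cid. Qed.

Lemma continuous_Kern n : continuous (@Kern R d n).
Proof.
rewrite (_ : Kern n = ctp (KL n)); last by apply/funext => x; rewrite KLE.
apply: continuous_sumr => p; apply: continuous_mulcst.
exact: (@continuous_md false p.2).
Qed.

Lemma Kern_periodic n : periodic (@Kern R d n).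
Proof.
move=> x i; rewrite -!KLE; apply: eq_bigr => p _; congr (_ * _).
exact: (@md_periodic false p.2 x i).
Qed.

End modes.

(** * Convolution with the kernel *)

Section convolution.
Context {R : realType} {d : nat}.
Local Notation Rd := 'rV[R]_d.
Local Notation mu := (@torus_measure R d).
Local Notation itg f := (mu.-integrable setT (EFin \o f)).
Implicit Types (f g : Rd -> R) (x y : Rd).

Definition KK n f x : R := \int[mu]_y (Kern n (x - y) * f y).

Lemma continuous_Kern_sub n x : continuous (fun y => Kern n (x - y)).
Proof.
move=> y; apply: (@continuous_comp _ _ _ (fun y => x - y) (Kern n)); last exact: continuous_Kern.
apply: (@cvgB _ _ _ (nbhs y) _ (fun=> x) id); [exact: cvg_cst|exact: cvg_id].
Qed.

Lemma mf_Kern n x : measurable_fun setT (fun y => Kern n (x - y)).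
Proof. by apply: continuous_measurable_row; exact: continuous_Kern_sub. Qed.

Lemma itg_Kern n x : itg (fun y => Kern n (x - y)).
Proof. by apply: (itg_bnd (mf_Kern n x)) => y; exact: Kern_bnd. Qed.

Lemma itg_KernM n f x : itg f -> itg (fun y => Kern n (x - y) * f y).
Proof. by move=> F; apply: itgM_bnd F; [exact: mf_Kern|move=> y; exact: Kern_bnd]. Qed.

Lemma itg_md b k f : itg f -> itg (fun y => md b k y * f y).
Proof.
move=> F; apply: itgM_bnd F; last by move=> y; exact: md_bnd.
by apply: cper_mf; exact: cper_md.
Qed.

Definition fc f b k : R := \int[mu]_y (md b k y * f y).

(** The addition formula for the cosine of k.(x - y) separates x from y and exhibits the convolution
    as a trigonometric polynomial. Its list of modes depends on n only, and f enters through the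
    coefficients. *)
Definition KKl n f : seq (R * (bool * 'rV[int]_d)) :=
  [seq (p.1 * fc f false p.2, (false, p.2)) | p <- KL n] ++
  [seq (p.1 * fc f true p.2, (true, p.2)) | p <- KL n].

Lemma KKE n f x : itg f -> KK n f x = tp (KKl n f) x.
Proof.
move=> F; rewrite /KK /tp /KKl big_cat !big_map/= -big_split/=.
rewrite (_ : \int[mu]_y _ = \int[mu]_y \sum_(p <- KL n)
  (p.1 * md false p.2 x * (md false p.2 y * f y) + p.1 * md true p.2 x * (md true p.2 y * f y))).
  rewrite integral_sum_R; last by move=> p; apply: itgD; apply: itgZ; exact: itg_md.
  apply: eq_bigr => p _; rewrite integralD_R; [|by apply: itgZ; exact: itg_md..].
  by rewrite !integralZ_R; [rewrite /fc /md/=; ring|exact: itg_md..].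
apply: eq_Rintegral => y _; rewrite -KLE /ctp mulr_suml; apply: eq_bigr => p _.
by rewrite angB cosB /md; ring.
Qed.

Lemma KK_tp n f : itg f -> KK n f = tp (KKl n f).
Proof. by move=> F; apply/funext => x; exact: KKE. Qed.

Lemma cper_KK n f : itg f -> cper (KK n f).
Proof. by move=> F; rewrite KK_tp//; exact: cper_tp. Qed.

Lemma Cinf_KK n f : itg f -> Cinf (KK n f).
Proof. by move=> F; rewrite KK_tp//; exact: Cinf_tp. Qed.

Lemma KK_cst n c x : KK n (fun=> c) x = c.
Proof.
rewrite /KK; under eq_Rintegral do rewrite mulrC.
by rewrite integralZ_R ?integral_Kern ?mulr1//; exact: itg_Kern.
Qed.

Lemma KKB n f g x : itg f -> itg g -> KK n (fun x => f x - g x) x = KK n f x - KK n g x.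
Proof.
move=> F G; rewrite /KK -integralB_R; [|exact: itg_KernM..].
by apply: eq_Rintegral => y _; ring.
Qed.

Lemma KKD n f g x : itg f -> itg g -> KK n (fun x => f x + g x) x = KK n f x + KK n g x.
Proof.
move=> F G; rewrite /KK -integralD_R; [|exact: itg_KernM..].
by apply: eq_Rintegral => y _; ring.
Qed.

Lemma KK_le n f g x : itg f -> itg g -> {ae mu, forall y, f y <= g y} -> KK n f x <= KK n g x.
Proof.
move=> F G fg; apply: integral_ae_le; [exact: itg_KernM..|].
by apply: filterS fg => y h; rewrite ler_wpM2l// Kern_ge0.
Qed.

Lemma KK_abs n f x : itg f -> `|KK n f x| <= KK n (fun y => `|f y|) x.
Proof.
move=> F; apply: (le_trans (integral_abs_R (itg_KernM _ _ F))).
rewrite le_eqVlt; apply/orP; left; apply/eqP; apply: eq_Rintegral => y _.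
by rewrite normrM (ger0_norm (Kern_ge0 _ _)).
Qed.

Lemma KK_bnd n f x : itg f -> `|KK n f x| <= kbnd d n * \int[mu]_y `|f y|.
Proof.
move=> F; apply: (le_trans (integral_abs_R (itg_KernM _ _ F))).
rewrite -integralZ_R; last exact: itg_abs.
apply: integral_le_R => [||y]; [exact/itg_abs/itg_KernM|exact/itgZ/itg_abs|].
by rewrite normrM ler_wpM2r// Kern_bnd.
Qed.

Lemma KK_sup n f (B : R) x : itg f -> {ae mu, forall y, `|f y| <= B} -> `|KK n f x| <= B.
Proof.
move=> F fB; apply: le_trans (KK_abs _ _ F) _; rewrite -[leRHS](KK_cst n B x).
by apply: KK_le => //; [exact: itg_abs|exact: itg_cst].
Qed.

Lemma KK_ge0 n f x : itg f -> {ae mu, forall y, 0 <= f y} -> 0 <= KK n f x.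
Proof. by move=> F f0; rewrite -(KK_cst n 0 x); apply: KK_le => //; exact: itg_cst. Qed.

(** Both sides are the same symmetric expression in the Fourier coefficients of f and g. *)
Lemma KK_sym n f g : itg f -> itg g ->
  \int[mu]_x (KK n f x * g x) = \int[mu]_x (f x * KK n g x).
Proof.
move=> F G.
have h (u v : Rd -> R) : itg u -> itg v -> \int[mu]_x (KK n u x * v x) =
    \sum_(p <- KL n) (p.1 * fc u false p.2 * fc v false p.2 + p.1 * fc u true p.2 * fc v true p.2).
  move=> U V; rewrite (_ : \int[mu]_x _ = \int[mu]_x \sum_(p <- KL n)
    (p.1 * fc u false p.2 * (md false p.2 x * v x) + p.1 * fc u true p.2 * (md true p.2 x * v x))).
    rewrite integral_sum_R; last by move=> p; apply: itgD; apply: itgZ; exact: itg_md.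
    apply: eq_bigr => p _; rewrite integralD_R; [|by apply: itgZ; exact: itg_md..].
    by rewrite !integralZ_R//; exact: itg_md.
  apply: eq_Rintegral => x _; rewrite KKE// /tp /KKl big_cat !big_map/= -big_split/= mulr_suml.
  by apply: eq_bigr => p _; ring.
rewrite h//; under [RHS]eq_Rintegral do rewrite mulrC.
by rewrite h//; apply: eq_bigr => p _; ring.
Qed.

Lemma integral_KK n f : itg f -> \int[mu]_x KK n f x = \int[mu]_x f x.
Proof.
move=> F; have := @KK_sym n f (fun=> 1) F (itg_cst 1).
under eq_Rintegral do rewrite mulr1; move=> ->.
by apply: eq_Rintegral => x _; rewrite KK_cst mulr1.
Qed.

Lemma KK_contr n f : itg f -> \int[mu]_x `|KK n f x| <= \int[mu]_x `|f x|.
Proof.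
move=> F; rewrite -[leRHS](integral_KK n (itg_abs F)).
apply: integral_le_R => [||x]; [exact/itg_abs/cper_itg/cper_KK|exact/cper_itg/cper_KK/itg_abs|].
exact: KK_abs.
Qed.

Lemma KK_aeeq n f g : itg f -> itg g -> {ae mu, forall y, f y = g y} -> KK n f = KK n g.
Proof.
move=> F G fg; apply/funext => x; apply/eqP; rewrite eq_le; apply/andP; split.
  by apply: KK_le => //; apply: filterS fg => y ->.
by apply: KK_le => //; apply: filterS fg => y ->.
Qed.

(** The weak derivative tested with modes only. That suffices for commutation with [KK], whose
    coefficients are pairings with modes. *)
Definition weak_d (i : 'I_d) f g := forall b k,
  \int[mu]_y (md b k y * g y) = - (msgn b * ang k (basis_vec i) * \int[mu]_y (md (~~ b) k y * f y)).

Lemma is_derive_KK n f g i x : itg f -> itg g -> weak_d i f g ->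
  is_derive x (basis_vec i) (KK n f) (KK n g x).
Proof.
move=> F G fg; rewrite KK_tp//; apply: (is_derive_eq (is_derive_tp _ _ _)).
rewrite KKE// /tp /dtp /KKl map_cat !big_cat/= !big_map/= addrC.
have fgE b k : fc g b k = - (msgn b * ang k (basis_vec i) * fc f (~~ b) k) := fg b k.
congr (_ + _); apply: eq_bigr => p _ /=; rewrite fgE/= /msgn; ring.
Qed.

Lemma weak_d_smooth i f g : cper f -> cper g -> (forall x, is_derive x (basis_vec i) f (g x)) ->
  weak_d i f g.
Proof.
move=> cf cg fg b k.
have E := @integration_by_parts_torus R d (md b k) f
  (fun x => msgn b * ang k (basis_vec i) * md (~~ b) k x) g i (cper_md b k) cf
  (cperM (cper_cst _) (cper_md _ _)) cg (fun x => is_derive_md b k x _) fg.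
rewrite E; congr (- _); rewrite -integralZ_R; last by apply: itg_md; exact: cper_itg.
by apply: eq_Rintegral => x _; ring.
Qed.

End convolution.

Section convolution_approximation.
Context {R : realType} {d : nat}.
Local Notation Rd := 'rV[R]_d.
Local Notation mu := (@torus_measure R d).
Local Notation itg f := (mu.-integrable setT (EFin \o f)).
Implicit Types (f g : Rd -> R) (x y : Rd).

(** A periodic continuous substitute for the squared distance to Z^d, with an explicit integral
    against the kernel. *)
Definition phi2 x : R := \sum_i (1 - c2 (x ord0 i)).

Lemma phi2_ge0 x : 0 <= phi2 x.
Proof. by apply: sumr_ge0 => i _; have /andP[_] := c2_le1 (x ord0 i); rewrite subr_ge0. Qed.

Lemma continuous_phi2 : continuous phi2.
Proof.
apply: continuous_sumr => i; apply: (@continuous_cstB _ _ R^o) => x.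
by apply: (@continuous_comp _ _ _ (fun x : Rd => x ord0 i) c2); [exact: coord_continuous|exact: continuous_c2].
Qed.

Lemma itg_Kern_c2 n x i : itg (fun y => Kern n (x - y) * (1 - c2 (x ord0 i - y ord0 i))).
Proof.
apply: (@itgMr_bnd _ _ _ _ 2); [|move=> y|exact: itg_Kern].
- apply: continuous_measurable_row; apply: (@continuous_cstB _ _ R^o) => y.
  apply: (@continuous_comp _ _ _ (fun y : Rd => x ord0 i - y ord0 i) c2); last exact: continuous_c2.
  apply: (@continuous_cstB _ _ R^o (x ord0 i) (fun y : Rd => y ord0 i)); exact: coord_continuous.
- by have /andP[h1 h2] := @c2_le1 R (x ord0 i - y ord0 i); rewrite ger0_norm; lra.
Qed.

Lemma itg_Kern_phi2 n x : itg (fun y => Kern n (x - y) * phi2 (x - y)).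
Proof.
rewrite (_ : (fun y => _) = fun y => \sum_i (Kern n (x - y) * (1 - c2 (x ord0 i - y ord0 i)))).
  by apply: itg_sum => i; exact: itg_Kern_c2.
by apply/funext => y; rewrite /phi2 mulr_sumr; apply: eq_bigr => i _; rewrite !mxE.
Qed.

Lemma integral_Kern_phi2 n x :
  \int[mu]_y (Kern n (x - y) * phi2 (x - y)) = d%:R / n.+1%:R.
Proof.
rewrite (_ : \int[mu]_y _ = \int[mu]_y \sum_i (Kern n (x - y) * (1 - c2 (x ord0 i - y ord0 i)))).
  rewrite integral_sum_R; last by move=> i; exact: itg_Kern_c2.
  under eq_bigr do rewrite integral_Kern_c2.
  by rewrite sumr_const card_ord -[LHS]mulr_natl.
by apply: eq_Rintegral => y _; rewrite /phi2 mulr_sumr; apply: eq_bigr => i _; rewrite !mxE.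
Qed.

Lemma KK_modulus n f (e C : R) x : itg f -> (forall y, `|f y - f x| <= e + C * phi2 (x - y)) ->
  `|KK n f x - f x| <= e + C * (d%:R / n.+1%:R).
Proof.
move=> F hf; rewrite -[X in _ - X](KK_cst n (f x) x) -KKB//; last exact: itg_cst.
have Fd : itg (fun y => f y - f x) by apply: itgB => //; exact: itg_cst.
apply: (le_trans (KK_abs _ _ Fd)).
apply: (@le_trans _ _ (\int[mu]_y (e * Kern n (x - y) + C * (Kern n (x - y) * phi2 (x - y))))).
  apply: integral_le_R => [||y]; first exact/itg_KernM/itg_abs.
    by apply: itgD; apply: itgZ; [exact: itg_Kern|exact: itg_Kern_phi2].
  have := hf y; have := Kern_ge0 n (x - y); nra.
rewrite integralD_R; [|exact/itgZ/itg_Kern|exact/itgZ/itg_Kern_phi2].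
rewrite !integralZ_R; [|exact: itg_Kern_phi2|exact: itg_Kern].
by rewrite integral_Kern mulr1 integral_Kern_phi2.
Qed.

Lemma phi2_per_l (z : 'I_d -> int) x y : phi2 (\row_j (x ord0 j + (z j)%:~R) - y) = phi2 (x - y).
Proof.
apply: eq_bigr => i _; rewrite !mxE; congr (1 - _).
rewrite /c2 addrAC mulrDr.
by have [-> _] := cos_sin_int (z i) (2 * pi * (x ord0 i - y ord0 i)).
Qed.

Lemma phi2N x : phi2 (- x) = phi2 x.
Proof. by apply: eq_bigr => i _; rewrite mxE c2N. Qed.

Lemma phi2_frac x y : phi2 (frac x - frac y) = phi2 (x - y).
Proof.
have h u v : phi2 (frac u - v) = phi2 (u - v).
  rewrite -(phi2_per_l (fun j => - Num.floor (u ord0 j)) u v); congr (phi2 (_ - _)).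
  by apply/rowP => j; rewrite !mxE intrN.
by rewrite h -phi2N opprB h -phi2N opprB.
Qed.

Lemma phi2_eq0 x : phi2 x = 0 -> forall i, exists z : int, x ord0 i = z%:~R.
Proof.
move=> /eqP; rewrite psumr_eq0; last first.
  by move=> i _; have /andP[_] := @c2_le1 R (x ord0 i); rewrite subr_ge0.
move=> /allP h i; have := h i (mem_index_enum i); rewrite /= subr_eq0 eq_sym => /eqP h1.
exists (Num.floor (x ord0 i)); apply/eqP; rewrite -subr_eq0; apply/negP => /negP ne.
pose t := x ord0 i - (Num.floor (x ord0 i))%:~R.
have /andP[f1 f2] := floor_itv (x ord0 i); rewrite intrD in f2.
have t0 : 0 < t by rewrite lt_neqAle eq_sym ne subr_ge0.
have t1 : t < 1 by rewrite /t; lra.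
have : c2 t = 1.
  rewrite /c2 /t -intrN mulrDr.
  by have [-> _] := cos_sin_int (- Num.floor (x ord0 i)) (2 * pi * x ord0 i).
rewrite /c2 (_ : 2 * pi * t = (pi * t) *+ 2); last by rewrite -mulr_natl; ring.
rewrite cos_mulr2n => h2.
have : sin (pi * t) ^+ 2 = 0 by rewrite sin2cos2; lra.
move/eqP; rewrite sqrf_eq0 gt_eqF// sin_gt0_pi//.
by rewrite mulr_gt0 ?pi_gt0//= gtr_pMr ?pi_gt0.
Qed.

End convolution_approximation.

Import HBSimple.

(** * Density of continuous periodic functions in L^1 *)

Section approximation.
Context {R : realType} {d : nat}.
Local Notation Rd := 'rV[R]_d.
Local Notation mu := (@torus_measure R d).
Local Notation itg f := (mu.-integrable setT (EFin \o f)).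
Implicit Types (f g : Rd -> R) (x y : Rd).

Lemma ultra_cube_cvg (U : set_system nat) (x : nat -> Rd) : UltraFilter U ->
  (forall n, cube (x n)) -> exists y, x n @[n --> U] --> y.
Proof.
move=> UU xc; have PU : ProperFilter U by exact: ultra_proper.
have h i : exists l : R, x n ord0 i @[n --> U] --> l.
  have [|l hl _] := @ultra_bounded_cvg R _ U (fun n => x n ord0 i) 1 UU; last by exists l.
  by move=> n; have := xc n i; rewrite /= in_itv/= => /andP[a b]; rewrite ger0_norm.
have [l hl] := choice h.
by exists (\row_i l i); apply: cvg_rowP => i; rewrite mxE; exact: hl.
Qed.

(** If no C worked, pairs of points violating the bound with [C = n.+1] would have ultralimits x and
    y in the cube with [phi2 (x - y) = 0]. Such x and y differ by an integer vector, so [f x = f y],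
    against a difference of at least e. *)
Lemma cper_modulus f (e : R) : cper f -> 0 < e ->
  exists2 C : R, 0 <= C & forall x y, `|f y - f x| <= e + C * phi2 (x - y).
Proof.
move=> cf e0; apply: contrapT => H.
have [B B0 fB] := cper_bnd cf.
have h n : exists z : Rd * Rd, [/\ cube z.1, cube z.2 & e + n.+1%:R * phi2 (z.1 - z.2) < `|f z.2 - f z.1|].
  apply: contrapT => N; apply: H; exists n.+1%:R => // x y.
  rewrite leNgt; apply/negP => lt; apply: N; exists (frac x, frac y) => /=.
  rewrite !(periodic_frac _ cf.1) phi2_frac; split => //; exact: frac_cube.
have [z hz] := choice h.
have [U UU Uoo] := ultra_eventually; have PU : ProperFilter U by exact: ultra_proper.
have [x xc] : exists y, (z n).1 @[n --> U] --> y.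
  by apply: ultra_cube_cvg => n; have [] := hz n.
have [y yc] : exists y, (z n).2 @[n --> U] --> y.
  by apply: ultra_cube_cvg => n; have [] := hz n.
have fx : f (z n).1 @[n --> U] --> f x by exact: (cvg_comp _ _ xc (cf.2 x)).
have fy : f (z n).2 @[n --> U] --> f y by exact: (cvg_comp _ _ yc (cf.2 y)).
have xy : (z n).1 - (z n).2 @[n --> U] --> x - y by exact: cvgB.
have ph : phi2 ((z n).1 - (z n).2) @[n --> U] --> phi2 (x - y).
  exact: (cvg_comp _ _ xy (@continuous_phi2 R d _)).
have ub (n : nat) : phi2 ((z n).1 - (z n).2) <= 2 * B * n.+1%:R^-1.
  have [_ _ h1] := hz n; have h2 := ler_normB (f (z n).2) (f (z n).1).
  have := fB (z n).1; have := fB (z n).2.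
  rewrite ler_pdivlMr// mulrC; lra.
have p0 : phi2 (x - y) = 0.
  apply/eqP; rewrite eq_le phi2_ge0 andbT.
  have lim : 2 * B * n.+1%:R^-1 @[n --> U] --> (0:R).
    rewrite -[X in _ --> X](mulr0 (2 * B)); apply: cvgM; first exact: cvg_cst.
    exact: cvg_trans (cvg_app _ Uoo) (@cvg_harmonic R).
  by apply: (ler_cvg_to ph lim); apply: (@filterS _ U _ setT _ _ filterT) => n _; exact: ub.
have {}p0 := phi2_eq0 p0; have [k hk] := choice p0.
have fxy : f x = f y.
  rewrite -(periodic_row k y cf.1); congr f; apply/rowP => j; rewrite mxE -hk !mxE.
  by ring.
have lim : `|f (z n).2 - f (z n).1| @[n --> U] --> `|f y - f x|.
  by apply: cvg_norm; exact: cvgB.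
have : e <= `|f y - f x|.
  apply: (cvgr_to_ge lim); apply: (@filterS _ U _ setT _ _ filterT) => n _.
  have [_ _ h1] := hz n; apply: le_trans (ltW h1); rewrite lerDl.
  by rewrite mulr_ge0// phi2_ge0.
by rewrite fxy subrr normr0; lra.
Qed.

Lemma nS_inv_small (K e : R) : 0 < e -> exists N, forall n, (N <= n)%N -> K / n.+1%:R <= e.
Proof.
move=> e0.
have : K * n.+1%:R^-1 @[n --> \oo] --> (K * 0 : R).
  by apply: cvgM; [exact: cvg_cst|exact: cvg_harmonic].
rewrite mulr0 => /cvgrPdist_le/(_ _ e0)[N _ hN]; exists N => n Nn.
have /= := hN n Nn; rewrite sub0r normrN; exact: le_trans (ler_norm _).
Qed.

Lemma KK_unif f (e : R) : cper f -> 0 < e ->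
  exists N, forall n, (N <= n)%N -> forall x, `|KK n f x - f x| <= e.
Proof.
move=> cf e0; have e2 : 0 < e / 2 by rewrite divr_gt0.
have [C C0 hC] := cper_modulus cf e2.
have [N hN] := nS_inv_small (C * d%:R) e2.
exists N => n Nn x; apply: (le_trans (KK_modulus n (cper_itg cf) (hC x))).
by rewrite mulrA [leRHS](splitr e) lerD2l; exact: hN.
Qed.

Lemma KK_unif_cvg f x : cper f -> KK n f x @[n --> \oo] --> f x.
Proof.
move=> cf; apply/cvgrPdist_le => e e0; have [N hN] := KK_unif cf e0.
by exists N => // n /= Nn; rewrite distrC; exact: hN.
Qed.

Definition L1app f := itg f /\ forall e : R, 0 < e -> exists2 g, cper g & \int[mu]_x `|f x - g x| <= e.

(** Uniform convergence for a continuous approximant, and the L^1 contraction property of [KK] for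
    the remainder. *)
Lemma KK_L1_cvg f : L1app f -> \int[mu]_x `|KK n f x - f x| @[n --> \oo] --> 0.
Proof.
move=> [F hf]; apply/cvgrPdist_le => e e0; have e3 : 0 < e / 3 by rewrite divr_gt0.
have [g cg hg] := hf _ e3; have G := cper_itg cg.
have [N hN] := KK_unif cg e3; exists N => // n /= Nn.
rewrite sub0r normrN ger0_norm ?integral_ge0_R//.
have FG : itg (fun x => f x - g x) by exact: itgB.
have iK (u : Rd -> R) : itg u -> itg (KK n u) by move=> U; exact/cper_itg/cper_KK.
apply: (@le_trans _ _ (\int[mu]_x (`|KK n (fun x => f x - g x) x| + (e / 3 + `|f x - g x|)))).
  apply: integral_le_R => [||x].
  - by apply/itg_abs/itgB => //; exact: iK.
  - apply: itgD; first exact/itg_abs/iK.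
    by apply: itgD; [exact: itg_cst|exact: itg_abs].
  - rewrite KKB// (_ : KK n f x - f x = (KK n f x - KK n g x) + (KK n g x - g x) + (g x - f x)); last by ring.
    apply: le_trans (ler_normD _ _) _; rewrite [`|g x - f x|]distrC [leRHS]addrA lerD2r.
    by apply: le_trans (ler_normD _ _) _; rewrite lerD2l hN.
rewrite integralD_R; [|exact/itg_abs/iK|by apply: itgD; [exact: itg_cst|exact: itg_abs]].
rewrite integralD_R; [|exact: itg_cst|exact: itg_abs].
rewrite integral_cst_R; have := KK_contr n FG; lra.
Qed.

Lemma L1app_lim (f : Rd -> R) : itg f ->
  (forall e : R, 0 < e -> exists2 g, L1app g & \int[mu]_x `|f x - g x| <= e) -> L1app f.
Proof.
move=> F h; split => // e e0; have e2 : 0 < e / 2 by rewrite divr_gt0.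
have [g [G hg] fg] := h _ e2; have [k ck gk] := hg _ e2; exists k => //.
have Kk := cper_itg ck.
apply: (@le_trans _ _ (\int[mu]_x (`|f x - g x| + `|g x - k x|))).
  apply: integral_le_R => [||x]; [exact/itg_abs/itgB|by apply: itgD; apply/itg_abs/itgB|].
  by rewrite (_ : f x - k x = (f x - g x) + (g x - k x)) ?ler_normD//; ring.
by rewrite integralD_R; [lra|exact/itg_abs/itgB..].
Qed.

Lemma L1app_cper f : cper f -> L1app f.
Proof.
move=> cf; split; first exact: cper_itg.
move=> e e0; exists f => //; rewrite (_ : \int[mu]_x _ = 0) ?ltW//.
by rewrite -[RHS](@integral_cst_R _ _ _ mu); apply: eq_Rintegral => x _; rewrite subrr normr0.
Qed.

Lemma L1appD (a : R) f g : L1app f -> L1app g -> L1app (fun x => a * f x + g x).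
Proof.
move=> [F hf] [G hg]; have iaf : itg (fun x => a * f x + g x) by apply: itgD => //; exact: itgZ.
split => // e e0.
have e1 : 0 < e / 2 / (`|a| + 1) by rewrite !divr_gt0// ltr_wpDl.
have e2 : 0 < e / 2 by rewrite divr_gt0.
have [f' cf' hf'] := hf _ e1; have [g' cg' hg'] := hg _ e2.
exists (fun x => a * f' x + g' x); first by apply: cperD => //; apply: cperM => //; exact: cper_cst.
have i1 : itg (fun x => `|f x - f' x|) by apply/itg_abs/itgB => //; exact: cper_itg.
have i2 : itg (fun x => `|g x - g' x|) by apply/itg_abs/itgB => //; exact: cper_itg.
apply: (@le_trans _ _ (\int[mu]_x (`|a| * `|f x - f' x| + `|g x - g' x|))).
  apply: integral_le_R => [||x].
  - apply/itg_abs/itgB => //; apply: itgD; last exact: cper_itg.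
    by apply: itgZ; exact: cper_itg.
  - by apply: itgD => //; exact: itgZ.
  - rewrite -normrM (_ : _ - _ = a * (f x - f' x) + (g x - g' x)) ?ler_normD//; ring.
rewrite integralD_R//; last exact: itgZ.
rewrite integralZ_R//.
have : `|a| * \int[mu]_x `|f x - f' x| <= e / 2; last by lra.
apply: (@le_trans _ _ (`|a| * (e / 2 / (`|a| + 1)))); first by rewrite ler_wpM2l.
rewrite mulrA ler_pdivrMr ?ltr_wpDl// mulrC ler_wpM2l ?(ltW e2)//.
by rewrite lerDl.
Qed.

Lemma integral_coord (i : 'I_d) (f : R -> R) (B : R) : measurable_fun setT f -> (forall t, `|f t| <= B) ->
  \int[mu]_x f (x ord0 i) = \int[uniform_prob (@ltr01 R)]_t f t.
Proof.
move=> mf fB; rewrite (@resample_R R d i _ B); last by move=> x; exact: fB.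
  rewrite -[RHS](@integral_cst_R _ _ _ mu); apply: eq_Rintegral => x _.
  by apply: eq_Rintegral => t _; rewrite mxE eqxx.
by apply: measurableT_comp => //; exact: measurable_coord.
Qed.

(* Indicators of Borel sets are [L^1] limits of continuous periodic functions, by a monotone-class argument. *)
Definition appset : set (set Rd) := [set A | measurable A /\ L1app (\1_A : Rd -> R)].

Lemma L1app_ext f g : (forall x, f x = g x) -> L1app f -> L1app g.
Proof. by move=> /funext ->. Qed.

Lemma appsetT : appset setT.
Proof.
split => //; apply: (@L1app_ext (fun=> 1)); last exact/L1app_cper/cper_cst.
by move=> x; rewrite indicE in_setT.
Qed.

Lemma appsetC A : appset A -> appset (~` A).
Proof.
move=> [mA hA]; split; first exact: measurableC.
apply: (@L1app_ext (fun x => -1 * \1_A x + 1)); last by apply: L1appD => //; exact/L1app_cper/cper_cst.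
by move=> x; rewrite !indicE in_setC; case: (x \in A) => /=; lra.
Qed.

Lemma itg_indic (A : set Rd) : measurable A -> itg (\1_A : Rd -> R).
Proof.
move=> mA; apply: (@itg_bnd _ _ _ _ 1); first exact: measurable_indic.
by move=> x; rewrite indicE; case: (x \in A); rewrite /= ?normr1 ?normr0.
Qed.

Lemma appsetI A B : appset A -> appset B -> appset (A `&` B).
Proof.
move=> [mA [iA hA]] [mB [iB hB]]; split; first exact: measurableI.
have iAB : itg (\1_(A `&` B) : Rd -> R) by apply: itg_indic; exact: measurableI.
apply: L1app_lim => // e e0; have e2 : 0 < e / 2 by rewrite divr_gt0.
have [f cf hf] := hA _ e2; have F := cper_itg cf; have [M M0 fM] := cper_bnd cf.
have e3 : 0 < e / 2 / (M + 1) by rewrite !divr_gt0// ltr_wpDl.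
have [g cg hg] := hB _ e3; have G := cper_itg cg.
exists (fun x => f x * g x); first exact/L1app_cper/cperM.
have FG := cper_itg (cperM cf cg).
apply: (@le_trans _ _ (\int[mu]_x (`|\1_A x - f x| + M * `|\1_B x - g x|))).
  apply: integral_le_R => [||x].
  - by apply/itg_abs/itgB.
  - by apply: itgD; [apply/itg_abs/itgB|apply/itgZ/itg_abs/itgB].
  - rewrite (_ : _ - _ = (\1_A x - f x) * \1_B x + f x * (\1_B x - g x)); last first.
      by rewrite !indicE in_setI; case: (x \in A); case: (x \in B) => /=; ring.
    apply: le_trans (ler_normD _ _) _; rewrite !normrM lerD//.
      by rewrite ler_piMr// indicE; case: (x \in B); rewrite /= ?normr1 ?normr0.
    by rewrite ler_wpM2r.
rewrite integralD_R; [|by apply/itg_abs/itgB|by apply/itgZ/itg_abs/itgB].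
rewrite integralZ_R; last by apply/itg_abs/itgB.
rewrite [leRHS](splitr e) lerD//.
apply: (@le_trans _ _ (M * (e / 2 / (M + 1)))); first by rewrite ler_wpM2l.
rewrite mulrA ler_pdivrMr ?ltr_wpDl// mulrC ler_wpM2l ?(ltW e2)//.
by rewrite lerDl.
Qed.

Lemma appset_bigcup (F : (set Rd)^nat) : (forall i, appset (F i)) -> appset (\bigcup_i F i).
Proof.
move=> hF; have mF : measurable (\bigcup_i F i) by apply: bigcupT_measurable => i; have [] := hF i.
split => //.
pose G n := ~` (\big[setI/setT]_(i < n) ~` F i).
have hG n : appset (G n).
  apply: appsetC; elim: n => [|n IH]; first by rewrite big_ord0; exact: appsetT.
  by rewrite big_ord_recr/=; apply: appsetI => //; exact: appsetC.
have GE n x : G n x <-> exists2 i, (i < n)%N & F i x.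
  rewrite /G -bigcap_seq; split.
    move=> /existsNP[i /not_implyP[_ /contrapT Fi]]; exists i => //; exact: ltn_ord.
  move=> [i ni Fi] /(_ (Ordinal ni)) /=; rewrite mem_index_enum; move/(_ isT).
  exact.
apply: L1app_lim; first exact: itg_indic.
have H1 n : measurable_fun setT (\1_(G n) : Rd -> R) by apply: measurable_indic; have [] := hG n.
have H2 : measurable_fun setT (\1_(\bigcup_i F i) : Rd -> R) by exact: measurable_indic.
have H3 n x : `|\1_(G n) x : R| <= 1 by rewrite indicE; case: (_ \in _); rewrite /= ?normr1 ?normr0.
have H4 : {ae mu, forall x, (\1_(G n) x : R) @[n --> \oo] --> (\1_(\bigcup_i F i) x : R)}.
  apply: aeW => x; have [[i _ Fi]|nF] := pselect ((\bigcup_i F i) x).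
    apply: cvg_near_cst.
    exists i.+1 => // n /= ni; rewrite !indicE !mem_set//; first by exists i.
    by apply/GE; exists i.
  rewrite (_ : (fun n => _) = fun=> \1_(\bigcup_i F i) x); first exact: cvg_cst.
  apply/funext => n; rewrite !indicE !memNset// => /GE[i _ Fi]; apply: nF; by exists i.
have /cvgrPdist_le H := dct_bnd H1 H2 H3 H4.
move=> e e0; have [N _ hN] := H _ e0.
exists (\1_(G N)); first exact: (hG N).2.
have /= := hN N (leqnn N); rewrite sub0r normrN ger0_norm ?integral_ge0_R//.
by under eq_Rintegral do rewrite distrC.
Qed.

Lemma continuous_clamp : continuous (fun t : R => Num.max 0 (Num.min 1 t)).
Proof.
move=> t; apply: (@continuous_comp _ _ _ (fun t : R => Num.min 1 t) (fun t => Num.max 0 t)).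
  rewrite (_ : (fun t => _) = fun t : R => (1 + t - `|1 - t|) / 2); last first.
    by apply/funext => u; rewrite minr_absE.
  apply: cvgM; last exact: cvg_cst.
  apply: cvgB; first by apply: cvgD; [exact: cvg_cst|exact: cvg_id].
  by apply: cvg_norm; apply: cvgB; [exact: cvg_cst|exact: cvg_id].
rewrite (_ : (fun t => _) = fun t : R => (0 + t + `|0 - t|) / 2); last first.
  by apply/funext => u; rewrite maxr_absE.
apply: cvgM; last exact: cvg_cst.
apply: cvgD; first by apply: cvgD; [exact: cvg_cst|exact: cvg_id].
by apply: cvg_norm; apply: cvgB; [exact: cvg_cst|exact: cvg_id].
Qed.

Lemma ray_approx (a : R) : exists F : nat -> R -> R,
  [/\ forall n, continuous (F n), forall n t, F n (t + 1) = F n t, forall n t, 0 <= F n t <= 1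
    & forall t, 0 < t < 1 -> F n t @[n --> \oo] --> ((a < t)%R%:R : R)].
Proof.
have [a0|a0] := ltP a 0.
  exists (fun _ _ => 1); split => // [n|n t|t /andP[t0 _]]; [exact: cst_continuous|by rewrite ler01 lexx|].
  by rewrite (lt_trans a0 t0); exact: cvg_cst.
have [a1|a1] := leP 1 a.
  exists (fun _ _ => 0); split => // [n|n t|t /andP[_ t1]]; [exact: cst_continuous|by rewrite lexx ler01|].
  by rewrite ltNge (le_trans (ltW t1) a1); exact: cvg_cst.
(* Both factors change sign under [t + 1], so S has period 1. Inside the unit interval it is
   positive exactly to the right of a, so its clamped multiples tend to the indicator of the ray. *)
pose S t := sin (pi * t) * sin (pi * (t - a)).
exists (fun n t => Num.max 0 (Num.min 1 (n%:R * S t))); split.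
- move=> n t; apply: (@continuous_comp _ _ _ (fun t => n%:R * S t) (fun t => Num.max 0 (Num.min 1 t))).
    apply: continuous_mulcst => {}t; apply: cvgM.
      apply: (@continuous_comp _ _ _ (fun t => pi * t) sin); last exact: continuous_sin.
      by apply: continuous_mulcst => x; exact: cvg_id.
    apply: (@continuous_comp _ _ _ (fun t => pi * (t - a)) sin); last exact: continuous_sin.
    by apply: continuous_mulcst => x; apply: cvgB; [exact: cvg_id|exact: cvg_cst].
  exact: continuous_clamp.
- move=> n t; rewrite /S.
  have -> : t + 1 - a = (t - a) + 1 by ring.
  by rewrite !mulrDr !mulr1 !sinDpi mulrNN.
- move=> n t; rewrite le_max lexx/= ge_max ler01/=.
  by rewrite ge_min lexx.
- move=> t /andP[t0 t1].
  have s1 : 0 < sin (pi * t) by rewrite sin_gt0_pi// mulr_gt0 ?pi_gt0//= gtr_pMr ?pi_gt0.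
  have [at_|ta] := ltP a t.
    have s2 : 0 < S t.
      rewrite mulr_gt0// sin_gt0_pi// mulr_gt0 ?pi_gt0 ?subr_gt0//= gtr_pMr ?pi_gt0//; lra.
    apply: cvg_near_cst.
    have [N _ hN] : \forall n \near \oo, (S t)^-1 <= n%:R by exact: nbhs_infty_ger.
    exists N => // n /= Nn; have := hN n Nn.
    rewrite -div1r ler_pdivrMr// => h.
    by rewrite min_l// max_r.
  rewrite (_ : (fun n => _) = fun=> 0); first exact: cvg_cst.
  apply/funext => n; rewrite max_l// ge_min; apply/orP; right.
  rewrite mulr_ge0_le0// mulr_ge0_le0 ?(ltW s1)//.
  rewrite -oppr_ge0 -sinN -mulrN opprB sin_ge0_pi// mulr_ge0 ?pi_ge0 ?subr_ge0//=.
  by rewrite ler_piMr ?pi_ge0//; lra.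
Qed.

Lemma ae_unif_oo : {ae (uniform_prob (@ltr01 R)), forall t, 0 < t < 1}.
Proof.
pose N : set R := ~` `]0, 1[.
have mN : measurable N by exact: measurableC.
have sub : ~` [set t : R | 0 < t < 1] `<=` N by move=> t /= h; rewrite /N/= in_itv/=.
suff N0 : uniform_prob (@ltr01 R) N = 0%E by exists N.
have := @integral_uniform R 0 1 ltr01 (EFin \o \1_N) _ _.
rewrite integral_indic// setIT => ->.
- rewrite integral_indic// setIC.
  have -> : `[0%R, 1%R]%classic `&` N = [set 0; 1].
    apply/seteqP; split => t /=; rewrite /N/= !in_itv/=.
      move=> [/andP[t0 t1] /negP]; rewrite negb_and -!leNgt => /orP[h|h]; [left|right];
        by apply/eqP; rewrite eq_le h ?t0 ?t1.
    by move=> [->|->]; rewrite !lexx !ler01/=; split => //; rewrite ltxx ?andbF.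
  have H : (@lebesgue_measure R) [set 0; 1] = 0%E.
    exact/countable_lebesgue_measure0/finite_set_countable/finite_set2.
  by rewrite [X in (_ * X)%E]H mule0.
- by apply/measurable_EFinP; exact: measurable_indic.
- by move=> t; rewrite lee_fin.
Qed.

Lemma appset_ray i (a : R) : appset [set x | a < x ord0 i].
Proof.
have mA : measurable [set x : Rd | a < x ord0 i].
  rewrite (_ : [set x | _] = (fun x : Rd => x ord0 i) @^-1` `]a, +oo[); last first.
    by apply/seteqP; split => x /=; rewrite in_itv/= andbT.
  by rewrite -[X in measurable X]setTI; apply: (@measurable_coord R d i).
split => //; apply: L1app_lim; first exact: itg_indic.
have [F [cF pF bF FF]] := ray_approx a.
have cc n : cper (fun x : Rd => F n (x ord0 i)).
  split => [x j|x].
    rewrite !mxE eqxx/=; case: (i == j) => /=; last by rewrite addr0.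
    exact: pF.
  by apply: (@continuous_comp _ _ _ (fun x : Rd => x ord0 i) (F n)); [exact: coord_continuous|exact: cF].
have mr : measurable_fun setT (fun t : measurableTypeR R => (a < t)%R%:R : R).
  rewrite (_ : (fun t => _) = \1_(`]a, +oo[%classic)); first exact: measurable_indic.
  apply/funext => t; rewrite indicE; congr (_%:R).
  by rewrite mem_setE in_itv/= andbT.
have mFn n : measurable_fun setT (F n : measurableTypeR R -> R) by exact: continuous_measurable_fun.
have b1 n t : `|F n t| <= 1 by have /andP[h0 h1] := bF n t; rewrite ger0_norm.
have H : {ae uniform_prob (@ltr01 R), forall t, F n t @[n --> \oo] --> ((a < t)%R%:R : R)}.
  by apply: (@filterS _ _ (ae_filter_ringOfSetsType (uniform_prob (@ltr01 R))) _ _ _ ae_unif_oo) => t ht; exact: FF.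
have /cvgrPdist_le L := dct_bnd mFn mr b1 H.
move=> e e0; have [N _ hN] := L e e0; exists (fun x => F N (x ord0 i)); first exact: L1app_cper.
have /= := hN N (leqnn N); rewrite sub0r normrN ger0_norm ?integral_ge0_R//.
apply: le_trans; rewrite -(@integral_coord i _ 2).
- rewrite le_eqVlt; apply/orP; left; apply/eqP; apply: eq_Rintegral => x _.
  by rewrite distrC indicE; congr (`|_ - _%:R|); case Q: (a < x ord0 i); [rewrite mem_set|rewrite memNset//= Q].
- by apply: (@measurableT_comp _ _ _ _ _ _ (fun t : R => `|t|) _ (fun t : measurableTypeR R => F N t - (a < t)%R%:R)); [exact: normr_measurable|exact: measurable_funB].
- move=> t; rewrite normr_id; apply: le_trans (ler_normB _ _) _.
  by have := b1 N t; case: (a < t)%R; rewrite /= ?normr1 ?normr0; lra.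
Qed.

Lemma appset_sigma : sigma_algebra setT appset.
Proof.
split; first by rewrite -setCT; apply: appsetC; exact: appsetT.
- by move=> A hA; rewrite setTD; exact: appsetC.
- exact: appset_bigcup.
Qed.

Lemma appset_preimage i (B : set R) : measurable B -> appset ((fun x : Rd => x ord0 i) @^-1` B).
Proof.
rewrite -[measurable]/((@ocitv R).-sigma.-measurable) RGenOInfty.measurableE => mB.
have : (@RGenOInfty.G R).-sigma.-measurable `<=` [set B | appset ((fun x : Rd => x ord0 i) @^-1` B)].
  apply: smallest_sub.
    split => /=.
    - by rewrite preimage_set0 -setCT; apply: appsetC; exact: appsetT.
    - by move=> A hA; rewrite setTD preimage_setC; exact: appsetC.
    - by move=> A hA; rewrite preimage_bigcup; exact: appset_bigcup.
  move=> _ [a ->] /=.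
  rewrite (_ : _ @^-1` _ = [set x : Rd | a < x ord0 i]); first exact: appset_ray.
  by apply/seteqP; split => x /=; rewrite in_itv/= andbT.
by apply.
Qed.

Lemma appset_measurable (A : set Rd) : measurable A -> appset A.
Proof.
apply: smallest_sub; first exact: appset_sigma.
move=> B; rewrite -bigcup_seq => -[i _ /= [C mC <-]].
by rewrite setTI; exact: appset_preimage.
Qed.

Lemma L1app_sum (I : Type) (s : seq I) (c : I -> R) (F : I -> Rd -> R) :
  (forall i, L1app (F i)) -> L1app (fun x => \sum_(i <- s) c i * F i x).
Proof.
move=> hF; elim: s => [|a s IH].
  apply: (@L1app_ext (fun=> 0)); last exact/L1app_cper/cper_cst.
  by move=> x; rewrite big_nil.
apply: (@L1app_ext (fun x => c a * F a x + \sum_(i <- s) c i * F i x)); last exact: L1appD.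
by move=> x; rewrite big_cons.
Qed.

Lemma L1app_itg f : itg f -> L1app f.
Proof.
move=> F; apply: L1app_lim => // e e0.
have [g [gi _ gl]] := approximation_sfun_integrable measurableT F.
have gap n : L1app (g n).
  have -> : (g n : Rd -> R) = (fun x => \sum_(y \in range (g n)) y * \1_(g n @^-1` [set y]) x).
    by apply/funext => x; rewrite [LHS]fimfunE.
  under eq_fun do rewrite fsbig_finite//=.
  apply: L1app_sum => i; apply: (appset_measurable _).2.
  exact: measurable_sfunP.
have /fine_cvgP[_ /cvgrPdist_le/(_ e e0)[N _ hN]] := gl.
exists (g N) => //; have := hN N (leqnn N); rewrite /= sub0r normrN.
by apply: le_trans; rewrite ler_norm.
Qed.

End approximation.

Lemma sqr_sub_le_of_variance {R : realFieldType} (Q a b : R) :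
  0 <= Q - 2 * b * b + b ^+ 2 -> (a - b) ^+ 2 <= Q - 2 * a * b + a ^+ 2.
Proof. by move=> h; rewrite sqrrB; lra. Qed.

Lemma tonelli_bnd d1 d2 (T1 : measurableType d1) (T2 : measurableType d2) (R : realType)
    (P : probability T1 R) (Q : probability T2 R) (f : T1 * T2 -> R) (B : R) :
  measurable_fun setT f -> (forall z, 0 <= f z <= B) ->
  [/\ measurable_fun setT (fun x => \int[Q]_y f (x, y)),
      measurable_fun setT (fun y => \int[P]_x f (x, y)) &
      \int[P]_x \int[Q]_y f (x, y) = \int[Q]_y \int[P]_x f (x, y)].
Proof.
move=> mf fB.
have f0 z : (0 <= (EFin \o f) z)%E by rewrite lee_fin; have /andP[] := fB z.
have fb z : `|f z| <= B by have /andP[a b] := fB z; rewrite ger0_norm.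
have mE : measurable_fun setT (EFin \o f) by apply/measurable_EFinP.
have m1 x : measurable_fun setT (fun y => f (x, y)) by exact: measurableT_comp (@pair1_measurable _ _ _ _ x).
have m2 y : measurable_fun setT (fun x => f (x, y)) by exact: measurableT_comp (@pair2_measurable _ _ _ _ y).
have i1 x : (\int[Q]_y (EFin \o f) (x, y))%E = (\int[Q]_y f (x, y))%:E.
  by rewrite -eint_fin//; exact: itg_bnd (m1 x) (fun y => fb (x, y)).
have i2 y : (\int[P]_x (EFin \o f) (x, y))%E = (\int[P]_x f (x, y))%:E.
  by rewrite -eint_fin//; exact: itg_bnd (m2 y) (fun x => fb (x, y)).
have M1 : measurable_fun setT (fun x => \int[Q]_y f (x, y)).
  apply/measurable_EFinP; have H := @measurable_fun_fubini_tonelli_F _ _ _ _ _ Q _ mE f0.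
  by apply: eq_measurable_fun H => x _ /=; rewrite -i1.
have M2 : measurable_fun setT (fun y => \int[P]_x f (x, y)).
  apply/measurable_EFinP; have H := @measurable_fun_fubini_tonelli_G _ _ _ _ _ P _ mE f0.
  by apply: eq_measurable_fun H => y _ /=; rewrite -i2.
split => //.
have := @fubini_tonelli _ _ _ _ _ P Q _ mE f0.
under eq_integral do rewrite i1; under [X in _ = X -> _]eq_integral do rewrite i2.
rewrite eint_fin; last by apply: (itg_bnd M1) => x; exact: integral_abs_bnd (m1 x) (fun y => fb (x, y)).
rewrite eint_fin; last by apply: (itg_bnd M2) => y; exact: integral_abs_bnd (m2 y) (fun x => fb (x, y)).
by move=> [].
Qed.

(** * Translation moduli, approximation rate and Poincaré inequality *)

Section translation.
Context {R : realType} {d : nat}.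
Local Notation Rd := 'rV[R]_d.
Local Notation mu := (@torus_measure R d).
Local Notation unif := (uniform_prob (@ltr01 R)).
Local Notation itg f := (mu.-integrable setT (EFin \o f)).
Implicit Types (f g w : Rd -> R) (x y v : Rd).

Lemma continuous_shift v : continuous (fun x : Rd => x + v).
Proof.
rewrite (_ : (fun x => _) = fun x => v - (0 - x)); last by apply/funext => x; rewrite sub0r opprK addrC.
by do 2 apply: continuous_cstB; move=> x; exact: cvg_id.
Qed.

Lemma cper_shift f v : cper f -> cper (fun x => f (x + v)).
Proof.
move=> [pf cf]; split => [x i|x]; first by rewrite addrAC pf.
by apply: (@continuous_comp _ _ _ (fun x => x + v) f); [exact: continuous_shift|exact: cf].
Qed.

Lemma cper_norm f : cper f -> cper (fun x => `|f x|).
Proof. by move=> cf; apply: (cper_comp cf) => x; exact: norm_continuous. Qed.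

Lemma integral_shift_basis f i (t : R) : cper f -> \int[mu]_x f (x + t *: basis_vec i) = \int[mu]_x f x.
Proof.
move=> cf; have [B B0 fB] := cper_bnd cf.
rewrite (@resample_R R d i _ B (cper_mf (cper_shift _ cf))); last by move=> x; exact: fB.
rewrite [RHS](@resample_R R d i _ B (cper_mf cf) fB).
apply: eq_Rintegral => x _.
rewrite -[RHS](@integral_unif_shift R (fun s => f (upd i s x)) t).
- by apply: eq_Rintegral => s _; rewrite updD addrC.
- move=> s; apply: (@continuous_comp _ _ _ (fun s => upd i s x) f); [exact: continuous_upd|exact: cf.2].
- by move=> s; rewrite addrC updD scale1r addrC cf.1.
Qed.

Lemma integral_shift f v : cper f -> \int[mu]_x f (x + v) = \int[mu]_x f x.
Proof.
move=> cf; rewrite -(row_basis v).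
elim: (index_enum _) => [|i s IH]; first by under eq_Rintegral do rewrite big_nil addr0.
under eq_Rintegral do rewrite big_cons addrA.
by rewrite (integral_shift_basis i (v ord0 i) (cper_shift (\sum_(j <- s) v ord0 j *: basis_vec j) cf)).
Qed.

Lemma cper_Kern_sub n x : cper (fun y => Kern n (x - y)).
Proof.
split; last exact: continuous_Kern_sub.
by move=> y i; rewrite -[LHS]KernN -[RHS]KernN !opprB addrAC Kern_periodic.
Qed.

Lemma KK_shift n f x : cper f -> KK n f x = \int[mu]_z (Kern n z * f (x + z)).
Proof.
move=> cf; rewrite /KK -(integral_shift x (cperM (cper_Kern_sub n x) cf)).
by apply: eq_Rintegral => z _; rewrite opprD addrCA subrr addr0 KernN [z + x]addrC.
Qed.

Definition tau w v : R := \int[mu]_x (w (x + v) - w x) ^+ 2.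

Lemma cper_tau w v : cper w -> cper (fun x => (w (x + v) - w x) ^+ 2).
Proof. by move=> cw; apply/cperX/cperB => //; exact: cper_shift. Qed.

Lemma tauD w v v' : cper w -> tau w (v + v') <= 2 * tau w v + 2 * tau w v'.
Proof.
move=> cw; rewrite /tau -(integral_shift v' (cper_tau v cw)) -!integralZ_R; last 2 first.
- exact/cper_itg/cper_tau.
- exact/cper_itg/(cper_shift v' (cper_tau v cw)).
rewrite -integralD_R; last 2 first.
- exact/itgZ/cper_itg/(cper_shift v' (cper_tau v cw)).
- exact/itgZ/cper_itg/cper_tau.
apply: integral_le_R => [||x].
- exact/cper_itg/cper_tau.
- apply: itgD; apply/itgZ/cper_itg; [exact: (cper_shift v' (cper_tau v cw))|exact: cper_tau].
- rewrite [v + v']addrC addrA; set a := w _; set b := w (x + v'); set c := w x.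
  by have := sqr_ge0 ((a - b) - (b - c)); lra.
Qed.

Lemma tau0 w : tau w 0 = 0.
Proof.
rewrite -[RHS](@integral_cst_R _ _ _ mu); apply: eq_Rintegral => x _.
by rewrite addr0 subrr expr0n.
Qed.

Lemma tau_ge0 w v : 0 <= tau w v.
Proof. by apply: integral_ge0_R => x; exact: sqr_ge0. Qed.

Lemma measurable_row_line i : measurable_fun setT (fun z : Rd * measurableTypeR R => z.1 + z.2 *: basis_vec i).
Proof.
apply: measurable_fun_rowP => j.
rewrite (_ : (fun z => _) = (fun z : Rd * measurableTypeR R => z.1 ord0 j + z.2 * basis_vec i ord0 j)); last first.
  by apply/funext => z; rewrite !mxE.
apply: measurable_funD.
  exact: (measurableT_comp (measurable_coord j) measurable_fst).
by apply: measurable_funM; [exact: measurable_snd|exact: measurable_cst].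
Qed.

Lemma is_derive_along_line (W : normedModType R) (f : W -> R) (x v : W) (t l c : R) : is_derive (x + (t * c) *: v) v f l ->
  is_derive t (1 : R) (fun s : R => f (x + (s * c) *: v)) (c * l).
Proof.
move=> H.
have e1 (r : R) : r *: (1 : R) = r by rewrite /GRing.scale/= mulr1.
have eqf : (fun r : R => r^-1 *: ((f \o shift (x + (t * c) *: v)) (r *: v) - f (x + (t * c) *: v))) =
    (fun r : R => r^-1 *: (((fun s => f (x + s *: v)) \o shift (t * c)) (r *: (1:R)) - f (x + (t * c) *: v))).
  by apply/funext => r /=; congr (_ *: (f _ - _)); rewrite e1 scalerDl addrCA.
have F : is_derive (t * c : R) (1 : R) (fun s : R => f (x + s *: v)) l.
  split; first by have := @ex_derive _ _ _ _ _ _ _ H; rewrite /derivable eqf.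
  by have := @derive_val _ _ _ _ _ _ _ H; rewrite /derive eqf.
have G : is_derive t (1 : R) (fun s : R => s * c) c.
  by apply: is_derive_eq; rewrite scaler0 add0r /GRing.scale/= mulr1.
have := @is_derive1_comp R (fun s => f (x + s *: v)) (fun s => s * c) t l c F G.
by rewrite mulrC.
Qed.

(** The increment of w is the integral of [t g] along the segment. Square it by Jensen, integrate in
    x first, and use translation invariance. *)
Lemma tau_line w g i (t : R) : cper w -> cper g -> (forall x, is_derive x (basis_vec i) w (g x)) ->
  tau w (t *: basis_vec i) <= t ^+ 2 * \int[mu]_x g x ^+ 2.
Proof.
move=> cw cg wg; have [B B0 gB] := cper_bnd cg.
have lin (x : Rd) : continuous (fun s : R => x + (s * t) *: basis_vec i).
  move=> s; apply: cvgD; first exact: cvg_cst.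
  by apply: cvgZr_tmp; apply: cvgMr_tmp; exact: cvg_id.
have cg1 x : continuous (fun s : R => g (x + (s * t) *: basis_vec i)).
  move=> s; apply: (@continuous_comp _ _ _ (fun s : R => x + (s * t) *: basis_vec i) g); last exact: cg.2.
  exact: lin.
have i1 x : unif.-integrable setT (EFin \o (fun s => t * g (x + (s * t) *: basis_vec i))).
  apply: itgZ; apply: (continuous_itg_unif (cg1 x)) => s; exact: gB.
have m2 : measurable_fun setT (fun z : Rd * measurableTypeR R => (t * g (z.1 + (z.2 * t) *: basis_vec i)) ^+ 2).
  apply: measurable_funX; apply: measurable_funM => //.
  apply: measurableT_comp; first exact: cper_mf.
  apply: (measurableT_comp (@measurable_row_line i) (_ : measurable_fun setT (fun z : Rd * measurableTypeR R => (z.1, z.2 * t)))).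
  apply: measurable_fun_pair; first exact: measurable_fst.
  by apply: measurable_funM; [exact: measurable_snd|exact: measurable_cst].
have b2 (z : Rd * measurableTypeR R) : 0 <= (t * g (z.1 + (z.2 * t) *: basis_vec i)) ^+ 2 <= t ^+ 2 * B ^+ 2.
  rewrite sqr_ge0/= exprMn ler_wpM2l ?sqr_ge0// -[X in X <= _]real_normK ?num_real//.
  by rewrite ler_sqr ?nnegrE.
have [M1 M2 E] := tonelli_bnd mu unif m2 b2.
apply: (@le_trans _ _ (\int[mu]_x \int[unif]_s (t * g (x + (s * t) *: basis_vec i)) ^+ 2)).
  apply: integral_le_R => [||x].
  - exact/cper_itg/cper_tau.
  - apply: (@itg_bnd _ _ _ mu (t ^+ 2 * B ^+ 2)) => // x; apply: integral_abs_bnd => [|s].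
      exact: (measurableT_comp m2 (@pair1_measurable _ _ _ _ x)).
    by have /andP[h0 h1] := b2 (x, s); rewrite ger0_norm.
  - have E1 : \int[unif]_s (t * g (x + (s * t) *: basis_vec i)) = w (x + t *: basis_vec i) - w x.
      have H s : is_derive (s : R) (1 : R) (fun s => w (x + (s * t) *: basis_vec i)) (t * g (x + (s * t) *: basis_vec i)).
        exact: is_derive_along_line.
      by rewrite (ftc_unif H) ?mul1r ?mul0r ?scale0r ?addr0//; exact: continuous_mulcst.
    rewrite -E1.
    have cF : continuous (fun s : R => t * g (x + (s * t) *: basis_vec i)) by exact: continuous_mulcst.
    have bF s : `|t * g (x + (s * t) *: basis_vec i)| <= `|t| * B by rewrite normrM ler_wpM2l.
    have mF := @continuous_measurable_fun R _ cF.
    have LF := @L2_bnd _ (measurableTypeR R) R unif _ _ mF bF.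
    apply: le_trans (L2_integral_norm LF).
    rewrite -[X in X <= _]real_normK ?num_real// ler_sqr ?nnegrE// ?integral_ge0_R//.
    exact: integral_abs_R.
rewrite E; apply: integral_le_bnd.
  apply: (@itg_bnd _ _ _ unif (t ^+ 2 * B ^+ 2)) => // s; apply: integral_abs_bnd => [|x].
    exact: (measurableT_comp m2 (@pair2_measurable _ _ _ _ s)).
  by have /andP[h0 h1] := b2 (x, s); rewrite ger0_norm.
move=> s; under eq_Rintegral do rewrite exprMn.
rewrite integralZ_R; last exact: (cper_itg (cper_shift ((s * t) *: basis_vec i) (cperX 2 cg))).
by rewrite (integral_shift ((s * t) *: basis_vec i) (cperX 2 cg)).
Qed.

Lemma tau_periodic w : cper w -> periodic (tau w).
Proof. by move=> cw v i; rewrite /tau; under eq_Rintegral do rewrite addrA cw.1. Qed.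

(** By periodicity a shift by t is also a shift by [t - 1]; take the shorter one and use that
    squares of numbers in the unit interval do not exceed them. *)
Lemma tau_basis w g i (t : R) : cper w -> cper g -> (forall x, is_derive x (basis_vec i) w (g x)) ->
  0 <= t <= 1 -> tau w (t *: basis_vec i) <= Num.min t (1 - t) * \int[mu]_x g x ^+ 2.
Proof.
move=> cw cg wg /andP[t0 t1].
have D0 : 0 <= \int[mu]_x g x ^+ 2 by apply: integral_ge0_R => x; exact: sqr_ge0.
have [_|_] := leP t (1 - t).
  by apply: (le_trans (tau_line t cw cg wg)); rewrite ler_wpM2r// expr2 ler_piMl.
rewrite (_ : t *: _ = (t - 1) *: basis_vec i + basis_vec i); last by rewrite -[X in _ + X]scale1r -scalerDl subrK.
rewrite tau_periodic//; apply: (le_trans (tau_line (t - 1) cw cg wg)); rewrite ler_wpM2r//.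
by rewrite -sqrrN opprB expr2 ler_piMl// ?subr_ge0// lerBlDr lerDl.
Qed.

Lemma tau_sum w (s : seq 'I_d) (z : Rd) : cper w ->
  tau w (\sum_(i <- s) z ord0 i *: basis_vec i) <= 2 ^+ size s * \sum_(i <- s) tau w (z ord0 i *: basis_vec i).
Proof.
move=> cw; elim: s => [|i s IH]; first by rewrite !big_nil mulr0 tau0.
rewrite !big_cons/= exprS -mulrA; apply: le_trans (tauD _ _ cw) _.
rewrite -mulrDr ler_pM2l// mulrDr lerD//.
by rewrite ler_peMl ?tau_ge0// exprn_ege1// ler1n.
Qed.

(** The factor lost by applying [tauD] once per coordinate. *)
Definition Cdim : R := 2 ^+ size (index_enum 'I_d).

Lemma tau_le (e : R) : 0 < e -> exists2 C : R, 0 <= C & forall w (g : 'I_d -> Rd -> R) z,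
  cper w -> (forall i, cper (g i)) -> (forall i x, is_derive x (basis_vec i) w (g i x)) ->
  tau w z <= Cdim * (e + C * phi2 z) * \sum_i \int[mu]_x g i x ^+ 2.
Proof.
move=> e0; have [C C0 hC] := dist_le_c2 e0; exists C => // w g z cw cg wg.
rewrite -(periodic_frac z (tau_periodic cw)) -{1}(row_basis (frac z)).
apply: (le_trans (tau_sum _ _ cw)); rewrite -mulrA ler_wpM2l ?exprn_ge0// mulr_sumr.
apply: ler_sum => i _; have /andP[f0 f1] := frac_itv z i.
have f01 : 0 <= frac z ord0 i <= 1 by rewrite f0 ltW.
apply: (le_trans (tau_basis cw (cg i) (wg i) f01)).
apply: ler_wpM2r; first by apply: integral_ge0_R => x; exact: sqr_ge0.
apply: (le_trans (hC _ f01)); rewrite lerD2l ler_wpM2l//.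
have -> : phi2 z = phi2 (frac z).
  by rewrite -[z in LHS]subr0 -phi2_frac (_ : frac 0 = 0) ?subr0//; apply/rowP => j; rewrite !mxE floor0 subr0.
rewrite /phi2 (bigD1 i)//= lerDl sumr_ge0// => j _.
by have := c2_le1 (frac z ord0 j); lra.
Qed.

(** The kernel is a probability density, so Jensen's inequality bounds the squared error at x by the
    averaged squared increment; then exchange the integrals. *)
Lemma KK_L2_dist n w : cper w -> 
  \int[mu]_x (w x - KK n w x) ^+ 2 <= \int[mu]_z (Kern n z * tau w z) /\
  itg (fun z => Kern n z * tau w z).
Proof.
move=> cw; have [B B0 wB] := cper_bnd cw.
pose F (p : Rd * Rd) := Kern n p.2 * (w (p.1 + p.2) - w p.1) ^+ 2.
have mF : measurable_fun setT F.
  have mw := cper_mf cw; have mK := @continuous_measurable_row _ _ _ (@continuous_Kern R d n).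
  apply: measurable_funM; first exact: (measurableT_comp mK measurable_snd).
  apply: measurable_funX; apply: measurable_funB; last exact: (measurableT_comp mw measurable_fst).
  apply: measurableT_comp => //; apply: measurable_fun_rowP => i.
  rewrite (_ : (fun z => _) = (fun z : Rd * Rd => z.1 ord0 i + z.2 ord0 i)); last by apply/funext => z; rewrite mxE.
  by apply: measurable_funD; apply: (measurableT_comp (measurable_coord i)); [exact: measurable_fst|exact: measurable_snd].
have bF p : 0 <= F p <= kbnd d n * (B + B) ^+ 2.
  rewrite mulr_ge0 ?Kern_ge0 ?sqr_ge0//= ler_pM ?Kern_ge0 ?sqr_ge0//.
    exact: le_trans (ler_norm _) (Kern_bnd _ _).
  rewrite -[leLHS]real_normK ?num_real// ler_sqr ?nnegrE ?addr_ge0//.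
  by apply: le_trans (ler_normB _ _) _; apply: lerD.
have [M1 M2 E] := tonelli_bnd mu mu mF bF.
have EZ z : \int[mu]_x F (x, z) = Kern n z * tau w z.
  by rewrite /F/= (integralZ_R _ (cper_itg (cper_tau z cw))).
have I2 : itg (fun z => Kern n z * tau w z).
  apply: (@itg_bnd _ _ _ mu (kbnd d n * (B + B) ^+ 2)) => [|z].
    by apply: eq_measurable_fun M2 => z _; rewrite EZ.
  rewrite -EZ; apply: integral_abs_bnd => [|x]; first exact: (measurableT_comp mF (@pair2_measurable _ _ _ _ z)).
  by have /andP[h0 h1] := bF (x, z); rewrite ger0_norm.
split; last exact: I2.
under [leRHS]eq_Rintegral do rewrite -EZ.
rewrite -E; apply: integral_le_R => [||x].
- exact: (cper_itg (cperX 2 (cperB cw (cper_KK n (cper_itg cw))))).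
- apply: (@itg_bnd _ _ _ mu (kbnd d n * (B + B) ^+ 2)) => [|x]; first exact: M1.
  apply: integral_abs_bnd => [|z].
    exact: (measurableT_comp mF (@pair1_measurable _ _ _ _ x)).
  by have /andP[h0 h1] := bF (x, z); rewrite ger0_norm.
- rewrite /F/=; set a := w x; set b := KK n w x.
  have cK : cper (@Kern R d n) by split; [exact: Kern_periodic|exact: continuous_Kern].
  have cx : cper (fun z => w (x + z)).
    by rewrite (_ : (fun z => _) = fun z => w (z + x)); [exact: cper_shift|apply/funext => z; rewrite addrC].
  have K1 : \int[mu]_z Kern n z = 1.
    by rewrite -[RHS](integral_Kern n (0 : Rd)); under [RHS]eq_Rintegral do rewrite sub0r KernN.
  have Eb : b = \int[mu]_z (Kern n z * w (x + z)) by exact: KK_shift.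
  have h : 0 <= \int[mu]_z (Kern n z * (w (x + z) - b) ^+ 2).
    by apply: integral_ge0_R => z; rewrite mulr_ge0 ?Kern_ge0 ?sqr_ge0.
  (* The second moment about c. At the mean b it is a variance, hence nonnegative, and comparing it
     with [c = w x] gives Jensen's inequality. *)
  have ex (c : R) : \int[mu]_z (Kern n z * (w (x + z) - c) ^+ 2) =
      \int[mu]_z (Kern n z * w (x + z) ^+ 2) - 2 * c * b + c ^+ 2.
    rewrite (_ : \int[mu]_z _ = \int[mu]_z (Kern n z * w (x + z) ^+ 2 + ((- (2 * c)) * (Kern n z * w (x + z)) + c ^+ 2 * Kern n z))).
      have j1 := cper_itg (cperM cK (cperX 2 cx)); have j2 := cper_itg (cperM cK cx).
      have j3 := cper_itg cK; have j4 := itgZ (- (2 * c)) j2; have j5 := itgZ (c ^+ 2) j3.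
      rewrite (integralD_R j1 (itgD j4 j5)) (integralD_R j4 j5) (integralZ_R _ j2) (integralZ_R _ j3).
      by rewrite K1 -Eb; ring.
    by apply: eq_Rintegral => z _; ring.
  by rewrite ex; move: h; rewrite ex; exact: sqr_sub_le_of_variance.
Qed.

(** The constant does not depend on w. This uniformity drives the compactness theorem, the Poincaré
    inequality and the logarithmic test. *)
Lemma KK_L2_rate (e : R) : 0 < e -> exists2 C : R, 0 <= C & forall n w (g : 'I_d -> Rd -> R),
  cper w -> (forall i, cper (g i)) -> (forall i x, is_derive x (basis_vec i) w (g i x)) ->
  \int[mu]_x (w x - KK n w x) ^+ 2 <= (e + C / n.+1%:R) * \sum_i \int[mu]_x g i x ^+ 2.
Proof.
move=> e0; have Cd0 : 0 < Cdim by rewrite exprn_gt0.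
have e1 : 0 < e / Cdim by rewrite divr_gt0.
have [C C0 hC] := tau_le e1; exists (Cdim * C * d%:R) => [|n w g cw cg wg]; first by rewrite !mulr_ge0// ltW.
have [h1 h2] := KK_L2_dist n cw; apply: le_trans h1 _.
set D := \sum_i _; have cK : cper (@Kern R d n) by split; [exact: Kern_periodic|exact: continuous_Kern].
have iK : itg (@Kern R d n) := cper_itg cK.
have iP : itg (fun z : Rd => Kern n z * phi2 z).
  apply: eq_integrable (itg_Kern_phi2 n (0 : Rd)) => // z _ /=; by rewrite sub0r KernN phi2N.
have K1 : \int[mu]_z Kern n z = 1.
  by rewrite -[RHS](integral_Kern n (0 : Rd)); under [RHS]eq_Rintegral do rewrite sub0r KernN.
have KP : \int[mu]_z (Kern n z * phi2 z) = d%:R / n.+1%:R.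
  by rewrite -[RHS](integral_Kern_phi2 n (0 : Rd)); under [RHS]eq_Rintegral do rewrite sub0r KernN phi2N.
apply: (@le_trans _ _ (\int[mu]_z ((e * D) * Kern n z + (Cdim * C * D) * (Kern n z * phi2 z)))).
  apply: integral_le_R => [//||z]; first by apply: itgD; exact: itgZ.
  have := hC w g z cw cg wg; rewrite -/D => h.
  have := ler_wpM2l (Kern_ge0 n z) h; move/le_trans; apply.
  rewrite le_eqVlt; apply/orP; left; apply/eqP.
  by field; rewrite gt_eqF.
rewrite integralD_R; [|exact: itgZ..]; rewrite !integralZ_R// K1 KP.
rewrite le_eqVlt; apply/orP; left; apply/eqP; rewrite !mulrDl mulr1; congr (_ + _).
by rewrite -!mulrA; do 2 congr (_ * _); rewrite mulrC -!mulrA.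
Qed.

Lemma KK0 w x : itg w -> KK 0 w x = \int[mu]_y w y.
Proof.
move=> iw; apply: eq_Rintegral => y _.
have Jc0 : @Jc R 0 = 1 by rewrite /Jc; under eq_Rintegral do rewrite expr0; rewrite (@integral_cst_R _ _ _ unif).
rewrite /Kern big1 ?mul1r// => i _.
by rewrite /kap expr0 Jc0 divr1.
Qed.

(** For [n = 0] the kernel is 1 and [KK 0 w] is the mean of w, so the case [e = 1] of the rate
    bounds the variance. *)
Lemma poincare : exists2 C : R, 0 <= C & forall w (g : 'I_d -> Rd -> R),
  cper w -> (forall i, cper (g i)) -> (forall i x, is_derive x (basis_vec i) w (g i x)) ->
  \int[mu]_x w x ^+ 2 <= C * ((\int[mu]_x w x) ^+ 2 + \sum_i \int[mu]_x g i x ^+ 2).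
Proof.
have [C C0 hC] := KK_L2_rate ltr01; exists (2 + 2 * (1 + C / 1%:R)) => [|w g cw cg wg].
  by rewrite addr_ge0// mulr_ge0// divr1 addr_ge0.
have iw := cper_itg cw; have := hC 0 w g cw cg wg; under eq_Rintegral do rewrite (KK0 _ iw).
set b := \int[mu]_x w x; set D := \sum_i _.
have D0 : 0 <= D by apply: sumr_ge0 => i _; apply: integral_ge0_R => x; exact: sqr_ge0.
move=> h.
have : \int[mu]_x w x ^+ 2 <= 2 * \int[mu]_x (w x - b) ^+ 2 + 2 * b ^+ 2.
  have j1 := cper_itg (cperX 2 (cperB cw (cper_cst b))); have j2 := itgZ 2 j1.
  rewrite -[X in _ + X](@integral_cst_R _ _ _ mu (2 * b ^+ 2)) -integralZ_R//.
  rewrite -integralD_R//; last exact: itg_cst.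
  apply: integral_le_R => [||x]; first exact: (cper_itg (cperX 2 cw)).
    by apply: itgD => //; exact: itg_cst.
  by have := sqr_ge0 (w x - b - b); nra.
move: h; rewrite divr1; have := sqr_ge0 b; nra.
Qed.

End translation.

Lemma cvg_sumr {R : realType} (T : Type) (F : set_system T) {FF : Filter F} (I : Type) (s : seq I)
    (f : I -> T -> R) (l : I -> R) :
  (forall i, f i x @[x --> F] --> l i) -> \sum_(i <- s) f i x @[x --> F] --> \sum_(i <- s) l i.
Proof.
move=> h; elim: s => [|a s IH]; first by under eq_fun do rewrite big_nil; rewrite big_nil; exact: cvg_cst.
by under eq_fun do rewrite big_cons; rewrite big_cons; exact: cvgD.
Qed.

(** * Compactness and Sobolev embedding *)

Section rellich.
Context {R : realType} {d : nat}.
Local Notation Rd := 'rV[R]_d.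
Local Notation mu := (@torus_measure R d).
Local Notation itg f := (mu.-integrable setT (EFin \o f)).
Implicit Types (f g w : Rd -> R) (x y v : Rd).

Lemma KK_L1_cvg_itg f : itg f -> \int[mu]_x `|KK n f x - f x| @[n --> \oo] --> 0.
Proof. by move=> F; exact/KK_L1_cvg/L1app_itg. Qed.

Lemma itg_KK n f : itg f -> itg (KK n f).
Proof. by move=> F; exact: cper_itg (cper_KK n F). Qed.

(** All [KK n f] vanish, and they tend to f in L^1. *)
Lemma trig_unique f : itg f -> (forall b k, \int[mu]_y (md b k y * f y) = 0) ->
  {ae mu, forall x, f x = 0}.
Proof.
move=> F h; have K0 n x : KK n f x = 0.
  rewrite KKE// /tp /KKl big_cat !big_map/= !big1 ?addr0// => p _; by rewrite /fc h mulr0 mul0r.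
have := KK_L1_cvg_itg F.
rewrite (_ : (fun n => _) = fun=> \int[mu]_x `|f x|); last first.
  by apply/funext => n; apply: eq_Rintegral => x _; rewrite K0 sub0r normrN.
move=> /(cvg_unique (@norm_hausdorff _ R^o) (@cvg_cst _ _ _ _ _)) E.
have := @integral_eq0_ae _ _ _ mu (fun x => `|f x|) (itg_abs F).
rewrite E => H; have {}H : {ae mu, forall x, `|f x| = 0}.
  by apply: H => //; apply: aeW => x.
by apply: filterS H => x /eqP; rewrite normr_eq0 => /eqP.
Qed.

Lemma L1_of_L2 (f : nat -> Rd -> R) (U : set_system nat) : ProperFilter U -> (forall n, L2 mu (f n)) ->
  \int[mu]_x f n x ^+ 2 @[n --> U] --> 0 -> \int[mu]_x `|f n x| @[n --> U] --> 0.
Proof.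
move=> PU F /cvgrPdist_le h; apply/cvgrPdist_le => e e0.
have e2 : 0 < e ^+ 2 by rewrite exprn_gt0.
apply: filterS (h _ e2) => n; rewrite !sub0r !normrN !ger0_norm ?integral_ge0_R//; last first.
  by move=> x; exact: sqr_ge0.
move=> hn; have := L2_integral_norm (F n) => hn'.
have : (\int[mu]_x `|f n x|) ^+ 2 <= e ^+ 2 by exact: le_trans hn'  hn.
by rewrite ler_sqr// nnegrE ?integral_ge0_R// ltW.
Qed.

Lemma cper_L2_md b k : L2 mu (md b k).
Proof. exact/cper_L2/cper_md. Qed.

(* A fixed kernel maps weak convergence to strong convergence, its range being finite-dimensional. *)
Lemma KK_weak_cvg n (w : nat -> Rd -> R) w0 (U : set_system nat) (UU : UltraFilter U) :
  (forall j, L2 mu (w j)) -> wcvg mu U w w0 ->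
  \int[mu]_x `|KK n (w j) x - KK n w0 x| @[j --> U] --> 0.
Proof.
move=> W [W0 hw]; have PU : ProperFilter U by exact: ultra_proper.
pose T (j : nat) : R := \sum_(p <- KL n) `|p.1| * (`|fc (w j) false p.2 - fc w0 false p.2| + `|fc (w j) true p.2 - fc w0 true p.2|).
have T0 : T j @[j --> U] --> 0.
  rewrite (_ : 0 = \sum_(p <- @KL R d n) `|p.1| * (0 + 0)); last by rewrite big1// => p _; rewrite addr0 mulr0.
  apply: cvg_sumr => p; apply: cvgM; first exact: cvg_cst.
  have h b : `|fc (w j) b p.2 - fc w0 b p.2| @[j --> U] --> 0.
    have H := hw (md b p.2) (cper_L2_md b p.2).
    apply/norm_cvg0P; rewrite -[X in _ --> X](subrr (fc w0 b p.2)).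
    apply: cvgB; last exact: cvg_cst.
    rewrite /fc; under eq_fun do (under eq_Rintegral do rewrite mulrC).
    by under eq_Rintegral do rewrite mulrC.
  by apply: cvgD; exact: h.
have Iw j := L2_itg (W j); have I0 := L2_itg W0.
have B j x : `|KK n (w j) x - KK n w0 x| <= T j.
  rewrite !KKE// /tp /KKl !big_cat !big_map/= -!big_split/= -sumrB.
  apply: le_trans (ler_norm_sum _ _ _) _; apply: ler_sum => p _.
  rewrite -/(md false p.2 x) -/(md true p.2 x).
  rewrite (_ : _ - _ = p.1 * ((fc (w j) false p.2 - fc w0 false p.2) * md false p.2 x + (fc (w j) true p.2 - fc w0 true p.2) * md true p.2 x)); last by ring.
  rewrite normrM ler_wpM2l//; apply: le_trans (ler_normD _ _) _; rewrite !normrM.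
  by apply: lerD; rewrite ler_piMr// md_bnd.
apply: (@squeeze_cvgr _ _ _ _ (fun=> 0) T) => //; last exact: cvg_cst.
apply: (@filterS _ U _ setT _ _ filterT) => j _; rewrite integral_ge0_R//=.
apply: integral_le_bnd => [|x]; last exact: B.
by apply/itg_abs/itgB; exact: itg_KK.
Qed.

(** [KK n] is close to the identity uniformly in j on a set of bounded gradients, and it turns weak
    convergence into strong convergence. So the sequence tends to its weak limit in L^1 along the
    ultrafilter, and an ordinary a.e. convergent subsequence is read off. *)
Lemma rellich (w : nat -> Rd -> R) (g : nat -> 'I_d -> Rd -> R) (C : R) :
  (forall n, cper (w n)) -> (forall n i, cper (g n i)) ->
  (forall n i x, is_derive x (basis_vec i) (w n) (g n i x)) ->
  (forall n, \int[mu]_x w n x ^+ 2 <= C) ->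
  (forall n, \sum_i \int[mu]_x g n i x ^+ 2 <= C) ->
  exists (s : nat -> nat) (w0 : Rd -> R), [/\ forall k, (k <= s k)%N, L2 mu w0 &
    {ae mu, forall x, w (s k) x @[k --> \oo] --> w0 x}].
Proof.
move=> cw cg wg hw hg.
have [U UU Uoo] := ultra_eventually; have PU : ProperFilter U by exact: ultra_proper.
have Lw n : L2 mu (w n) := cper_L2 (cw n).
have [w0 W0] := weak_L2_limit UU Lw hw.
have L0 : L2 mu w0 := W0.1.
have I0 := L2_itg L0; have Iw n := L2_itg (Lw n).
have D0 n : 0 <= \sum_i \int[mu]_x g n i x ^+ 2.
  by apply: sumr_ge0 => i _; apply: integral_ge0_R => x; exact: sqr_ge0.
have C0 : 0 <= C by exact: le_trans (hg 0%N).
have key (e : R) : 0 < e -> exists n, forall j, \int[mu]_x `|w j x - KK n (w j) x| <= e /\ \int[mu]_x `|KK n w0 x - w0 x| <= e.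
  move=> e0; have e1 : 0 < e ^+ 2 / 2 / (C + 1) by rewrite !divr_gt0 ?exprn_gt0// ltr_wpDl.
  have [K K0 hK] := @KK_L2_rate R d _ e1.
  have e2 : 0 < e ^+ 2 / 2 / (C + 1) by rewrite !divr_gt0 ?exprn_gt0// ltr_wpDl.
  have [N hN] := nS_inv_small K e2.
  have /cvgrPdist_le/(_ e e0)[M _ hM] := KK_L1_cvg_itg I0.
  exists (maxn N M) => j; split; last first.
    by have := hM _ (leq_maxr N M); rewrite /= sub0r normrN ger0_norm ?integral_ge0_R.
  have h1 := hK (maxn N M) _ _ (cw j) (cg j) (wg j).
  have h2 := hN _ (leq_maxl N M).
  have LB := L2B (Lw j) (cper_L2 (cper_KK (maxn N M) (Iw j))).
  have := L2_integral_norm LB => h3.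
  have : (\int[mu]_x `|w j x - KK (maxn N M) (w j) x|) ^+ 2 <= e ^+ 2.
    apply: le_trans h3 _; apply: le_trans h1 _.
    apply: (@le_trans _ _ ((e ^+ 2 / 2 / (C + 1) + e ^+ 2 / 2 / (C + 1)) * C)).
      by rewrite ler_pM// ?lerD2l// addr_ge0 ?(ltW e1)// divr_ge0.
    rewrite -mulrDl -mulrDl -mulr2n -[_ ^+ 2 *+ 2]mulr_natr mulfK ?pnatr_eq0// -mulrA.
    by rewrite ler_piMr ?sqr_ge0// ler_pdivrMl ?ltr_wpDl// mulr1 lerDl.
  by rewrite ler_sqr// nnegrE ?integral_ge0_R// ltW.
have cvgU : \int[mu]_x `|w j x - w0 x| @[j --> U] --> 0.
  apply/cvgrPdist_le => e e0; have e3 : 0 < e / 3 by rewrite divr_gt0.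
  have [n hn] := key _ e3.
  have /cvgrPdist_le/(_ _ e3) := KK_weak_cvg n UU Lw W0.
  apply: filterS => j; rewrite !sub0r !normrN !ger0_norm ?integral_ge0_R// => hj.
  have [h1 h2] := hn j.
  have i1 := itg_abs (itgB (Iw j) (itg_KK n (Iw j))).
  have i2 := itg_abs (itgB (itg_KK n (Iw j)) (itg_KK n I0)).
  have i3 := itg_abs (itgB (itg_KK n I0) I0).
  apply: (@le_trans _ _ (\int[mu]_x (`|w j x - KK n (w j) x| + (`|KK n (w j) x - KK n w0 x| + `|KK n w0 x - w0 x|)))).
    apply: integral_le_R => [||x]; [exact/itg_abs/itgB|by apply: itgD => //; exact: itgD|].
    rewrite (_ : w j x - w0 x = (w j x - KK n (w j) x) + ((KK n (w j) x - KK n w0 x) + (KK n w0 x - w0 x))); last by ring.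
    by apply: le_trans (ler_normD _ _) _; rewrite lerD2l ler_normD.
  rewrite (integralD_R i1 (itgD i2 i3)) (integralD_R i2 i3).
  apply: le_trans (lerD h1 (lerD hj h2)) _; have := e0; clear; lra.
have ex k : exists N, (k <= N)%N /\ \int[mu]_x `|w N x - w0 x| <= k.+1%:R^-1.
  have k0 : 0 < k.+1%:R^-1 :> R by rewrite invr_gt0.
  have /cvgrPdist_le/(_ _ k0) h := cvgU.
  have : U [set N | (k <= N)%N].
    by apply: Uoo; exists k.
  move=> h'; have [N [/= h1 h2]] := @filter_ex _ U _ _ (filterI h h').
  by exists N; split => //; move: h1; rewrite sub0r normrN ger0_norm ?integral_ge0_R.
have [s hs] := choice ex.
have F n : itg (fun x => `|w (s n) x - w0 x|) by exact/itg_abs/itgB.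
have lim0 : \int[mu]_x `|w (s n) x - w0 x| @[n --> \oo] --> 0.
  apply: (@squeeze_cvgr _ _ _ _ (fun=> 0) (fun n => n.+1%:R^-1)); [|exact: cvg_cst|exact: cvg_harmonic].
  by apply: (@filterS _ _ _ setT _ _ filterT) => n _; rewrite integral_ge0_R//=; exact: (hs n).2.
have [t ht tc] := @ae_subseq _ _ _ mu _ F (fun n x => normr_ge0 _) lim0.
exists (s \o t), w0; split => //.
  by move=> k /=; exact: leq_trans (ht k) (hs _).1.
apply: filterS tc => x /norm_cvg0P h.
rewrite -[X in _ --> X]add0r; under eq_fun do rewrite -[w _ x](subrK (w0 x)).
by apply: cvgD => //; exact: cvg_cst.
Qed.

(** The sublists of s. For the list of all coordinates they index the mixed derivatives with each
    coordinate used at most once. *)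
Fixpoint subs (I : Type) (s : seq I) : seq (seq I) :=
  if s is i :: s' then subs s' ++ map (cons i) (subs s') else [:: [::]].

Lemma subs_size (I : eqType) (s T : seq I) : T \in subs s -> (size T <= size s)%N.
Proof.
elim: s T => [|i s IH] T /=; first by rewrite inE => /eqP ->.
rewrite mem_cat => /orP[/IH/leqW//|/mapP[T' /IH h ->]] /=.
by rewrite ltnS.
Qed.

Definition trunc (s : seq 'I_d) (z : Rd) : Rd := \row_j (if j \in s then z ord0 j else 0).

Lemma measurable_trunc s : measurable_fun setT (trunc s).
Proof.
apply: measurable_fun_rowP => i; under eq_fun do rewrite mxE.
by case: (i \in s); [exact: measurable_coord|exact: measurable_cst].
Qed.

Lemma trunc_upd s i t (z : Rd) : i \notin s -> trunc (i :: s) (upd i t z) = trunc s z + t *: basis_vec i.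
Proof.
move=> si; apply/rowP => j; rewrite !mxE inE eqxx/=.
have [->|ji] := eqVneq j i; first by rewrite (negPf si) mulr1 add0r.
by rewrite /= mulr0 addr0.
Qed.

(** [f x] is the integral over the unit interval of the derivative of [(t - 1) f (x + t e_i)], whose
    endpoint value at [t = 1] vanishes. *)
Lemma one_dim_sup (f g : Rd -> R) i x : cper f -> cper g ->
  (forall x, is_derive x (basis_vec i) f (g x)) ->
  `|f x| <= \int[uniform_prob (@ltr01 R)]_t (`|f (x + t *: basis_vec i)| + `|g (x + t *: basis_vec i)|).
Proof.
move=> cf cg fg; pose b := basis_vec i : Rd.
have [B B0 fB] := cper_bnd cf; have [C C0 gC] := cper_bnd cg.
have cl (u : Rd -> R) : cper u -> continuous (fun t : R => u (x + t *: b)).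
  move=> cu t; apply: (@continuous_comp _ _ _ (fun t : R => x + t *: b) u); last exact: cu.2.
  by apply: cvgD; [exact: cvg_cst|apply: cvgZr_tmp; exact: cvg_id].
have H (t : R) : is_derive t (1:R) (fun t : R => (t - 1) * f (x + t *: b)) (f (x + t *: b) + (t - 1) * g (x + t *: b)).
  have h : is_derive t (1:R) (fun t : R => f (x + t *: b)) (g (x + t *: b)).
    have := @is_derive_along_line R _ f x b t (g (x + t *: b)) 1; rewrite mulr1 mul1r => h.
    have /= := h (fg _); congr (is_derive _ _ _ _).
    by apply/funext => s; rewrite mulr1.
  apply: is_derive_eq; rewrite /GRing.scale/= subr0 mulr1; ring.
have c1 : continuous (fun t : R => (t - 1) * g (x + t *: b)).
  move=> t; apply: cvgM; last exact: cl.
  by apply: cvgB; [exact: cvg_id|exact: cvg_cst].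
have c2' : continuous (fun t : R => f (x + t *: b) + (t - 1) * g (x + t *: b)).
  by move=> t; apply: cvgD; [exact: cl|exact: c1].
have := ftc_unif H c2'; rewrite subrr mul0r scale0r addr0 !sub0r mulN1r opprK => E.
have mF := @continuous_measurable_fun R _ c2'.
have ub : {ae uniform_prob (@ltr01 R), forall t, `|f (x + t *: b) + (t - 1) * g (x + t *: b)| <= `|f (x + t *: b)| + `|g (x + t *: b)|}.
  apply: (@filterS _ _ (ae_filter_ringOfSetsType (uniform_prob (@ltr01 R))) _ _ _ (@ae_unif_oo R)) => t /andP[t0 t1].
  apply: le_trans (ler_normD _ _) _; rewrite lerD2l normrM ler_piMl//.
  by rewrite ler_norml; apply/andP; split; lra.
have cS : continuous (fun t : R => `|f (x + t *: b)| + `|g (x + t *: b)|).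
  move=> t; apply: cvgD; [exact: (cl _ (cper_norm cf))|exact: (cl _ (cper_norm cg))].
have iS : (uniform_prob (@ltr01 R)).-integrable setT (EFin \o (fun t : R => `|f (x + t *: b)| + `|g (x + t *: b)|)).
  apply: (continuous_itg_unif cS (B := B + C)) => t.
  by rewrite ger0_norm ?addr_ge0// lerD.
have iF := @itg_aele _ (measurableTypeR R) R (uniform_prob (@ltr01 R)) _ _ mF ub iS.
rewrite -E; apply: le_trans (integral_abs_R iF) _.
exact: (integral_ae_le (itg_abs iF) iS ub).
Qed.

(** The embedding of W^(d,1) into bounded functions. Each application of [one_dim_sup] averages over
    one more coordinate at the price of one more derivative; after all of them the base point
    disappears by translation invariance. *)
Lemma sup_bound (g : seq 'I_d -> Rd -> R) x : (forall T, cper (g T)) ->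
  (forall T i, (size T < d)%N -> forall x, is_derive x (basis_vec i) (g T) (g (i :: T) x)) ->
  `|g [::] x| <= \sum_(T <- subs (enum 'I_d)) \int[mu]_y `|g T y|.
Proof.
move=> cg dg.
pose G s y : R := \sum_(T <- subs s) `|g T y|.
have cG s : cper (G s) by apply: cper_sum => T; exact: cper_norm.
have iT s : itg (fun z => G s (x + trunc s z)).
  have [B B0 hB] := cper_bnd (cG s).
  apply: (@itg_bnd _ _ _ mu B) => [|z]; last exact: hB.
  apply: measurableT_comp; first exact: cper_mf.
  apply: measurable_fun_rowP => i; under eq_fun do rewrite mxE.
  by apply: measurable_funD; [exact: measurable_cst|exact: (measurableT_comp (measurable_coord i) (measurable_trunc s))].
(* Only the coordinates in s have been averaged so far; [trunc s z] moves x in these alone. *)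
have key s : uniq s -> `|g [::] x| <= \int[mu]_z G s (x + trunc s z).
  elim: s => [|i s IH] us.
    rewrite (_ : \int[mu]_z _ = `|g [::] x|)//.
    rewrite -[RHS](@integral_cst_R _ _ _ mu); apply: eq_Rintegral => z _.
    rewrite /G/= big_seq1 (_ : trunc [::] z = 0) ?addr0//.
    by apply/rowP => j; rewrite !mxE.
  have /= /andP[si us'] := us.
  have ss : (size s < d)%N.
    by have := max_card (mem (i :: s)); rewrite card_ord (card_uniqP us).
  apply: le_trans (IH us') _.
  have [B B0 hB] := cper_bnd (cG (i :: s)).
  have mt : measurable_fun setT (fun z => G (i :: s) (x + trunc (i :: s) z)) by exact: itg_mf.
  rewrite (@resample_R R d i _ B mt (fun z => hB _)).
  have ES z : \int[uniform_prob (@ltr01 R)]_t G (i :: s) (x + trunc (i :: s) (upd i t z)) =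
      \int[uniform_prob (@ltr01 R)]_t G (i :: s) (x + trunc s z + t *: basis_vec i).
    by apply: eq_Rintegral => t _; rewrite trunc_upd// addrA.
  have one y : G s y <= \int[uniform_prob (@ltr01 R)]_t G (i :: s) (y + t *: basis_vec i).
    have cl (u : Rd -> R) : cper u -> continuous (fun t : R => u (y + t *: basis_vec i)).
      move=> cu t; apply: (@continuous_comp _ _ _ (fun t : R => y + t *: basis_vec i) u); last exact: cu.2.
      by apply: cvgD; [exact: cvg_cst|apply: cvgZr_tmp; exact: cvg_id].
    have il (u : Rd -> R) : cper u -> (uniform_prob (@ltr01 R)).-integrable setT (EFin \o (fun t : R => u (y + t *: basis_vec i))).
      move=> cu; have [Bu _ hu] := cper_bnd cu.
      by apply: (continuous_itg_unif (cl u cu) (B := Bu)) => t; exact: hu.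
    have cgi T : cper (fun y => `|g T y| + `|g (i :: T) y|) by apply: cperD; exact: cper_norm.
    rewrite (_ : \int[_]_t _ = \int[uniform_prob (@ltr01 R)]_t \sum_(T <- subs s) (`|g T (y + t *: basis_vec i)| + `|g (i :: T) (y + t *: basis_vec i)|)).
      rewrite (integral_sum_R (subs s) (fun T => il _ (cgi T))).
      rewrite /G big_seq [leRHS]big_seq; apply: ler_sum => T /subs_size hT.
      by apply: one_dim_sup => // z; apply: dg; exact: leq_ltn_trans ss.
    apply: eq_Rintegral => t _; rewrite /G/= big_cat/= big_map -big_split/=.
    by [].
  under [leRHS]eq_Rintegral do rewrite ES.
  have M : measurable_fun setT (fun z => \int[uniform_prob (@ltr01 R)]_t G (i :: s) (x + trunc s z + t *: basis_vec i)).
    have mH : measurable_fun setT (fun p : Rd * measurableTypeR R => G (i :: s) (x + trunc s p.1 + p.2 *: basis_vec i)).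
      apply: measurableT_comp; first exact: cper_mf.
      apply: measurable_fun_rowP => j; under eq_fun do rewrite !mxE.
      apply: measurable_funD; [apply: measurable_funD; first exact: measurable_cst|].
        have := measurableT_comp (measurableT_comp (measurable_coord j) (measurable_trunc s)) (@measurable_fst _ _ Rd (measurableTypeR R)).
        by apply: eq_measurable_fun => p _ /=; rewrite mxE.
      by apply: measurable_funM; [exact: measurable_snd|exact: measurable_cst].
    have bH (p : Rd * measurableTypeR R) : 0 <= G (i :: s) (x + trunc s p.1 + p.2 *: basis_vec i) <= B.
      by rewrite sumr_ge0//=; exact: le_trans (ler_norm _) (hB _).
    by have [] := tonelli_bnd mu (uniform_prob (@ltr01 R)) mH bH.
  apply: integral_le_R => [||z]; [exact: iT| |exact: one].
  apply: (@itg_bnd _ _ _ mu B) => // z; apply: integral_abs_bnd => [|t]; last exact: hB.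
  apply: continuous_measurable_fun => t; apply: (@continuous_comp _ _ _ (fun t : R => x + trunc s z + t *: basis_vec i) (G (i :: s))); last exact: (cG _).2.
  by apply: cvgD; [exact: cvg_cst|apply: cvgZr_tmp; exact: cvg_id].
apply: le_trans (key _ (enum_uniq _)) _.
rewrite (_ : \int[mu]_z _ = \int[mu]_z G (enum 'I_d) (z + x)).
  rewrite (integral_shift x (cG _)) /G integral_sum_R// => T.
  exact/cper_itg/cper_norm.
apply: eq_Rintegral => z _; rewrite (_ : trunc _ z = z) 1?addrC//.
by apply/rowP => j; rewrite mxE mem_enum.
Qed.

Lemma is_derive_cvg (V : normedModType R) (f : V -> R) (x v : V) (l : R) :
  (forall e : R, 0 < e -> \forall t \near (0 : R), `|f (x + t *: v) - f x - t * l| <= `|t| * e) ->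
  is_derive x v f l.
Proof.
move=> h.
have H : (fun t : R => t^-1 *: ((f \o shift x) (t *: v) - f x)) @ 0^' --> l.
  apply/cvgrPdist_le => e e0; have := h e e0 => /nbhs_ballP[del /= del0 hd].
  apply/nbhs_ballP; exists del => //= t bt tn0; have := hd t bt; rewrite /= addrC => ht.
  have tp : 0 < `|t| by rewrite normr_gt0.
  rewrite -(ler_pM2l tp) -normrM; apply: le_trans ht.
  rewrite le_eqVlt -normrN; apply/orP; left; apply/eqP; congr (`|_|).
  rewrite [x + _]addrC; set a := f _ - f x.
  by rewrite -[t^-1 *: a]/(t^-1 * a) mulrBr mulVKf// opprB addrC.
split; first by apply/cvg_ex; exists l.
exact: cvg_lim.
Qed.

Lemma unif_limit_continuous (T : topologicalType) (G : nat -> T -> R) (w : T -> R) :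
  (forall n, continuous (G n)) ->
  (forall e : R, 0 < e -> exists n, forall x : T, `|G n x - w x| <= e) -> continuous w.
Proof.
move=> cG un x; apply/cvgrPdist_le => e e0; have e3 : 0 < e / 3 by rewrite divr_gt0.
have [N hN] := un _ e3; have /cvgrPdist_le/(_ _ e3) := cG N x.
apply: filterS => y hy; have h1 := hN x; have h2 := hN y.
rewrite (_ : w x - w y = (w x - G N x) + (G N x - G N y) + (G N y - w y)); last by ring.
apply: le_trans (ler_normD _ _) _; apply: le_trans (lerD (ler_normD _ _) (lexx _)) _.
by move: h1 h2 hy; rewrite distrC; move=> h1 h2 h3; clear -h1 h2 h3; lra.
Qed.

Lemma uniform_limit_C1 (F G : nat -> Rd -> R) f i :
  (forall n, cper (G n)) -> (forall n x, is_derive x (basis_vec i) (F n) (G n x)) ->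
  (forall x, F n x @[n --> \oo] --> f x) ->
  (forall e : R, 0 < e -> exists N, forall n k, (N <= n)%N -> (N <= k)%N -> forall x, `|G n x - G k x| <= e) ->
  exists2 w : Rd -> R, cper w & forall x, is_derive x (basis_vec i) f (w x).
Proof.
move=> cG FG Ff cau.
have cv x : cvgn (G ^~ x).
  apply: cauchy_cvg; apply: cauchy_exP => e e0.
  have [N hN] := cau (e / 2) (divr_gt0 e0 (ltr0Sn _ 1)).
  exists (G N x); exists N => // n /= Nn; rewrite /ball/=.
  by apply: le_lt_trans (hN N n (leqnn N) Nn x) _; rewrite ltr_pdivrMr// mulr_natr mulr2n ltrDl.
pose w x : R := limn (G ^~ x).
have wl x : G n x @[n --> \oo] --> w x by exact: cv.
have un (e : R) : 0 < e -> exists N, forall n, (N <= n)%N -> forall x, `|G n x - w x| <= e.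
  move=> e0; have [N hN] := cau e e0; exists N => n Nn x.
  have H : `|G n x - G k x| @[k --> \oo] --> `|G n x - w x|.
    by apply: cvg_norm; apply: cvgB; [exact: cvg_cst|exact: wl].
  by apply: (cvgr_to_le H); exists N => // k /= Nk; exact: hN.
have cw : cper w.
  split => [x j|x].
    rewrite /w (_ : G ^~ (x + basis_vec j) = G ^~ x)//; apply/funext => n; exact: (cG n).1.
  apply: (@unif_limit_continuous _ G w) => [n|e e0]; first exact: (cG n).2.
  by have [N hN] := un e e0; exists N; exact: hN.
exists w => // x; apply: is_derive_cvg => e e0.
have e2 : 0 < e / 2 by rewrite divr_gt0.
have cl (u : Rd -> R) : cper u -> continuous (fun t : R => u (x + t *: basis_vec i)).
  move=> cu t; apply: (@continuous_comp _ _ _ (fun t : R => x + t *: basis_vec i) u); last exact: cu.2.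
  by apply: cvgD; [exact: cvg_cst|apply: cvgZr_tmp; exact: cvg_id].
have /cvgrPdist_le/(_ _ e2)/nbhs_ballP[del /= del0 hd] := cl w cw 0.
apply/nbhs_ballP; exists del => //= t; rewrite /ball/= sub0r normrN => td.
have [N hN] := un _ e2.
have lim : `|F n (x + t *: basis_vec i) - F n x - t * w x| @[n --> \oo] --> `|f (x + t *: basis_vec i) - f x - t * w x|.
  by apply: cvg_norm; apply: cvgB; [apply: cvgB; exact: Ff|exact: cvg_cst].
apply: (cvgr_to_le lim); exists N => // n /= Nn.
(* The difference quotient of [F n] is the mean of [G n] on the segment, which is within e of [w x]
   uniformly in n. *)
have H s : is_derive (s : R) (1 : R) (fun s => F n (x + (s * t) *: basis_vec i)) (t * G n (x + (s * t) *: basis_vec i)).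
  exact: is_derive_along_line.
have cGn : continuous (fun s : R => G n (x + (s * t) *: basis_vec i)).
  move=> s; apply: (@continuous_comp _ _ _ (fun s : R => x + (s * t) *: basis_vec i) (G n)); last exact: (cG n).2.
  by apply: cvgD; [exact: cvg_cst|apply: cvgZr_tmp; apply: cvgMr_tmp; exact: cvg_id].
have := ftc_unif H (continuous_mulcst cGn); rewrite mul1r mul0r scale0r addr0 => <-.
have [B B0 hB] := cper_bnd (cG n).
have i1 := continuous_itg_unif cGn (fun s => hB (x + (s * t) *: basis_vec i)).
rewrite (integralZ_R t i1) -mulrBr normrM ler_wpM2l//.
rewrite -[X in _ - X](@integral_cst_R _ _ _ (uniform_prob (@ltr01 R)) (w x)).
rewrite -(integralB_R i1 (itg_cst _)).
apply: le_trans (integral_abs_R (itgB i1 (itg_cst _))) _.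
rewrite -[leRHS](@integral_cst_R _ _ _ (uniform_prob (@ltr01 R)) e).
apply: (integral_ae_le (itg_abs (itgB i1 (itg_cst _))) (itg_cst _)).
apply: (@filterS _ _ (ae_filter_ringOfSetsType (uniform_prob (@ltr01 R))) _ _ _ (@ae_unif_oo R)) => s /andP[s0 s1].
have h1 := hN n Nn (x + (s * t) *: basis_vec i).
have h2 : `|w x - w (x + (s * t) *: basis_vec i)| <= e / 2.
  have := hd (s * t); rewrite scale0r addr0 /ball/= sub0r normrN; apply.
  apply: le_lt_trans td; rewrite normrM ler_piMl// ger0_norm ?ltW//.
rewrite -(subrK (w (x + (s * t) *: basis_vec i)) (G n _)) -addrA.
apply: le_trans (ler_normD _ _) _; rewrite [leRHS]splitr; apply: lerD => //.
by rewrite distrC.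
Qed.

Lemma KK_L1_cauchy f : itg f -> forall e : R, 0 < e -> exists N, forall n k, (N <= n)%N -> (N <= k)%N ->
  \int[mu]_x `|KK n f x - KK k f x| <= e.
Proof.
move=> F e e0; have e2 : 0 < e / 2 by rewrite divr_gt0.
have /cvgrPdist_le/(_ _ e2)[N _ hN] := KK_L1_cvg_itg F; exists N => n k Nn Nk.
have h m : (N <= m)%N -> \int[mu]_x `|KK m f x - f x| <= e / 2.
  by move=> /hN; rewrite /= sub0r normrN ger0_norm ?integral_ge0_R.
have i1 m := itg_abs (itgB (itg_KK m F) F).
apply: (@le_trans _ _ (\int[mu]_x (`|KK n f x - f x| + `|KK k f x - f x|))).
  apply: integral_le_R => [||x]; [exact: (itg_abs (itgB (itg_KK n F) (itg_KK k F)))|exact: itgD|].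
  move: (KK n f x) (KK k f x) (f x) => a b c.
  by rewrite -[X in _ <= _ + X]normrN (_ : a - b = (a - c) + - (b - c)) ?ler_normD//; ring.
rewrite (integralD_R (i1 n) (i1 k)) [leRHS]splitr; apply: lerD; exact: h.
Qed.

Lemma weak_partial_weak_d (s : seq 'I_d) (i : 'I_d) (f v v' : Rd -> R) :
  is_weak_partial s f v -> is_weak_partial (rcons s i) f v' -> weak_d i v v'.
Proof.
move=> [_ [_ iv] h] [_ _ h'] b k.
have E : partial (rcons s i) (md b k) = partial s (partial [:: i] (md b k) : Rd -> R).
  by rewrite /partial map_rcons /iter_derive foldr_rcons.
have T : md b k = tp [:: (1, (b, k))] :> (Rd -> R).
  by apply/funext => y; rewrite /tp big_seq1 mul1r.
have C1 : Cinf (md b k : Rd -> R) by rewrite T; exact: Cinf_tp.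
have C2 : Cinf (partial [:: i] (md b k) : Rd -> R) by rewrite T partial_tp; exact: Cinf_tp.
have := h' _ C1; rewrite E (h _ C2) size_rcons exprSr -mulrA => /mulfI.
rewrite signr_eq0 => /(_ isT) e.
under eq_Rintegral do rewrite mulrC.
apply: oppr_inj; rewrite opprK -mulN1r -e.
have pE y : partial [:: i] (md b k) y = (msgn b * ang k (basis_vec i)) * md (~~ b) k y.
  by rewrite /partial /=; exact: (@derive_val _ _ _ _ _ _ _ (is_derive_md b k y (basis_vec i))).
rewrite -integralZ_R.
  by apply: eq_Rintegral => y _; rewrite pE mulrC mulrA.
exact: itg_md.
Qed.

Definition Sob (r : nat) f := forall s : seq 'I_d, (size s <= r)%N -> exists v : Rd -> R, is_weak_partial s f v.

(** The i-th derivative of f has d further weak derivatives in L^1. The convolutions of all these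
    are Cauchy in L^1, so [sup_bound] makes the convolutions of the i-th derivative uniformly
    Cauchy. *)
Lemma Sob_C1 f i : cper f -> Sob d.+1 f -> exists2 w : Rd -> R, cper w & forall x, is_derive x (basis_vec i) f (w x).
Proof.
move=> cf hf.
have [v hv] : exists v : seq 'I_d -> Rd -> R, forall s, (size s <= d.+1)%N -> is_weak_partial s f (v s).
  have /choice[v hv] : forall s : seq 'I_d, exists v : Rd -> R, (size s <= d.+1)%N -> is_weak_partial s f v.
    move=> s; have [h|h] := leqP (size s) d.+1; last by exists f.
    by have [v hv] := hf s h; exists v.
  by exists v.
have iv s : (size s <= d.+1)%N -> itg (v s) by move=> /hv[_ []].
have fv : itg f := cper_itg cf.
(* The derivative of f along i and then T. Lists grow at the head in [sup_bound] but at the tail in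
   [weak_partial_weak_d], hence the reversal; the value 0 for long lists only makes the family
   total. *)
pose V T := if (size T <= d)%N then v (i :: rev T) else fun=> 0.
have iV T : itg (V T).
  by rewrite /V; case: leqP => h; [apply: iv; rewrite /= size_rev|exact: itg_cst].
apply: (@uniform_limit_C1 (fun n => KK n f) (fun n => KK n (V [::]))).
- by move=> n; exact: cper_KK.
- move=> n x; apply: is_derive_KK => //; rewrite /V/=.
  apply: (@weak_partial_weak_d [::] i f); last exact: (hv [:: i]).
  split; [by split; [exact: cf.1|exact: fv]|by split; [exact: cf.1|exact: fv]|move=> phi _].
  by rewrite expr0 mul1r.
- by move=> x; exact: KK_unif_cvg.
move=> e e0.
pose S := subs (enum 'I_d).
have e1 : 0 < e / (size S).+1%:R by rewrite divr_gt0.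
have [N hN] : exists N : nat, forall T, T \in S -> forall n k, (N <= n)%N -> (N <= k)%N ->
    \int[mu]_x `|KK n (V T) x - KK k (V T) x| <= e / (size S).+1%:R.
  elim: S (e / _) e1 => [|T s IH] r r0; first by exists 0%N.
  have [N hN] := IH r r0; have [N' hN'] := KK_L1_cauchy (iV T) r0.
  exists (maxn N N') => T'; rewrite inE => /orP[/eqP ->|T's] n k.
    by rewrite !geq_max => /andP[_ h1] /andP[_ h2]; exact: hN'.
  by rewrite !geq_max => /andP[h1 _] /andP[h2 _]; exact: hN.
exists N => n k Nn Nk x.
apply: le_trans (@sup_bound (fun T y => KK n (V T) y - KK k (V T) y) x _ _) _.
- by move=> T; apply: cperB; exact: cper_KK.
- move=> T j Td y.
  have wd : weak_d j (V T) (V (j :: T)).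
    rewrite /V/= (ltnW Td) Td rev_cons.
    by apply: (@weak_partial_weak_d (i :: rev T) j f); apply: hv; rewrite /= ?size_rcons size_rev// ltnW.
  by apply: is_deriveB; exact: is_derive_KK.
apply: (@le_trans _ _ (\sum_(T <- S) e / (size S).+1%:R)).
  by rewrite big_seq [leRHS]big_seq; apply: ler_sum => T TS; exact: hN.
rewrite big_const_seq count_predT iter_addr_0 -[_ *+ _]mulr_natr mulrAC ler_pdivrMr//.
by rewrite ler_pM2l// ler_nat.
Qed.

End rellich.

(** * The nonlinearity *)

Record assumptions (R : realType) (d : nat) (E : set R) (h : ('rV[R]_d -> R) -> 'rV[R]_d -> R)
    (g g1 g2 V : 'rV[R]_d -> R -> R -> R) (alpha kappa1 : R) : Prop := Assumptions {
  asE : E = [set t | 0 < t] \/ E = [set t | 0 <= t];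
  asop : is_operator h;
  asV : smooth3 E V;
  asreg : h_regularity h;
  aslip : h_lipschitz h;
  asgs : g_structure E h g g1 g2;
  asV1 : V1 E h g V;
  asV2 : V2 alpha kappa1 E h g1 V;
  asV3 : V3 alpha kappa1 E V }.

Lemma measurable_fun_countable_pieces dX (X : measurableType dX) dY (Y : measurableType dY)
    (K : countType) (z : X -> K) (f : K -> X -> Y) :
  (forall k, measurable (z @^-1` [set k])) -> (forall k, measurable_fun setT (f k)) ->
  measurable_fun setT (fun x => f (z x) x).
Proof.
move=> mz mf _ B mB; rewrite setTI.
rewrite (_ : _ @^-1` B = \bigcup_(n in [set: nat]) (if @unpickle K n is Some k then z @^-1` [set k] `&` f k @^-1` B else set0)).
  apply: bigcupT_measurable => n; case: unpickle => [k|]; last exact: measurable0.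
  by apply: measurableI => //; rewrite -[X in measurable X]setTI; exact: mf.
apply/seteqP; split => [x Bx|x [n _]].
  by exists (pickle (z x)) => //; rewrite pickleK.
by case: unpickle => [k|//] [/= <-].
Qed.

Section nonlinearity.
Context {R : realType} {d : nat} {E : set R} {h : ('rV[R]_d -> R) -> 'rV[R]_d -> R}
  {g g1 g2 V : 'rV[R]_d -> R -> R -> R} {al ka : R}.
Context (A : assumptions E h g g1 g2 V al ka).
Local Notation Rd := 'rV[R]_d.
Local Notation mu := (@torus_measure R d).
Local Notation itg f := (mu.-integrable setT (EFin \o f)).
Implicit Types (m f w : Rd -> R) (x y : Rd).

Lemma E_ge0 t : E t -> 0 <= t.
Proof. by case: (asE A) => ->//= /ltW. Qed.

Lemma E_gt0 t : 0 < t -> E t.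
Proof. by case: (asE A) => ->//= /ltW. Qed.

Lemma al_gt0 : 0 < al. Proof. by have [] := asV2 A. Qed.
Lemma ka_gt0 : 0 < ka. Proof. by have [] := asV2 A. Qed.

Lemma MacE_Mac m : MacE E m -> Mac m.
Proof. by move=> [L Em]; split => //; apply: aeW => x; exact: E_ge0. Qed.

Lemma cper_h m : Mac m -> cper (h m).
Proof. by move=> M; have [] := (asop A).1 m M. Qed.

Lemma cper_MacE m : cper m -> (forall x, E (m x)) -> MacE E m.
Proof. by move=> cm Em; split => //; split; [exact: cm.1|exact: cper_itg]. Qed.

(** V is smooth only through an extension to an open neighbourhood of its domain, so continuity is
    used along families with values in E. *)
Lemma V_cvg (T : Type) (F : set_system T) {FF : Filter F} (x : T -> Rd) (t th : T -> R) x0 (t0 th0 : R) :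
  (forall s, E (t s)) -> E t0 -> x s @[s --> F] --> x0 -> t s @[s --> F] --> t0 -> th s @[s --> F] --> th0 ->
  V (x s) (t s) (th s) @[s --> F] --> V x0 t0 th0.
Proof.
move=> Et Et0 hx ht hth; have [_ [U [G [oU UE sG GV]]]] := asV A.
have U0 : U (x0, t0, th0) by apply: UE.
have [cG _] := sG [::] _ U0.
have H1 := @cvg_pair T Rd R F (nbhs x0) (nbhs t0) FF (nbhs_filter _) (nbhs_filter _) x t hx ht.
have H : (x s, t s, th s) @[s --> F] --> (x0, t0, th0).
  exact: (@cvg_pair T (Rd * R)%type R F (nbhs (x0, t0)) (nbhs th0) FF (nbhs_filter _) (nbhs_filter _) _ th H1 hth).
have -> : (fun s => V (x s) (t s) (th s)) = G \o (fun s => (x s, t s, th s)).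
  by apply/funext => s; rewrite /= (GV (x s, t s, th s))//; exact: Et.
have -> : V x0 t0 th0 = G (x0, t0, th0) by rewrite (GV (x0, t0, th0)).
exact: (cvg_comp _ _ H cG).
Qed.

Lemma V_periodic t th : E t -> periodic (fun x => V x t th).
Proof. exact: (asV A).1. Qed.

Lemma along_cper m : cper m -> (forall x, E (m x)) -> cper (along V h m).
Proof.
move=> cm Em; have ch := cper_h (MacE_Mac (cper_MacE cm Em)).
split => [x i|x]; first by rewrite /along ch.1 cm.1 (V_periodic _ (Em x)).
by apply: (@V_cvg _ (nbhs x) (nbhs_filter x) (fun y => y) m (h m)) => //; [exact: cm.2|exact: ch.2].
Qed.

Lemma along_periodic m : MacE E m -> periodic (along V h m).
Proof.
move=> M x i; have ch := cper_h (MacE_Mac M).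
by rewrite /along ch.1 (M.1.1) (V_periodic _ (M.2 x)).
Qed.

Lemma along_measurable m : MacE E m -> measurable_fun setT (along V h m).
Proof.
move=> M; have ch := cper_h (MacE_Mac M); have mm := itg_mf M.1.2.
(* The upper end of the grid cell: it is strictly positive even when m is below the first grid step,
   hence lies in E in both cases. *)
pose q n (z : int) : R := (z%:~R + 1) / n.+1%:R.
pose z n x := Num.floor (n.+1%:R * m x).
have z0 n x : 0 <= (z n x)%:~R :> R.
  rewrite ler0z /z floor_ge0 mulr_ge0//; exact: E_ge0 (M.2 x).
have Eq n (k : int) : 0 <= k%:~R :> R -> E (q n k).
  by move=> k0; apply: E_gt0; rewrite divr_gt0// ltr_wpDl.
pose f n (k : int) x := if (0 <= k%:~R :> R) then V x (q n k) (h m x) else 0.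
apply: (@measurable_fun_cvg _ _ R setT (fun n x => f n (z n x) x) (along V h m)) => [n|x _].
  apply: (@measurable_fun_countable_pieces _ _ _ _ _ (z n) (f n)) => k.
    have := mm measurableT _ (measurable_floorM (n.+1%:R) k); rewrite setTI.
    by [].
  rewrite (_ : f n k = if (0 : R) <= (k : int)%:~R then (fun x => V x (q n k) (h m x)) else fun=> 0); last first.
    by rewrite /f; apply/funext => x; case: ifP.
  case: ifPn => [k0|_]; last exact: measurable_cst.
  apply: continuous_measurable_row => x; apply: (@V_cvg _ (nbhs x) (nbhs_filter x) (fun y => y) (fun=> q n k) (h m)).
  - by move=> y; exact: Eq.
  - exact: Eq.
  - by move=> P.
  - exact: cvg_cst.
  - exact: ch.2.
rewrite /f/along; under eq_fun do rewrite z0.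
apply: V_cvg.
- by move=> n; exact: Eq.
- exact: M.2.
- exact: cvg_cst.
- rewrite /q; under eq_fun do rewrite mulrDl mul1r.
  have := cvgD (@floorM_cvg R (m x)) (@cvg_harmonic R); rewrite addr0; exact.
- exact: cvg_cst.
Qed.

Lemma along_le m x : MacE E m -> along V h m x <= ka * (1 + m x `^ al + `|h m x|).
Proof. by move=> M; apply: asV3 A _ _ _ (M.2 x). Qed.

(** (V1) bounds V below by g, (V2) bounds [g1] below by the power, and [g2] is nonnegative along
    m. *)
Lemma along_ge : exists c C : R, [/\ 0 < c, 0 <= C & forall m, MacE E m ->
  {ae mu, forall x, c * m x `^ al - C <= along V h m x}].
Proof.
have [[c1 [c2 [c3 [[c10 c20 c30] Vg _]]]] _] := asV1 A.
have [_ ka0 g1g _] := asV2 A; have [[_ _ gE _ g20] _ _ _] := asgs A.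
exists (c1 / ka), (c1 * ka + c2^-1); split => [||m M].
- by rewrite divr_gt0.
- by rewrite addr_ge0// ?mulr_ge0 ?invr_ge0// ltW.
apply: filterS (g20 m M) => x gx; have Em := M.2 x.
apply: le_trans (Vg x (m x) (h m x) Em).
rewrite gE//; have := g1g x (m x) (h m x) Em; move: gx; rewrite /along.
set a := g1 _ _ _; set b := g2 _ _ _; set t := _ `^ al => b0 ha.
have : c1 * (ka^-1 * t - ka) <= c1 * (a + b) by rewrite ler_pM2l//; lra.
lra.
Qed.

(** Compare [h m] with h at the constant density 1. *)
Lemma h_L1 : exists2 C : R, 0 <= C & forall m, MacE E m ->
  \int[mu]_x `|h m x| <= C * (1 + \int[mu]_x m x).
Proof.
have [C C0 hC] := aslip A.
have M1 : MacE E (fun _ : Rd => 1) by apply: cper_MacE; [exact: cper_cst|move=> _; exact: E_gt0].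
exists (\int[mu]_x `|h (fun=> 1) x| + C) => [|m M].
  by rewrite addr_ge0 ?integral_ge0_R// ltW.
have ih := cper_itg (cper_h (MacE_Mac M)); have i1 := cper_itg (cper_h (MacE_Mac M1)).
have im := M.1.2.
have ib := itg_abs (itgB ih i1).
have ic := itg_abs (itgB im (itg_cst 1)).
have := hC m (fun=> 1) (MacE_Mac M) (MacE_Mac M1); rewrite /Int (eint_fin ib) (eint_fin ic) -EFinM lee_fin => hle.
apply: (@le_trans _ _ (\int[mu]_x (`|h m x - h (fun=> 1) x| + `|h (fun=> 1) x|))).
  apply: integral_le_R => [||x]; [exact: itg_abs|by apply: itgD => //; exact: itg_abs|].
  by rewrite -{1}(subrK (h (fun=> 1) x) (h m x)) ler_normD.
rewrite (integralD_R ib (itg_abs i1)).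
have m0 : 0 <= \int[mu]_x m x by apply: integral_ge0_R => x; exact: E_ge0 (M.2 x).
have : \int[mu]_x `|m x - 1| <= 1 + \int[mu]_x m x.
  rewrite -{2}(@integral_cst_R _ _ _ mu 1) -(integralD_R (itg_cst 1) im).
  apply: integral_le_R => [//||x]; first by apply: itgD => //; exact: itg_cst.
  have mx := E_ge0 (M.2 x); rewrite ler_norml; apply/andP; split; lra.
have := integral_ge0_R (P := mu) (fun x => normr_ge0 (h (fun=> 1) x)).
move: hle m0; set a := \int[mu]_x _; set b := \int[mu]_x _; set c := \int[mu]_x _; set e := \int[mu]_x _.
move: (a) (b) (c) (e) => {}a {}b {}c {}e; clear -C0 => h1 m0 h2 h3.
have := ler_wpM2l (ltW C0) h3; have := mulr_ge0 h2 m0; lra.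
Qed.

Lemma along_itg m : MacE E m -> itg (fun x => m x `^ al) -> itg (along V h m).
Proof.
move=> M ia; have [c [C [c0 C0 hc]]] := along_ge.
have ih := cper_itg (cper_h (MacE_Mac M)).
apply: (@itg_aele _ _ _ mu _ (fun x => C + ka * (1 + m x `^ al + `|h m x|))).
- exact: along_measurable.
- apply: filterS (hc m M) => x hx; have := along_le x M.
  have k0 := ka_gt0; have p0 := powR_ge0 (m x) al; have n0 := normr_ge0 (h m x).
  have q0 : 0 <= ka * (1 + m x `^ al + `|h m x|) by rewrite mulr_ge0 ?addr_ge0 ?(ltW k0).
  have cp : 0 <= c * m x `^ al by rewrite mulr_ge0// ltW.
  move=> h1; rewrite ler_norml; apply/andP; split; lra.
- apply: itgD; first exact: itg_cst.
  by apply: itgZ; apply: itgD; [apply: itgD => //; exact: itg_cst|exact: itg_abs].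
Qed.

End nonlinearity.

(** * A chain rule by partial increments *)

Section chain_rule.
Context {R : realType} {W : normedModType R}.
Implicit Types (F DF : W -> R) (p v z : W).

Lemma mvt_line F DF v z (a c e : R) :
  (forall s : R, 0 <= s <= 1 -> is_derive (z + (s * a) *: v) v F (DF (z + (s * a) *: v))) ->
  (forall s : R, 0 <= s <= 1 -> `|DF (z + (s * a) *: v) - c| <= e) ->
  `|F (z + a *: v) - F z - a * c| <= `|a| * e.
Proof.
move=> dF bF.
have D (s : R) : 0 <= s <= 1 -> is_derive s (1 : R) (fun s : R => F (z + (s * a) *: v)) (a * DF (z + (s * a) *: v)).
  by move=> s01; apply: is_derive_along_line; exact: dF.
have [] := @MVT R (fun s : R => F (z + (s * a) *: v)) (fun s : R => a * DF (z + (s * a) *: v)) 0 1 ltr01.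
- move=> s; rewrite in_itv/= => /andP[s0 s1]; apply: D; by rewrite !ltW.
- apply: derivable_within_continuous => s; rewrite in_itv/= => s01.
  by have [] := D s s01.
move=> s; rewrite in_itv/= => /andP[s0 s1]; rewrite mul1r mul0r scale0r addr0 subr0 mulr1 => ->.
by rewrite -mulrBr normrM ler_wpM2l// bF// !ltW.
Qed.

(** One coordinate of the chain rule, when only directional derivatives of F are known. The base
    point [q t] moves with t, so the mean value theorem is applied near p and continuity of [DF] at
    p absorbs the displacement. *)
Lemma chain_step F DF p v (q : R -> W) (a : R -> R) (l : R) :
  (\forall z \near p, is_derive z v F (DF z)) -> {for p, continuous DF} ->
  q t @[t --> (0:R)] --> p -> is_derive (0 : R) (1 : R) a l -> a 0 = 0 ->
  is_derive (0 : R) (1 : R) (fun t => F (q t + a t *: v) - F (q t)) (DF p * l).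
Proof.
move=> dF cDF qp da a0; apply: is_derive_cvg => e e0.
pose M := `|l| + 1; pose e1 := e / 2 / M; pose e2 := Num.min 1 (e / 2 / (`|DF p| + 1)).
have M0 : 0 < M by rewrite /M ltr_wpDl.
have D0 : 0 < `|DF p| + 1 by rewrite ltr_wpDl.
have e10 : 0 < e1 by rewrite !divr_gt0.
have e20 : 0 < e2 by rewrite lt_min ltr01 !divr_gt0.
have /cvgrPdist_le/(_ _ e10) cb := cDF.
have [r /= r0 hr] := (nbhs_ballP p _).1 (filterI dF cb).
have ca : a t @[t --> (0:R)] --> (0:R).
  rewrite -[X in _ --> X]a0; apply: differentiable_continuous; apply/derivable1_diffP; by case: da.
have r2 : 0 < r / 2 by rewrite divr_gt0.
have v0 : 0 < `|v| + 1 by rewrite ltr_wpDl.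
have rv : 0 < r / 2 / (`|v| + 1) by rewrite divr_gt0.
have /cvgrPdist_lt/(_ _ r2) hq := qp.
have /cvgrPdist_lt/(_ _ rv) ha := ca.
have hd : \forall t \near (0:R), `|a t - t * l| <= `|t| * e2.
  have [d1 d2] := da.
  have H : (fun t : R => t^-1 *: ((a \o shift 0) (t *: (1:R)) - a 0)) @ 0^' --> l.
    by rewrite -d2; exact: d1.
  have /cvgrPdist_le/(_ _ e20)/nbhs_ballP[del /= del0 hdel] := H.
  apply/nbhs_ballP; exists del => //= t td.
  have [->|tn0] := eqVneq t 0; first by rewrite a0 mul0r subrr normr0 mul0r.
  have /= := hdel t td tn0; rewrite a0 subr0 addr0 /GRing.scale/= mulr1 => ht.
  rewrite (_ : a t - t * l = - (t * (l - t^-1 * a t))); last by rewrite mulrBr mulVKf// opprB.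
  by rewrite normrN normrM ler_wpM2l.
apply: filterS3 hq ha hd => t hq ha hd.
have -> : (0 : R) + t *: (1 : R) = t by rewrite add0r /GRing.scale/= mulr1.
rewrite a0 scale0r addr0 subrr subr0.
have pr (s : R) : 0 <= s <= 1 -> ball p r (q t + (s * a t) *: v).
  move=> /andP[s0 s1]; rewrite -ball_normE /ball_/= opprD addrA.
  apply: le_lt_trans (ler_normB _ _) _; rewrite [ltRHS]splitr; apply: ltr_leD => //.
  rewrite normrZ normrM; move: ha; rewrite sub0r normrN ltr_pdivlMr// => ha.
  apply: (@le_trans _ _ (`|a t| * (`|v| + 1))); last exact: ltW.
  rewrite [_ * `|a t|]mulrC -mulrA; apply: ler_pM; rewrite ?mulr_ge0//.
  by apply: le_trans (_ : `|v| <= _); [rewrite ler_piMl// ger0_norm|rewrite lerDl].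
have H := @mvt_line F DF v (q t) (a t) (DF p) e1
  (fun s s01 => (hr _ (pr s s01)).1) _.
have {}H : `|F (q t + a t *: v) - F (q t) - a t * DF p| <= `|a t| * e1.
  by apply: H => s s01; have [_] := hr _ (pr s s01); rewrite distrC.
have e21 : e2 <= 1 by rewrite /e2 ge_min lexx.
have e22 : `|DF p| * e2 <= e / 2.
  apply: (@le_trans _ _ (`|DF p| * (e / 2 / (`|DF p| + 1)))); first by rewrite ler_wpM2l// /e2 ge_min lexx orbT.
  rewrite mulrA ler_pdivrMr// mulrC ler_wpM2l// ?lerDl//; by rewrite ltW// divr_gt0.
have aM : `|a t| <= `|t| * M.
  rewrite -(subrK (t * l) (a t)); apply: le_trans (ler_normD _ _) _.
  rewrite /M normrM mulrDr addrC lerD2l; apply: le_trans hd _.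
  by rewrite ler_wpM2l.
rewrite (_ : _ - t * (DF p * l) = (F (q t + a t *: v) - F (q t) - a t * DF p) + DF p * (a t - t * l)); last by ring.
apply: le_trans (ler_normD _ _) _; rewrite (_ : `|t| * e = `|t| * (e / 2) + `|t| * (e / 2)); last by field.
apply: lerD.
  apply: le_trans H _; apply: (@le_trans _ _ (`|t| * M * e1)); first by rewrite ler_wpM2r// ltW.
  by rewrite /e1 -mulrA ler_wpM2l// mulrCA divff ?gt_eqF// mulr1.
rewrite normrM; apply: (@le_trans _ _ (`|DF p| * (`|t| * e2))); first by rewrite ler_wpM2l.
by rewrite mulrCA ler_wpM2l.
Qed.

Lemma is_derive_add3 (f1 f2 f3 : R -> R) (c t l1 l2 l3 : R) : is_derive (t : R) (1 : R) f1 l1 ->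
  is_derive (t : R) (1 : R) f2 l2 -> is_derive (t : R) (1 : R) f3 l3 ->
  is_derive (t : R) (1 : R) (fun t => f1 t + f2 t + f3 t + c) (l1 + l2 + l3).
Proof. by move=> ? ? ?; apply: is_derive_eq; rewrite addr0. Qed.

End chain_rule.

Lemma powR_cvg {R : realType} (T : Type) (F : set_system T) {FF : ProperFilter F} (a : T -> R) (l p : R) :
  0 < p -> (forall s, 0 <= a s) -> a s @[s --> F] --> l -> a s `^ p @[s --> F] --> l `^ p.
Proof.
move=> p0 a0 al; have l0 : 0 <= l.
  by apply: (cvgr_to_ge al); apply: (@filterS _ F _ setT _ _ filterT) => s _.
have [lp|] := ltP 0 l.
  have cl : {for l, continuous (fun t : R => t `^ p)}.
    by apply: differentiable_continuous; apply/derivable1_diffP; apply: derivable_powR; rewrite in_itv/= lp.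
  exact: (cvg_comp _ _ al cl).
move=> l0'; have {l0 l0'}l0 : l = 0 by apply/eqP; rewrite eq_le l0 l0'.
(* At 0 the power need not be differentiable; its monotonicity is used instead. *)
rewrite l0 powR0 ?gt_eqF//; apply/cvgrPdist_le => e e0.
have ep : 0 < e `^ p^-1 by rewrite powR_gt0.
move: al; rewrite l0 => /cvgrPdist_le/(_ _ ep); apply: filterS => s.
rewrite !sub0r !normrN !ger0_norm ?powR_ge0// => h.
have := ge0_ler_powR (ltW p0) (a0 s) (ltW ep) h; rewrite -powRrM mulVf ?gt_eqF// powRr1//.
exact: ltW.
Qed.

Section smooth_nonlinearity.
Context {R : realType} {d : nat} {E : set R} {h : ('rV[R]_d -> R) -> 'rV[R]_d -> R}
  {g g1 g2 V : 'rV[R]_d -> R -> R -> R} {al ka : R}.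
Context (A : assumptions E h g g1 g2 V al ka).
Local Notation Rd := 'rV[R]_d.
Local Notation mu := (@torus_measure R d).
Local Notation itg f := (mu.-integrable setT (EFin \o f)).
Implicit Types (m f w : Rd -> R) (x y : Rd).

Lemma derive_periodic f w (v : Rd) : periodic f -> (forall x, is_derive x v f (w x)) -> periodic w.
Proof.
move=> pf fw x i; have := @derive_val _ _ _ _ _ _ _ (fw (x + basis_vec i)) => <-.
have := @derive_val _ _ _ _ _ _ _ (fw x) => <-.
rewrite /derive (_ : (fun s => _) = (fun s => s^-1 *: ((f \o shift x) (s *: v) - f x)))//.
by apply/funext => s /=; rewrite addrA !pf.
Qed.

Lemma along_C1 m (dm dh : Rd -> R) i : cper m -> (forall x, E (m x)) -> cper dm -> cper dh ->
  (forall x, is_derive x (basis_vec i) m (dm x)) ->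
  (forall x, is_derive x (basis_vec i) (h m) (dh x)) ->
  exists2 w : Rd -> R, cper w & forall x, is_derive x (basis_vec i) (along V h m) (w x).
Proof.
move=> cm Em cdm cdh mdm hdh.
have ch := cper_h A (MacE_Mac A (cper_MacE cm Em)).
have [_ [U [F [oU UE sF FV]]]] := asV A.
pose e := basis_vec i : Rd.
pose v1 : Rd * R * R := (e, 0, 0); pose v2 : Rd * R * R := (0, 1, 0); pose v3 : Rd * R * R := (0, 0, 1).
pose P x : Rd * R * R := (x, m x, h m x).
have UP x : U (P x) by apply: UE; exact: Em.
have FP x : F (P x) = along V h m x by rewrite FV//; exact: Em.
have dF v p : U p -> is_derive p v F (iter_derive [:: v] F p).
  by move=> Up; have [_ dv] := sF [::] p Up; split; [exact: dv|].
have cF v p : U p -> {for p, continuous (iter_derive [:: v] F)}.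
  by move=> Up; have [] := sF [:: v] p Up.
have nU p : U p -> \forall z \near p, U z by move=> Up; exact: open_nbhs_nbhs.
pose D v x := iter_derive [:: v] F (P x).
pose w x := D v1 x * 1 + D v2 x * dm x + D v3 x * dh x.
have cP (T : Type) (G : set_system T) (FG : Filter G) (a : T -> Rd) (b c : T -> R) a0 b0 c0 :
    a s @[s --> G] --> a0 -> b s @[s --> G] --> b0 -> c s @[s --> G] --> c0 ->
    ((a s, b s, c s) : Rd * R * R) @[s --> G] --> ((a0, b0, c0) : Rd * R * R).
  move=> ha hb hc.
  have H1 := @cvg_pair T Rd R G (nbhs a0) (nbhs b0) FG (nbhs_filter _) (nbhs_filter _) a b ha hb.
  exact: (@cvg_pair T (Rd * R)%type R G (nbhs (a0, b0)) (nbhs c0) FG (nbhs_filter _) (nbhs_filter _) _ c H1 hc).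
have line (f df : Rd -> R) x : (forall x, is_derive x e f (df x)) ->
    is_derive (0 : R) (1 : R) (fun t => f (t *: e + x)) (df x).
  move=> fdf; have := @is_derive_along_line R _ f x e 0 (df x) 1; rewrite mul0r scale0r addr0 mul1r => H.
  have /= := H (fdf x); congr (is_derive _ _ _ _).
  by apply/funext => t; rewrite mulr1 addrC.
have dw x : is_derive x e (along V h m) (w x).
  apply: is_derive_line.
  pose mt (t : R) := m (t *: e + x); pose ht (t : R) := h m (t *: e + x).
  have dmt : is_derive (0 : R) (1 : R) mt (dm x) by exact: line.
  have dht : is_derive (0 : R) (1 : R) ht (dh x) by exact: line.
  have m0 : mt 0 = m x by rewrite /mt scale0r add0r.
  have h0 : ht 0 = h m x by rewrite /ht scale0r add0r.
  have cmt : mt t @[t --> (0:R)] --> m x.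
    by rewrite -m0; apply: differentiable_continuous; apply/derivable1_diffP; by case: dmt.
  have cht : ht t @[t --> (0:R)] --> h m x.
    by rewrite -h0; apply: differentiable_continuous; apply/derivable1_diffP; by case: dht.
  have st v : is_derive (0 : R) (1 : R) (fun t : R => t) 1 by exact: is_derive_id.
  have cx : (fun _ : R => x) t @[t --> (0:R)] --> x by exact: cvg_cst.
  have near_d v : \forall z \near P x, is_derive z v F (iter_derive [:: v] F z).
    by apply: filterS (nU _ (UP x)) => z Uz; exact: dF.
  (* The increment of V along (x, m, h) is split into three, first in x, then in m, then in h; each
     base point tends to [P x]. *)
  have S1 := @chain_step _ _ F _ (P x) v1 (fun t => (x, mt t, ht t)) (fun t => t) 1 (near_d v1) (cF v1 _ (UP x))
    (cP _ _ (nbhs_filter _) _ _ _ _ _ _ cx cmt cht) (is_derive_id _ _) erefl.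
  have da2 : is_derive (0 : R) (1 : R) (fun t => mt t - m x) (dm x).
    by apply: is_derive_eq; rewrite subr0.
  have a20 : mt 0 - m x = 0 by rewrite m0 subrr.
  have S2 := @chain_step _ _ F _ (P x) v2 (fun t => (x, m x, ht t)) (fun t => mt t - m x) (dm x) (near_d v2) (cF v2 _ (UP x))
    (cP _ _ (nbhs_filter _) _ _ _ _ _ _ cx (@cvg_cst _ _ _ _ _) cht) da2 a20.
  have da3 : is_derive (0 : R) (1 : R) (fun t => ht t - h m x) (dh x).
    by apply: is_derive_eq; rewrite subr0.
  have a30 : ht 0 - h m x = 0 by rewrite h0 subrr.
  have S3 := @chain_step _ _ F _ (P x) v3 (fun t => (x, m x, h m x)) (fun t => ht t - h m x) (dh x) (near_d v3) (cF v3 _ (UP x))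
    (cP _ _ (nbhs_filter _) _ _ _ _ _ _ cx (@cvg_cst _ _ _ _ _) (@cvg_cst _ _ _ _ _)) da3 a30.
  have {}S1 : is_derive (0 : R) (1 : R) (fun t : R => F ((x, mt t, ht t) + t *: v1) - F (x, mt t, ht t)) (D v1 x * 1) := S1.
  have := is_derive_add3 (F (P x)) S1 (S2 (nbhs_filter _)) (S3 (nbhs_filter _) (nbhs_filter _)).
  rewrite /w -/(D v1 x) -/(D v2 x) -/(D v3 x); congr (is_derive _ _ _ _).
  apply/funext => t; rewrite -FP /P -/(mt t) -/(ht t).
  have -> : (x, mt t, ht t) + t *: v1 = (t *: e + x, mt t, ht t).
    by rewrite /v1; congr (_, _, _); rewrite /= ?scaler0 ?addr0// addrC.
  have -> : (x, m x, ht t) + (mt t - m x) *: v2 = (x, mt t, ht t).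
    rewrite /v2; congr (_, _, _); rewrite /= ?scaler0 ?addr0//.
    by rewrite /GRing.scale/= mulr1 addrC subrK.
  have -> : (x, m x, h m x) + (ht t - h m x) *: v3 = (x, m x, ht t).
    rewrite /v3; congr (_, _, _); rewrite /= ?scaler0 ?addr0//.
    by rewrite /GRing.scale/= mulr1 addrC subrK.
  by ring.
exists w => //; split.
  apply: (@derive_periodic (along V h m) w e) => //; exact: (along_periodic A (cper_MacE cm Em)).
have cD v : continuous (D v).
  move=> x; have H := cP Rd (nbhs x) (nbhs_filter x) (fun y => y) m (h m) x (m x) (h m x) (fun P p => p) (cm.2 x) (ch.2 x).
  exact: (cvg_comp _ _ H (cF v (P x) (UP x))).
move=> x; rewrite /w.
apply: (@cvgD _ _ _ _ (nbhs_filter x) (fun x => D v1 x * 1 + D v2 x * dm x) (fun x => D v3 x * dh x)).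
  apply: (@cvgD _ _ _ _ (nbhs_filter x) (fun x => D v1 x * 1) (fun x => D v2 x * dm x)).
    by apply: (@cvgM _ _ _ (nbhs_filter x) (D v1) (fun=> 1)); [exact: cD|exact: cvg_cst].
  by apply: (@cvgM _ _ _ (nbhs_filter x) (D v2) dm); [exact: cD|exact: cdm.2].
by apply: (@cvgM _ _ _ (nbhs_filter x) (D v3) dh); [exact: cD|exact: cdh.2].
Qed.

Lemma cper_powR m (p : R) : cper m -> (forall x, 0 <= m x) -> 0 < p -> cper (fun x => m x `^ p).
Proof.
move=> cm m0 p0; split => [x i|x]; first by rewrite cm.1.
exact: (@powR_cvg _ _ (nbhs x) (nbhs_pfilter x) m (m x) p p0 m0 (cm.2 x)).
Qed.

(** By (V1) the integral of mV controls [c1] times that of [m g1], while the integrals of V, m, [g1]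
    and [g2] are all absorbed by (g-structure) at the cost of a small multiple of the same quantity.
    (V2) then turns [m g1] into the power. *)
Lemma energy_lower : exists c C : R, [/\ 0 < c, 0 <= C & forall m, cper m -> (forall x, E (m x)) ->
  c * \int[mu]_x m x `^ (al + 1) - C <= \int[mu]_x ((m x - 1) * along V h m x)].
Proof.
have [[c1 [c2 [c3 [[c10 c20 c30] Vg Wg]]]] _] := asV1 A.
have [_ ka0 g1g _] := asV2 A.
have [[_ _ gE gm g20] [c c0 hc2] hd _] := asgs A.
(* S is the total coefficient with which the bound [del G1 + Cd] enters, so the choice of [del] uses
   up exactly half of [c1]. *)
pose S := c2^-1 + c3 + c3 * c.
have i20 : 0 < c2^-1 by rewrite invr_gt0.
have cc0 : 0 < c3 * c by rewrite mulr_gt0.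
have S0 : 0 < S by rewrite /S !addr_gt0.
pose del := c1 / 2 / S.
have del0 : 0 < del by rewrite !divr_gt0.
have [Cd Cd0 hCd] := hd _ del0.
have ik0 : 0 < ka^-1 by rewrite invr_gt0.
have kd0 : 0 < 1 + ka * del by rewrite ltr_wpDl// mulr_gt0.
exists (c1 / 2 * (ka^-1 / (1 + ka * del))), (c1 / 2 * (ka * Cd / (1 + ka * del)) + S * Cd + c2 + c3 * c).
split.
- by rewrite !mulr_gt0// invr_gt0.
- by rewrite !addr_ge0// ?mulr_ge0 ?divr_ge0 ?mulr_ge0 ?invr_ge0 ?ltW.
move=> m cm Em; have M := cper_MacE cm Em.
have m0 x : 0 <= m x := E_ge0 A (Em x).
have cW := along_cper A cm Em; have iW := cper_itg cW; have im := cper_itg cm.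
have [B B0 hB] := cper_bnd cW; have [Bm Bm0 hBm] := cper_bnd cm.
have [mg1 mg2] := gm m M.
have gB x : along g1 h m x + along g2 h m x <= (B + c2^-1) / c1.
  rewrite ler_pdivlMr// mulrC -(gE _ _ _ (Em x)).
  have := Vg x (m x) (h m x) (Em x); have := hB x; rewrite ler_norml => /andP[_]; rewrite /along; lra.
have g1l x : ka^-1 * m x `^ al - ka <= along g1 h m x by exact: g1g.
have g1l' x : - ka <= along g1 h m x.
  by apply: le_trans (g1l x); rewrite lerBrDl subrr mulr_ge0 ?powR_ge0// ltW.
pose K := ka + (B + c2^-1) / c1.
have K1 : 0 <= (B + c2^-1) / c1 by apply: divr_ge0; [apply: addr_ge0 => //|]; exact: ltW.
have K0 : 0 <= K by rewrite /K addr_ge0// ltW.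
have ig1 : itg (along g1 h m).
  apply: (@itg_aebnd _ _ _ mu K) => //; apply: filterS (g20 m M) => x hx.
  have := gB x; have := g1l' x; rewrite /K ler_norml => h1 h2; apply/andP; split; lra.
have ig2 : itg (along g2 h m).
  apply: (@itg_aebnd _ _ _ mu K) => //; apply: filterS (g20 m M) => x hx.
  have := gB x; have := g1l' x; rewrite /K ler_norml => h1 h2; apply/andP; split; lra.
have img1 : itg (fun x => m x * along g1 h m x) by apply: (itgM_bnd (cper_mf cm) hBm).
have img2 : itg (fun x => m x * along g2 h m x) by apply: (itgM_bnd (cper_mf cm) hBm).
have imW : itg (fun x => m x * along V h m x) := cper_itg (cperM cm cW).
pose G1 := \int[mu]_x (m x * along g1 h m x); pose I1 := \int[mu]_x along g1 h m x.
pose I2 := \int[mu]_x along g2 h m x; pose Im := \int[mu]_x m x.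
pose P := \int[mu]_x m x `^ (al + 1).
have [hI1 hIm] : I1 <= del * G1 + Cd /\ Im <= del * G1 + Cd.
  have := hCd m M; rewrite /Int (eint_fin ig1) (eint_fin im) (eint_fin img1) -EFinM -EFinD.
  by rewrite ge_max !lee_fin => /andP[].
have hI2 : I2 <= c * (1 + Im).
  by have := hc2 m M; rewrite /Int (eint_fin ig2) (eint_fin im) -EFinD -EFinM lee_fin.
have hW : \int[mu]_x along V h m x <= c2 + c3 * (I1 + I2).
  have ig : itg (along g h m).
    rewrite (_ : along g h m = fun x => along g1 h m x + along g2 h m x); first exact: itgD.
    by apply/funext => x; rewrite /along gE.
  have Ig : \int[mu]_x along g h m x = I1 + I2.
    by rewrite -(integralD_R ig1 ig2); apply: eq_Rintegral => x _; rewrite /along gE.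
  by have := Wg m M; rewrite /Int (eint_fin iW) (eint_fin ig) -EFinM -EFinD lee_fin Ig.
have ip : itg (fun x => m x `^ (al + 1)).
  by apply/cper_itg/cper_powR => //; rewrite addr_gt0// (al_gt0 A).
have hG1 : ka^-1 * P - ka * Im <= G1.
  rewrite -(integralZ_R _ ip) -(integralZ_R _ im) -(integralB_R (itgZ _ ip) (itgZ _ im)).
  apply: (integral_le_R (itgB (itgZ _ ip) (itgZ _ im)) img1) => x.
  have al0 := al_gt0 A.
  rewrite (_ : m x `^ (al + 1) = m x * m x `^ al); last first.
    by rewrite addrC powRD ?powRr1//; rewrite gt_eqF ?implyFb// addr_gt0.
  have := ler_wpM2l (m0 x) (g1l x); lra.
have hmW : c1 * G1 - c2^-1 * Im <= \int[mu]_x (m x * along V h m x).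
  rewrite -(integralZ_R _ img1) -(integralZ_R _ im) -(integralB_R (itgZ _ img1) (itgZ _ im)).
  apply: (integral_ae_le (itgB (itgZ _ img1) (itgZ _ im)) imW).
  apply: filterS (g20 m M) => x hx.
  have := Vg x (m x) (h m x) (Em x); rewrite (gE _ _ _ (Em x)) => hv.
  have h2 : 0 <= c1 * (m x * along g2 h m x) by rewrite !mulr_ge0// ltW.
  have := ler_wpM2l (m0 x) hv; move: h2; rewrite /along; lra.
have -> : \int[mu]_x ((m x - 1) * along V h m x) = \int[mu]_x (m x * along V h m x) - \int[mu]_x along V h m x.
  by rewrite -(integralB_R imW iW); apply: eq_Rintegral => x _; rewrite mulrBl mul1r.
have Sdel : S * del = c1 / 2 by rewrite /del mulrCA divff ?mulr1// gt_eqF.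
rewrite -/P.
move: hI1 hIm hI2 hW hG1 hmW; move: (\int[mu]_x along V h m x) (\int[mu]_x (m x * along V h m x)) => w1 w2.
move: G1 I1 I2 Im P => G1 I1 I2 Im P hI1 hIm hI2 hW hG1 hmW.
have e1 : c2^-1 * Im <= c2^-1 * (del * G1 + Cd) by rewrite ler_pM2l.
have e2 : c3 * I1 <= c3 * (del * G1 + Cd) by rewrite ler_pM2l.
have e3 : c3 * I2 <= c3 * (c * (1 + Im)) by rewrite ler_pM2l.
have e4 : (c3 * c) * Im <= (c3 * c) * (del * G1 + Cd) by rewrite ler_pM2l.
have e5 : S * (del * G1 + Cd) = c1 / 2 * G1 + S * Cd by rewrite mulrDr mulrA Sdel.
have lo : c1 / 2 * G1 - S * Cd - c2 - c3 * c <= w2 - w1.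
  move: e5; rewrite /S; move: (c2^-1) e1 hmW => ic2 e1 hmW; lra.
have e6 : ka^-1 * P - ka * Cd <= (1 + ka * del) * G1.
  have := ler_wpM2l (ltW ka0) hIm; lra.
have e7 : c1 / 2 * (ka^-1 * P - ka * Cd) / (1 + ka * del) <= c1 / 2 * G1.
  by rewrite ler_pdivrMr// -[leRHS]mulrA ler_pM2l ?divr_gt0// [leRHS]mulrC.
apply: le_trans lo; rewrite !opprD !addrA.
rewrite !lerD2r; apply: le_trans e7.
rewrite le_eqVlt; apply/orP; left; apply/eqP; rewrite !mulrA; move: (ka^-1) (_ ^-1) => a b; ring.
Qed.

End smooth_nonlinearity.

Lemma cvg_of_sub0 {R : realType} (T : Type) (F : set_system T) {FF : Filter F} (a : T -> R) (l : R) :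
  a s - l @[s --> F] --> 0 -> a s @[s --> F] --> l.
Proof.
move=> h; rewrite -[l]add0r (_ : a = fun s => (a s - l) + l).
  by apply: cvgD => //; exact: cvg_cst.
by apply/funext => s; rewrite subrK.
Qed.

(** * Galerkin approximation *)

Section minimax.
Context {R : realType}.

(* Minimise the sum of the squares of the negative parts of [B lam] over the simplex. *)
Lemma minimax_skew (n : nat) (B : 'I_n.+1 -> 'I_n.+1 -> R) : (forall i j, 0 <= B i j + B j i) ->
  exists lam : 'I_n.+1 -> R, [/\ forall i, 0 <= lam i, \sum_i lam i = 1 &
    forall i, 0 <= \sum_j lam j * B i j].
Proof.
move=> sB.
pose S := [set l : 'I_n.+1 -> R | (forall i, 0 <= l i) /\ \sum_i l i = 1].
pose a (l : 'I_n.+1 -> R) i := \sum_j l j * B i j.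
pose f l := \sum_i (Num.max (- a l i) 0) ^+ 2.
have S0 : S (fun i => (i == ord0)%:R).
  split => [i|]; first exact: ler0n.
  by rewrite (bigD1 ord0)//= big1 ?addr0// => i /negPf ->.
have f0 l : 0 <= f l by apply: sumr_ge0 => i _; exact: sqr_ge0.
have hi : has_inf (f @` S).
  by split; [exists (f (fun i => (i == ord0)%:R)); exists (fun i => (i == ord0)%:R)|exists 0 => _ [l _ <-]].
have ex (k : nat) : exists l, S l /\ f l <= inf (f @` S) + k.+1%:R^-1.
  have [_ [l Sl <-] fl] := @inf_adherent _ (f @` S) k.+1%:R^-1 ltac:(by rewrite invr_gt0) hi.
  by exists l; split => //; exact: ltW.
have [L hL] := choice ex.
have [U UU Uoo] := ultra_eventually; have PU : ProperFilter U by exact: ultra_proper.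
have cv i : exists l : R, L k i @[k --> U] --> l.
  have [|l hl _] := @ultra_bounded_cvg R _ U (fun k => L k i) 1 UU; last by exists l.
  move=> k; have [[h0 h1] _] := hL k; rewrite ger0_norm// -h1 (bigD1 i)//= lerDl.
  by apply: sumr_ge0.
have [lam hlam] := choice cv.
have Slam : S lam.
  split => [i|].
    by apply: (cvgr_to_ge (hlam i)); apply: (@filterS _ U _ setT _ _ filterT) => k _; have [[]] := hL k.
  have H : \sum_i L k i @[k --> U] --> \sum_i lam i by apply: cvg_sumr.
  apply: (cvg_unique (@norm_hausdorff _ R^o) H).
  rewrite (_ : (fun k => _) = fun=> 1); first exact: cvg_cst.
  by apply/funext => k; have [[_ ->]] := hL k.
have ca i : a (L k) i @[k --> U] --> a lam i.
  by apply: cvg_sumr => j; apply: cvgM; [exact: hlam|exact: cvg_cst].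
have cmax (t : nat -> R) (l : R) : t k @[k --> U] --> l -> Num.max (- t k) 0 @[k --> U] --> Num.max (- l) 0.
  move=> tl; rewrite maxr_absE; under eq_fun do rewrite maxr_absE.
  apply: cvgM; last exact: cvg_cst.
  apply: cvgD; first by apply: cvgD; [exact: cvgN|exact: cvg_cst].
  by apply: cvg_norm; apply: cvgB; [exact: cvgN|exact: cvg_cst].
have cf : f (L k) @[k --> U] --> f lam.
  apply: cvg_sumr => i; rewrite /GRing.exp/=; have H := cmax _ _ (ca i).
  by apply: cvgM.
have fmin mu_ : S mu_ -> f lam <= f mu_.
  move=> Smu; apply: (@le_trans _ _ (inf (f @` S))).
    have lim : inf (f @` S) + k.+1%:R^-1 @[k --> U] --> inf (f @` S) + 0.
      by apply: cvgD; [exact: cvg_cst|exact: cvg_trans (cvg_app _ Uoo) (@cvg_harmonic R)].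
    rewrite addr0 in lim; apply: (ler_cvg_to cf lim).
    by apply: (@filterS _ U _ setT _ _ filterT) => k _; exact: (hL k).2.
  by apply: ge_inf; [exact: hi.2|exists mu_].
pose p i := Num.max (- a lam i) 0.
have p0 i : 0 <= p i by rewrite /p le_max lexx orbT.
(* First-order optimality: a step t towards [mu_] changes the objective by at most
   [- 2 t Q + t^2 D], so a positive Q would contradict minimality. *)
have key mu_ : S mu_ -> \sum_i p i * (a mu_ i - a lam i) <= 0.
  move=> [m0 m1]; have [l0 l1] := Slam.
  pose b i := a mu_ i - a lam i.
  rewrite leNgt; apply/negP => Q0; set Q := \sum_i _ in Q0.
  pose D := \sum_i b i ^+ 2; have D0 : 0 <= D by apply: sumr_ge0 => i _; exact: sqr_ge0.
  pose t := Num.min 1 (Q / (D + 1)).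
  have D1 : 0 < D + 1 by rewrite ltr_wpDl.
  have t0 : 0 < t by rewrite lt_min ltr01 divr_gt0.
  have t1 : t <= 1 by rewrite /t ge_min lexx.
  have tD : t * D < 2 * Q.
    apply: (@le_lt_trans _ _ (Q / (D + 1) * D)); first by rewrite ler_wpM2r// /t ge_min lexx orbT.
    apply: (@le_lt_trans _ _ Q); last by lra.
    by rewrite mulrAC ler_pdivrMr// ler_pM2l// lerDl.
  pose lt_ i := lam i + t * (mu_ i - lam i).
  have St : S lt_.
    split => [i|].
      rewrite /lt_ (_ : _ + _ = (1 - t) * lam i + t * mu_ i); last by ring.
      by rewrite addr_ge0// mulr_ge0// ?subr_ge0// ltW.
    by rewrite /lt_ big_split/= -mulr_sumr sumrB l1 m1 subrr mulr0 addr0.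
  have at_ i : a lt_ i = a lam i + t * b i.
    by rewrite /a/b/a -sumrB mulr_sumr -big_split/=; apply: eq_bigr => j _; rewrite /lt_; ring.
  have := fmin _ St.
  have : f lt_ <= \sum_i (p i - t * b i) ^+ 2.
    apply: ler_sum => i _; rewrite at_ -[leRHS]real_normK ?num_real// ler_sqr ?nnegrE ?le_max ?lexx ?orbT//.
    rewrite ge_max normr_ge0 andbT opprD; apply: le_trans (ler_norm _).
    by rewrite lerD2r /p le_max lexx.
  rewrite (_ : \sum_i _ = f lam - 2 * t * Q + t ^+ 2 * D); last first.
    rewrite /f /Q /D -/p !mulr_sumr -sumrN -!big_split/=; apply: eq_bigr => i _.
    by rewrite -/(p i) -/(b i); ring.
  move=> h1 h2; have : 0 <= t * (t * D - 2 * Q) by move: (le_trans h2 h1); lra.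
  by rewrite pmulr_rge0// subr_ge0 leNgt tD.
exists lam; split; [exact: Slam.1|exact: Slam.2|].
have pz : forall i, p i = 0.
  have [s0|s0] := eqVneq (\sum_i p i) 0.
    by move=> i; have /eqP := s0; rewrite psumr_eq0// => /allP/(_ i); rewrite mem_index_enum => /(_ isT)/eqP.
  have sp : 0 < \sum_i p i by rewrite lt_def s0 sumr_ge0.
  (* Compare lam with the normalised vector p of its own negative parts. The hypothesis on B makes
     the quadratic form of p nonnegative, while [p i * a lam i = - p i ^ 2]; together they force p
     to vanish. *)
  have Sp : S (fun i => p i / \sum_i p i).
    by split => [i|]; [rewrite divr_ge0// ltW|rewrite -mulr_suml divff].
  have := key _ Sp.
  have E i : p i * a lam i = - p i ^+ 2.
    rewrite /p; have [h|h] := leP (- a lam i) 0; first by rewrite mul0r expr0n oppr0.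
    by ring.
  have Q0 : 0 <= \sum_i p i * a p i.
    have : 0 <= \sum_i \sum_j p i * p j * (B i j + B j i).
      by apply: sumr_ge0 => i _; apply: sumr_ge0 => j _; rewrite !mulr_ge0.
    rewrite (_ : \sum_i _ = \sum_i p i * a p i + \sum_i p i * a p i); first lra.
    have e1 : \sum_i \sum_j p i * p j * B i j = \sum_i p i * a p i.
      by apply: eq_bigr => i _; rewrite /a mulr_sumr; apply: eq_bigr => j _; rewrite mulrA.
    have e2 : \sum_i \sum_j p i * p j * B j i = \sum_i p i * a p i.
      by rewrite exchange_big/= -e1; apply: eq_bigr => i _; apply: eq_bigr => j _; rewrite [p j * _]mulrC.
    rewrite -{1}e1 -e2 -big_split/=; apply: eq_bigr => i _; rewrite -big_split/=.
    by apply: eq_bigr => j _; rewrite mulrDr.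
  set s := \sum_i p i in s0 sp Sp *.
  have -> : \sum_i p i * (a (fun i => p i / s) i - a lam i) = s^-1 * (\sum_i p i * a p i) + \sum_i p i ^+ 2.
    rewrite mulr_sumr -big_split/=; apply: eq_bigr => i _; rewrite mulrBr E opprK; congr (_ + _).
    by rewrite /a mulrCA; congr (_ * _); rewrite mulr_sumr; apply: eq_bigr => j _; rewrite mulrAC mulrC.
  move=> h; have h2 : \sum_i p i ^+ 2 <= 0.
    by apply: le_trans h; rewrite lerDr mulr_ge0// invr_ge0 ltW.
  have /eqP : \sum_i p i ^+ 2 = 0 by apply/eqP; rewrite eq_le h2 sumr_ge0// => i _; exact: sqr_ge0.
  rewrite psumr_eq0; last by move=> i _; exact: sqr_ge0.
  move=> /allP H i; have := H i; rewrite mem_index_enum => /(_ isT).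
  by rewrite sqrf_eq0 => /eqP.
move=> i; have := pz i; rewrite /p -/(a lam i) => h.
by rewrite -oppr_le0 -h le_max lexx.
Qed.

(** Finitely many tests are met simultaneously by [minimax_skew], so the solution sets generate a
    proper filter; the limit along an ultrafilter above it meets all tests. Convexity and
    compactness of T are expressed only through the values of B. *)
Lemma vi_exists (T : Type) (x0 : T) (B : T -> T -> R) :
  (forall y z, 0 <= B y z + B z y) ->
  (forall n (y : 'I_n.+1 -> T) (lam : 'I_n.+1 -> R), (forall i, 0 <= lam i) -> \sum_i lam i = 1 ->
     exists z, forall w, B w z = \sum_j lam j * B w (y j)) ->
  (forall U : set_system T, UltraFilter U -> exists z, forall w, B w y @[y --> U] --> B w z) ->
  exists z, forall w, 0 <= B w z.
Proof.
move=> mono conv comp.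
(* Indices past the end give the default [x0], so [x0] is always among the tests; accordingly [okex]
   uses [(size s).+1] points, the last being [x0]. *)
pose ok s z := forall i : nat, 0 <= B (nth x0 s i) z.
have okcat s1 s2 z : ok (s1 ++ s2) z -> ok s1 z /\ ok s2 z.
  move=> h; split => i.
    have [i1|i1] := ltnP i (size s1); first by have := h i; rewrite nth_cat i1.
    rewrite nth_default//; have := h (size (s1 ++ s2)); by rewrite nth_default.
  by have := h (size s1 + i)%N; rewrite nth_cat ltnNge leq_addr/= addKn.
have okex s : exists z, ok s z.
  pose y (i : 'I_(size s).+1) := nth x0 s i.
  have [lam [l0 l1 lB]] := minimax_skew (fun i j => mono (y i) (y j)).
  have [z hz] := conv _ y lam l0 l1; exists z => i.
  have [i1|i1] := ltnP i (size s).+1; first by have := lB (Ordinal i1); rewrite hz.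
  rewrite nth_default; last exact: ltnW.
  by have := lB ord_max; rewrite hz /y/= nth_default.
pose F : set_system T := [set A | exists s, [set z | ok s z] `<=` A].
have FF : ProperFilter F.
  split.
    by move=> [s hs]; have [z hz] := okex s; exact: hs z hz.
  split.
  - by exists [::].
  - move=> P Q [s hs] [s' hs']; exists (s ++ s') => z /okcat[h h'].
    by split; [exact: hs|exact: hs'].
  - by move=> P Q PQ [s hs]; exists s => z /hs/PQ.
have [U [UU FU]] := ultraFilterLemma FF; have PU : ProperFilter U by exact: ultra_proper.
have [z hz] := comp U UU; exists z => w.
apply: (cvgr_to_ge (hz w)); apply: FU; exists [:: w] => y /(_ 0%N).
exact.
Qed.

End minimax.

(** * Coordinates in the Galerkin spaces *)

Section trig_spaces.
Context {R : realType} {d : nat}.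
Local Notation Rd := 'rV[R]_d.
Local Notation mu := (@torus_measure R d).
Local Notation itg f := (mu.-integrable setT (EFin \o f)).

(* [(true, 0)] stands for [sin 0 = 0]. *)
Definition mode (j : nat) : bool * 'rV[int]_d := odflt (true, 0) (unpickle j).

Definition tl p (c : nat -> R) : seq (R * (bool * 'rV[int]_d)) := [seq (c j, mode j) | j <- iota 0 p].

Definition ts p c : Rd -> R := tp (tl p c).

Definition dts p c i : Rd -> R := tp (dtp (basis_vec i) (tl p c)).

Lemma tsE p c x : ts p c x = \sum_(0 <= j < p) c j * md (mode j).1 (mode j).2 x.
Proof. by rewrite /ts /tp /tl big_map/= /index_iota subn0. Qed.

Lemma dtsE p c i x : dts p c i x = \sum_(0 <= j < p) c j * (msgn (mode j).1 * ang (mode j).2 (basis_vec i) * md (~~ (mode j).1) (mode j).2 x).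
Proof.
by rewrite /dts /tp /dtp /tl -map_comp big_map/= /index_iota subn0; apply: eq_bigr => j _ /=; rewrite [RHS]mulrA.
Qed.

Lemma cper_ts p c : cper (ts p c). Proof. exact: cper_tp. Qed.
Lemma cper_dts p c i : cper (dts p c i). Proof. exact: cper_tp. Qed.
Lemma is_derive_ts p c i x : is_derive x (basis_vec i) (ts p c) (dts p c i x).
Proof. exact: is_derive_tp. Qed.

Lemma ts_lin p (a : R) c c' x : ts p (fun j => a * c j + c' j) x = a * ts p c x + ts p c' x.
Proof. by rewrite !tsE mulr_sumr -big_split/=; apply: eq_bigr => j _; ring. Qed.

Lemma dts_lin p (a : R) c c' i x : dts p (fun j => a * c j + c' j) i x = a * dts p c i x + dts p c' i x.
Proof. by rewrite !dtsE mulr_sumr -big_split/=; apply: eq_bigr => j _; ring. Qed.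

(** These coordinates carry a polynomial given as a list into the Galerkin spaces. A mode repeated
    in the list receives the sum of its coefficients, and [wt] bounds every such sum. *)
Definition coef (a : seq (R * (bool * 'rV[int]_d))) j : R := \sum_(x <- a | pickle x.2 == j) x.1.

Definition wt (a : seq (R * (bool * 'rV[int]_d))) : R := \sum_(x <- a) `|x.1|.

Lemma coef_le a j : `|coef a j| <= wt a.
Proof.
rewrite /coef /wt; apply: le_trans (ler_norm_sum _ _ _) _.
by rewrite [leRHS](bigID (fun x => pickle x.2 == j))/= lerDl sumr_ge0.
Qed.

Lemma wt_ge0 a : 0 <= wt a. Proof. by apply: sumr_ge0. Qed.

Definition pbound (a : seq (R * (bool * 'rV[int]_d))) := (\max_(x <- a) (pickle x.2)).+1.

Lemma ts_coef a p : (pbound a <= p)%N -> ts p (coef a) = tp a.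
Proof.
move=> ap; apply/funext => x; rewrite tsE /coef /tp.
under eq_bigr do rewrite mulr_suml.
rewrite (exchange_big_dep predT)//= big_seq [RHS]big_seq; apply: eq_bigr => y ya.
have yp : (pickle y.2 < p)%N.
  by apply: leq_trans ap; rewrite ltnS; apply: (@leq_bigmax_seq _ a predT (fun x => pickle x.2)).
rewrite (big_rem (pickle y.2))/= ?mem_index_iota//.
rewrite eqxx /mode pickleK/= big_seq_cond big1 ?addr0// => j /andP[].
by rewrite mem_rem_uniq ?iota_uniq// inE => /andP[/negPf + _] /eqP e; rewrite e eqxx.
Qed.

Lemma dts_coef a p i : (pbound a <= p)%N -> dts p (coef a) i = tp (dtp (basis_vec i) a).
Proof.
move=> ap; apply/funext => x.
have h1 := is_derive_ts p (coef a) i x; rewrite (ts_coef ap) in h1.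
have h2 := is_derive_tp a x (basis_vec i).
by rewrite -(@derive_val _ _ _ _ _ _ _ h1) -(@derive_val _ _ _ _ _ _ _ h2).
Qed.

End trig_spaces.

Section galerkin.
Context {R : realType} {d : nat} {E : set R} {h : ('rV[R]_d -> R) -> 'rV[R]_d -> R}
  {g g1 g2 V : 'rV[R]_d -> R -> R -> R} {al ka : R}.
Context (A : assumptions E h g g1 g2 V al ka).
Local Notation Rd := 'rV[R]_d.
Local Notation mu := (@torus_measure R d).
Local Notation itg f := (mu.-integrable setT (EFin \o f)).
Implicit Types (m f w : Rd -> R) (x y : Rd).

(** [h (m n)] converges in L^1 by the Lipschitz property, hence a.e. only along a subsequence. The
    majorant given by (V3) and [along_ge] varies with n, but its integrals converge, so Pratt's
    lemma applies. *)
Lemma along_L1_cvg (m : nat -> Rd -> R) m0 : (forall n, MacE E (m n)) -> MacE E m0 ->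
  {ae mu, forall x, m n x @[n --> \oo] --> m0 x} ->
  \int[mu]_x `|m n x - m0 x| @[n --> \oo] --> 0 ->
  (forall n, itg (fun x => m n x `^ al)) -> itg (fun x => m0 x `^ al) ->
  \int[mu]_x m n x `^ al @[n --> \oo] --> \int[mu]_x m0 x `^ al ->
  exists s : nat -> nat, [/\ forall k, (k <= s k)%N,
    {ae mu, forall x, along V h (m (s k)) x @[k --> \oo] --> along V h m0 x} &
    \int[mu]_x `|along V h (m (s k)) x - along V h m0 x| @[k --> \oo] --> 0].
Proof.
move=> M M0 ae_m L1m ia ia0 cva.
have ch n := cper_h A (MacE_Mac A (M n)); have ch0 := cper_h A (MacE_Mac A M0).
have ih n := itg_abs (itgB (cper_itg (ch n)) (cper_itg ch0)).
have [C C0 hC] := aslip A.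
have hL n : \int[mu]_x `|h (m n) x - h m0 x| <= C * \int[mu]_x `|m n x - m0 x|.
  have := hC _ _ (MacE_Mac A (M n)) (MacE_Mac A M0).
  by rewrite /Int (eint_fin (ih n)) (eint_fin (itg_abs (itgB (M n).1.2 M0.1.2))) -EFinM lee_fin.
have hcv : \int[mu]_x `|h (m n) x - h m0 x| @[n --> \oo] --> 0.
  apply: (@squeeze_cvgr _ _ _ _ (fun=> 0) (fun n => C * \int[mu]_x `|m n x - m0 x|)); last 2 first.
  - exact: cvg_cst.
  - by rewrite -[X in _ --> X](mulr0 C); apply: cvgM; [exact: cvg_cst|exact: L1m].
  by apply: (@filterS _ _ _ setT _ _ filterT) => n _; rewrite hL integral_ge0_R.
have [s ks hs] := @ae_subseq _ _ _ mu _ ih (fun n x => normr_ge0 _) hcv.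
have aeW : {ae mu, forall x, along V h (m (s k)) x @[k --> \oo] --> along V h m0 x}.
  apply: filterS2 hs ae_m => x /norm_cvg0P hx mx.
  apply: (@V_cvg _ _ _ _ _ _ _ _ _ _ A _ _ _ (fun=> x) (fun k => m (s k) x) (fun k => h (m (s k)) x)).
  - by move=> k; exact: (M _).2.
  - exact: M0.2.
  - exact: cvg_cst.
  - exact: (cvg_comp _ _ (cvg_geid ks) mx).
  - exact: cvg_of_sub0.
exists s; split => //.
have [c [D [c0 D0 lo]]] := along_ge A.
pose G m x := D + ka * (1 + m x `^ al + `|h m x|).
have k0 := ka_gt0 A.
have iG n : itg (G (m n)).
  apply: itgD; first exact: itg_cst.
  by apply: itgZ; apply: itgD; [apply: itgD => //; exact: itg_cst|exact/itg_abs/cper_itg].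
have iG0 : itg (G m0).
  apply: itgD; first exact: itg_cst.
  by apply: itgZ; apply: itgD; [apply: itgD => //; exact: itg_cst|exact/itg_abs/cper_itg].
have IG m' : itg (fun x => m' x `^ al) -> cper (h m') ->
    \int[mu]_x G m' x = D + ka * (1 + \int[mu]_x m' x `^ al + \int[mu]_x `|h m' x|).
  move=> i1 c1; have i2 := itg_abs (cper_itg c1).
  have i3 := itgD (itg_cst 1) i1; have i4 := itgD i3 i2.
  by rewrite (integralD_R (itg_cst D) (itgZ ka i4)) (integralZ_R ka i4) (integralD_R i3 i2)
    (integralD_R (itg_cst 1) i1) !(@integral_cst_R _ _ _ mu).
have hn : \int[mu]_x `|h (m n) x| @[n --> \oo] --> \int[mu]_x `|h m0 x|.
  apply: integral_cvg_of_L1 => [n||]; [exact/itg_abs/cper_itg|exact/itg_abs/cper_itg|].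
  apply: (@squeeze_cvgr _ _ _ _ (fun=> 0) (fun n => \int[mu]_x `|h (m n) x - h m0 x|)); [|exact: cvg_cst|exact: hcv].
  apply: (@filterS _ _ _ setT _ _ filterT) => n _; rewrite integral_ge0_R//=.
  apply: integral_le_R => [||x]; [|exact: ih|exact: ler_dist_dist].
  by apply/itg_abs/itgB; exact/itg_abs/cper_itg.
apply: (@pratt _ _ _ mu (fun k => along V h (m (s k))) (fun k => G (m (s k))) _ (G m0)).
- by move=> k; exact: (along_itg A (M (s k)) (ia _)).
- exact: (along_itg A M0 ia0).
- by move=> k; exact: iG.
- exact: iG0.
- move=> k; apply: filterS (lo _ (M (s k))) => x hx; have := along_le A x (M (s k)).
  have p0 := powR_ge0 (m (s k) x) al; have n0 := normr_ge0 (h (m (s k)) x).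
  have q0 : 0 <= ka * (1 + m (s k) x `^ al + `|h (m (s k)) x|) by rewrite mulr_ge0 ?addr_ge0 ?(ltW k0).
  have cp : 0 <= c * m (s k) x `^ al by rewrite mulr_ge0// ltW.
  move=> h1; rewrite /G ler_norml; apply/andP; split; lra.
- exact: aeW.
- apply: filterS2 hs ae_m => x /norm_cvg0P hx mx.
  have hx' : h (m (s k)) x @[k --> \oo] --> h m0 x.
    exact: cvg_of_sub0.
  rewrite /G; apply: cvgD; first exact: cvg_cst.
  apply: cvgM; first exact: cvg_cst.
  apply: cvgD; last exact: cvg_norm.
  apply: cvgD; first exact: cvg_cst.
  apply: powR_cvg; first exact: (al_gt0 A).
    by move=> k; exact: E_ge0 A _ ((M _).2 x).
  exact: (cvg_comp _ _ (cvg_geid ks) mx).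
- rewrite IG//; under eq_fun do rewrite IG//.
  apply: cvgD; first exact: cvg_cst.
  apply: cvgM; first exact: cvg_cst.
  apply: cvgD; last exact: (cvg_comp _ _ (cvg_geid ks) hn).
  apply: cvgD; first exact: cvg_cst.
  exact: (cvg_comp _ _ (cvg_geid ks) cva).
Qed.

End galerkin.

(** * The finite-dimensional variational inequality *)

Section galerkin_form.
Context {R : realType} {d : nat} {E : set R} {h : ('rV[R]_d -> R) -> 'rV[R]_d -> R}
  {g g1 g2 V : 'rV[R]_d -> R -> R -> R} {al ka : R}.
Context (A : assumptions E h g g1 g2 V al ka).
Local Notation Rd := 'rV[R]_d.
Local Notation mu := (@torus_measure R d).
Local Notation itg f := (mu.-integrable setT (EFin \o f)).
Implicit Types (y z w : (nat -> R) * (nat -> R)).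
Context (p q : nat).

Definition hj z x : R :=
  - ts q z.2 x - (\sum_i dts q z.2 i x ^+ 2) / 2 + along V h (ts p z.1) x.

Definition fpi z (v : Rd -> R) (dv : 'I_d -> Rd -> R) x : R :=
  (ts p z.1 x - 1) * v x + \sum_i ts p z.1 x * dts q z.2 i x * dv i x.

(** The operator at z paired with w, the divergence being integrated by parts. It is linear in w but
    not in z. *)
Definition lform z w : R :=
  \int[mu]_x (ts p w.1 x * hj z x + fpi z (ts q w.2) (dts q w.2) x).

(** The bounds concern all indices, also those beyond p and q, so that every coordinate converges
    along an ultrafilter. *)
Definition feasible (rho rho' r : R) z :=
  [/\ forall j, `|z.1 j| <= rho, forall j, `|z.2 j| <= rho' & forall x : Rd, r <= ts p z.1 x].

Lemma cper_hj z : (forall x : Rd, E (ts p z.1 x)) -> cper (hj z).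
Proof.
move=> Ez; apply: cperD; last by apply: (along_cper A) => //; exact: cper_ts.
apply: cperB; first by rewrite (_ : (fun x => _) = fun x => 0 - ts q z.2 x); [apply: cperB; [exact: cper_cst|exact: cper_ts]|apply/funext => x; rewrite sub0r].
by apply: cperM; [apply: cper_sum => i; exact/cperX/cper_dts|exact: cper_cst].
Qed.

Lemma cper_fpi z v dv : cper v -> (forall i, cper (dv i)) -> cper (fpi z v dv).
Proof.
move=> cv cdv; apply: cperD.
  by apply: cperM => //; apply: cperB; [exact: cper_ts|exact: cper_cst].
by apply: cper_sum => i; apply: cperM => //; apply: cperM; [exact: cper_ts|exact: cper_dts].
Qed.

Lemma cper_lform z w : (forall x : Rd, E (ts p z.1 x)) ->
  cper (fun x => ts p w.1 x * hj z x + fpi z (ts q w.2) (dts q w.2) x).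
Proof.
move=> Ez; apply: cperD; first by apply: cperM; [exact: cper_ts|exact: cper_hj].
by apply: cper_fpi; [exact: cper_ts|move=> i; exact: cper_dts].
Qed.

Lemma lformE z : (forall x : Rd, E (ts p z.1 x)) -> exists al_ be_ : nat -> R, forall w,
  lform z w = \sum_(0 <= j < p) w.1 j * al_ j + \sum_(0 <= j < q) w.2 j * be_ j.
Proof.
move=> Ez; have chj := cper_hj Ez.
pose e (j : nat) : Rd -> R := @md R d (@mode d j).1 (@mode d j).2.
pose de (j : nat) (i : 'I_d) (x : Rd) : R := msgn (@mode d j).1 * ang (@mode d j).2 (basis_vec i) * md (~~ (@mode d j).1) (@mode d j).2 x.
have ce j : cper (e j) by exact: cper_md.
have cde j i : cper (de j i).
  by rewrite /de; apply: cperM; [exact: cper_cst|exact: cper_md].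
have c1 j : cper (fun x => e j x * hj z x) by exact: cperM.
have c2 j : cper (fpi z (e j) (de j)) by exact: cper_fpi.
exists (fun j => \int[mu]_x (e j x * hj z x)), (fun j => \int[mu]_x fpi z (e j) (de j) x) => w.
have E1 x : ts p w.1 x * hj z x + fpi z (ts q w.2) (dts q w.2) x =
    \sum_(0 <= j < p) w.1 j * (e j x * hj z x) + \sum_(0 <= j < q) w.2 j * fpi z (e j) (de j) x.
  congr (_ + _); first by rewrite tsE mulr_suml; apply: eq_bigr => j _; rewrite mulrA.
  rewrite /fpi; set M := ts p z.1 x; rewrite tsE mulr_sumr.
  under [X in _ + X]eq_bigr => i _ do rewrite [dts q w.2 i x]dtsE mulr_sumr.
  rewrite exchange_big/= -big_split/=; apply: eq_bigr => j _.
  rewrite mulrDr mulr_sumr; congr (_ + _); first by rewrite mulrCA.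
  by apply: eq_bigr => i _; rewrite mulrCA.
rewrite /lform; under eq_Rintegral do rewrite E1.
have i1 : itg (fun x => \sum_(0 <= j < p) w.1 j * (e j x * hj z x)).
  by apply: itg_sum => j; exact/itgZ/cper_itg.
have i2 : itg (fun x => \sum_(0 <= j < q) w.2 j * fpi z (e j) (de j) x).
  by apply: itg_sum => j; exact/itgZ/cper_itg.
rewrite (integralD_R i1 i2); congr (_ + _).
  rewrite integral_sum_R; last by move=> j; exact/itgZ/cper_itg.
  by apply: eq_bigr => j _; rewrite integralZ_R//; exact: cper_itg.
rewrite integral_sum_R; last by move=> j; exact/itgZ/cper_itg.
by apply: eq_bigr => j _; rewrite integralZ_R//; exact: cper_itg.
Qed.

(** The sum equals the monotone expression of (V1) plus the integral of [(m_y + m_z) / 2] times the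
    squared distance of the two gradients. *)
Lemma lform_monotone y z : (forall x : Rd, E (ts p y.1 x)) -> (forall x : Rd, E (ts p z.1 x)) ->
  0 <= (lform y y - lform y z) + (lform z z - lform z y).
Proof.
move=> Ey Ez.
have I u w (Eu : forall x : Rd, E (ts p u.1 x)) := cper_itg (cper_lform w Eu).
rewrite /lform -(integralB_R (I _ y Ey) (I _ z Ey)) -(integralB_R (I _ z Ez) (I _ y Ez)).
rewrite -(integralD_R (itgB (I _ y Ey) (I _ z Ey)) (itgB (I _ z Ez) (I _ y Ez))).
have [_ mono] := asV1 A.
have cW u (Eu : forall x : Rd, E (ts p u.1 x)) := along_cper A (cper_ts p u.1) Eu.
apply: le_trans (mono _ _ (_ : CinfE E (ts p y.1)) (_ : CinfE E (ts p z.1))) _.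
- by split => //; exact: Cinf_tp.
- by split => //; exact: Cinf_tp.
apply: integral_le_R => [||x].
- by apply/cper_itg/cperM; apply: cperB; (exact: cper_ts || exact: cW).
- by apply: itgD; apply: itgB; exact: I.
have -> : (ts p y.1 x * hj y x + fpi y (ts q y.2) (dts q y.2) x - (ts p z.1 x * hj y x + fpi y (ts q z.2) (dts q z.2) x)) +
   (ts p z.1 x * hj z x + fpi z (ts q z.2) (dts q z.2) x - (ts p y.1 x * hj z x + fpi z (ts q y.2) (dts q y.2) x)) =
  (along V h (ts p y.1) x - along V h (ts p z.1) x) * (ts p y.1 x - ts p z.1 x) +
  \sum_i (ts p y.1 x + ts p z.1 x) / 2 * (dts q y.2 i x - dts q z.2 i x) ^+ 2.
  rewrite /fpi /hj.
  set my := ts p y.1 x; set mz := ts p z.1 x; set uy := ts q y.2 x; set uz := ts q z.2 x.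
  set wy := along _ _ _ _; set wz := along _ _ _ _.
  have -> : \sum_i (my + mz) / 2 * (dts q y.2 i x - dts q z.2 i x) ^+ 2 =
     (mz - my) / 2 * (\sum_i dts q y.2 i x ^+ 2) + (my - mz) / 2 * (\sum_i dts q z.2 i x ^+ 2) +
     (\sum_i my * dts q y.2 i x * dts q y.2 i x - \sum_i my * dts q y.2 i x * dts q z.2 i x) +
     (\sum_i mz * dts q z.2 i x * dts q z.2 i x - \sum_i mz * dts q z.2 i x * dts q y.2 i x).
    rewrite !mulr_sumr -!sumrB -!big_split/=; apply: eq_bigr => i _; by field.
  by field.
rewrite lerDl; apply: sumr_ge0 => i _; rewrite mulr_ge0 ?sqr_ge0// divr_ge0// addr_ge0//.
  exact: E_ge0 A _ (Ey x).
exact: E_ge0 A _ (Ez x).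
Qed.

Lemma ts_cvg (T : Type) (F : set_system T) (FF : Filter F) (n : nat) (c : T -> nat -> R) (c0 : nat -> R) (x : Rd) :
  (forall j, c s j @[s --> F] --> c0 j) -> ts n (c s) x @[s --> F] --> ts n c0 x.
Proof.
move=> hc; rewrite tsE; under eq_fun do rewrite tsE.
by apply: cvg_sumr => j; apply: cvgM; [exact: hc|exact: cvg_cst].
Qed.

(** In Minty's form the unknown z occurs only in the linear argument, so convex combinations and
    coordinatewise limits pass through finite sums. *)
Lemma galerkin_minty (rho rho' r : R) z0 : 0 < r -> feasible rho rho' r z0 ->
  exists z, feasible rho rho' r z /\ forall y, feasible rho rho' r y -> lform y z <= lform y y.
Proof.
move=> r0 fz0.
have Ef y : feasible rho rho' r y -> forall x : Rd, E (ts p y.1 x).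
  by move=> [_ _ h3] x; apply: (E_gt0 A); exact: lt_le_trans (h3 x).
pose T := {y | feasible rho rho' r y}.
pose B (y z : T) := lform (proj1_sig y) (proj1_sig y) - lform (proj1_sig y) (proj1_sig z).
have [|||[z fz] hz] := @vi_exists R T (exist _ z0 fz0) B.
- by move=> y z; exact: lform_monotone (Ef _ (proj2_sig y)) (Ef _ (proj2_sig z)).
- move=> n y lam l0 l1.
  pose z : (nat -> R) * (nat -> R) := (fun j => \sum_i lam i * (proj1_sig (y i)).1 j, fun j => \sum_i lam i * (proj1_sig (y i)).2 j).
  have tsz x : ts p z.1 x = \sum_i lam i * ts p (proj1_sig (y i)).1 x.
    rewrite tsE /=; under eq_bigr do rewrite mulr_suml.
    rewrite exchange_big/=; apply: eq_bigr => i _; rewrite tsE mulr_sumr.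
    by apply: eq_bigr => j _; rewrite mulrA.
  have bz (u : 'I_n.+1 -> R) (b : R) : (forall i, `|u i| <= b) -> `|\sum_i lam i * u i| <= b.
    move=> ub; apply: le_trans (ler_norm_sum _ _ _) _; rewrite -[leRHS]mul1r -l1 mulr_suml.
    by apply: ler_sum => i _; rewrite normrM ger0_norm// ler_wpM2l.
  have fz : feasible rho rho' r z.
    split => [j|j|x].
    - by apply: bz => i; have [] := proj2_sig (y i).
    - by apply: bz => i; have [] := proj2_sig (y i).
    - rewrite tsz -[leLHS]mul1r -l1 mulr_suml; apply: ler_sum => i _; rewrite ler_wpM2l//.
      by have [] := proj2_sig (y i).
  exists (exist _ z fz) => w; rewrite /B/=.
  have [a_ [b_ hab]] := lformE (Ef _ (proj2_sig w)).
  have -> : \sum_j lam j * (lform (proj1_sig w) (proj1_sig w) - lform (proj1_sig w) (proj1_sig (y j))) =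
     lform (proj1_sig w) (proj1_sig w) - \sum_j lam j * lform (proj1_sig w) (proj1_sig (y j)).
    by under eq_bigr do rewrite mulrBr; rewrite sumrB -mulr_suml l1 mul1r.
  congr (_ - _); rewrite hab; under [RHS]eq_bigr do rewrite hab mulrDr !mulr_sumr.
  rewrite big_split/=; congr (_ + _); rewrite exchange_big/=; apply: eq_bigr => j _.
    by rewrite mulr_suml; apply: eq_bigr => i _; rewrite mulrA.
  by rewrite mulr_suml; apply: eq_bigr => i _; rewrite mulrA.
- move=> U UU; have PU : ProperFilter U by exact: ultra_proper.
  have c1 j : exists l : R, (proj1_sig y).1 j @[y --> U] --> l /\ `|l| <= rho.
    have [|l hl1 hl2] := @ultra_bounded_cvg R _ U (fun y : T => (proj1_sig y).1 j) rho UU; last by exists l.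
    by move=> y; have [] := proj2_sig y.
  have c2 j : exists l : R, (proj1_sig y).2 j @[y --> U] --> l /\ `|l| <= rho'.
    have [|l hl1 hl2] := @ultra_bounded_cvg R _ U (fun y : T => (proj1_sig y).2 j) rho' UU; last by exists l.
    by move=> y; have [] := proj2_sig y.
  have [l1 hl1] := choice c1; have [l2 hl2] := choice c2.
  have fz : feasible rho rho' r (l1, l2).
    split => [j|j|x]; [exact: (hl1 j).2|exact: (hl2 j).2|].
    have H : ts p (proj1_sig s).1 x @[s --> U] --> ts p l1 x by apply: ts_cvg => j; exact: (hl1 j).1.
    by apply: (cvgr_to_ge H); apply: (@filterS _ U _ setT _ _ filterT) => y _; have [] := proj2_sig y.
  exists (exist _ (l1, l2) fz) => w; rewrite /B/=.
  apply: cvgB; first exact: cvg_cst.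
  have [a_ [b_ hab]] := lformE (Ef _ (proj2_sig w)).
  rewrite hab; under eq_fun do rewrite hab.
  apply: cvgD; apply: cvg_sumr => j; apply: cvgM; try exact: cvg_cst.
    exact: (hl1 j).1.
  exact: (hl2 j).1.
exists z; split => // y fy.
by have := hz (exist _ y fy); rewrite /B/= subr_ge0.
Qed.

Lemma integral_quadratic_cvg (a b c : Rd -> R) : cper a -> cper b -> cper c ->
  \int[mu]_x (a x + n.+1%:R^-1 * b x + n.+1%:R^-1 ^+ 2 * c x) @[n --> \oo] --> \int[mu]_x a x.
Proof.
move=> /cper_itg ia /cper_itg ib /cper_itg ic.
rewrite (_ : (fun n => _) = (fun n : nat => \int[mu]_x a x + n.+1%:R^-1 * \int[mu]_x b x + n.+1%:R^-1 ^+ 2 * \int[mu]_x c x)); last first.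
  apply/funext => n; rewrite (integralD_R (itgD ia (itgZ _ ib)) (itgZ _ ic)) (integralD_R ia (itgZ _ ib)).
  by rewrite (integralZ_R _ ib) (integralZ_R _ ic).
rewrite -[X in _ --> X]addr0; apply: cvgD.
  rewrite -[X in _ --> X]addr0; apply: cvgD; first exact: cvg_cst.
  rewrite -[X in _ --> X](mul0r (\int[mu]_x b x)); apply: cvgM; [exact: cvg_harmonic|exact: cvg_cst].
rewrite -[X in _ --> X](mul0r (\int[mu]_x c x)); apply: cvgM; last exact: cvg_cst.
rewrite -[X in _ --> X](mul0r (0 : R)); under eq_fun do rewrite expr2.
by apply: cvgM; exact: cvg_harmonic.
Qed.

(** Along a segment every term except V is a polynomial of degree at most 2 in the parameter. V is
    treated by [along_L1_cvg], whence the subsequence. *)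
Lemma lform_hemicontinuous y z (t := fun n : nat => n.+1%:R^-1 : R)
    (zn := fun n => ((fun j => t n * (y.1 j + -1 * z.1 j) + z.1 j, fun j => t n * (y.2 j + -1 * z.2 j) + z.2 j) : (nat -> R) * (nat -> R))) :
  (forall n (x : Rd), E (ts p (zn n).1 x)) -> (forall x : Rd, E (ts p z.1 x)) ->
  exists s : nat -> nat, forall w, lform (zn (s k)) w @[k --> \oo] --> lform z w.
Proof.
move=> En Ez.
pose d1 j := y.1 j + -1 * z.1 j; pose d2 j := y.2 j + -1 * z.2 j.
pose M (n : nat) : Rd -> R := ts p (zn n).1; pose M0 : Rd -> R := ts p z.1; pose dM : Rd -> R := ts p d1.
have ME n x : M n x = t n * dM x + M0 x by rewrite /M /zn ts_lin.
have cM n : cper (M n) by exact: cper_ts.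
have cM0 : cper M0 by exact: cper_ts.
have [B1 B10 hB1] := cper_bnd (cper_ts p d1 : cper dM); have [B2 B20 hB2] := cper_bnd cM0.
have t1 n : 0 <= t n <= 1 by rewrite invr_ge0 ler0n/= invf_le1// ler1n.
have tc : t n @[n --> \oo] --> 0 by exact: cvg_harmonic.
have Mx x : M n x @[n --> \oo] --> M0 x.
  apply: cvg_of_sub0; rewrite (_ : (fun n => _) = fun n => t n * dM x); last by apply/funext => n; rewrite ME addrK.
  by rewrite -(mul0r (dM x)); apply: cvgM => //; exact: cvg_cst.
have Mn0 n x : 0 <= M n x by exact: E_ge0 A _ (En n x).
have Mb n x : M n x <= B1 + B2.
  rewrite ME; apply: le_trans (ler_norm _) _; apply: le_trans (ler_normD _ _) _; apply: lerD => //.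
  have /andP[h0 h1] := t1 n; rewrite normrM ger0_norm//; apply: le_trans (hB1 x).
  by rewrite ler_piMl.
have al0 := al_gt0 A.
have ia n : itg (fun x => M n x `^ al) by apply/cper_itg/cper_powR.
have ia0 : itg (fun x => M0 x `^ al).
  by apply/cper_itg/cper_powR => // x; exact: E_ge0 A _ (Ez x).
have [|||||s [ks _ L1W]] := along_L1_cvg A (fun n => cper_MacE (cM n) (En n)) (cper_MacE cM0 Ez).
- exact: aeW.
- apply: (dct_bnd (B := B1 + B2)).
  + by move=> n; exact: cper_mf.
  + exact: cper_mf.
  + by move=> n x; rewrite ger0_norm.
  + exact: aeW.
- exact: ia.
- exact: ia0.
- apply: integral_cvg_of_L1 => //.
  apply: (dct_bnd (B := (B1 + B2) `^ al)).
  + by move=> n; exact: (itg_mf (ia n)).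
  + exact: (itg_mf ia0).
  + move=> n x; rewrite ger0_norm ?powR_ge0//; apply: ge0_ler_powR => //; rewrite ?nnegrE ?addr_ge0//.
    exact: ltW.
  + by apply: aeW => x; apply: powR_cvg.
exists s => w.
pose u0 : Rd -> R := ts q z.2; pose du : Rd -> R := ts q d2.
pose g0 i : Rd -> R := dts q z.2 i; pose dg i : Rd -> R := dts q d2 i.
pose mw : Rd -> R := ts p w.1; pose uw : Rd -> R := ts q w.2; pose gw i : Rd -> R := dts q w.2 i.
pose a x := mw x * hj z x + fpi z uw gw x.
pose b x := - 1 * (mw x * du x) + dM x * uw x + \sum_i (- 1 * (mw x * g0 i x * dg i x) + (dM x * g0 i x + M0 x * dg i x) * gw i x).
pose c x := \sum_i (- 2^-1 * (mw x * dg i x ^+ 2) + dM x * dg i x * gw i x).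
have ca : cper a := cper_lform w Ez.
have cmw : cper mw by exact: cper_ts.
have [cdu cdM cuw] : [/\ cper du, cper dM & cper uw] by split; exact: cper_ts.
have cg0 i : cper (g0 i) by exact: cper_dts.
have cdg i : cper (dg i) by exact: cper_dts.
have cgw i : cper (gw i) by exact: cper_dts.
have cm1 := cperM; have cd1 := cperD; have cc1 := @cper_cst R d.
have cb : cper b.
  apply: cperD; first by apply: cperD; [apply: cperM => //; exact: cperM|exact: cperM].
  apply: cper_sum => i; apply: cperD; first by apply: cperM => //; apply: cperM => //; exact: cperM.
  by apply: cperM => //; apply: cperD; exact: cperM.
have cc : cper c.
  apply: cper_sum => i; apply: cperD; first by apply: cperM => //; apply: cperM => //; exact: cperX.
  by apply: cperM => //; exact: cperM.
have cW n := along_cper A (cM n) (En n); have cW0 := along_cper A cM0 Ez.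
have E1 n x : mw x * hj (zn n) x + fpi (zn n) uw gw x =
    (a x + t n * b x + t n ^+ 2 * c x) + mw x * (along V h (M n) x - along V h M0 x).
  rewrite /a /hj /fpi -/(M n) -/(M n x) -/M0 -/(M0 x) /b /c ME.
  have -> : ts q (zn n).2 x = t n * du x + u0 x by rewrite /zn ts_lin.
  rewrite -/(u0 x).
  have sq : \sum_i dts q (zn n).2 i x ^+ 2 = \sum_i g0 i x ^+ 2 + 2 * t n * (\sum_i g0 i x * dg i x) + t n ^+ 2 * \sum_i dg i x ^+ 2.
    rewrite !mulr_sumr -!big_split/=; apply: eq_bigr => i _; rewrite /zn dts_lin -/(dg i x) -/(g0 i x); ring.
  have s2 (X Y : R) : \sum_i (t n * X + Y) * dts q (zn n).2 i x * gw i x =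
      \sum_i Y * g0 i x * gw i x + t n * (\sum_i (X * g0 i x + Y * dg i x) * gw i x) + t n ^+ 2 * \sum_i X * dg i x * gw i x.
    rewrite !mulr_sumr -!big_split/=; apply: eq_bigr => i _; rewrite /zn dts_lin -/(dg i x) -/(g0 i x); ring.
  rewrite sq (s2 (dM x) (M0 x)) !big_split/= -!mulr_sumr.
  have -> : \sum_i mw x * g0 i x * dg i x = mw x * \sum_i g0 i x * dg i x.
    by rewrite mulr_sumr; apply: eq_bigr => i _; rewrite mulrA.
  by field.
have iq n := itgD (itgD (cper_itg ca) (itgZ (t n) (cper_itg cb))) (itgZ (t n ^+ 2) (cper_itg cc)).
have iD n := cper_itg (cperM cmw (cperB (cW n) cW0)).
have E2 n : lform (zn n) w = \int[mu]_x (a x + t n * b x + t n ^+ 2 * c x) + \int[mu]_x (mw x * (along V h (M n) x - along V h M0 x)).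
  by rewrite -(integralD_R (iq n) (iD n)); apply: eq_Rintegral => x _; rewrite -E1.
rewrite (_ : (fun k => _) = fun k => \int[mu]_x (a x + t (s k) * b x + t (s k) ^+ 2 * c x) +
    \int[mu]_x (mw x * (along V h (M (s k)) x - along V h M0 x))); last by apply/funext => k; rewrite E2.
rewrite -[X in _ --> X]addr0; apply: cvgD.
  exact: (cvg_comp _ _ (cvg_geid ks) (integral_quadratic_cvg ca cb cc)).
have [Bw Bw0 hBw] := cper_bnd cmw.
apply/norm_cvg0P; apply: (@squeeze_cvgr _ _ _ _ (fun=> 0) (fun k => Bw * \int[mu]_x `|along V h (M (s k)) x - along V h M0 x|)); last 2 first.
- exact: cvg_cst.
- by rewrite -[X in _ --> X](mulr0 Bw); apply: cvgM; [exact: cvg_cst|exact: L1W].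
apply: (@filterS _ _ _ setT _ _ filterT) => k _; rewrite normr_ge0/=.
apply: le_trans (integral_abs_R (iD _)) _.
have iA := itg_abs (itgB (cper_itg (cW (s k))) (cper_itg cW0)).
rewrite -(integralZ_R Bw iA); apply: integral_le_R => [||x]; [exact/itg_abs/iD|exact: itgZ|].
by rewrite normrM ler_wpM2r.
Qed.

Lemma galerkin_solution (rho rho' r : R) z0 : 0 < r -> feasible rho rho' r z0 ->
  exists z, feasible rho rho' r z /\ forall y, feasible rho rho' r y -> lform z z <= lform z y.
Proof.
move=> r0 fz0; have [z [fz hz]] := galerkin_minty r0 fz0; exists z; split => // y fy.
have Ef u : feasible rho rho' r u -> forall x : Rd, E (ts p u.1 x).
  by move=> [_ _ h3] x; apply: (E_gt0 A); exact: lt_le_trans (h3 x).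
pose t (n : nat) : R := n.+1%:R^-1.
pose zn n : (nat -> R) * (nat -> R) := (fun j => t n * (y.1 j + -1 * z.1 j) + z.1 j, fun j => t n * (y.2 j + -1 * z.2 j) + z.2 j).
have t1 n : 0 <= t n <= 1 by rewrite invr_ge0 ler0n/= invf_le1// ler1n.
have t0 n : 0 < t n by rewrite invr_gt0.
have bnd n (a b c : R) : `|a| <= c -> `|b| <= c -> `|t n * (a + -1 * b) + b| <= c.
  have /andP[h0 h1] := t1 n; rewrite !ler_norml => /andP[a1 a2] /andP[b1 b2].
  have := ler_wpM2l h0 a1; have := ler_wpM2l h0 a2.
  have h2 : 0 <= 1 - t n by rewrite subr_ge0.
  have := ler_wpM2l h2 b1; have := ler_wpM2l h2 b2.
  move=> q1 q2 q3 q4; apply/andP; split; lra.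
have fn n : feasible rho rho' r (zn n).
  have [fz1 fz2 fz3] := fz; have [fy1 fy2 fy3] := fy; split => [j|j|x]; [exact: bnd|exact: bnd|].
  rewrite /zn ts_lin /= (_ : ts p (fun j => y.1 j + -1 * z.1 j) x = ts p y.1 x - ts p z.1 x); last first.
    rewrite (_ : (fun j => _) = fun j => -1 * z.1 j + y.1 j); last by apply/funext => j; rewrite addrC.
    by rewrite ts_lin; ring.
  have /andP[h0 h1] := t1 n; have h2 : 0 <= 1 - t n by rewrite subr_ge0.
  have := ler_wpM2l h0 (fy3 x); have := ler_wpM2l h2 (fz3 x); lra.
have [s hs] := @lform_hemicontinuous y z (fun n => Ef _ (fn n)) (Ef _ fz).
apply: (ler_cvg_to (hs z) (hs y)); apply: (@filterS _ _ _ setT _ _ filterT) => k _.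
have := hz _ (fn (s k)); have [a_ [b_ hab]] := lformE (Ef _ (fn (s k))).
(* By linearity in the second argument the inequality at [zn] becomes t times a difference; divide
   by t before letting it tend to 0. *)
have -> : lform (zn (s k)) (zn (s k)) = lform (zn (s k)) z + t (s k) * (lform (zn (s k)) y - lform (zn (s k)) z).
  have alg (a b c d0 e0 : R) : a + b + c * (d0 + e0 - (a + b)) = (a + c * (d0 - a)) + (b + c * (e0 - b)) by ring.
  rewrite !hab alg.
  by congr (_ + _); rewrite -sumrB mulr_sumr -big_split/=; apply: eq_bigr => j _; ring.
by rewrite lerDl pmulr_rge0// subr_ge0.
Qed.

End galerkin_form.

(** * A priori estimates *)

Section level.
Context {R : realType} {d : nat} {E : set R} {h : ('rV[R]_d -> R) -> 'rV[R]_d -> R}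
  {g g1 g2 V : 'rV[R]_d -> R -> R -> R} {al ka : R}.
Context (A : assumptions E h g g1 g2 V al ka).
Local Notation Rd := 'rV[R]_d.
Local Notation mu := (@torus_measure R d).
Local Notation itg f := (mu.-integrable setT (EFin \o f)).
Implicit Types (a b : seq (R * (bool * 'rV[int]_d))) (y z w : (nat -> R) * (nat -> R)) (x : Rd).

Definition gsol p q rho rho' r z := @feasible R d p rho rho' r z /\
  forall y, @feasible R d p rho rho' r y -> @lform R d h V p q z z <= @lform R d h V p q z y.

Definition sqd q z x := \sum_i dts q z.2 i x ^+ 2.

Definition cl (t : R) : seq (R * (bool * 'rV[int]_d)) := [:: (t, (false, 0))].
Definition pone : nat := pbound (cl 1).

Lemma tp_cl t x : tp (cl t) x = t.
Proof. by rewrite /tp /cl big_seq1 md_cos0 mulr1. Qed.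

Lemma pbound_cl t : pbound (cl t) = pone.
Proof. by rewrite /pone /pbound /cl !big_seq1. Qed.

Lemma wt_cl t : wt (cl t) = `|t|.
Proof. by rewrite /wt big_seq1. Qed.

Context (p q : nat) (rho rho' r : R) (z : (nat -> R) * (nat -> R)).
Context (r0 : 0 < r) (rho0 : 0 <= rho) (rho0' : 0 <= rho') (pp : (pone <= p)%N)
  (S : gsol p q rho rho' r z).

Let m : Rd -> R := ts p z.1.
Let u : Rd -> R := ts q z.2.
Let G i : Rd -> R := dts q z.2 i.
Let W : Rd -> R := along V h m.
Let HJz : Rd -> R := @hj R d h V p q z.
Let Sq : Rd -> R := sqd q z.

Lemma lev_r x : r <= m x. Proof. by have [[_ _ +] _] := S; apply. Qed.
Lemma lev_gt0 x : 0 < m x. Proof. exact: lt_le_trans (lev_r x). Qed.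
Lemma lev_E x : E (m x). Proof. exact: (E_gt0 A (lev_gt0 x)). Qed.
Lemma lev_cm : cper m. Proof. exact: cper_ts. Qed.
Lemma lev_cu : cper u. Proof. exact: cper_ts. Qed.
Lemma lev_cG i : cper (G i). Proof. exact: cper_dts. Qed.
Lemma lev_cW : cper W. Proof. exact: (along_cper A lev_cm lev_E). Qed.
Lemma lev_cS : cper Sq. Proof. by apply: cper_sum => i; exact/cperX/cper_dts. Qed.
Lemma lev_chj : cper HJz. Proof. exact: (cper_hj A q lev_E). Qed.

Lemma lev_hjE x : HJz x = - u x - Sq x / 2 + W x. Proof. by []. Qed.

Lemma lev_test a b : (pbound a <= p)%N -> (pbound b <= q)%N ->
  (forall j, `|coef a j| <= rho) -> (forall j, `|coef b j| <= rho') -> (forall x, r <= tp a x) ->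
  @lform R d h V p q z z <= \int[mu]_x (tp a x * HJz x + fpi p q z (tp b) (fun i => tp (dtp (basis_vec i) b)) x).
Proof.
move=> pa qb ca cb ra; have [_ St] := S.
have := St (coef a, coef b); rewrite /lform/= (ts_coef pa) (ts_coef qb).
rewrite (_ : dts q (coef b) = fun i => tp (dtp (basis_vec i) b)); last by apply/funext => i; rewrite (dts_coef _ qb).
by apply; split => //= x; rewrite (ts_coef pa).
Qed.

Lemma lev_test0 a : (pbound a <= p)%N -> (forall j, `|coef a j| <= rho) -> (forall x, r <= tp a x) ->
  @lform R d h V p q z z <= \int[mu]_x (tp a x * HJz x).
Proof.
move=> pa ca ra; have [_ St] := S.
have -> : \int[mu]_x (tp a x * HJz x) = @lform R d h V p q z (coef a, fun=> 0).
  apply: eq_Rintegral => x _; rewrite /= (ts_coef pa) /fpi.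
  rewrite [ts q _ x]tsE [\sum_(0 <= j < q) _]big1 ?mulr0 ?add0r; last by move=> j _; rewrite mul0r.
  rewrite [\sum_i _]big1 ?addr0// => i _; rewrite [dts q (fun=> 0) i x]dtsE big1 ?mulr0// => j _; by rewrite mul0r.
by apply: St; split => //= [j|x]; [rewrite normr0|rewrite (ts_coef pa)].
Qed.

(** The value of the form at z minus its value at the test (1, 0). Optimality makes it nonpositive
    when that test is feasible, and a lower bound for it controls the residuals of both
    equations. *)
Definition Q0 : R := \int[mu]_x ((m x - 1) * W x) + 2^-1 * \int[mu]_x (m x * Sq x) + 2^-1 * \int[mu]_x Sq x.

Lemma lev_lform : @lform R d h V p q z z = \int[mu]_x (m x * W x) + 2^-1 * \int[mu]_x (m x * Sq x) - \int[mu]_x u x.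
Proof.
have i1 := cper_itg (cperM lev_cm lev_cW); have i2 := cper_itg (cperM lev_cm lev_cS).
have i3 := cper_itg lev_cu.
rewrite -(integralZ_R _ i2) -(integralD_R i1 (itgZ _ i2)) -(integralB_R (itgD i1 (itgZ _ i2)) i3).
apply: eq_Rintegral => x _; rewrite -/m -/HJz lev_hjE /fpi -/m -/u.
have -> : \sum_i m x * dts q z.2 i x * dts q z.2 i x = m x * Sq x.
  by rewrite /Sq /sqd mulr_sumr; apply: eq_bigr => i _; rewrite expr2 mulrA.
by rewrite -/(u x) -/(m x); field.
Qed.

Lemma lev_hj_int (t : R) : \int[mu]_x (t * HJz x) = t * (\int[mu]_x W x - \int[mu]_x u x - 2^-1 * \int[mu]_x Sq x).
Proof.
have i1 := cper_itg lev_cu; have i2 := cper_itg lev_cS; have i3 := cper_itg lev_cW.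
rewrite (integralZ_R _ (cper_itg lev_chj)); congr (_ * _).
rewrite -(integralZ_R _ i2) -(integralB_R i3 i1) -(integralB_R (itgB i3 i1) (itgZ _ i2)).
apply: eq_Rintegral => x _.
by rewrite lev_hjE; field.
Qed.

(** The test is the constant density t with zero second component. The value [t = 1] eliminates the
    integral of u, and values on either side of 1 bound that integral from above and from below. *)
Lemma lev_theta (t : R) : r <= t -> t <= rho ->
  \int[mu]_x (m x * W x) + 2^-1 * \int[mu]_x (m x * Sq x) + t / 2 * \int[mu]_x Sq x <=
  t * \int[mu]_x W x + (1 - t) * \int[mu]_x u x.
Proof.
move=> rt tr; have := @lev_test0 (cl t); rewrite pbound_cl => /(_ pp).
rewrite lev_lform => H.
have : \int[mu]_x (m x * W x) + 2^-1 * \int[mu]_x (m x * Sq x) - \int[mu]_x u x <= \int[mu]_x (tp (cl t) x * HJz x).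
  apply: H => [j|x]; last by rewrite tp_cl.
  apply: le_trans (coef_le _ _) _; rewrite wt_cl ger0_norm//; exact: le_trans (ltW r0) rt.
under [leRHS]eq_Rintegral do rewrite tp_cl.
rewrite lev_hj_int; move: (\int[mu]_x _) (\int[mu]_x _) (\int[mu]_x _) (\int[mu]_x _) (\int[mu]_x _) => c1 c2 c3 c4 c5 hh.
clear H; lra.
Qed.

Lemma lev_Q0 : Q0 = @lform R d h V p q z z - \int[mu]_x (1 * HJz x).
Proof.
have i1 := cper_itg (cperM lev_cm lev_cW); have i2 := cper_itg lev_cW.
rewrite lev_lform lev_hj_int /Q0.
have -> : \int[mu]_x ((m x - 1) * W x) = \int[mu]_x (m x * W x) - \int[mu]_x W x.
  by rewrite -(integralB_R i1 i2); apply: eq_Rintegral => x _; rewrite mulrBl mul1r.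
ring.
Qed.

Lemma coef1_le j : 1 <= rho -> `|coef (cl 1) j| <= rho.
Proof. by move=> h1; apply: le_trans (coef_le _ _) _; rewrite wt_cl normr1. Qed.

Definition fpint (v : Rd -> R) (dv : 'I_d -> Rd -> R) : R := \int[mu]_x fpi p q z v dv x.

(* The Fokker-Planck residual is small because [+-(rho' / B) b] is an admissible test. *)
Lemma lev_fp b (B : R) : 1 <= rho -> r <= 1 -> 0 < B -> 0 < rho' -> wt b <= B -> (pbound b <= q)%N ->
  `|fpint (tp b) (fun i => tp (dtp (basis_vec i) b))| <= - Q0 * (B / rho').
Proof.
move=> rh r1 B0 rp wb qb.
pose sc (t : R) := [seq (t * e.1, e.2) | e <- b].
have tsc t x : tp (sc t) x = t * tp b x.
  by rewrite /tp /sc big_map/= mulr_sumr; apply: eq_bigr => e _; rewrite mulrA.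
have dsc t i x : tp (dtp (basis_vec i) (sc t)) x = t * tp (dtp (basis_vec i) b) x.
  rewrite /tp /dtp /sc -map_comp !big_map/= mulr_sumr; apply: eq_bigr => e _; by rewrite !mulrA.
have psc t : pbound (sc t) = pbound b by rewrite /pbound /sc big_map.
have wsc t : wt (sc t) = `|t| * wt b.
  by rewrite /wt /sc big_map/= mulr_sumr; apply: eq_bigr => e _; rewrite normrM.
set F := fpint _ _.
have cb : cper (tp b) by exact: cper_tp.
have cdb i : cper (tp (dtp (basis_vec i) b)) by exact: cper_tp.
have iF := cper_itg (@cper_fpi R d p q z (tp b) _ cb cdb).
have key t : `|t| <= rho' / B -> Q0 <= t * F.
  move=> ht; have := @lev_test (cl 1) (sc t); rewrite pbound_cl psc => /(_ pp qb) H.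
  rewrite lev_Q0 lerBlDl.
  have {}H : @lform R d h V p q z z <= \int[mu]_x (tp (cl 1) x * HJz x + fpi p q z (tp (sc t)) (fun i => tp (dtp (basis_vec i) (sc t))) x).
    apply: H => [j|j|x]; [exact: coef1_le| |by rewrite tp_cl].
    apply: le_trans (coef_le _ _) _; rewrite wsc; apply: (@le_trans _ _ (rho' / B * B)).
      by apply: ler_pM; rewrite ?wt_ge0.
    by rewrite divfK// gt_eqF.
  apply: le_trans H _; rewrite -(integralZ_R _ iF) -(integralD_R (itgZ 1 (cper_itg lev_chj)) (itgZ _ iF)).
  rewrite le_eqVlt; apply/orP; left; apply/eqP; apply: eq_Rintegral => x _; rewrite tp_cl; congr (_ + _).
  rewrite /fpi tsc mulrDr mulr_sumr mulrCA; congr (_ + _); apply: eq_bigr => i _; rewrite dsc.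
  by rewrite mulrCA.
have t0 : 0 <= rho' / B by rewrite divr_ge0 ?ltW.
have h1 := key (rho' / B); rewrite ger0_norm// in h1.
have h2 := key (- (rho' / B)); rewrite normrN ger0_norm// in h2.
have {}h1 := h1 (lexx _); have {}h2 := h2 (lexx _).
have b0 : 0 <= B / rho' by rewrite divr_ge0 ?ltW.
have e1 : B / rho' * (rho' / B * F) = F by field; rewrite !gt_eqF.
have := ler_wpM2l b0 h2; rewrite mulNr mulrN e1 => h3.
have := ler_wpM2l b0 h1; rewrite e1 => h4.
rewrite ler_norml mulNr opprK [Q0 * _]mulrC h4/=; lra.
Qed.

(** The test is [1 + t a] with the largest t that keeps the coefficients below rho; the slack [Q0]
    is then divided by t. *)
Lemma lev_HJ a (B : R) : 1 < rho -> r <= 1 -> 0 < B -> wt a <= B -> (pbound a <= p)%N ->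
  (forall x, 0 <= tp a x) -> Q0 * (B / (rho - 1)) <= \int[mu]_x (tp a x * HJz x).
Proof.
move=> rh r1 B0 wa pa a0.
have rh1 : 0 < rho - 1 by rewrite subr_gt0.
pose t := (rho - 1) / B; have t0 : 0 < t by rewrite divr_gt0.
pose c := (1, (false, 0)) :: [seq (t * e.1, e.2) | e <- a] : seq (R * (bool * 'rV[int]_d)).
have tc x : tp c x = 1 + t * tp a x.
  rewrite /tp /c big_cons md_cos0 mulr1; congr (_ + _).
  by rewrite big_map/= mulr_sumr; apply: eq_bigr => e _; rewrite mulrA.
have pc : (pbound c <= p)%N.
  move: pa pp; rewrite /pone /pbound /c /cl !big_cons big_map big_nil/= maxn0 => pa' pp'.
  by rewrite /maxn; case: ifP.
have wc : wt c <= rho.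
  rewrite /wt /c big_cons/= normr1 big_map/=.
  have -> : \sum_(j <- a) `|t * j.1| = t * wt a.
    by rewrite /wt mulr_sumr; apply: eq_bigr => e _; rewrite normrM (ger0_norm (ltW t0)).
  rewrite -lerBrDl; apply: (@le_trans _ _ (t * B)); first by rewrite ler_pM2l.
  by rewrite /t divfK// gt_eqF.
have H : @lform R d h V p q z z <= \int[mu]_x (tp c x * HJz x).
  apply: lev_test0 => // [j|x]; first exact: le_trans (coef_le _ _) wc.
  by rewrite tc; apply: le_trans r1 _; rewrite lerDl mulr_ge0// ltW.
have ia := cper_itg (cperM (cper_tp a) lev_chj).
have : Q0 <= t * \int[mu]_x (tp a x * HJz x).
  rewrite lev_Q0 lerBlDl; apply: le_trans H _.
  rewrite -(integralZ_R _ ia) -(integralD_R (itgZ 1 (cper_itg lev_chj)) (itgZ _ ia)).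
  rewrite le_eqVlt; apply/orP; left; apply/eqP; apply: eq_Rintegral => x _; rewrite tc; ring.
have b0 : 0 < B / (rho - 1) by rewrite divr_gt0.
move=> /(ler_wpM2l (ltW b0)); rewrite [Q0 * _]mulrC => hh; apply: le_trans hh _.
rewrite mulrA (_ : _ * t = 1) ?mul1r// /t; by field; rewrite !gt_eqF.
Qed.

End level.

(** The arithmetic of the a priori bounds with all integrals replaced by variables. Test 1 against
    the lower energy bound gives [Pm <= P] and bounds both dissipations by [2 Ce]; tests 1/2 and 3/2
    then enclose U, and Poincaré's inequality bounds [U2]. *)
Lemma level_arith {R : realFieldType} (c Ce CL Ch CP ka P Im IW ImW D0 Dm Pm Pa Ih U U2 : R) :
  0 < c -> 0 <= Ce -> 0 <= CL -> 0 <= Ch -> 0 <= CP -> 0 < ka -> c * P = Ce -> 0 <= P ->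
  0 <= ka * (2 + P + Ch * (2 + P)) + CL ->
  0 <= CP * ((2 * CL * (1 + P) + 3 * (ka * (2 + P + Ch * (2 + P)) + CL)) ^+ 2 + 2 * Ce) ->
  ImW + 2^-1 * Dm + 1 / 2 * D0 <= 1 * IW + (1 - 1) * U ->
  ImW + 2^-1 * Dm + 1 / 2 / 2 * D0 <= 1 / 2 * IW + (1 - 1 / 2) * U ->
  ImW + 2^-1 * Dm + 3 / 2 / 2 * D0 <= 3 / 2 * IW + (1 - 3 / 2) * U ->
  c * Pm - Ce <= ImW - IW -> 0 <= D0 -> 0 <= Dm -> Im <= 1 + Pm -> Pa <= 1 + Pm -> 0 <= Im -> 0 <= Pm ->
  IW <= ka * (1 + Pa + Ih) -> - CL <= IW -> - CL * Im <= ImW -> Ih <= Ch * (1 + Im) ->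
  U2 <= CP * (U ^+ 2 + D0) ->
  let K := P + 2 * Ce + (1 + P) +
    CP * ((2 * CL * (1 + P) + 3 * (ka * (2 + P + Ch * (2 + P)) + CL)) ^+ 2 + 2 * Ce) + Ce +
    (ka * (2 + P + Ch * (2 + P)) + CL) in
  [/\ Pm <= K, Dm <= K, D0 <= K &
  [/\ Im <= K, U2 <= K, - K <= ImW - IW + 2^-1 * Dm + 2^-1 * D0 & `|IW| <= K]].
Proof.
move=> c0 Ce0 CL0 Ch0 CP0 ka0 PE P0 I0 K0 t1 t2 t3 en D00 Dm0 hm1 ha1 mI0 pI0 hW hWl1 hWl2 hhm poi /=.
have b1 : c * Pm <= c * P by rewrite PE; lra.
have bP : Pm <= P by rewrite -(ler_pM2l c0).
have cP0 : 0 <= c * Pm by rewrite mulr_ge0// ltW.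
have bD0 : D0 <= 2 * Ce by lra.
have bDm : Dm <= 2 * Ce by lra.
have bI : Im <= 1 + P by lra.
have bIh : Ih <= Ch * (2 + P) by apply: le_trans hhm _; rewrite ler_wpM2l//; lra.
have bW : IW <= ka * (2 + P + Ch * (2 + P)).
  apply: le_trans hW _; rewrite ler_pM2l//; lra.
move: I0 K0 bW; set J := ka * _ => I0 K0 bW.
have J0 : 0 <= J by rewrite mulr_ge0 ?(ltW ka0)// !addr_ge0// mulr_ge0// addr_ge0.
have cI : CL * Im <= CL * (1 + P) by rewrite ler_wpM2l.
have U1 : U <= 2 * CL * (1 + P) + 3 * (J + CL) by lra.
have U1' : - (2 * CL * (1 + P) + 3 * (J + CL)) <= U by lra.
have UU : U ^+ 2 <= (2 * CL * (1 + P) + 3 * (J + CL)) ^+ 2.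
  move: U1 U1'; set X := 2 * CL * _ + _ => U1 U1'; have X1 : 0 <= X + U by lra.
  by rewrite -subr_ge0 subr_sqr mulr_ge0 ?subr_ge0.
have bU2 : U2 <= CP * ((2 * CL * (1 + P) + 3 * (J + CL)) ^+ 2 + 2 * Ce).
  by apply: le_trans poi _; rewrite ler_wpM2l// lerD.
move: K0 bU2; set K := CP * _ => K0 bU2.
clear hhm poi UU U1 U1' t2 t3 hW bIh cI hWl2 hm1 ha1 mI0 b1 c0 CP0 Ch0 ka0 PE I0 pI0.
split; last (split; last by rewrite ler_norml; apply/andP; split; lra); lra.
Qed.

Section level_bounds.
Context {R : realType} {d : nat} {E : set R} {h : ('rV[R]_d -> R) -> 'rV[R]_d -> R}
  {g g1 g2 V : 'rV[R]_d -> R -> R -> R} {al ka : R}.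
Context (A : assumptions E h g g1 g2 V al ka).
Local Notation Rd := 'rV[R]_d.
Local Notation mu := (@torus_measure R d).
Local Notation itg f := (mu.-integrable setT (EFin \o f)).

Lemma le_1powR (t b c : R) : 0 <= t -> 0 < b -> b <= c -> t `^ b <= 1 + t `^ c.
Proof.
move=> t0 b0 bc; have [t1|t1] := leP 1 t.
  apply: (@le_trans _ _ (t `^ c)); first exact: ler_powR.
  by rewrite lerDr.
apply: (@le_trans _ _ (1 `^ b)); last by rewrite powR1 lerDl powR_ge0.
by apply: ge0_ler_powR; rewrite ?nnegrE// ltW.
Qed.

(** The bounds on r and rho make the constant densities 1/2, 1 and 3/2 admissible. *)
Definition small_level p q (rho rho' r : R) z := [/\ 0 < r <= 1 / 2, 3 / 2 <= rho, 0 <= rho',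
  (@pone R d <= p)%N & @gsol R d h V p q rho rho' r z].

(** The constant is independent of the degrees, of the coefficient bounds and of r. *)
Lemma level_bounds : exists2 C : R, 0 <= C & forall (p q : nat) rho rho' r z, small_level p q rho rho' r z ->
  [/\ \int[mu]_x ts p z.1 x `^ (al + 1) <= C,
      \int[mu]_x (ts p z.1 x * sqd q z x) <= C,
      \int[mu]_x sqd q z x <= C &
      [/\ \int[mu]_x ts p z.1 x <= C, \int[mu]_x ts q z.2 x ^+ 2 <= C, - C <= @Q0 R d h V p q z &
      `|\int[mu]_x along V h (ts p z.1) x| <= C]].
Proof.
have [c [Ce [c0 Ce0 hen]]] := energy_lower A.
have [cL [CL [cL0 CL0 hlo]]] := along_ge A.
have [Ch Ch0 hh] := h_L1 A.
have [CP CP0 hP] := @poincare R d.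
have ka0 := ka_gt0 A; have al0 := al_gt0 A.
have [P PE P0] : exists2 P, c * P = Ce & 0 <= P.
  by exists (Ce / c); [rewrite mulrC divfK// gt_eqF|rewrite divr_ge0// ltW].
pose I := ka * (2 + P + Ch * (2 + P)) + CL.
have I0 : 0 <= I by rewrite addr_ge0// mulr_ge0 ?(ltW ka0)// !addr_ge0// mulr_ge0// addr_ge0.
pose Iu := 2 * CL * (1 + P) + 3 * I.
have Iu0 : 0 <= Iu by rewrite addr_ge0// mulr_ge0// ?mulr_ge0// addr_ge0.
pose K := CP * (Iu ^+ 2 + 2 * Ce).
have K0 : 0 <= K by rewrite mulr_ge0// addr_ge0 ?sqr_ge0// mulr_ge0.
exists (P + 2 * Ce + (1 + P) + K + Ce + I).
  have h2 : 0 <= 2 * Ce by rewrite mulr_ge0.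
  by do ?[apply: addr_ge0 => //].
move=> p q rho rho' r z [/andP[r0 r1] rho1 rho'0 pp S].
have h13 : 1 / 2 <= 3 / 2 :> R by lra.
have rho0 : 0 <= rho by apply: le_trans rho1; lra.
have rle1 : r <= 1 by apply: le_trans r1 _; lra.
have rho11 : 1 <= rho by apply: le_trans rho1; lra.
pose m := ts p z.1 : Rd -> R; pose W := along V h m; pose Sq := sqd q z : Rd -> R.
have cm : cper m := lev_cm p z; have Em := lev_E A r0 S; have cW : cper W := lev_cW A r0 S.
have cS : cper Sq := lev_cS q z.
have m0 x : 0 <= m x by exact: E_ge0 A _ (Em x).
have S0 x : 0 <= Sq x by apply: sumr_ge0 => i _; exact: sqr_ge0.
have ip : itg (fun x => m x `^ (al + 1)) by apply/cper_itg/cper_powR => //; rewrite addr_gt0.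
have ia : itg (fun x => m x `^ al) by apply/cper_itg/cper_powR.
have im := cper_itg cm; have iW := cper_itg cW; have imW := cper_itg (cperM cm cW).
have iS := cper_itg cS; have imS := cper_itg (cperM cm cS).
have M := cper_MacE cm Em.
have th1 := lev_theta A r0 rho'0 pp S rle1 rho11.
have th2 := lev_theta A r0 rho'0 pp S r1 (le_trans h13 rho1).
have th3 := lev_theta A r0 rho'0 pp S (le_trans r1 h13) rho1.
have en := hen m cm Em.
have D0 : 0 <= \int[mu]_x Sq x by exact: integral_ge0_R.
have Dm : 0 <= \int[mu]_x (m x * Sq x) by apply: integral_ge0_R => x; rewrite mulr_ge0.
have eW : \int[mu]_x ((m x - 1) * W x) = \int[mu]_x (m x * W x) - \int[mu]_x W x.
  by rewrite -(integralB_R imW iW); apply: eq_Rintegral => x _; rewrite mulrBl mul1r.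
have hm1 : \int[mu]_x m x <= 1 + \int[mu]_x m x `^ (al + 1).
  rewrite -{1}(@integral_cst_R _ _ _ mu 1) -(integralD_R (itg_cst 1) ip).
  apply: (integral_le_R im (itgD (itg_cst 1) ip)) => x.
  rewrite -{1}(powRr1 (m0 x)); apply: le_1powR => //; by rewrite lerDr ltW.
have ha1 : \int[mu]_x m x `^ al <= 1 + \int[mu]_x m x `^ (al + 1).
  rewrite -{1}(@integral_cst_R _ _ _ mu 1) -(integralD_R (itg_cst 1) ip).
  apply: (integral_le_R ia (itgD (itg_cst 1) ip)) => x.
  by apply: le_1powR => //; rewrite lerDl.
have mI0 : 0 <= \int[mu]_x m x by exact: integral_ge0_R.
have pI0 : 0 <= \int[mu]_x m x `^ (al + 1) by apply: integral_ge0_R => x; exact: powR_ge0.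
have ch := cper_h A (MacE_Mac A M); have ih := itg_abs (cper_itg ch).
have hW : \int[mu]_x W x <= ka * (1 + \int[mu]_x m x `^ al + \int[mu]_x `|h m x|).
  rewrite -(@integral_cst_R _ _ _ mu 1) -(integralD_R (itg_cst 1) ia) -(integralD_R (itgD (itg_cst 1) ia) ih).
  rewrite -(integralZ_R _ (itgD (itgD (itg_cst 1) ia) ih)).
  apply: (integral_le_R iW (itgZ _ (itgD (itgD (itg_cst 1) ia) ih))) => x.
  by apply: (along_le A).
have hWl : {ae mu, forall x, - CL <= W x}.
  apply: filterS (hlo m M) => x; apply: le_trans; rewrite lerDr mulr_ge0 ?powR_ge0// ltW//.
have hWl1 : - CL <= \int[mu]_x W x.
  by rewrite -(@integral_cst_R _ _ _ mu (- CL)); apply: (integral_ae_le (itg_cst _) iW hWl).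
have hWl2 : - CL * \int[mu]_x m x <= \int[mu]_x (m x * W x).
  rewrite -(integralZ_R _ im); apply: (integral_ae_le (itgZ _ im) imW).
  by apply: filterS hWl => x hx; rewrite [leLHS]mulrC ler_wpM2l.
have hhm := hh m M.
have EQ : @Q0 R d h V p q z = \int[mu]_x (m x * W x) - \int[mu]_x W x + 2^-1 * \int[mu]_x (m x * Sq x) + 2^-1 * \int[mu]_x Sq x.
  by rewrite -eW.
have poi := hP (ts q z.2) (dts q z.2) (cper_ts q z.2) (fun i => cper_dts q z.2 i) (fun i x => is_derive_ts q z.2 i x).
have ES : \sum_i \int[mu]_x dts q z.2 i x ^+ 2 = \int[mu]_x Sq x.
  by rewrite /Sq /sqd integral_sum_R// => i; exact/cper_itg/cperX/cper_dts.
rewrite -/m -/Sq -/W EQ; rewrite ES in poi.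
move: (th1) (th2) (th3) en D0 Dm hm1 ha1 mI0 pI0 hW hWl1 hWl2 hhm poi; rewrite eW.
rewrite -/m -/Sq -/W.
move: (\int[mu]_x m x) (\int[mu]_x W x) (\int[mu]_x (m x * W x)) (\int[mu]_x Sq x) (\int[mu]_x (m x * Sq x))
  (\int[mu]_x m x `^ (al + 1)) (\int[mu]_x m x `^ al) (\int[mu]_x `|h m x|) (\int[mu]_x ts q z.2 x) (\int[mu]_x ts q z.2 x ^+ 2).
move=> Im IW ImW D0 Dm Pm Pa Ih U U2.
move: P0 I0 Iu0 K0; rewrite /K /Iu /I => P0 I0 Iu0 K0 t1 t2 t3 en D00 Dm0 hm1 ha1 mI0 pI0 hW hWl1 hWl2 hhm poi.
exact: (level_arith c0 Ce0 CL0 Ch0 CP0 ka0 PE P0 I0 K0 t1 t2 t3 en D00 Dm0 hm1 ha1 mI0 pI0 hW hWl1 hWl2 hhm poi).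
Qed.

End level_bounds.

Lemma sin_scale_cvg {R : realType} (a : R) : n.+1%:R * sin (a / n.+1%:R) @[n --> \oo] --> a.
Proof.
have D : is_derive (0 : R) (1 : R) (fun t => sin (a * t)) a.
  have D1 : is_derive (0 : R) (1 : R) (fun t => a * t) a.
    have := is_deriveM (is_derive_cst (a : R) (0 : R) (1 : R)) (is_derive_id (0 : R) 1).
    by rewrite /GRing.scale/= mulr0 addr0 mulr1.
  have := @is_derive1_comp R sin (fun t => a * t) 0 _ _ _ D1.
  by move=> /(_ _ (is_derive_sin _)); rewrite mulr0 cos0 mul1r.
have [dv de] := D.
have dc : (fun h : R => h^-1 *: (sin (a * (h *: 1 + 0)) - sin (a * 0))) h @[h --> 0^'] --> a.
  by rewrite -[X in _ --> X]de; exact: dv.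
have n0 : (n.+1%:R^-1 : R) @[n --> \oo] --> 0^'.
  have c0 : (n.+1%:R^-1 : R) @[n --> \oo] --> 0 by exact: cvg_harmonic.
  move=> P [e /= e0 Pe]; have [N _ hN] := c0 _ (nbhsx_ballx (0:R) e e0); exists N => // n Nn /=.
  by apply: Pe; [exact: (hN n Nn)|rewrite invr_eq0 pnatr_eq0].
have := cvg_comp _ _ n0 dc; apply: cvg_trans; apply: near_eq_cvg; near=> n.
by rewrite /= invrK mulr0 sin0 subr0 addr0 /GRing.scale/= mulr1.
Unshelve. all: by end_near. Qed.

Section weak_partial_trig.
Context {R : realType} {d : nat}.
Local Notation Rd := 'rV[R]_d.
Local Notation mu := (@torus_measure R d).
Local Notation itg f := (mu.-integrable setT (EFin \o f)).
Implicit Types (a : seq (R * (bool * 'rV[int]_d))) (f u v phi : Rd -> R) (x : Rd).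

Lemma cper_L1 f : cper f -> L1 f.
Proof. by move=> cf; split; [case: cf|exact: cper_itg]. Qed.

Lemma Cinf_partial (s : seq 'I_d) phi : Cinf phi -> cper (partial s phi) /\
  forall i x, is_derive x (basis_vec i) (partial s phi) (partial (i :: s) phi x).
Proof.
move=> [pp sp].
have D t i x : is_derive x (basis_vec i) (partial t phi) (partial (i :: t) phi x).
  by apply: DeriveDef => //; exact: (sp (map basis_vec t) x Logic.I).2.
split=> //; split; last by move=> x; exact: (sp (map basis_vec s) x Logic.I).1.
elim: s => [//|i s IH]; exact: (derive_periodic IH (D s i)).
Qed.

Lemma Cinf_cper phi : Cinf phi -> cper phi.
Proof. by move=> /(@Cinf_partial [::]) []. Qed.

Lemma is_weak_partial_tp (s : seq 'I_d) a : exists a', is_weak_partial s (tp a) (tp a').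
Proof.
elim: s a => [|i s IH] a.
  exists a; split; [exact/cper_L1/cper_tp|exact/cper_L1/cper_tp|move=> phi _].
  by rewrite expr0 mul1r.
have [a' [h1 h2 h3]] := IH (dtp (basis_vec i) a); exists a'; split=> //; first exact/cper_L1/cper_tp.
move=> phi cphi; have [c1 d1] := Cinf_partial s cphi; have [c2' _] := Cinf_partial (i :: s) cphi.
rewrite (integration_by_parts_torus (cper_tp a) c1 (cper_tp _) c2' (fun x => is_derive_tp a x _) (d1 i)).
by rewrite (h3 _ cphi) /= exprS mulN1r mulNr.
Qed.

Lemma weak_partial_unique (s : seq 'I_d) u v v' : is_weak_partial s u v -> is_weak_partial s u v' ->
  {ae mu, forall x, v x = v' x}.
Proof.
move=> [_ [_ iv] hv] [_ [_ iv'] hv'].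
have : {ae mu, forall x, v x - v' x = 0}.
  apply: trig_unique; first exact: itgB.
  move=> b k.
  have cm : Cinf (@md R d b k).
    by have := @Cinf_tp R d [:: (1, (b, k))]; rewrite (_ : tp _ = md b k)//; apply/funext => x; rewrite /tp big_seq1 mul1r.
  have := hv _ cm; rewrite (hv' _ cm) => /eqP; rewrite eq_sym.
  rewrite (inj_eq (mulfI _)) ?signr_eq0// => /eqP e.
  rewrite (_ : \int[mu]_y _ = \int[mu]_y (v y * md b k y) - \int[mu]_y (v' y * md b k y)).
    by rewrite e subrr.
  rewrite -(integralB_R (itgMr_bnd (cper_mf (cper_md b k)) (@md_bnd _ _ b k) iv) (itgMr_bnd (cper_mf (cper_md b k)) (@md_bnd _ _ b k) iv')).
  by apply: eq_Rintegral => x _; ring.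
by apply: filterS => x /eqP; rewrite subr_eq0 => /eqP.
Qed.

Lemma weak_partial_aeeq (s : seq 'I_d) u v : is_weak_partial s u v ->
  is_weak_partial s u (weak_partial s u) /\ {ae mu, forall x, weak_partial s u x = v x}.
Proof.
move=> h; have h' : is_weak_partial s u (weak_partial s u) by exact: (@xgetPex _ (fun=> 0) [set v | is_weak_partial s u v] (ex_intro _ v h)).
by split=> //; exact: (weak_partial_unique h' h).
Qed.

Lemma Int_sqr_fin f : L2 mu f -> (Int (fun x => (f x ^+ 2)%R) < +oo)%E.
Proof. by move=> [_ i2]; rewrite /Int (eint_fin i2) ltry. Qed.

Lemma sobolev_nat (k : nat) u : L1 u ->
  (forall s : seq 'I_d, (size s <= k)%N -> exists2 v, is_weak_partial s u v & L2 mu v) ->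
  sobolev k%:R u.
Proof.
move=> lu hs; split=> //.
  by move=> s; rewrite Num.Theory.natrK => /hs [v hv _]; exists v.
rewrite /sobolev_sqnorm natrK eqxx adde0.
apply: lte_sum_pinfty => j _; apply: lte_sum_pinfty => s _.
have [|v hv l2] := hs s; first by rewrite size_tuple -ltnS.
have [[_ [_ iw] _] e] := weak_partial_aeeq hv.
apply: Int_sqr_fin; apply: (L2_aeeq (itg_mf iw) _ l2).
by apply: filterS e => x ->.
Qed.

Lemma sobolev_tp (k : nat) a : sobolev k%:R (tp a).
Proof.
apply: sobolev_nat; first exact/cper_L1/cper_tp.
by move=> s _; have [a' ha] := is_weak_partial_tp s a; exists (tp a') => //; exact/cper_L2/cper_tp.
Qed.

End weak_partial_trig.

(** * Second-order estimate by difference quotients *)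

Section second_order.
Context {R : realType} {d : nat} {E : set R} {h : ('rV[R]_d -> R) -> 'rV[R]_d -> R}
  {g g1 g2 V : 'rV[R]_d -> R -> R -> R} {al ka : R}.
Context (A : assumptions E h g g1 g2 V al ka).
Local Notation Rd := 'rV[R]_d.
Local Notation mu := (@torus_measure R d).
Local Notation itg f := (mu.-integrable setT (EFin \o f)).
Implicit Types (c : nat -> R) (x : Rd).

Definition d2ts n c i k : Rd -> R := tp (dtp (basis_vec k) (dtp (basis_vec i) (tl n c))).

Lemma is_derive_dts n c i k x : is_derive x (basis_vec k) (dts n c i) (d2ts n c i k x).
Proof. exact: is_derive_tp. Qed.

Lemma cper_d2ts n c i k : cper (d2ts n c i k). Proof. exact: cper_tp. Qed.

Definition fr (i : 'I_d) j : R := ang (@mode d j).2 (basis_vec i).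
(** The action of the second derivative in direction i on the coefficients. *)
Definition lap1 i c j : R := - fr i j ^+ 2 * c j.

Lemma ts_lap1 n c i : ts n (lap1 i c) = d2ts n c i i.
Proof.
apply/funext => x; rewrite /ts /d2ts /tp /dtp /tl !big_map; apply: eq_bigr => j _ /=.
by rewrite negbK /lap1 /fr; case: (mode j).1; rewrite /msgn/=; ring.
Qed.

Lemma dts_lap1 n c i k : dts n (lap1 i c) k = tp (dtp (basis_vec i) (dtp (basis_vec k) (dtp (basis_vec i) (tl n c)))).
Proof.
apply/funext => x; rewrite /dts /tp /dtp /tl !big_map; apply: eq_bigr => j _ /=.
by rewrite negbK /lap1 /fr; case: (mode j).1; rewrite /msgn/=; ring.
Qed.

Lemma ts_average n c i (s : R) x : ts n (fun j => cos (fr i j * s) * c j) x =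
  (ts n c (x + s *: basis_vec i) + ts n c (x - s *: basis_vec i)) / 2.
Proof.
rewrite !tsE -big_split/= mulr_suml; apply: eq_bigr => j _.
by rewrite /fr ang_basis mulrAC -md_avg -mulrDr; ring.
Qed.

Context (p q : nat) (rho rho' r : R) (z : (nat -> R) * (nat -> R)).
Context (r0 : 0 < r) (S : @gsol R d h V p q rho rho' r z).

(* The averages of the translates of [z] by [+-s e_i] are admissible, and their second
   difference quotients tend to the second derivative as [s] tends to 0. *)
Lemma lev_second_test i : 0 <= @lform R d h V p q z (lap1 i z.1, lap1 i z.2).
Proof.
have [a [b lE]] := lformE A q (lev_E A r0 S); have [[f1 f2 f3] St] := S.
pose sq n j : R := (n.+1%:R * sin (fr i j / n.+1%:R)) ^+ 2.
have csq j : sq n j @[n --> \oo] --> fr i j ^+ 2.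
  by rewrite (_ : (sq ^~ j) = (fun n => (n.+1%:R * sin (fr i j / n.+1%:R)) * (n.+1%:R * sin (fr i j / n.+1%:R))))
    ?expr2//; apply: cvgM; exact: sin_scale_cvg.
have lim : \sum_(0 <= j < p) - sq n j * z.1 j * a j + \sum_(0 <= j < q) - sq n j * z.2 j * b j @[n --> \oo] -->
    @lform R d h V p q z (lap1 i z.1, lap1 i z.2).
  have cc j (c e : R) : - sq n j * c * e @[n --> \oo] --> - fr i j ^+ 2 * c * e.
    exact: (cvgM (cvgM (cvgN (csq j)) (cvg_cst c)) (cvg_cst e)).
  by rewrite lE /= /lap1; apply: cvgD; apply: cvg_sumr => j; exact: cc.
apply: (cvgr_to_ge lim); apply: nearW => n.
pose s : R := 2 / n.+1%:R.
(* The double-angle formula: the averaging factor is 1 minus a positive multiple, the same for all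
   modes, of a sequence tending to the squared frequency. Dividing by that multiple leaves the test
   [lap1]. *)
have cE j : cos (fr i j * s) = 1 - 2 * n.+1%:R^-1 ^+ 2 * sq n j.
  rewrite /s (_ : _ * _ = (fr i j / n.+1%:R) *+ 2); last by rewrite mulrCA mulr_natl.
  rewrite cos_mulr2n cos2sin2 /sq exprMn mulrA -[2 * _ * _]mulrA -exprMn mulVf ?pnatr_eq0// expr1n mulr1 mulrnBl.
  by rewrite -mulr_natl; ring.
have := St (fun j => cos (fr i j * s) * z.1 j, fun j => cos (fr i j * s) * z.2 j).
have cos1 (X : R) : `|cos X| <= 1 by rewrite ler_norml cos_geN1 cos_le1.
have fe : @feasible R d p rho rho' r (fun j => cos (fr i j * s) * z.1 j, fun j => cos (fr i j * s) * z.2 j).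
  split=> [j|j|x] /=.
  - by rewrite normrM; apply: le_trans (f1 j); rewrite ler_piMl.
  - by rewrite normrM; apply: le_trans (f2 j); rewrite ler_piMl.
  - by rewrite ts_average; have := f3 (x + s *: basis_vec i); have := f3 (x - s *: basis_vec i); move: (ts p _ _) (ts p _ _) => X Y; lra.
move=> /(_ fe); rewrite !lE /=.
have e (N : nat) (c e : nat -> R) : \sum_(0 <= j < N) cos (fr i j * s) * c j * e j =
    \sum_(0 <= j < N) c j * e j + 2 * n.+1%:R^-1 ^+ 2 * \sum_(0 <= j < N) - sq n j * c j * e j.
  by rewrite mulr_sumr -big_split/=; apply: eq_bigr => j _; rewrite cE; ring.
rewrite !e; move: (\sum_(0 <= j < p) - _ * _ * _) (\sum_(0 <= j < q) - _ * _ * _) => X Y.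
move: (\sum_(0 <= j < p) _) (\sum_(0 <= j < q) _) => X' Y' hh.
have n2 : 0 < 2 * (n.+1%:R^-1 : R) ^+ 2 by rewrite mulr_gt0// exprn_gt0// invr_gt0 ltr0n.
by move: hh; rewrite addrACA -mulrDr lerDl pmulr_rge0.
Qed.

Let m : Rd -> R := ts p z.1.
Let u : Rd -> R := ts q z.2.
Let W : Rd -> R := along V h m.

Lemma lev_W_C1 i : exists2 w : Rd -> R, cper w & forall x, is_derive x (basis_vec i) W (w x).
Proof.
have cm : cper m := lev_cm p z; have Em := lev_E A r0 S.
have M := cper_MacE cm Em; have ch := cper_h A (MacE_Mac A M).
(* The order [d.+2] is admissible in (h-regularity), is an integer, and provides the [d.+1] weak
   derivatives that [Sob_C1] asks for. *)
have kd : d%:R / 2 + 1 < d.+2%:R :> R.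
  have := ler0n R d; rewrite -(addn2 d) natrD; lra.
have [hr _] := asreg A kd.
have [|lh hs _] := hr m.
  by split; [exact: sobolev_tp|apply: aeW => x; exact: (E_ge0 A (Em x))].
have Sh : Sob d.+1 (h m).
  by move=> s ss; apply: hs; rewrite natrK; exact: leq_trans ss _.
have [dh cdh hdh] := Sob_C1 i ch Sh.
exact: (along_C1 A cm Em (cper_dts p z.1 i) cdh (fun x => is_derive_ts p z.1 i x) hdh).
Qed.

(* The integrand of the second-derivative test is, up to the terms of the conclusion,
   [d_i] of a periodic function. *)
Lemma lev_second i (w : Rd -> R) : cper w -> (forall x, is_derive x (basis_vec i) W (w x)) ->
  \int[mu]_x (dts p z.1 i x * w x) + \sum_k \int[mu]_x (m x * d2ts q z.2 i k x ^+ 2) <= 0.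
Proof.
move=> cw hw; have H := lev_second_test i.
have cm : cper m := lev_cm p z; have cu : cper u := cper_ts q z.2.
have cmi := cper_dts p z.1 i; have cui (k : 'I_d) := cper_dts q z.2 k; have cuik (k : 'I_d) := cper_d2ts q z.2 i k.
have chj : cper (@hj R d h V p q z) := lev_chj A r0 S.
have cI := cper_lform A q (lap1 i z.1, lap1 i z.2) (lev_E A r0 S).
pose F x := dts p z.1 i x * @hj R d h V p q z x + (m x - 1) * dts q z.2 i x + \sum_k m x * dts q z.2 k x * d2ts q z.2 i k x.
pose Q x := dts p z.1 i x * w x + \sum_k m x * d2ts q z.2 i k x ^+ 2.
have cF : cper F.
  apply: cperD; first by exact: (cperD (cperM cmi chj) (cperM (cperB cm (cper_cst 1)) (cui i))).
  by apply: cper_sum => k; exact: (cperM (cperM cm (cui k)) (cuik k)).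
have cQ : cper Q.
  apply: cperD; first exact: cperM.
  by apply: cper_sum => k; exact: (cperM cm (cperX 2 (cuik k))).
have dF x : is_derive x (basis_vec i) F (ts p (lap1 i z.1) x * @hj R d h V p q z x +
    @fpi R d p q z (ts q (lap1 i z.2)) (dts q (lap1 i z.2)) x + Q x).
  have d1 := is_derive_ts p z.1 i x; have d3 := is_derive_ts q z.2 i x.
  have dk k : is_derive x (basis_vec i) (dts q z.2 k) (d2ts q z.2 i k x).
    rewrite (_ : d2ts q z.2 i k x = d2ts q z.2 k i x); first exact: is_derive_dts.
    by rewrite /d2ts /tp /dtp /tl !big_map; apply: eq_bigr => j _ /=; ring.
  have dik k : is_derive x (basis_vec i) (d2ts q z.2 i k) (dts q (lap1 i z.2) k x) by rewrite dts_lap1; exact: is_derive_tp.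
  have dmi := is_derive_dts p z.1 i i x; have dui := is_derive_dts q z.2 i i x.
  have dsq k : is_derive x (basis_vec i) (fun y => dts q z.2 k y ^+ 2) (2 * dts q z.2 k x * d2ts q z.2 i k x).
    by have := is_derive_powX 2 (dk k).
  have dS := is_derive_sum (fun k => dsq k).
  have dH : is_derive x (basis_vec i) (@hj R d h V p q z) (- dts q z.2 i x - (\sum_k 2 * dts q z.2 k x * d2ts q z.2 i k x) / 2 + w x).
    have dS2 := is_deriveM dS (is_derive_cst (2^-1 : R) x (basis_vec i)).
    have := is_deriveD (is_deriveB (is_deriveN d3) dS2) (hw x).
    rewrite (_ : _ + W = @hj R d h V p q z); last first.
      by apply/funext => y; rewrite /hj !fctE fct_sumE.
    move=> D; apply: (is_derive_eq D); rewrite /GRing.scale/= mulr0 add0r; congr (_ - _ + _).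
    by rewrite mulrC.
  have dP k := is_deriveM (is_deriveM d1 (dk k)) (dik k).
  have := is_deriveD (is_deriveD (is_deriveM dmi dH) (is_deriveM (is_deriveB d1 (is_derive_cst (1 : R) x (basis_vec i))) dui)) (is_derive_sum dP).
  rewrite (_ : _ + _ = F); last by apply/funext => y; rewrite /F !fctE fct_sumE.
  move=> D; apply: (is_derive_eq D); rewrite /GRing.scale/= /Q /fpi !ts_lap1.
  pose T := \sum_k dts q z.2 k x * d2ts q z.2 i k x.
  have -> : \sum_k 2 * dts q z.2 k x * d2ts q z.2 i k x = 2 * T.
    by rewrite /T mulr_sumr; apply: eq_bigr => k _; rewrite mulrA.
  set L := \sum_i0 (_ * _ + _).
  have -> : L = \sum_k ts p z.1 x * dts q z.2 k x * dts q (lap1 i z.2) k x +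
      \sum_k m x * d2ts q z.2 i k x ^+ 2 + dts p z.1 i x * T.
    rewrite /L /T mulr_sumr -!big_split/=; apply: eq_bigr => k _; rewrite !fctE /m; ring.
  by rewrite (_ : (ts p z.1 - cst 1) x = ts p z.1 x - 1)//; field.
have I0 := integral_partial0 (proj1 cF) (cperD cI cQ) dF.
have iQ := cper_itg cQ; have iI := cper_itg cI.
rewrite (integralD_R iI iQ) in I0.
have EQ : \int[mu]_x Q x = \int[mu]_x (dts p z.1 i x * w x) + \sum_k \int[mu]_x (m x * d2ts q z.2 i k x ^+ 2).
  have i1 := cper_itg (cperM cmi cw); have ik k := cper_itg (cperM cm (cperX 2 (cuik k))).
  by rewrite -(integral_sum_R _ ik) -(integralD_R i1 (itg_sum _ ik)).
by rewrite -EQ -I0 lerDr; exact: H.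
Qed.

End second_order.

Section second_order_bounds.
Context {R : realType} {d : nat} {E : set R} {h : ('rV[R]_d -> R) -> 'rV[R]_d -> R}
  {g g1 g2 V : 'rV[R]_d -> R -> R -> R} {al ka : R}.
Context (A : assumptions E h g g1 g2 V al ka).
Local Notation Rd := 'rV[R]_d.
Local Notation mu := (@torus_measure R d).

(** Summing [lev_second] over i bounds the pairing of the gradients of V and m from above, and (V2)
    bounds it from below. Both terms of the conclusion are nonnegative, so each is bounded. *)
Lemma level_second p q (rho rho' r : R) z : 0 < r -> @gsol R d h V p q rho rho' r z ->
  \int[mu]_x (ts p z.1 x `^ (al - 1) * \sum_i dts p z.1 i x ^+ 2) <= ka ^+ 2 /\
  \sum_i \sum_k \int[mu]_x (ts p z.1 x * d2ts q z.2 i k x ^+ 2) <= ka.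
Proof.
move=> r0 S; have Em := lev_E A r0 S; have m0 := lev_gt0 r0 S.
have [_ ka0 _ /(_ (ts p z.1))] := asV2 A.
have cE : CinfE E (ts p z.1) := conj (Cinf_tp (tl p z.1)) Em.
have [w cw hw] : exists2 w : 'I_d -> Rd -> R, forall i, cper (w i) &
    forall i x, is_derive x (basis_vec i) (along V h (ts p z.1)) (w i x).
  have /choice[w hw] i : exists w : Rd -> R, cper w /\ forall x, is_derive x (basis_vec i) (along V h (ts p z.1)) (w x).
    by have [w c1 c2] := lev_W_C1 A r0 S i; exists w.
  by exists w => i; case: (hw i).
move=> /(_ cE).
have pE i x : partial [:: i] (along V h (ts p z.1)) x = w i x by exact: derive_val.
have qE i x : partial [:: i] (ts p z.1) x = dts p z.1 i x by rewrite /ts partial_tp.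
rewrite (_ : \int[mu]_x (\sum_(i < d) _) = \sum_i \int[mu]_x (dts p z.1 i x * w i x)); last first.
  rewrite -(integral_sum_R _ (fun i => cper_itg (cperM (cper_dts p z.1 i) (cw i)))).
  by apply: eq_Rintegral => x _; apply: eq_bigr => i _; rewrite pE qE mulrC.
rewrite (_ : \int[mu]_x (_ * \sum_(i < d) _) = \int[mu]_x (ts p z.1 x `^ (al - 1) * \sum_i dts p z.1 i x ^+ 2)); last first.
  by apply: eq_Rintegral => x _; congr (_ * _); apply: eq_bigr => i _; rewrite qE.
have : \sum_i \int[mu]_x (dts p z.1 i x * w i x) + \sum_i \sum_k \int[mu]_x (ts p z.1 x * d2ts q z.2 i k x ^+ 2) <= 0.
  by rewrite -big_split/=; apply: sumr_le0 => i _; exact: (lev_second A r0 S (cw i) (hw i)).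
have : 0 <= \sum_i \sum_k \int[mu]_x (ts p z.1 x * d2ts q z.2 i k x ^+ 2).
  by do 2![apply: sumr_ge0 => ? _]; apply: integral_ge0_R => x; rewrite mulr_ge0 ?sqr_ge0// ltW.
have : 0 <= \int[mu]_x (ts p z.1 x `^ (al - 1) * \sum_i dts p z.1 i x ^+ 2).
  by apply: integral_ge0_R => x; rewrite mulr_ge0 ?powR_ge0// sumr_ge0// => i _; exact: sqr_ge0.
set X := \int[mu]_x _; set Y := \sum_i \sum_k _; set Z := \sum_i _ => X0 Y0 YZ XZ.
have k0 : 0 <= ka^-1 * X by rewrite mulr_ge0// invr_ge0 ltW.
have X1 : ka^-1 * X <= ka by lra.
split; last by lra.
by rewrite mulrC ler_pdivrMr// -expr2 in X1.
Qed.

End second_order_bounds.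

Lemma is_derive_compR {R : realType} {d : nat} (F : R -> R) (f : 'rV[R]_d -> R) x v df dF :
  is_derive x v f df -> is_derive (f x) (1 : R) F dF -> is_derive x v (fun y => F (f y)) (dF * df).
Proof.
move=> hf hF; apply: is_derive_line.
have h1 : is_derive (0 : R) (1 : R) (fun s : R => f (x + (s * 1) *: v)) (1 * df).
  by apply: is_derive_along_line; rewrite mul0r scale0r addr0.
have h2 : is_derive (f (x + (0 * 1) *: v)) (1 : R) F dF by rewrite mul0r scale0r addr0.
have h12 := @is_derive1_comp R F (fun s : R => f (x + (s * 1) *: v)) 0 _ _ h2 h1.
rewrite mul1r in h12; move: h12; congr (is_derive _ _ _ _).
by apply/funext => t /=; rewrite mulr1 addrC.
Qed.

Lemma young_bound {R : realFieldType} (k a b c : R) : `|a| ^+ 2 <= k -> a * b * c <= 2^-1 * (b ^+ 2 + k * c ^+ 2).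
Proof.
rewrite real_normK ?num_real// => ak; have := ler_wpM2r (sqr_ge0 c) ak.
have := sqr_ge0 (b - a * c); rewrite sqrrB exprMn; lra.
Qed.

Lemma sum_le_of_differences {R : realFieldType} (a b c a' b' c' : R) :
  a - b <= c -> a' - b' <= c' -> a + a' <= b + b' + c + c'.
Proof. by move=> h1 h2; lra. Qed.

Lemma log_bound_combine {R : realFieldType} (a b c e f x y z : R) :
  a + b <= e + 2^-1 * (1 + f) + c -> c <= x -> - y <= b -> e <= z -> f <= 1 -> a <= z + 1 + x + y.
Proof. by move=> h1 h2 h3 h4 h5; lra. Qed.

Lemma mass_young {R : realFieldType} (a b : R) : 0 <= a -> b * a <= 2^-1 * (a + a * b ^+ 2).
Proof. by move=> a0; have := mulr_ge0 a0 (sqr_ge0 (b - 1)); rewrite sqrrB1; lra. Qed.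

Section kernel_coefficients.
Context {R : realType} {d : nat}.
Local Notation Rd := 'rV[R]_d.
Local Notation mu := (@torus_measure R d).
Local Notation itg f := (mu.-integrable setT (EFin \o f)).
Implicit Types (f g : Rd -> R) (x : Rd).

(** Because of this the degree q can be fixed before the function to be convolved is known. *)
Lemma pbound_KKl n f f' : pbound (KKl n f) = pbound (KKl n f').
Proof. by rewrite /pbound /KKl !big_cat !big_map. Qed.

Lemma wt_KKl n f (L : R) : measurable_fun setT f -> (forall x, `|f x| <= L) ->
  wt (KKl n f) <= \sum_(e <- @KL R d n) `|e.1| * (2 * L).
Proof.
move=> mf fL.
have hfc b k : `|fc f b k| <= L.
  apply: integral_abs_bnd; first exact: (measurable_funM (cper_mf (cper_md b k)) mf).
  by move=> x; rewrite normrM; apply: le_trans (fL x); rewrite ler_piMl// md_bnd.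
rewrite /wt /KKl big_cat/= !big_map -big_split/=; apply: ler_sum => e _.
by rewrite !normrM -mulrDr ler_wpM2l// mulr_natl mulr2n lerD.
Qed.

Lemma dtp_KKl n f g i x : cper f -> cper g -> (forall x, is_derive x (basis_vec i) f (g x)) ->
  tp (dtp (basis_vec i) (KKl n f)) x = KK n g x.
Proof.
move=> cf cg df.
have h1 := is_derive_KK n x (cper_itg cf) (cper_itg cg) (weak_d_smooth cf cg df).
have h2 := is_derive_tp (KKl n f) x (basis_vec i).
by rewrite -(KK_tp n (cper_itg cf)) in h2; rewrite -(@derive_val _ _ _ _ _ _ _ h1) (@derive_val _ _ _ _ _ _ _ h2).
Qed.

(** A coefficient box in a fixed finite-dimensional space bounds all derivatives uniformly. *)
Lemma tl_deriv_bound p (rho : R) (vs : seq Rd) : exists2 M : R, 0 <= M & forall c x,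
  (forall j, `|c j| <= rho) -> `|tp (foldr (@dtp R d) (tl p c) vs) x| <= M.
Proof.
have [b [f hbf]] : exists (b : nat -> R) (f : nat -> bool * 'rV[int]_d), forall c,
    foldr (@dtp R d) (tl p c) vs = [seq (c j * b j, f j) | j <- iota 0 p].
  elim: vs => [|v vs [b [f IH]]] /=.
    by exists (fun=> 1), (@mode d) => c; apply: eq_map => j; rewrite mulr1.
  exists (fun j => b j * (msgn (f j).1 * ang (f j).2 v)), (fun j => (~~ (f j).1, (f j).2)) => c.
  by rewrite IH /dtp -map_comp; apply: eq_map => j /=; rewrite -!mulrA.
exists (\sum_(j <- iota 0 p) `|rho| * `|b j|); first by apply: sumr_ge0 => j _; rewrite mulr_ge0.
move=> c x hc; rewrite hbf /tp big_map; apply: le_trans (ler_norm_sum _ _ _) _.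
apply: ler_sum => j _ /=; rewrite !normrM; apply: (@le_trans _ _ (`|c j| * `|b j|)).
  by rewrite ler_piMr// md_bnd.
by rewrite ler_wpM2r// (le_trans (hc j))// ler_norm.
Qed.

Lemma ln_bound (r M t : R) : 0 < r -> r <= t -> t <= M -> `|ln t| <= `|ln r| + M.
Proof.
move=> r0 rt tM; have t0 := lt_le_trans r0 rt.
have M0 : 0 <= M := le_trans (ltW t0) tM.
rewrite ler_norml; apply/andP; split.
  have : ln r <= ln t by rewrite ler_ln.
  by have := ler_norm (- ln r); rewrite normrN; lra.
by have := ln_sublinear t0; have := normr_ge0 (ln r); lra.
Qed.

Lemma ln_derivatives p c (r M : R) : 0 < r -> (forall x : Rd, r <= ts p c x) ->
  (forall x : Rd, [/\ `|ts p c x| <= M, forall i, `|dts p c i x| <= M & forall i k, `|d2ts p c i k x| <= M]) ->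
  [/\ cper (fun x : Rd => ln (ts p c x)), forall i, cper (fun x : Rd => dts p c i x / ts p c x),
    forall i x, is_derive x (basis_vec i) (fun x : Rd => ln (ts p c x)) (dts p c i x / ts p c x) &
    forall i k, exists f : Rd -> R, [/\ cper f,
      forall x, is_derive x (basis_vec k) (fun x : Rd => dts p c i x / ts p c x) (f x) &
      forall x, `|f x| <= M / r + (M / r) ^+ 2]].
Proof.
move=> r0 rm bM; have m0 x : 0 < ts p c x := lt_le_trans r0 (rm x).
have cm : cper (@ts R d p c) := cper_ts p c.
have cV : cper (fun x : Rd => (ts p c x)^-1).
  by apply: (@cper_comp _ _ GRing.inv _ cm) => x; apply: inv_continuous; rewrite gt_eqF.
have dV k x : is_derive x (basis_vec k) (fun x : Rd => (ts p c x)^-1) (- (ts p c x) ^- 2 * dts p c k x).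
  have [dv de] := is_derive_ts p c k x.
  apply: DeriveDef; first by apply: derivableV => //; rewrite gt_eqF.
  by rewrite deriveV ?gt_eqF// de.
split.
- by apply: (@cper_comp _ _ (@ln R) _ cm) => x; exact: continuous_ln.
- by move=> i; exact: (cperM (cper_dts p c i) cV).
- by move=> i x; rewrite mulrC; exact: (is_derive_compR (is_derive_ts p c i x) (is_derive1_ln (m0 x))).
move=> i k; exists (fun x : Rd => d2ts p c i k x * (ts p c x)^-1 - dts p c i x * dts p c k x * (ts p c x)^-1 ^+ 2); split.
- exact: (cperB (cperM (cper_d2ts p c i k) cV) (cperM (cperM (cper_dts p c i) (cper_dts p c k)) (cperX 2 cV))).
- move=> x; have D := is_deriveM (is_derive_dts p c i k x) (dV k x); apply: (is_derive_eq D).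
  by rewrite /GRing.scale/= exprVn; ring.
move=> x; have [_ b1 b2] := bM x.
have Vr : `|(ts p c x)^-1| <= r^-1 by rewrite ger0_norm ?lef_pV2 ?posrE ?m0// invr_ge0 ltW.
apply: le_trans (ler_normB _ _) _; apply: lerD; first by rewrite normrM ler_pM.
by rewrite !normrM exprMn !expr2; do ![apply: ler_pM => //|rewrite mulr_ge0//].
Qed.

End kernel_coefficients.

(** * The logarithmic test *)

Section log_test.
Context {R : realType} {d : nat} {E : set R} {h : ('rV[R]_d -> R) -> 'rV[R]_d -> R}
  {g g1 g2 V : 'rV[R]_d -> R -> R -> R} {al ka : R}.
Context (A : assumptions E h g g1 g2 V al ka).
Local Notation Rd := 'rV[R]_d.
Local Notation mu := (@torus_measure R d).
Local Notation itg f := (mu.-integrable setT (EFin \o f)).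

(** C is uniform, whereas [q0] and [rho0] depend on the data of m: the kernel index n is fixed by
    the uniform derivative bounds of [ln m] on the feasible set, and q and rho' must admit its
    convolution as a test. Since m times the gradient of [ln m] is the gradient of m, the coupling
    term becomes the integral of Du.Dm, which the bound on m|D^2 u|^2 controls. *)
Lemma level_log : exists2 C : R, 0 <= C & forall p rho r, exists (q0 : nat) (rho0 : R),
  forall q rho' z, (q0 <= q)%N -> rho0 <= rho' -> @small_level R d h V p q rho rho' r z ->
  \int[mu]_x ((ts p z.1 x - 1) * ln (ts p z.1 x)) <= C.
Proof.
have h13 : 1 <= 3 / 2 :> R by lra.
have h12 : 1 / 2 <= 1 :> R by lra.
have [C1 C10 hC] := level_bounds A; have ka0 := ka_gt0 A.
exists (C1 + 1 + (C1 + d%:R) / 2 + (d%:R * C1 + ka) / 2).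
  by rewrite !addr_ge0// divr_ge0// addr_ge0// ?mulr_ge0// ltW.
move=> p rho r.
have [r0|r0] := leP r 0; first by exists 0%N, 0 => q rho' z _ _ [/andP[]]; rewrite ltNge r0.
have [M1 M10 hM1] := @tl_deriv_bound R d p rho [::].
have /choice[M2 hM2] i : exists M : R, 0 <= M /\ forall c x, (forall j, `|c j| <= rho) -> `|@dts R d p c i x| <= M.
  by have [M hM0 hM] := @tl_deriv_bound R d p rho [:: basis_vec i]; exists M.
have /choice[M3 hM3] (ik : 'I_d * 'I_d) : exists M : R, 0 <= M /\ forall c x, (forall j, `|c j| <= rho) -> `|@d2ts R d p c ik.1 ik.2 x| <= M.
  by have [M hM0 hM] := @tl_deriv_bound R d p rho [:: basis_vec ik.2; basis_vec ik.1]; exists M.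
pose M := M1 + \sum_i M2 i + \sum_ik M3 ik.
have S20 : 0 <= \sum_i M2 i by apply: sumr_ge0 => i _; case: (hM2 i).
have S30 : 0 <= \sum_i M3 i by apply: sumr_ge0 => i _; case: (hM3 i).
have M0 : 0 <= M by rewrite !addr_ge0.
have bM c : (forall j, `|c j| <= rho) -> forall x, [/\ `|@ts R d p c x| <= M, forall i, `|@dts R d p c i x| <= M & forall i k, `|@d2ts R d p c i k x| <= M].
  move=> hc x; split=> [|i|i k].
  - by apply: le_trans (hM1 c x hc) _; rewrite /M -addrA lerDl addr_ge0.
  - apply: le_trans ((hM2 i).2 c x hc) _; rewrite /M -addrA addrCA -[leLHS]addr0.
    apply: lerD; last by rewrite addr_ge0.
    by rewrite (bigD1 i)//= lerDl sumr_ge0// => j _; case: (hM2 j).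
  - apply: le_trans ((hM3 (i, k)).2 c x hc) _; rewrite /M -[leLHS]add0r.
    apply: lerD; first by rewrite addr_ge0.
    by rewrite (bigD1 (i, k))//= lerDl sumr_ge0// => j _; case: (hM3 j).
pose N := M / r + (M / r) ^+ 2.
have Mr0 : 0 <= M / r by rewrite divr_ge0// ltW.
have N0 : 0 <= N by rewrite addr_ge0// exprn_ge0.
pose G := d%:R * N ^+ 2.
have G0 : 0 <= G by rewrite mulr_ge0// exprn_ge0.
(* With [e = 1 / (2 K)], both parts of the rate are at most e, so the squared error of the
   convolution multiplied by [(M + 1)^2] is at most 1. *)
pose K := (M + 1) ^+ 2 * (G + 1).
have M1gt : 0 < (M + 1) ^+ 2 by rewrite exprn_gt0// ltr_wpDl.
have K0 : 0 < K by rewrite mulr_gt0// ltr_wpDl.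
pose e := (2 * K)^-1.
have e0 : 0 < e by rewrite invr_gt0 mulr_gt0.
have [Cr Cr0 rate] := @KK_L2_rate R d e e0.
have [n hn] := nS_inv_small Cr e0; have {}hn := hn n (leqnn n).
have apx w (gw : 'I_d -> Rd -> R) : cper w -> (forall i, cper (gw i)) ->
    (forall i x, is_derive x (basis_vec i) w (gw i x)) -> (forall i x, `|gw i x| <= N) ->
    (M + 1) ^+ 2 * \int[mu]_x (w x - KK n w x) ^+ 2 <= 1.
  move=> cw cg dw bg; have := rate n w gw cw cg dw.
  have hG : \sum_i \int[mu]_x gw i x ^+ 2 <= G.
    rewrite /G -[X in X%:R * _](card_ord d) -sum1_card natr_sum mulr_suml; apply: ler_sum => i _; rewrite mul1r.
    apply: integral_le_bnd; first exact: (cper_itg (cperX 2 (cg i))).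
    by move=> x; rewrite -real_normK ?num_real// ler_sqr ?nnegrE.
  have hG0 : 0 <= \sum_i \int[mu]_x gw i x ^+ 2.
    by apply: sumr_ge0 => i _; apply: integral_ge0_R => x; exact: sqr_ge0.
  move: (\int[mu]_x _) (\sum_i _) hG hG0 => X Y hG hG0 XY.
  have X2 : X <= K^-1 * (G + 1).
    have eC0 : 0 <= e + Cr / n.+1%:R := addr_ge0 (ltW e0) (divr_ge0 Cr0 (ler0n _ _)).
    apply: le_trans XY _; apply: ler_pM => //; last by rewrite (le_trans hG)// lerDl.
    by apply: (@le_trans _ _ (e + e)); [rewrite lerD2l|rewrite /e invfM -mulr2n -[_ *+ 2]mulr_natl mulrA divff ?mul1r].
  apply: (@le_trans _ _ ((M + 1) ^+ 2 * (K^-1 * (G + 1)))); first by rewrite ler_wpM2l// ltW.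
  by rewrite mulrCA mulVf// gt_eqF.
pose L := `|ln r| + M; have L0 : 0 <= L by rewrite addr_ge0.
pose B := \sum_(e <- @KL R d n) `|e.1| * (2 * L) + 1.
have B0 : 0 < B by rewrite ltr_wpDl// sumr_ge0// => ? _; rewrite mulr_ge0// mulr_ge0.
exists (pbound (@KKl R d n (fun=> 0))), B => q rho' z qq rr SL.
have [/andP[_ r1] rho1 rho'0 pp S] := SL.
have [b1 b2 b3 [b4 b5 b6 b7]] := hC _ _ _ _ _ _ SL.
have rho11 : 1 <= rho := le_trans h13 rho1.
have rle1 : r <= 1 := le_trans r1 h12.
have rho'gt : 0 < rho' := lt_le_trans B0 rr.
have [[f1 f2 f3] _] := S.
have bz := bM _ f1.
set m : Rd -> R := ts p z.1.
have m0 x : 0 < m x := lt_le_trans r0 (f3 x).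
have [cf cfi df dfi] := ln_derivatives r0 f3 bz.
set f := (fun x => ln (m x)) in cf df; set fi := fun i x => dts p z.1 i x / m x.
have [cm cS] : cper m /\ cper (sqd q z : Rd -> R) by split; [exact: cper_ts|exact: lev_cS].
have bf x : `|f x| <= L by apply: ln_bound r0 (f3 x) _; apply: le_trans (ler_norm _) _; case: (bz x).
have bfi i x : `|fi i x| <= N.
  rewrite /fi normrM; apply: (@le_trans _ _ (M / r)); last by rewrite lerDl exprn_ge0.
  by apply: ler_pM => //; [case: (bz x)|rewrite ger0_norm ?lef_pV2 ?posrE ?m0 ?f3// invr_ge0 ltW].
have a1 := apx f fi cf cfi df bfi.
have a2 i : (M + 1) ^+ 2 * \int[mu]_x (fi i x - KK n (fi i) x) ^+ 2 <= 1.
  have /choice[gk hk] k := dfi i k.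
  by apply: (apx _ gk (cfi i)) => k; case: (hk k).
have := lev_fp A r0 pp S rho11 rle1 B0 rho'gt (b := KKl n f).
have wb : wt (KKl n f) <= B by apply: le_trans (wt_KKl n (cper_mf cf) bf) _; rewrite lerDl.
move=> /(_ wb); rewrite (pbound_KKl n f (fun=> 0)) => /(_ qq).
rewrite /fpint (_ : (fun i => tp (dtp _ _)) = fun i => KK n (fi i)); last first.
  by apply/funext => i; apply/funext => x; exact: (dtp_KKl n x cf (cfi i) (df i)).
rewrite -(KK_tp n (cper_itg cf)) => FP.
have {}FP : \int[mu]_x @fpi R d p q z (KK n f) (fun i => KK n (fi i)) x <= C1.
  apply: le_trans (ler_norm _) (le_trans FP _).
  have t0 : 0 <= B / rho' by rewrite divr_ge0// ltW.
  have t1 : B / rho' <= 1 by rewrite ler_pdivrMr// mul1r.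
  apply: (@le_trans _ _ (C1 * (B / rho'))); last by rewrite ler_piMr.
  by rewrite ler_wpM2r// lerNl.
have cKf := cper_KK n (cper_itg cf); have cKfi i := cper_KK n (cper_itg (cfi i)).
have cui (i : 'I_d) := cper_dts q z.2 i; have cmi (i : 'I_d) := cper_dts p z.1 i.
pose err x := (f x - KK n f x) ^+ 2; pose erri i x := (fi i x - KK n (fi i) x) ^+ 2.
have ierr := cper_itg (cperX 2 (cperB cf cKf)) : itg err.
have ierri i := cper_itg (cperX 2 (cperB (cfi i) (cKfi i))) : itg (erri i).
pose k := (M + 1) ^+ 2.
have am x : `|m x| <= M by case: (bz x).
(* Replacing [ln m] and its gradient by their convolutions costs Young terms: m is bounded by M, so
   the squared errors carry the weight k that [apx] has made harmless. *)
have low x : (m x - 1) * f x + \sum_i dts q z.2 i x * dts p z.1 i x <=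
    @fpi R d p q z (KK n f) (fun i => KK n (fi i)) x + 2^-1 * (1 + k * err x) +
    \sum_i 2^-1 * (dts q z.2 i x ^+ 2 + k * erri i x).
  have s1 : (m x - 1) * (f x - KK n f x) <= 2^-1 * (1 + k * err x).
    have := @young_bound _ k (m x - 1) 1 (f x - KK n f x); rewrite mulr1 expr1n; apply.
    rewrite /k ler_sqr ?nnegrE// ?addr_ge0//.
    by apply: le_trans (ler_normB _ _) _; rewrite normr1 lerD2r.
  have s2 i : dts q z.2 i x * dts p z.1 i x - m x * dts q z.2 i x * KK n (fi i) x <= 2^-1 * (dts q z.2 i x ^+ 2 + k * erri i x).
    have e1 : dts p z.1 i x = m x * fi i x by rewrite /fi mulrC divfK// gt_eqF.
    rewrite e1 (_ : _ - _ = m x * dts q z.2 i x * (fi i x - KK n (fi i) x)); last by ring.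
    by apply: young_bound; rewrite /k ler_sqr ?nnegrE ?addr_ge0// (le_trans (am x))// lerDl.
  have S2 := ler_sum (index_enum 'I_d) (P := xpredT) (fun i _ => s2 i); rewrite sumrB in S2.
  rewrite /fpi -/m; move: s1 S2; rewrite mulrBr.
  exact: sum_le_of_differences.
have i1 := cper_itg (cperM (cperB cm (cper_cst 1)) cf).
have i2 i := cper_itg (cperM (cui i) (cmi i)).
have i3 := cper_itg (@cper_fpi R d p q z _ _ cKf cKfi).
have i4 := itgZ 2^-1 (itgD (itg_cst 1) (itgZ k ierr)).
have iu i := cper_itg (cperX 2 (cui i)).
have i5 i := itgZ 2^-1 (itgD (iu i) (itgZ k (ierri i))).
have := integral_le_R (itgD i1 (itg_sum _ i2)) (itgD (itgD i3 i4) (itg_sum _ i5)) low.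
rewrite (integralD_R i1 (itg_sum _ i2)) (integral_sum_R _ i2) (integralD_R (itgD i3 i4) (itg_sum _ i5)).
rewrite (integralD_R i3 i4) (integral_sum_R _ i5) (integralZ_R _ (itgD (itg_cst 1) (itgZ k ierr))).
rewrite (integralD_R (itg_cst 1) (itgZ k ierr)) integral_cst_R (integralZ_R _ ierr) => INT.
have E2 : \sum_i \int[mu]_x (2^-1 * (dts q z.2 i x ^+ 2 + k * erri i x)) <= (C1 + d%:R) / 2.
  apply: (@le_trans _ _ (2^-1 * (\int[mu]_x sqd q z x + d%:R))); last by rewrite mulrC ler_wpM2r// lerD2r.
  have dE : d%:R = \sum_(i < d) 1 :> R by rewrite sumr_const card_ord.
  rewrite dE (integral_sum_R _ iu) -big_split/= mulr_sumr.
  apply: ler_sum => i _; rewrite (integralZ_R _ (itgD (iu i) (itgZ k (ierri i)))) ler_pM2l//.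
  by rewrite (integralD_R (iu i) (itgZ k (ierri i))) (integralZ_R _ (ierri i)) lerD2l; exact: a2.
(* Integrate by parts and split m d_i^2 u by Young's inequality into m and m times the square. *)
have E3 : - ((d%:R * C1 + ka) / 2) <= \sum_i \int[mu]_x (dts q z.2 i x * dts p z.1 i x).
  have [_ hk] := level_second A r0 S.
  have hk2 : \sum_i \int[mu]_x (m x * d2ts q z.2 i i x ^+ 2) <= ka.
    apply: le_trans hk; apply: ler_sum => i _; rewrite (bigD1 i)//= lerDl; apply: sumr_ge0 => j _.
    by apply: integral_ge0_R => x; rewrite mulr_ge0 ?sqr_ge0// ltW// m0.
  apply: (@le_trans _ _ (- (2^-1 * \sum_(i < d) (C1 + \int[mu]_x (m x * d2ts q z.2 i i x ^+ 2))))).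
    rewrite lerN2 [leLHS]mulrC ler_pM2r ?invr_gt0// big_split/= lerD//.
    by rewrite sumr_const card_ord mulr_natl.
  rewrite mulr_sumr -sumrN; apply: ler_sum => i _.
  have im := cper_itg cm; have im2 := cper_itg (cperM cm (cperX 2 (cper_d2ts q z.2 i i))).
  rewrite (integration_by_parts_torus (cui i) cm (cper_d2ts q z.2 i i) (cmi i)
    (fun x => is_derive_dts q z.2 i i x) (fun x => is_derive_ts p z.1 i x)) lerN2.
  apply: (@le_trans _ _ (2^-1 * (\int[mu]_x m x + \int[mu]_x (m x * d2ts q z.2 i i x ^+ 2)))); last first.
    by rewrite ler_pM2l// lerD2r.
  rewrite -(integralD_R im im2) -(integralZ_R _ (itgD im im2)).
  apply: (integral_le_R (cper_itg (cperM (cper_d2ts q z.2 i i) cm)) (itgZ _ (itgD im im2))) => x.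
  exact: mass_young (ltW (m0 x)).
have a1' : k * \int[mu]_x err x <= 1 := a1.
move: INT E2 E3 FP a1'; rewrite -/f.
set I1 := \int[mu]_x ((m x - 1) * f x); set I2 := \sum_i _; set I3 := \sum_i _.
set I4 := \int[mu]_x fpi _ _ _ _ _ _; set I5 := k * _; exact: log_bound_combine.
Qed.

End log_test.

Lemma sqr_le_add1 {R : realFieldType} (Y C : R) : Y ^+ 2 <= C -> Y <= 1 + C.
Proof. by move=> h; have := sqr_ge0 (Y - 1); have := sqr_ge0 Y; rewrite sqrrB1; lra. Qed.

(** * Approximate solutions of the full problem *)

Section approximation.
Context {R : realType} {d : nat} {E : set R} {h : ('rV[R]_d -> R) -> 'rV[R]_d -> R}
  {g g1 g2 V : 'rV[R]_d -> R -> R -> R} {al ka : R}.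
Local Notation Rd := 'rV[R]_d.
Local Notation mu := (@torus_measure R d).
Local Notation itg f := (mu.-integrable setT (EFin \o f)).
Implicit Types (a b : seq (R * (bool * 'rV[int]_d))) (x : Rd).

(** All that the passage to the limit uses; degrees and coefficients are forgotten, and the
    inequalities are stated for a fixed test and large n. *)
Record approximation (C : R) (m u : nat -> Rd -> R) (dm du : nat -> 'I_d -> Rd -> R)
    (W := fun n => along V h (m n)) (S := fun n x => \sum_i du n i x ^+ 2) := Approximation {
  ap_m : forall n, cper (m n);
  ap_u : forall n, cper (u n);
  ap_dm : forall n i, cper (dm n i);
  ap_du : forall n i, cper (du n i);
  ap_m' : forall n i x, is_derive x (basis_vec i) (m n) (dm n i x);
  ap_u' : forall n i x, is_derive x (basis_vec i) (u n) (du n i x);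
  ap_m0 : forall n x, 0 < m n x;
  ap_bm : forall n, \int[mu]_x m n x `^ (al + 1) <= C;
  ap_bmS : forall n, \int[mu]_x (m n x * S n x) <= C;
  ap_bS : forall n, \int[mu]_x S n x <= C;
  ap_bm1 : forall n, \int[mu]_x m n x <= C;
  ap_bu : forall n, \int[mu]_x u n x ^+ 2 <= C;
  ap_bdm : forall n, \int[mu]_x (m n x `^ (al - 1) * \sum_i dm n i x ^+ 2) <= C;
  ap_ln : forall n, \int[mu]_x ((m n x - 1) * ln (m n x)) <= C;
  ap_energy : forall n, \int[mu]_x (m n x * W n x) + 2^-1 * \int[mu]_x (m n x * S n x) <=
    \int[mu]_x u n x + C / n.+1%:R;
  ap_fp : forall b, \int[mu]_x ((m n x - 1) * tp b x + \sum_i m n x * du n i x * tp (dtp (basis_vec i) b) x)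
    @[n --> \oo] --> 0;
  ap_hj : forall a, (forall x, 0 <= tp a x) -> forall e : R, 0 < e -> exists N, forall n, (N <= n)%N ->
    - e <= \int[mu]_x (tp a x * (- u n x - S n x / 2 + W n x));
  ap_minty : forall a b (r : R), 0 < r -> (forall x, r <= tp a x) -> exists N, forall n, (N <= n)%N ->
    0 <= \int[mu]_x ((tp a x - m n x) *
        (- tp b x - (\sum_i tp (dtp (basis_vec i) b) x ^+ 2) / 2 + along V h (tp a) x) +
      ((tp a x - 1) * (tp b x - u n x) + \sum_i tp a x * tp (dtp (basis_vec i) b) x *
        (tp (dtp (basis_vec i) b) x - du n i x)))
}.

Context (A : assumptions E h g g1 g2 V al ka).

Lemma feasible_one p (rho rho' r : R) : (@pone R d <= p)%N -> 1 <= rho -> 0 <= rho' -> r <= 1 ->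
  @feasible R d p rho rho' r (coef (@cl R d 1), fun=> 0).
Proof.
move=> pp rh rh' r1; split=> [j|j|x] /=; first exact: coef1_le.
  by rewrite normr0.
by rewrite (ts_coef pp) tp_cl.
Qed.

Definition pN n : nat := (@pone R d + n)%N.
Definition rhoN n : R := n.+2%:R.
Definition rN n : R := n.+2%:R^-1.

Lemma level_sequence : exists2 C : R, 0 <= C & exists (q : nat -> nat) (rho' : nat -> R) z, forall n,
  [/\ @small_level R d h V (pN n) (q n) (rhoN n) (rho' n) (rN n) (z n), (n <= q n)%N, n.+1%:R <= rho' n &
   \int[mu]_x ((ts (pN n) (z n).1 x - 1) * ln (ts (pN n) (z n).1 x)) <= C].
Proof.
have [C C0 hC] := level_log A; exists C => //.
have : forall n, exists t : nat * R * ((nat -> R) * (nat -> R)),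
  [/\ @small_level R d h V (pN n) t.1.1 (rhoN n) t.1.2 (rN n) t.2, (n <= t.1.1)%N, n.+1%:R <= t.1.2 &
   \int[mu]_x ((ts (pN n) t.2.1 x - 1) * ln (ts (pN n) t.2.1 x)) <= C].
  move=> n; have [q0 [rho0 hq]] := hC (pN n) (rhoN n) (rN n).
  (* Large enough for the logarithmic test, and tending to infinity so that every test eventually
     becomes admissible. *)
  pose q := maxn q0 n; pose rho' := Num.max rho0 n.+1%:R.
  have r0 : 0 < rN n by rewrite invr_gt0.
  have r1 : rN n <= 1 / 2 by rewrite mul1r lef_pV2 ?posrE// ler_nat.
  have rh : 2 <= rhoN n by rewrite /rhoN ler_nat.
  have rh' : n.+1%:R <= rho' by rewrite /rho' le_max lexx orbT.
  have rh0 : 0 <= rho' by apply: le_trans rh'.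
  have pp : (@pone R d <= pN n)%N by rewrite leq_addr.
  have r11 : rN n <= 1 by lra.
  have rh11 : 1 <= rhoN n by lra.
  have fe := feasible_one pp rh11 rh0 r11.
  have [z hz] := galerkin_solution A q r0 fe.
  have SL : @small_level R d h V (pN n) q (rhoN n) rho' (rN n) z.
    split=> //; [by rewrite r0|lra].
  exists (q, rho', z) => /=; split=> //; first by rewrite leq_maxr.
  by apply: hq SL; [rewrite leq_maxl|rewrite le_max lexx].
move=> /choice[t ht]; exists (fun n => (t n).1.1), (fun n => (t n).1.2), (fun n => (t n).2) => n.
exact: ht.
Qed.

Lemma nS_inv_cvg0 (K : R) : K / n.+1%:R @[n --> \oo] --> 0.
Proof. by rewrite -[X in _ --> X](mulr0 K); apply: cvgM; [exact: cvg_cst|exact: cvg_harmonic]. Qed.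

Lemma approximation_exists : exists (C : R) m u dm du, 0 <= C /\ approximation C m u dm du.
Proof.
have [C1 C10 h1] := level_bounds A; have [C2 C20 [q [rho' [z hz]]]] := level_sequence.
have ka0 := ka_gt0 A.
pose C := C1 + C2 + ka ^+ 2 + (C1 + (1 + C1)).
have C3 : 0 <= ka ^+ 2 by exact: sqr_ge0.
have C0 : 0 <= C by rewrite !addr_ge0.
have CC1 : C1 <= C by rewrite /C; lra.
have CC2 : C2 <= C by rewrite /C; lra.
have CC3 : ka ^+ 2 <= C by rewrite /C; lra.
have CC4 : C1 + (1 + C1) <= C by rewrite /C; lra.
exists C, (fun n => ts (pN n) (z n).1), (fun n => ts (q n) (z n).2), (fun n => dts (pN n) (z n).1), (fun n => dts (q n) (z n).2).
have r0 n : 0 < rN n by rewrite invr_gt0.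
have SL n : @small_level R d h V (pN n) (q n) (rhoN n) (rho' n) (rN n) (z n) by case: (hz n).
have S n : @gsol R d h V (pN n) (q n) (rhoN n) (rho' n) (rN n) (z n) by case: (SL n).
have rho0' n : 0 < rho' n by case: (hz n) => _ _ + _; apply: lt_le_trans.
have pp n : (@pone R d <= pN n)%N by rewrite leq_addr.
have rh n : 2 <= rhoN n by rewrite /rhoN ler_nat.
have rle1 n : rN n <= 1 by rewrite invf_le1// ler1n.
have rh1 n : 1 < rhoN n by rewrite /rhoN ltr1n.
have Q n : - C1 <= @Q0 R d h V (pN n) (q n) (z n) by have [_ _ _ []] := h1 _ _ _ _ _ _ (SL n).
split=> //; split.
- by move=> n; exact: cper_ts.
- by move=> n; exact: cper_ts.
- by move=> n i; exact: cper_dts.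
- by move=> n i; exact: cper_dts.
- by move=> n i x; exact: is_derive_ts.
- by move=> n i x; exact: is_derive_ts.
- by move=> n x; exact: (lev_gt0 (r0 n) (S n)).
- by move=> n; apply: le_trans CC1; have [] := h1 _ _ _ _ _ _ (SL n).
- by move=> n; apply: le_trans CC1; have [] := h1 _ _ _ _ _ _ (SL n).
- by move=> n; apply: le_trans CC1; have [] := h1 _ _ _ _ _ _ (SL n).
- by move=> n; apply: le_trans CC1; have [_ _ _ []] := h1 _ _ _ _ _ _ (SL n).
- by move=> n; apply: le_trans CC1; have [_ _ _ []] := h1 _ _ _ _ _ _ (SL n).
- by move=> n; apply: le_trans CC3; have [] := level_second A (r0 n) (S n).
- by move=> n; apply: le_trans CC2; case: (hz n).
- move=> n.
  have [_ _ bS [_ bu _ bW]] := h1 _ _ _ _ _ _ (SL n).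
  (* The test is the smallest admissible constant [rN n]. The terms that carry this factor are of
     order [1 / n.+1], except one that is nonnegative and is dropped. *)
  have := lev_theta A (r0 n) (ltW (rho0' n)) (pp n) (S n) (lexx _) (le_trans (rle1 n) (ltW (rh1 n))).
  have S0 : 0 <= \int[mu]_x sqd (q n) (z n) x.
    by apply: integral_ge0_R => x; apply: sumr_ge0 => i _; exact: sqr_ge0.
  have hu : `|\int[mu]_x ts (q n) (z n).2 x| <= 1 + C1.
    have := L2_integral_norm (cper_L2 (@cper_ts R d (q n) (z n).2)).
    have := integral_abs_R (cper_itg (@cper_ts R d (q n) (z n).2)) => h2 h3.
    apply: le_trans h2 _; apply: sqr_le_add1; exact: le_trans h3 bu.
  have kr : rN n <= n.+1%:R^-1 by rewrite lef_pV2 ?posrE// ler_nat.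
  move: S0 bW hu; set D := \int[mu]_x sqd _ _ _; set IW := \int[mu]_x along _ _ _ _; set U := \int[mu]_x ts (q n) _ _.
  set X := \int[mu]_x _; set Y := \int[mu]_x _ => S0 bW hu key.
  have c1 : 0 <= rN n / 2 * D by rewrite mulr_ge0// divr_ge0// ltW.
  have c2 : rN n * (IW - U) <= C / n.+1%:R.
    apply: (@le_trans _ _ (rN n * C)); last by rewrite mulrC ler_wpM2l.
    rewrite ler_pM2l//; apply: le_trans (ler_norm _) _; apply: le_trans (ler_normB _ _) _.
    exact: le_trans (lerD bW hu) CC4.
  rewrite -/X -/Y; move: key c1 c2; rewrite mulrBl mul1r mulrBr.
  by move: (rN n * IW) (rN n * U) (rN n / 2 * D) (C / _) => k1 k2 k3 k4 key c1 c2; lra.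
- move=> b; apply/cvgr0Pnorm_le => e e0.
  have B0 : 0 < wt b + 1 by rewrite ltr_wpDl// wt_ge0.
  have [N hN] := nS_inv_small (C1 * (wt b + 1)) e0.
  exists (maxn N (pbound b)) => // n /=; rewrite geq_max => /andP[nN nb].
  have qb : (pbound b <= q n)%N by apply: leq_trans nb _; case: (hz n).
  apply: le_trans (hN n nN).
  apply: le_trans (lev_fp A (r0 n) (pp n) (S n) (ltW (rh1 n)) (rle1 n) B0 (rho0' n) _ qb) _.
    by rewrite lerDl.
  apply: (@le_trans _ _ (C1 * ((wt b + 1) / rho' n))).
    by apply: ler_wpM2r; [exact: divr_ge0 (ltW B0) (ltW (rho0' n))|rewrite lerNl].
  rewrite -mulrA ler_wpM2l// ler_pM2l// lef_pV2 ?posrE//; by case: (hz n).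
- move=> a a0 e e0.
  have B0 : 0 < wt a + 1 by rewrite ltr_wpDl// wt_ge0.
  have [N hN] := nS_inv_small (C1 * (wt a + 1)) e0.
  exists (maxn N (pbound a)) => n; rewrite geq_max => /andP[nN na].
  have pa : (pbound a <= pN n)%N by apply: leq_trans na _; rewrite leq_addl.
  have w1 : wt a <= wt a + 1 by rewrite lerDl.
  have K := lev_HJ A (r0 n) (ltW (rho0' n)) (pp n) (S n) (rh1 n) (rle1 n) B0 w1 pa a0.
  rewrite -[leRHS]/(\int[mu]_x (tp a x * @hj R d h V (pN n) (q n) (z n) x)); apply: le_trans K.
  have e1 : rhoN n - 1 = n.+1%:R by rewrite /rhoN -(natr1 n.+1) addrK.
  rewrite e1; apply: (@le_trans _ _ (- (C1 * (wt a + 1) / n.+1%:R))); first by rewrite lerN2 hN.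
  rewrite -mulrA -mulNr; apply: ler_wpM2r => //; by rewrite divr_ge0// ltW.
- move=> a b r rr ra.
  have [N1 hN1] := nS_inv_small (wt a + wt b) (@ltr01 R).
  have [N2 hN2] := nS_inv_small 1 rr.
  exists (maxn (maxn N1 N2) (maxn (pbound a) (pbound b))) => n.
  rewrite !geq_max => /andP[/andP[/hN1 {}hN1 /hN2 {}hN2] /andP[na nb]].
  rewrite ler_pdivrMr// mul1r in hN1.
  have pa : (pbound a <= pN n)%N by apply: leq_trans na _; rewrite leq_addl.
  have qb : (pbound b <= q n)%N by apply: leq_trans nb _; case: (hz n).
  have wb : wt b <= n.+1%:R by apply: le_trans hN1; rewrite lerDr wt_ge0.
  have wa : wt a <= n.+1%:R by apply: le_trans hN1; rewrite lerDl wt_ge0.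
  have fy : @feasible R d (pN n) (rhoN n) (rho' n) (rN n) (coef a, coef b).
    split=> [j|j|x] /=.
    - by apply: le_trans (coef_le _ _) _; apply: le_trans wa _; rewrite /rhoN ler_nat.
    - by apply: le_trans (coef_le _ _) _; apply: le_trans wb _; case: (hz n).
    - rewrite (ts_coef pa); apply: le_trans (ra x); apply: le_trans hN2.
      by rewrite mul1r lef_pV2 ?posrE// ler_nat.
  have [_ /(_ _ fy) opt] := S n.
  have Ez := lev_E A (r0 n) (S n).
  have Ey x : E (@ts R d (pN n) (coef a, coef b).1 x).
    by apply: (E_gt0 A); rewrite /= (ts_coef pa); apply: lt_le_trans (ra x).
  (* Monotonicity moves the operator from the solution to the fixed test, which is the form that
     survives weak limits. *)
  have := lform_monotone A (q n) Ey Ez => mono.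
  have {}mono : 0 <= @lform R d h V (pN n) (q n) (coef a, coef b) (coef a, coef b) - @lform R d h V (pN n) (q n) (coef a, coef b) (z n).
    by move: mono opt; move: (lform _ _ _ _) (lform _ _ _ _) (lform _ _ _ _) (lform _ _ _ _) => k1 k2 k3 k4; lra.
  apply: le_trans mono _; rewrite le_eqVlt; apply/orP; left; apply/eqP.
  rewrite /lform -(integralB_R (cper_itg (cper_lform A (q n) _ Ey)) (cper_itg (cper_lform A (q n) _ Ey))).
  apply: eq_Rintegral => x _; rewrite /hj /fpi /= (ts_coef pa) (ts_coef qb).
  have e1 i : dts (q n) (coef b) i = tp (dtp (basis_vec i) b) by rewrite (dts_coef _ qb).
  have e2 : \sum_i dts (q n) (coef b) i x ^+ 2 = \sum_i tp (dtp (basis_vec i) b) x ^+ 2.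
    by apply: eq_bigr => i _; rewrite e1.
  have e3 : \sum_i tp a x * dts (q n) (coef b) i x * dts (q n) (coef b) i x =
      \sum_i tp a x * tp (dtp (basis_vec i) b) x * (tp (dtp (basis_vec i) b) x - dts (q n) (z n).2 i x) +
      \sum_i tp a x * dts (q n) (coef b) i x * dts (q n) (z n).2 i x.
    by rewrite -big_split/=; apply: eq_bigr => i _; rewrite e1; ring.
  by rewrite e2 e3; ring.
Qed.

End approximation.

(** * Passage to the limit *)

Section limit_tools.
Context {R : realType} {d : nat}.
Local Notation Rd := 'rV[R]_d.
Local Notation mu := (@torus_measure R d).
Local Notation itg f := (mu.-integrable setT (EFin \o f)).
Implicit Types (f : Rd -> R) (x : Rd).

Lemma bounded_subseq (a : nat -> R) (B : R) : (forall n, `|a n| <= B) ->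
  exists (s : nat -> nat) (l : R), (forall k, (k <= s k)%N) /\ a (s k) @[k --> \oo] --> l.
Proof.
move=> aB; have [U UU oU] := @ultra_eventually.
have [l al _] := @ultra_bounded_cvg R _ U a B UU aB.
have : forall k, exists n, (k <= n)%N /\ `|l - a n| <= k.+1%:R^-1.
  move=> k; have k0 : 0 < k.+1%:R^-1 :> R by rewrite invr_gt0.
  have h1 : U [set n | `|l - a n| < k.+1%:R^-1] by move/cvgrPdist_lt : al => /(_ _ k0).
  have h2 : U [set n | (k <= n)%N] by apply: oU; exists k.
  have [n [/= n1 n2]] : [set n | `|l - a n| < k.+1%:R^-1] `&` [set n | (k <= n)%N] !=set0.
    by apply: (@filter_ex _ U); exact: filterI.
  by exists n; split=> //; exact: ltW.
move=> /choice[s hs]; exists s, l; split; first by move=> k; case: (hs k).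
apply/cvgrPdist_le => e e0; have [N hN] := nS_inv_small 1 e0.
by exists N => // k /hN; rewrite mul1r; apply: le_trans; case: (hs k).
Qed.

Lemma ae_open_cube : {ae mu, forall x, forall i, 0 < x ord0 i < 1}.
Proof.
apply: filter_forall => i.
pose f (t : R) : R := \1_(~` [set t : R | 0 < t < 1]) t.
have mD : measurable [set t : R | 0 < t < 1].
  by rewrite (_ : [set t : R | _] = `]0, 1[%classic) ?measurable_itv//; apply/seteqP; split=> t; rewrite /= in_itv.
have mf : measurable_fun setT f by apply: measurable_indic; exact: measurableC.
have bf t : `|f t| <= 1 by rewrite /f indicE; case: (_ \in _); rewrite ?normr1 ?normr0.
have i1 : itg (fun x => f (x ord0 i)).
  by apply: (itg_bnd (B := 1)) => //; exact: (measurableT_comp mf (measurable_coord i)).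
have z : \int[mu]_x f (x ord0 i) <= 0.
  have e0 := @integral_cst_R _ _ R (uniform_prob (@ltr01 R)) 0.
  rewrite (integral_coord i mf bf) -[leRHS]e0 le_eqVlt; apply/orP; left; apply/eqP.
  have H := @integral_aeeq _ _ R (uniform_prob (@ltr01 R)) f (fun=> 0) mf (measurable_cst _).
  apply: H.
  apply: (@filterS _ _ (ae_filter_ringOfSetsType (uniform_prob (@ltr01 R))) _ _ _ (@ae_unif_oo R)) => t t01.
  by rewrite /f indicE memNset//; apply.
apply: filterS (integral_eq0_ae i1 _ z); last by apply: aeW => x; rewrite /f indicE.
move=> x; rewrite /f indicE => /eqP; case: (boolP (_ \in _)) => [|/negP]; first by rewrite oner_eq0.
by move=> H _; apply: contrapT => nx; apply: H; rewrite mem_set.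
Qed.

Lemma ae_frac_id : {ae mu, forall x, frac x = x}.
Proof.
apply: filterS ae_open_cube => x hx; apply/rowP => i; rewrite mxE.
have -> : Num.floor (x ord0 i) = 0 by apply/floor_def; rewrite add0r; have /andP[h1 h2] := hx i; rewrite (ltW h1).
by rewrite subr0.
Qed.

Lemma measurable_frac : measurable_fun setT (@frac R d).
Proof.
apply: measurable_fun_rowP => i; rewrite (_ : (fun x => _) = fun x => x ord0 i - (Num.floor (x ord0 i))%:~R).
  apply: measurable_funB; first exact: measurable_coord.
  rewrite [X in measurable_fun _ X](_ : _ = (fun z : int => z%:~R : R) \o (fun x : Rd => Num.floor (x ord0 i)))//.
  apply: measurable_countable_factor => z.
  have := measurable_coord i measurableT (@measurable_floorM R 1 z).
  by rewrite setTI; congr (measurable _); apply/seteqP; split=> x /=; rewrite mul1r.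
by apply/funext => x; rewrite mxE.
Qed.

(** A.e. limits are merely measurable, while [L1] asks for exact periodicity. Composition with
    [frac] repairs this on a null set, since the measure lives on the unit cube. *)
Lemma periodic_representative f : measurable_fun setT f ->
  [/\ periodic (f \o @frac R d), measurable_fun setT (f \o @frac R d) & {ae mu, forall x, f (frac x) = f x}].
Proof.
move=> mf; split; [exact: frac_periodic|exact: (measurableT_comp mf measurable_frac)|].
by apply: filterS ae_frac_id => x ->.
Qed.

(** The cutoff vanishes for t above a. Below a it is at most 1, [- ln a <= - ln t], and the
    remaining inequality says that [t ln t >= -1]. *)
Lemma log_cutoff (t a : R) : 0 < t -> 0 < a < 1 -> Num.max 0 (1 - t / a) * - ln a <= (t - 1) * ln t + 1.
Proof.
move=> t0 /andP[a0 a1].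
have la : 0 <= - ln a by rewrite oppr_ge0 ln_le0// ltW.
have h0 : 0 <= (t - 1) * ln t.
  have [t1|t1] := leP 1 t; first by rewrite mulr_ge0 ?subr_ge0// ln_ge0.
  by rewrite -mulrNN mulr_ge0// oppr_ge0 ?subr_le0 ?ln_le0// ltW.
have [ta|ta] := leP a t.
  rewrite (_ : Num.max _ _ = 0); first by rewrite mul0r addr_ge0.
  by apply/max_idPl; rewrite subr_le0 ler_pdivlMr// mul1r.
have t1 : t < 1 by apply: lt_trans a1.
have mx : Num.max 0 (1 - t / a) <= 1.
  by rewrite ge_max ler01/= lerBlDr lerDl divr_ge0// ltW.
apply: (@le_trans _ _ (- ln t)).
  apply: (@le_trans _ _ (- ln a)); first by rewrite ler_piMl.
  by rewrite lerN2 ler_ln// ltW.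
have : ln t^-1 <= t^-1 by apply/ltW/ln_sublinear; rewrite invr_gt0.
rewrite lnV ?posrE// => /(ler_wpM2l (ltW t0)); rewrite divff ?gt_eqF// mulrN mulrBl mul1r; lra.
Qed.

(* Integrating [log_cutoff] with [a = exp (- n)] bounds the measure of [l <= 0] by [(C + 1) / n]. *)
Lemma ae_limit_gt0 (m : nat -> Rd -> R) (l : Rd -> R) (C : R) : (forall n, cper (m n)) -> (forall n x, 0 < m n x) ->
  (forall n, \int[mu]_x ((m n x - 1) * ln (m n x)) <= C) -> measurable_fun setT l ->
  {ae mu, forall x, m n x @[n --> \oo] --> l x} -> {ae mu, forall x, 0 < l x}.
Proof.
move=> cm m0 bl ml ml0.
pose a (n : nat) : R := expR (- n.+1%:R).
pose ph n t := Num.max 0 (Num.min 1 (1 - t / a n)) : R.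
have a01 n : 0 < a n < 1 by rewrite /a expR_gt0 expR_lt1 oppr_lt0 ltr0n.
have cph n : continuous (ph n).
  move=> t; apply: (@continuous_comp _ _ _ (fun t : R => 1 - t / a n) (fun t => Num.max 0 (Num.min 1 t))); last exact: continuous_clamp.
  by apply: cvgB; [exact: cvg_cst|apply: cvgM; [exact: cvg_id|exact: cvg_cst]].
have ph01 n t : 0 <= ph n t <= 1 by rewrite /ph le_max lexx/= ge_max ler01 ge_min lexx.
have phb n t : `|ph n t| <= 1 by have /andP[h0 h1] := ph01 n t; rewrite ger0_norm.
have phE n t : 0 < t -> ph n t = Num.max 0 (1 - t / a n).
  move=> t0; congr (Num.max _ _); apply/min_idPr.
  by rewrite lerBlDr lerDl divr_ge0 ?ltW//; case/andP: (a01 n).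
have mph n (f : Rd -> R) : measurable_fun setT f -> measurable_fun setT (fun x => ph n (f x)).
  by move=> mf; exact: (measurableT_comp (continuous_measurable_fun (cph n)) mf).
have key n : \int[mu]_x ph n (l x) <= (C + 1) / n.+1%:R.
  have ae1 : {ae mu, forall x, ph n (m k x) @[k --> \oo] --> ph n (l x)}.
    by apply: filterS ml0 => x hx; apply: (cvg_comp _ _ hx); exact: cph.
  have ik k : itg (fun x => ph n (m k x)) := itg_bnd (mph n _ (cper_mf (cm k))) (fun x => phb n (m k x)).
  have il : itg (fun x => ph n (l x)) := itg_bnd (mph n _ ml) (fun x => phb n (l x)).
  have L1c := dct_bnd (fun k => mph n _ (cper_mf (cm k))) (mph n _ ml) (fun k x => phb n (m k x)) ae1.
  apply: (cvgr_to_le (integral_cvg_of_L1 ik il L1c)); apply: nearW => k.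
  have iln : itg (fun x => (m k x - 1) * ln (m k x)).
    apply/cper_itg/cperM; first exact: (cperB (cm k) (cper_cst 1)).
    by apply: (@cper_comp _ _ (@ln R) _ (cm k)) => x; exact: continuous_ln.
  rewrite ler_pdivlMr ?ltr0n// mulrC -(integralZ_R _ (ik k)).
  apply: (@le_trans _ _ (\int[mu]_x ((m k x - 1) * ln (m k x) + 1))).
    apply: (integral_le_R (itgZ _ (ik k)) (itgD iln (itg_cst 1))) => x.
    have := log_cutoff (m0 k x) (a01 n); by rewrite -(phE _ _ (m0 k x)) /a expRK opprK mulrC.
  by rewrite (integralD_R iln (itg_cst 1)) integral_cst_R lerD2r.
pose D := [set x | l x <= 0].
have mD : measurable D.
  have := ml measurableT _ (measurable_itv `]-oo, 0]%R); rewrite setTI.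
  by congr measurable; apply/seteqP; split=> x; rewrite /D /= in_itv.
have iD := itg_indic mD.
have D0 : \int[mu]_x (\1_D x : R) <= 0.
  apply: (cvgr_to_ge (nS_inv_cvg0 (C + 1))); apply: nearW => n; apply: le_trans (key n).
  apply: (integral_le_R iD (itg_bnd (mph n _ ml) (fun x => phb n (l x)))) => x.
  rewrite indicE; case: (boolP (x \in D)) => [|_]; last by case/andP: (ph01 n (l x)).
  rewrite inE /D /= => lx; rewrite /ph le_max; apply/orP; right; rewrite le_min lexx/= lerBrDr gerDl.
  by rewrite pmulr_lle0// invr_gt0; case/andP: (a01 n).
apply: filterS (integral_eq0_ae iD _ D0); last by apply: aeW => x; rewrite indicE.
move=> x; rewrite indicE => /eqP; case: (boolP (x \in D)) => [|/negP]; first by rewrite oner_eq0.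
by move=> H _; rewrite ltNge; apply/negP => lx; apply: H; rewrite inE.
Qed.

End limit_tools.

(** * Extraction of strongly convergent subsequences *)

Section extraction.
Context {R : realType} {d : nat} {E : set R} {h : ('rV[R]_d -> R) -> 'rV[R]_d -> R}
  {g g1 g2 V : 'rV[R]_d -> R -> R -> R} {al ka : R}.
Context (A : assumptions E h g g1 g2 V al ka).
Local Notation Rd := 'rV[R]_d.
Local Notation mu := (@torus_measure R d).
Local Notation itg f := (mu.-integrable setT (EFin \o f)).
Local Notation approx := (@approximation R d h V al).
Implicit Types (m u : nat -> Rd -> R) (dm du : nat -> 'I_d -> Rd -> R) (x : Rd).

Lemma approximation_sub (C : R) m u dm du (s : nat -> nat) : 0 <= C -> (forall k, (k <= s k)%N) ->
  approx C m u dm du -> approx C (m \o s) (u \o s) (dm \o s) (du \o s).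
Proof.
move=> C0 hs [a1 a2 a3 a4 a5 a6 a7 a8 a9 a10 a11 a12 a13 a14 a15 a16 a17 a18]; split; rewrite ?/comp.
all: try by [move=> n; move: (s n)].
- move=> n; apply: le_trans (a15 (s n)) _; rewrite lerD2l ler_wpM2l// lef_pV2 ?posrE// ler_nat ltnS; exact: hs.
- by move=> b; exact: (cvg_comp _ _ (cvg_geid hs) (a16 b)).
- by move=> a a0 e e0; have [N hN] := a17 a a0 e e0; exists N => n Nn; apply: hN; exact: leq_trans (hs n).
- by move=> a b r r0 ra; have [N hN] := a18 a b r r0 ra; exists N => n Nn; apply: hN; exact: leq_trans (hs n).
Qed.

Let be : R := (al + 1) / 2.

Lemma be_gt0 : 0 < be.
Proof. by have al0 := al_gt0 A; rewrite divr_gt0// addr_gt0. Qed.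

Definition psi m n x : R := m n x `^ ((al + 1) / 2).
Definition dpsi m dm n i x : R := (al + 1) / 2 * m n x `^ ((al + 1) / 2 - 1) * dm n i x.

(** With the exponent (al + 1)/2, the squared gradient of the power is a constant times
    [m^(al-1) |Dm|^2], the quantity bounded through (V2). *)
Lemma psi_bounds (C : R) m u dm du : approx C m u dm du -> forall n,
  [/\ cper (psi m n), forall i, cper (dpsi m dm n i),
    forall i x, is_derive x (basis_vec i) (psi m n) (dpsi m dm n i x),
    \int[mu]_x psi m n x ^+ 2 <= C & \sum_i \int[mu]_x dpsi m dm n i x ^+ 2 <= be ^+ 2 * C].
Proof.
move=> AP n; have b0 := be_gt0; have m0 := ap_m0 AP n; have cm := ap_m AP n.
have cP (c : R) : cper (fun x => m n x `^ c).
  apply: (@cper_comp _ _ (fun t => t `^ c) _ cm) => x.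
  have [dv _] := is_derive1_powR c (m0 x); apply: differentiable_continuous; exact/derivable1_diffP.
have cd i : cper (dpsi m dm n i).
  exact: (cperM (cperM (cper_cst _) (cP _)) (ap_dm AP n i)).
split=> //; first exact: cP.
- by move=> i x; exact: (is_derive_compR (ap_m' AP n i x) (is_derive1_powR _ (m0 x))).
- rewrite (_ : \int[mu]_x _ = \int[mu]_x m n x `^ (al + 1)); first exact: (ap_bm AP).
  apply: eq_Rintegral => x _; by rewrite /psi -powR_mulrn ?powR_ge0// -powRrM; congr (_ `^ _); field.
have e i x : dpsi m dm n i x ^+ 2 = be ^+ 2 * (m n x `^ (al - 1) * dm n i x ^+ 2).
  rewrite /dpsi !exprMn -mulrA; congr (_ * (_ * _)).
  by rewrite -powR_mulrn ?powR_ge0// -powRrM; congr (_ `^ _); field.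
have id i : itg (fun x => m n x `^ (al - 1) * dm n i x ^+ 2) := cper_itg (cperM (cP _) (cperX 2 (ap_dm AP n i))).
rewrite (_ : \sum_i _ = be ^+ 2 * \int[mu]_x (m n x `^ (al - 1) * \sum_i dm n i x ^+ 2)).
  by rewrite ler_wpM2l ?sqr_ge0//; exact: (ap_bdm AP).
under [in RHS]eq_Rintegral do rewrite mulr_sumr.
rewrite (integral_sum_R _ id) mulr_sumr; apply: eq_bigr => i _.
by rewrite -(integralZ_R _ (id i)); apply: eq_Rintegral => x _; rewrite e.
Qed.

(** [sS] is the limit of the dissipations, kept as a number because only lower semicontinuity
    relates it to the limit functions. *)
Record limit_data (C : R) m u dm du (m0 u0 : Rd -> R) (sS : R) := LimitData {
  ld_C : 0 <= C;
  ld_ap : approx C m u dm du;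
  ld_E : MacE E m0;
  ld_m0 : forall x, 0 < m0 x;
  ld_u0 : L1 u0;
  ld_u2 : L2 mu u0;
  ld_m : {ae mu, forall x, m n x @[n --> \oo] --> m0 x};
  ld_mL1 : \int[mu]_x `|m n x - m0 x| @[n --> \oo] --> 0;
  ld_uL1 : \int[mu]_x `|u n x - u0 x| @[n --> \oo] --> 0;
  ld_W : {ae mu, forall x, along V h (m n) x @[n --> \oo] --> along V h m0 x};
  ld_WL1 : \int[mu]_x `|along V h (m n) x - along V h m0 x| @[n --> \oo] --> 0;
  ld_S : \int[mu]_x (m n x * \sum_i du n i x ^+ 2) @[n --> \oo] --> sS
}.

(** Vitali's theorem with [q = 1] for the absolute values, which then serve as varying majorants in
    Pratt's lemma. *)
Lemma L1_cvg_of_L2_bound (u : nat -> Rd -> R) (u0 : Rd -> R) (C : R) : (forall n, L2 mu (u n)) -> L2 mu u0 ->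
  (forall n, \int[mu]_x u n x ^+ 2 <= C) -> {ae mu, forall x, u n x @[n --> \oo] --> u0 x} ->
  \int[mu]_x `|u n x - u0 x| @[n --> \oo] --> 0.
Proof.
move=> l2 l20 bu uc.
have iu n := L2_itg (l2 n); have iu0 := L2_itg l20.
have sq n x : `|u n x| `^ (1 + 1) = u n x ^+ 2.
  by rewrite (_ : 1 + 1 = 2%:R)// powR_mulrn// real_normK ?num_real.
have ac : {ae mu, forall x, `|u n x| @[n --> \oo] --> `|u0 x|}.
  by apply: filterS uc => x; exact: cvg_norm.
have [n|n|i0 L] := @vitali_powR _ _ _ mu (fun n x => `|u n x|) (fun x => `|u0 x|) 1 C ltr01 (fun n => itg_abs (iu n)) (itg_mf (itg_abs iu0)) (fun n x => normr_ge0 _) ac.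
- by under [X in EFin \o X]eq_fun do rewrite sq; case: (l2 n).
- by under eq_Rintegral do rewrite sq.
apply: (pratt iu iu0 (fun n => itg_abs (iu n)) (itg_abs iu0) _ uc ac).
  by move=> n; apply: aeW => x; exact: lexx.
exact: (integral_cvg_of_L1 (fun n => itg_abs (iu n)) (itg_abs iu0) L).
Qed.

Lemma limit_exists : exists (C : R) m u dm du (m0 u0 : Rd -> R) (sS : R), limit_data C m u dm du m0 u0 sS.
Proof.
have [C [m [u [dm [du [C0 AP]]]]]] := approximation_exists A.
have al0 := al_gt0 A; have b0 := be_gt0.
pose C2 := C + be ^+ 2 * C.
have CC : C <= C2 by rewrite lerDl mulr_ge0// sqr_ge0.
have [s1 [p0 [hs1 l2p p0c]]] : exists (s : nat -> nat) (w0 : Rd -> R), [/\ forall k, (k <= s k)%N, L2 mu w0 &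
    {ae mu, forall x, psi m (s k) x @[k --> \oo] --> w0 x}].
  apply: (@rellich _ _ (psi m) (dpsi m dm) C2) => n; have [c1 c2 c3 c4 c5] := psi_bounds AP n => //.
  - exact: le_trans CC.
  - by apply: le_trans c5 _; rewrite lerDr.
have AP1 := approximation_sub C0 hs1 AP.
have [s2 [u1 [hs2 l2u u1c]]] : exists (s : nat -> nat) (w0 : Rd -> R), [/\ forall k, (k <= s k)%N, L2 mu w0 &
    {ae mu, forall x, (u \o s1) (s k) x @[k --> \oo] --> w0 x}].
  apply: (@rellich _ _ (u \o s1) (du \o s1) C) => n; [exact: (ap_u AP1)|exact: (ap_du AP1)|exact: (ap_u' AP1)|exact: (ap_bu AP1)|].
  rewrite -(integral_sum_R _ (fun i => cper_itg (cperX 2 (ap_du AP1 n i)))); exact: (ap_bS AP1).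
have AP2 := approximation_sub C0 hs2 AP1.
have [s3 [sS [hs3 Sc]]] : exists (s : nat -> nat) (l : R), (forall k, (k <= s k)%N) /\
    \int[mu]_x (((m \o s1) \o s2) (s k) x * \sum_i ((du \o s1) \o s2) (s k) i x ^+ 2) @[k --> \oo] --> l.
  apply: (@bounded_subseq _ (fun n => \int[mu]_x (((m \o s1) \o s2) n x * \sum_i ((du \o s1) \o s2) n i x ^+ 2)) C) => n.
  rewrite ger0_norm; first exact: (ap_bmS AP2).
  apply: integral_ge0_R => x; rewrite mulr_ge0 ?(ltW (ap_m0 AP2 n x))//.
  by apply: sumr_ge0 => i _; exact: sqr_ge0.
have AP3 := approximation_sub C0 hs3 AP2.
have h32 k : (k <= s2 (s3 k))%N by exact: leq_trans (hs3 k) (hs2 _).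
have c3 := cvg_geid hs3; have c32 := cvg_geid h32.
pose m3 : nat -> Rd -> R := ((m \o s1) \o s2) \o s3; pose u3 : nat -> Rd -> R := ((u \o s1) \o s2) \o s3.
have cm3 n : cper (m3 n) := ap_m AP3 n; have m3p n x : 0 < m3 n x := ap_m0 AP3 n x.
(* Compactness is available for the power of m; the inverse power recovers the density. *)
pose ml x : R := p0 x `^ be^-1.
have mml : measurable_fun setT ml.
  exact: (measurableT_comp (measurable_powR be^-1) (L2_mf l2p)).
have mlc : {ae mu, forall x, m3 n x @[n --> \oo] --> ml x}.
  apply: filterS p0c => x hx.
  rewrite (_ : (fun n => m3 n x) = fun n => psi m (s1 (s2 (s3 n))) x `^ be^-1); last first.
    apply/funext => n; rewrite /psi -powRrM divff ?gt_eqF// powRr1//; exact: ltW (m3p n x).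
  apply: powR_cvg; [by rewrite invr_gt0|by move=> n; exact: powR_ge0|].
  exact: (cvg_comp _ _ c32 hx).
have ml0 := ae_limit_gt0 cm3 m3p (ap_ln AP3) mml mlc.
(* Adds 1 where the limit vanishes. This happens on a null set only, and makes the density positive
   everywhere, as membership in [MacE] requires. *)
pose cor (t : R) : R := t + \1_[set t : R | t <= 0] t.
have corE t : 0 < t -> cor t = t.
  by move=> t0; rewrite /cor indicE memNset ?addr0//= => t1; move: t0; rewrite ltNge t1.
have cor0 t : 0 <= t -> 0 < cor t.
  rewrite le_eqVlt => /orP[/eqP<-|t0]; last by rewrite corE.
  by rewrite /cor indicE mem_set//= add0r.
have mcor : measurable_fun setT cor.
  apply: measurable_funD; first exact: measurable_id.
  apply: measurable_indic; rewrite (_ : [set t | _] = `]-oo, 0]%classic) ?measurable_itv//.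
have [pm1 mm1 m1e] := periodic_representative (measurableT_comp mcor mml).
have [pu mu0 ue] := periodic_representative (L2_mf l2u).
set m0 := (cor \o ml) \o @frac R d in pm1 mm1 m1e; set u0 := u1 \o @frac R d in pu mu0 ue.
have m0p x : 0 < m0 x by apply: cor0; exact: powR_ge0.
have m0c : {ae mu, forall x, m3 n x @[n --> \oo] --> m0 x}.
  by apply: filterS3 mlc ml0 m1e => x h1 h2 h3; rewrite -[X in _ --> X]/((cor \o ml) (frac x)) h3 /= corE.
have im3 n := cper_itg (cm3 n); have im3' n x : 0 <= m3 n x := ltW (m3p n x).
have ip3 n (c : R) : 0 < c -> itg (fun x => m3 n x `^ c).
  by move=> c0; exact: (cper_itg (cper_powR (cm3 n) (im3' n) c0)).
have [|n|im0 mL1] := vitali_powR al0 im3 mm1 im3' m0c (C := C).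
- by move=> n; apply: ip3; rewrite addr_gt0.
- by rewrite addrC; exact: (ap_bm AP3).
have ME : MacE E m0 by split=> [|x]; [split|exact: (E_gt0 A)].
have M3 n : MacE E (m3 n) by apply: (cper_MacE (cm3 n)) => x; exact: (E_gt0 A).
have aE n x : (m3 n x `^ al) `^ (1 + al^-1) = m3 n x `^ (al + 1).
  by rewrite -powRrM mulrDr mulr1 divff ?gt_eqF.
have [||n x||n|n|i0a aL1] := @vitali_powR _ _ _ mu (fun n x => m3 n x `^ al) (fun x => m0 x `^ al) al^-1 C _ (fun n => ip3 n _ al0).
- by rewrite invr_gt0.
- exact: (measurableT_comp (measurable_powR al) mm1).
- exact: powR_ge0.
- by apply: filterS m0c => x hx; apply: powR_cvg al0 _ hx => n.
- by under [X in EFin \o X]eq_fun do rewrite aE; apply: ip3; rewrite addr_gt0.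
- by under eq_Rintegral do rewrite aE; exact: (ap_bm AP3).
have [s4 [hs4 Wc WL1]] := along_L1_cvg A M3 ME m0c mL1 (fun n => ip3 n _ al0) i0a
  (integral_cvg_of_L1 (fun n => ip3 n _ al0) i0a aL1).
have c4 := cvg_geid hs4; have AP4 := approximation_sub C0 hs4 AP3.
have l2u0 : L2 mu u0 by apply: (L2_aeeq mu0 _ l2u); apply: filterS ue => x hx; exact: esym.
exists C, (m3 \o s4), (u3 \o s4), (((dm \o s1) \o s2) \o s3 \o s4), (((du \o s1) \o s2) \o s3 \o s4), m0, u0, sS.
split; [exact: C0|exact: AP4|exact: ME|exact: m0p| |exact: l2u0| | | |exact: Wc|exact: WL1|].
- by split=> //; exact: L2_itg l2u0.
- by apply: filterS m0c => x hx; exact: (cvg_comp _ _ c4 hx).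
- exact: (cvg_comp _ _ c4 mL1).
- apply: (L1_cvg_of_L2_bound _ l2u0 (ap_bu AP4)); first by move=> n; exact/cper_L2/(ap_u AP4).
  apply: filterS2 u1c ue => x h1 h2; rewrite -[X in _ --> X]/(u1 (frac x)) h2.
  exact: (cvg_comp _ _ c4 (cvg_comp _ _ c3 h1)).
- exact: (cvg_comp _ _ c4 Sc).
Qed.

End extraction.

(** * Weak limits of gradients and weighted gradients *)

Section weak_limits.
Context {R : realType} {d : nat}.
Local Notation Rd := 'rV[R]_d.
Local Notation mu := (@torus_measure R d).
Local Notation itg f := (mu.-integrable setT (EFin \o f)).
Context (U : set_system nat) (UU : UltraFilter U) (oU : \oo `<=` U).

Let PU : ProperFilter U. Proof. exact: ultra_proper. Qed.

Lemma cvg_U (T : topologicalType) (a : nat -> T) (l : T) : a n @[n --> \oo] --> l -> a n @[n --> U] --> l.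
Proof. by move=> h P /h hP; exact: oU. Qed.

Lemma cvg_uniq_U (a : nat -> R) (l l' : R) : a n @[n --> U] --> l -> a n @[n --> U] --> l' -> l = l'.
Proof. by move=> h1 h2; exact: (cvg_unique (@norm_hausdorff _ R^o) h1 h2). Qed.

Lemma wcvg_aeeq (f : nat -> Rd -> R) (G G' : Rd -> R) : measurable_fun setT G' ->
  {ae mu, forall x, G x = G' x} -> wcvg mu U f G -> wcvg mu U f G'.
Proof.
move=> mG' e [LG hG]; have LG' := L2_aeeq mG' e LG; split=> // ps Lp.
rewrite (_ : \int[mu]_x (G' x * ps x) = \int[mu]_x (G x * ps x)); first exact: hG.
apply: integral_aeeq; [exact: itg_mf (L2_itgM LG' Lp)|exact: itg_mf (L2_itgM LG Lp)|].
by apply: filterS e => x ->.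
Qed.

Lemma integral_L1_cvg_bnd (w : nat -> Rd -> R) (w0 f : Rd -> R) (B : R) : (forall n, itg (w n)) -> itg w0 ->
  measurable_fun setT f -> (forall x, `|f x| <= B) -> \int[mu]_x `|w n x - w0 x| @[n --> \oo] --> 0 ->
  \int[mu]_x (w n x * f x) @[n --> \oo] --> \int[mu]_x (w0 x * f x).
Proof.
move=> iw iw0 mf bf L.
have B0 : 0 <= B := le_trans (normr_ge0 _) (bf 0).
have iwf n := itgMr_bnd mf bf (iw n); have iwf0 := itgMr_bnd mf bf iw0.
apply: integral_cvg_of_L1 => //.
have L' : B * \int[mu]_x `|w n x - w0 x| @[n --> \oo] --> 0.
  by rewrite -[X in _ --> X](mulr0 B); apply: cvgM L; exact: cvg_cst.
apply: (squeeze_cvgr _ (cvg_cst 0) L'); apply: nearW => n; apply/andP; split.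
  by apply: integral_ge0_R => x; exact: normr_ge0.
have ia := itg_abs (itgB (iw n) iw0).
rewrite -(integralZ_R _ ia); apply: (integral_le_R (itg_abs (itgB (iwf n) iwf0)) (itgZ _ ia)) => x.
by rewrite -mulrBl normrM mulrC ler_wpM2r.
Qed.

Lemma weak_gradient_limit (w : nat -> Rd -> R) (dw : nat -> 'I_d -> Rd -> R) (w0 : Rd -> R) (C : R) i :
  (forall n, cper (w n)) -> (forall n, cper (dw n i)) ->
  (forall n x, is_derive x (basis_vec i) (w n) (dw n i x)) -> itg w0 ->
  \int[mu]_x `|w n x - w0 x| @[n --> \oo] --> 0 -> (forall n, \int[mu]_x dw n i x ^+ 2 <= C) ->
  exists G, [/\ wcvg mu U (fun n => dw n i) G, periodic G &
    forall f df : Rd -> R, cper f -> cper df -> (forall x, is_derive x (basis_vec i) f (df x)) ->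
    \int[mu]_x (w0 x * df x) = - \int[mu]_x (G x * f x)].
Proof.
move=> cw cdw dwD iw0 wL1 bw.
have [G1 wG1] := weak_L2_limit UU (fun n => cper_L2 (cdw n)) bw.
have [pG mG eG] := periodic_representative (L2_mf wG1.1).
exists (G1 \o @frac R d); have wG : wcvg mu U (fun n => dw n i) (G1 \o @frac R d).
  by apply: (wcvg_aeeq mG _ wG1); apply: filterS eG => x hx; exact: esym.
split=> // f df cf cdf dfD.
have [Bf _ bf] := cper_bnd cdf.
have c1 := cvg_U (integral_L1_cvg_bnd (fun n => cper_itg (cw n)) iw0 (cper_mf cdf) bf wL1).
have c2 := wG.2 f (cper_L2 cf).
apply: (cvg_uniq_U c1).
rewrite (_ : (fun n => _) = (fun n => - \int[mu]_x (dw n i x * f x))); first exact: cvgN.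
apply/funext => n; exact: (integration_by_parts_torus (cw n) cf (cdw n) cdf (dwD n) dfD).
Qed.

Lemma weak_partial_of_C1 i (w0 G : Rd -> R) : L1 w0 -> L1 G ->
  (forall f df : Rd -> R, cper f -> cper df -> (forall x, is_derive x (basis_vec i) f (df x)) ->
    \int[mu]_x (w0 x * df x) = - \int[mu]_x (G x * f x)) -> is_weak_partial [:: i] w0 G.
Proof.
move=> l0 lG hG; split=> // phi cphi; rewrite expr1 mulN1r.
have [cp dp] := @Cinf_partial _ _ [::] phi cphi; have [cp1 _] := @Cinf_partial _ _ [:: i] phi cphi.
exact: (hG _ _ cp cp1 (dp i)).
Qed.

Lemma sobolev1_of_weak_partial (w0 : Rd -> R) : L1 w0 -> L2 mu w0 ->
  (forall i, exists2 G, is_weak_partial [:: i] w0 G & L2 mu G) -> sobolev 1 w0.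
Proof.
move=> l0 l2 hG; apply: (@sobolev_nat _ _ 1) => // -[_|i [_|//]]; last exact: hG.
exists w0 => //; split=> // phi _; by rewrite expr0 mul1r.
Qed.

(** The squared difference of two square roots is at most the distance of the radicands. *)
Lemma sqrt_L2_cvg (m : nat -> Rd -> R) (m0 : Rd -> R) : (forall n, itg (m n)) -> itg m0 ->
  (forall n x, 0 <= m n x) -> (forall x, 0 <= m0 x) -> \int[mu]_x `|m n x - m0 x| @[n --> \oo] --> 0 ->
  [/\ forall n, L2 mu (fun x => Num.sqrt (m n x)), L2 mu (fun x => Num.sqrt (m0 x)) &
   \int[mu]_x (Num.sqrt (m n x) - Num.sqrt (m0 x)) ^+ 2 @[n --> \oo] --> 0].
Proof.
move=> im im0 mp m0p L.
have msq (f : Rd -> R) : itg f -> (forall x, 0 <= f x) -> L2 mu (fun x => Num.sqrt (f x)).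
  move=> i_f f0; split.
    exact: (measurableT_comp (continuous_measurable_fun (@sqrt_continuous R)) (itg_mf i_f)).
  by under [X in EFin \o X]eq_fun do rewrite sqr_sqrtr//.
have l n := msq _ (im n) (mp n); have l0 := msq _ im0 m0p; split=> //.
apply: (squeeze_cvgr _ (cvg_cst 0) L); apply: nearW => n; apply/andP; split.
  by apply: integral_ge0_R => x; exact: sqr_ge0.
apply: (integral_le_R (L2B (l n) l0).2 (itg_abs (itgB (im n) im0))) => x.
rewrite -{2}(sqr_sqrtr (mp n x)) -{2}(sqr_sqrtr (m0p x)) subr_sqr normrM -real_normK ?num_real// expr2.
rewrite ler_wpM2l// (ger0_norm (addr_ge0 (sqrtr_ge0 _) (sqrtr_ge0 _))) ler_norml.
by have := sqrtr_ge0 (m n x); have := sqrtr_ge0 (m0 x); move: (Num.sqrt _) (Num.sqrt _) => a b; lra.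
Qed.

(** The functions [sqrt (m n) f n] are bounded in L^2. Their weak limit is identified by bounded
    tests, where strong times weak convergence applies, and the modes suffice to determine it. A
    second multiplication by the square root gives the limit of [m n f n]. *)
Lemma weighted_weak_limit (m : nat -> Rd -> R) (m0 : Rd -> R) (f : nat -> Rd -> R) (G : Rd -> R) (C : R) :
  (forall n, cper (m n)) -> (forall n, cper (f n)) -> itg m0 ->
  (forall n x, 0 <= m n x) -> (forall x, 0 <= m0 x) -> \int[mu]_x `|m n x - m0 x| @[n --> \oo] --> 0 ->
  (forall n, \int[mu]_x f n x ^+ 2 <= C) -> (forall n, \int[mu]_x (m n x * f n x ^+ 2) <= C) -> wcvg mu U f G ->
  wcvg mu U (fun n x => Num.sqrt (m n x) * f n x) (fun x => Num.sqrt (m0 x) * G x) /\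
  forall (ps : Rd -> R) (B : R), measurable_fun setT ps -> (forall x, `|ps x| <= B) ->
  \int[mu]_x (m n x * f n x * ps x) @[n --> U] --> \int[mu]_x (m0 x * G x * ps x).
Proof.
move=> cm cf im0 mp m0p L bf bmf wG.
have [ls ls0 sL] := sqrt_L2_cvg (fun n => cper_itg (cm n)) im0 mp m0p L.
have cs n : cper (fun x => Num.sqrt (m n x)).
  by apply: (@cper_comp _ _ (@Num.sqrt R) _ (cm n)) => x; exact: sqrt_continuous.
pose F n x := Num.sqrt (m n x) * f n x.
have lF n : L2 mu (F n) by exact: (cper_L2 (cperM (cs n) (cf n))).
have bF n : \int[mu]_x F n x ^+ 2 <= C.
  apply: le_trans (bmf n); rewrite le_eqVlt; apply/orP; left; apply/eqP; apply: eq_Rintegral => x _.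
  by rewrite exprMn sqr_sqrtr.
have [H wH] := weak_L2_limit UU lF bF.
have key (ps : Rd -> R) B : measurable_fun setT ps -> (forall x, `|ps x| <= B) ->
    \int[mu]_x (H x * ps x) = \int[mu]_x (Num.sqrt (m0 x) * G x * ps x).
  move=> mps bps.
  have h1 := wcvg_strong UU (fun n => cper_L2 (cf n)) bf wG ls ls0 (cvg_U sL) mps bps.
  exact: (cvg_uniq_U (wH.2 ps (L2_bnd mps bps)) h1).
have iH := L2_itg wH.1; have iSG := L2_itgM ls0 wG.1.
have eH : {ae mu, forall x, H x = Num.sqrt (m0 x) * G x}.
  have : {ae mu, forall x, H x - Num.sqrt (m0 x) * G x = 0}.
    apply: trig_unique; first exact: itgB.
    move=> b k; have mm := cper_mf (@cper_md R d b k); have bm := @md_bnd R d b k.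
    rewrite (_ : \int[mu]_y _ = \int[mu]_y (H y * md b k y) - \int[mu]_y (Num.sqrt (m0 y) * G y * md b k y)).
      by rewrite (key _ _ mm bm) subrr.
    by rewrite -(integralB_R (itgMr_bnd mm bm iH) (itgMr_bnd mm bm iSG)); apply: eq_Rintegral => x _; rewrite mulrC mulrBl.
  by apply: filterS => x /eqP; rewrite subr_eq0 => /eqP.
have wH' := wcvg_aeeq (itg_mf iSG) eH wH; split=> // ps B mps bps.
have := wcvg_strong UU lF bF wH' ls ls0 (cvg_U sL) mps bps.
have -> : (fun n => \int[mu]_x (Num.sqrt (m n x) * F n x * ps x)) = (fun n => \int[mu]_x (m n x * f n x * ps x)).
  by apply/funext => n; apply: eq_Rintegral => x _; rewrite /F mulrA -expr2 sqr_sqrtr.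
by under eq_Rintegral do rewrite mulrA -expr2 sqr_sqrtr//.
Qed.

End weak_limits.

Section limit_equations.
Context {R : realType} {d : nat} {E : set R} {h : ('rV[R]_d -> R) -> 'rV[R]_d -> R}
  {g g1 g2 V : 'rV[R]_d -> R -> R -> R} {al ka : R}.
Context (A : assumptions E h g g1 g2 V al ka).
Local Notation Rd := 'rV[R]_d.
Local Notation mu := (@torus_measure R d).
Local Notation itg f := (mu.-integrable setT (EFin \o f)).
Context {C : R} {m u : nat -> Rd -> R} {dm du : nat -> 'I_d -> Rd -> R} {m0 u0 : Rd -> R} {sS : R}.
Context (LD : @limit_data R d E h V al C m u dm du m0 u0 sS).
Context (U : set_system nat) (UU : UltraFilter U) (oU : \oo `<=` U).

Let PU : ProperFilter U. Proof. exact: ultra_proper. Qed.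
Let AP := ld_ap LD.
Let al0 := al_gt0 A.
Let im0 : itg m0 := (ld_E LD).1.2.
Let iu0 : itg u0 := (ld_u0 LD).2.
Let m0p x : 0 <= m0 x := ltW (ld_m0 LD x).
Let mp n x : 0 <= m n x := ltW (ap_m0 AP n x).

Lemma lim_pow : itg (fun x => m0 x `^ (al + 1)).
Proof.
have p0 : 0 < al + 1 by rewrite addr_gt0.
have ip n := cper_itg (cper_powR (ap_m AP n) (mp n) p0).
have mp0 : measurable_fun setT (fun x => m0 x `^ (al + 1)) := measurableT_comp (measurable_powR (al + 1)) (itg_mf im0).
have ae : {ae mu, forall x, m n x `^ (al + 1) @[n --> \oo] --> m0 x `^ (al + 1)}.
  by apply: filterS (ld_m LD) => x hx; apply: powR_cvg p0 _ hx => n.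
have [] := fatou_R ip (fun n => aeW _ (fun x => powR_ge0 _ _)) mp0 ae (ap_bm AP) (cvg_cst C) => //.
Qed.

Lemma bound_du n i : \int[mu]_x du n i x ^+ 2 <= C.
Proof.
apply: le_trans (ap_bS AP n); apply: (integral_le_R (cper_itg (cperX 2 (ap_du AP n i)))).
  by apply: itg_sum => j; exact/cper_itg/cperX/(ap_du AP).
by move=> x; rewrite (bigD1 i)//= lerDl; apply: sumr_ge0 => j _; exact: sqr_ge0.
Qed.

Lemma bound_mdu n i : \int[mu]_x (m n x * du n i x ^+ 2) <= C.
Proof.
have cS : cper (fun x => \sum_i du n i x ^+ 2) by apply: cper_sum => j; exact/cperX/(ap_du AP).
apply: le_trans (ap_bmS AP n).
apply: (integral_le_R (cper_itg (cperM (ap_m AP n) (cperX 2 (ap_du AP n i)))) (cper_itg (cperM (ap_m AP n) cS))).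
by move=> x; rewrite ler_wpM2l// (bigD1 i)//= lerDl; apply: sumr_ge0 => j _; exact: sqr_ge0.
Qed.

Lemma lim_grad i : [/\ is_weak_partial [:: i] u0 (weak_grad u0 i), wcvg mu U (fun n => du n i) (weak_grad u0 i) &
  forall f df : Rd -> R, cper f -> cper df -> (forall x, is_derive x (basis_vec i) f (df x)) ->
    \int[mu]_x (u0 x * df x) = - \int[mu]_x (weak_grad u0 i x * f x)].
Proof.
have [G [wG pG hG]] := weak_gradient_limit UU oU (ap_u AP) (fun n => ap_du AP n i) (fun n => ap_u' AP n i) iu0
  (ld_uL1 LD) (fun n => bound_du n i).
have lG : L1 G by split=> //; exact: L2_itg wG.1.
have [wp e] := weak_partial_aeeq (weak_partial_of_C1 (ld_u0 LD) lG hG).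
have [_ [_ iw] _] := wp; have mw := itg_mf iw.
split=> //; first by apply: (wcvg_aeeq mw _ wG); apply: filterS e => x.
move=> f df cf cdf dfD; rewrite (hG f df cf cdf dfD); congr (- _).
have [B _ bf] := cper_bnd cf.
apply: integral_aeeq; [exact: (measurable_funM (itg_mf lG.2) (cper_mf cf))|exact: (measurable_funM mw (cper_mf cf))|].
by apply: filterS e => x hx; rewrite /weak_grad hx.
Qed.

Lemma sobolev_u0 : sobolev 1 u0.
Proof.
apply: (sobolev1_of_weak_partial (ld_u0 LD) (ld_u2 LD)) => i.
by have [w1 w2 _] := lim_grad i; exists (weak_grad u0 i) => //; case: w2.
Qed.

Lemma sobolev_m0 : sobolev 1 (fun x => m0 x `^ ((al + 1) / 2)).
Proof.
have b0 : 0 < (al + 1) / 2 := be_gt0 A.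
have PB := psi_bounds A AP.
pose p0 x := m0 x `^ ((al + 1) / 2).
have mp0 : measurable_fun setT p0 := measurableT_comp (measurable_powR _) (itg_mf im0).
have l2 : L2 mu p0.
  split=> //; rewrite (_ : _ \o _ = EFin \o (fun x => m0 x `^ (al + 1))); first exact: lim_pow.
  by apply/funext => x /=; rewrite /p0 -powR_mulrn ?powR_ge0// -powRrM divfK.
have pp : periodic p0 by move=> x i; rewrite /p0 (ld_E LD).1.1.
have l1 : L1 p0 by split=> //; exact: L2_itg l2.
have pc : {ae mu, forall x, @psi R d al m n x @[n --> \oo] --> p0 x}.
  by apply: filterS (ld_m LD) => x hx; apply: powR_cvg b0 _ hx => n.
have L := L1_cvg_of_L2_bound (fun n => cper_L2 (let: And5 c _ _ _ _ := PB n in c)) l2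
  (fun n => let: And5 _ _ _ c _ := PB n in c) pc.
apply: (sobolev1_of_weak_partial l1 l2) => i.
have bd n : \int[mu]_x @dpsi R d al m dm n i x ^+ 2 <= ((al + 1) / 2) ^+ 2 * C.
  have [_ _ _ _] := PB n; apply: le_trans; rewrite (bigD1 i)//= lerDl.
  by apply: sumr_ge0 => j _; apply: integral_ge0_R => x; exact: sqr_ge0.
have [G [wG pG hG]] := @weak_gradient_limit R d U UU oU (@psi R d al m) (@dpsi R d al m dm) p0 _ i
  (fun n => let: And5 c _ _ _ _ := PB n in c) (fun n => let: And5 _ c _ _ _ := PB n in c i)
  (fun n => let: And5 _ _ c _ _ := PB n in c i) l1.2 L bd.
exists G; last by case: wG.
by apply: weak_partial_of_C1 => //; split=> //; exact: L2_itg wG.1.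
Qed.

Local Notation G := (weak_grad u0).

Lemma lim_weighted i : wcvg mu U (fun n x => Num.sqrt (m n x) * du n i x) (fun x => Num.sqrt (m0 x) * G i x) /\
  forall (ps : Rd -> R) (B : R), measurable_fun setT ps -> (forall x, `|ps x| <= B) ->
  \int[mu]_x (m n x * du n i x * ps x) @[n --> U] --> \int[mu]_x (m0 x * G i x * ps x).
Proof.
have [_ wG _] := lim_grad i.
exact: (weighted_weak_limit UU oU (ap_m AP) (fun n => ap_du AP n i) im0 mp m0p (ld_mL1 LD)
  (fun n => bound_du n i) (fun n => bound_mdu n i) wG).
Qed.

Lemma itg_mG2 i : itg (fun x => m0 x * G i x ^+ 2).
Proof.
have [[_ i2] _] := (lim_weighted i).1; apply: eq_integrable i2 => // x _ /=.
by rewrite exprMn sqr_sqrtr.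
Qed.

Lemma itg_mG i : itg (fun x => m0 x * G i x).
Proof.
have [_ [[mG iG] _] _] := lim_grad i.
have l0 : L2 mu (fun x => Num.sqrt (m0 x)).
  have [_ l0 _] := sqrt_L2_cvg (fun n => cper_itg (ap_m AP n)) im0 mp m0p (ld_mL1 LD); exact: l0.
apply: eq_integrable (L2_itgM l0 (lim_weighted i).1.1) => // x _ /=.
by rewrite mulrA -expr2 sqr_sqrtr.
Qed.

End limit_equations.

Section limit_system.
Context {R : realType} {d : nat} {E : set R} {h : ('rV[R]_d -> R) -> 'rV[R]_d -> R}
  {g g1 g2 V : 'rV[R]_d -> R -> R -> R} {al ka : R}.
Context (A : assumptions E h g g1 g2 V al ka).
Local Notation Rd := 'rV[R]_d.
Local Notation mu := (@torus_measure R d).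
Local Notation itg f := (mu.-integrable setT (EFin \o f)).
Context {C : R} {m u : nat -> Rd -> R} {dm du : nat -> 'I_d -> Rd -> R} {m0 u0 : Rd -> R} {sS : R}.
Context (LD : @limit_data R d E h V al C m u dm du m0 u0 sS).
Context (U : set_system nat) (UU : UltraFilter U) (oU : \oo `<=` U).

Let PU : ProperFilter U. Proof. exact: ultra_proper. Qed.
Let AP := ld_ap LD.
Let al0 := al_gt0 A.
Let im0 : itg m0 := (ld_E LD).1.2.
Let iu0 : itg u0 := (ld_u0 LD).2.
Let m0p x : 0 <= m0 x := ltW (ld_m0 LD x).
Let mp n x : 0 <= m n x := ltW (ap_m0 AP n x).
Local Notation G := (weak_grad u0).
Let im n : itg (m n) := cper_itg (ap_m AP n).
Let iG (i : 'I_d) : itg (G i).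
Proof. by have [[_ [_ ?] _] _ _] := lim_grad LD UU oU i. Qed.
Let iG2 (i : 'I_d) : itg (fun x => G i x ^+ 2).
Proof. by have [_ [[_ ?] _] _] := lim_grad LD UU oU i. Qed.
Let imG (i : 'I_d) : itg (fun x => m0 x * G i x) := itg_mG LD UU oU i.

Lemma itg_m0_al : itg (fun x => m0 x `^ al).
Proof.
apply: (itg_le (g := fun x => 1 + m0 x `^ (al + 1))); last exact: (itgD (itg_cst 1) (lim_pow A LD)).
  exact: (measurableT_comp (measurable_powR al) (itg_mf im0)).
by move=> x; rewrite ger0_norm ?powR_ge0//; apply: le_1powR => //; rewrite lerDl.
Qed.

Lemma itg_W0 : itg (along V h m0).
Proof. exact: (along_itg A (ld_E LD) itg_m0_al). Qed.

Lemma itg_HJ : itg (HJ V h m0 u0).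
Proof.
apply: (itgD (itgB (itgN iu0) _) itg_W0).
exact: (itgZr _ (itg_sum _ iG2)).
Qed.

Lemma integral_KK_cvg (F f : Rd -> R) : itg F -> cper f ->
  \int[mu]_x (F x * KK n f x) @[n --> \oo] --> \int[mu]_x (F x * f x).
Proof.
move=> iF cf; have [B _ bf] := cper_bnd cf.
rewrite (_ : (fun n => _) = (fun n => \int[mu]_x (KK n F x * f x))).
  exact: (integral_L1_cvg_bnd (fun n => itg_KK n iF) iF (cper_mf cf) bf (KK_L1_cvg_itg iF)).
by apply/funext => n; rewrite (KK_sym n iF (cper_itg cf)).
Qed.

Lemma lim_fp_trig b : \int[mu]_x ((m0 x - 1) * tp b x) + \sum_i \int[mu]_x (m0 x * G i x * tp (dtp (basis_vec i) b) x) = 0.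
Proof.
have cb : cper (tp b) by exact: cper_tp.
have cdb i : cper (tp (dtp (basis_vec i) b)) by exact: cper_tp.
have [B _ bb] := cper_bnd cb.
apply: (cvg_uniq_U UU _ (cvg_U oU (ap_fp AP b))).
rewrite (_ : (fun n => _) = fun n => (\int[mu]_x (m n x * tp b x) - \int[mu]_x tp b x) + \sum_i \int[mu]_x (m n x * du n i x * tp (dtp (basis_vec i) b) x)).
  rewrite (_ : \int[mu]_x ((m0 x - 1) * tp b x) = \int[mu]_x (m0 x * tp b x) - \int[mu]_x tp b x); last first.
    rewrite -(integralB_R (itgMr_bnd (cper_mf cb) bb im0) (cper_itg cb)).
    by apply: eq_Rintegral => x _; rewrite mulrBl mul1r.
  apply: cvgD; last first.
    apply: cvg_sumr => i; have [B' _ bb'] := cper_bnd (cdb i).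
    exact: ((lim_weighted LD UU oU i).2 _ _ (cper_mf (cdb i)) bb').
  apply: cvgB; last exact: cvg_cst.
  exact: (cvg_U oU (integral_L1_cvg_bnd im im0 (cper_mf cb) bb (ld_mL1 LD))).
apply/funext => n.
have i1 := cper_itg (cperM (ap_m AP n) cb); have i2 := cper_itg cb.
have i3 i := cper_itg (cperM (cperM (ap_m AP n) (ap_du AP n i)) (cdb i)).
rewrite -(integralB_R i1 i2) -(integral_sum_R _ i3) -(integralD_R (itgB i1 i2) (itg_sum _ i3)).
by apply: eq_Rintegral => x _; rewrite mulrBl mul1r.
Qed.

(** The equation extends from trigonometric polynomials to C^1 tests because [KK] commutes with
    derivatives and converges uniformly on continuous functions. *)
Lemma lim_fp (f : Rd -> R) (df : 'I_d -> Rd -> R) : cper f -> (forall i, cper (df i)) ->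
  (forall i x, is_derive x (basis_vec i) f (df i x)) ->
  \int[mu]_x ((m0 x - 1) * f x) = - \sum_i \int[mu]_x (m0 x * G i x * df i x).
Proof.
move=> cf cdf dfD.
have im1 := itgB im0 (itg_cst 1).
have lim : \int[mu]_x ((m0 x - 1) * KK n f x) + \sum_i \int[mu]_x (m0 x * G i x * KK n (df i) x) @[n --> \oo] -->
    \int[mu]_x ((m0 x - 1) * f x) + \sum_i \int[mu]_x (m0 x * G i x * df i x).
  apply: cvgD; first exact: (integral_KK_cvg im1 cf).
  by apply: cvg_sumr => i; exact: (integral_KK_cvg (imG i) (cdf i)).
have z : \int[mu]_x ((m0 x - 1) * f x) + \sum_i \int[mu]_x (m0 x * G i x * df i x) = 0.
  apply: (cvg_unique (@norm_hausdorff _ R^o) lim).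
  rewrite (_ : (fun n => _) = fun=> 0); first exact: cvg_cst.
  apply/funext => n; rewrite -[RHS](lim_fp_trig (KKl n f)) -(KK_tp n (cper_itg cf)); congr (_ + _).
  apply: eq_bigr => i _; apply: eq_Rintegral => x _; congr (_ * _).
  by rewrite (dtp_KKl n x cf (cdf i) (dfD i)).
by apply/eqP; rewrite -addr_eq0 z.
Qed.

Lemma lim_mass : \int[mu]_x m0 x = 1.
Proof.
have := @lim_fp (fun=> 1) (fun _ _ => 0) (cper_cst 1) (fun i => cper_cst 0) (fun i x => is_derive_cst (1 : R) x (basis_vec i)).
rewrite [\sum_i _]big1 ?oppr0; last first.
  by move=> i _; rewrite -[RHS](@integral_cst_R _ _ _ mu 0); apply: eq_Rintegral => x _; rewrite mulr0.
under eq_Rintegral do rewrite mulr1.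
by rewrite (integralB_R im0 (itg_cst 1)) integral_cst_R => /eqP; rewrite subr_eq0 => /eqP.
Qed.

(** The quadratic term is only lower semicontinuous, but it enters with a minus sign, so the
    inequality survives. Its approximations are given limits [z i] along U before comparison. *)
Lemma lim_hj_trig a : (forall x : Rd, 0 <= tp a x) -> 0 <= \int[mu]_x (HJ V h m0 u0 x * tp a x).
Proof.
move=> a0; have ca : cper (tp a) by exact: cper_tp.
have ma := cper_mf ca; have [B B0 ba] := cper_bnd ca.
have cW n : cper (along V h (m n)).
  by apply: (along_cper A (ap_m AP n)) => x; exact: (E_gt0 A (ap_m0 AP n x)).
pose Z n i := \int[mu]_x (tp a x * du n i x ^+ 2).
have iZ n i := cper_itg (cperM ca (cperX 2 (ap_du AP n i))).
have /choice[z hz] i : exists l : R, Z n i @[n --> U] --> l.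
  have [|l hl _] := @ultra_bounded_cvg R _ U (Z ^~ i) (B * C) UU; last by exists l.
  move=> n; rewrite ger0_norm; last by apply: integral_ge0_R => x; rewrite mulr_ge0 ?sqr_ge0.
  have id := cper_itg (cperX 2 (ap_du AP n i)).
  apply: (@le_trans _ _ (B * \int[mu]_x du n i x ^+ 2)); last by rewrite ler_wpM2l//; exact: (bound_du LD).
  rewrite -(integralZ_R _ id); apply: (integral_le_R (iZ n i) (itgZ _ id)) => x.
  by rewrite ler_wpM2r ?sqr_ge0// (le_trans (ler_norm _) (ba x)).
have Gz i : \int[mu]_x (tp a x * G i x ^+ 2) <= z i.
  have [_ wG _] := lim_grad LD UU oU i.
  apply: (wcvg_lsc UU (fun n => cper_L2 (ap_du AP n i)) wG ma (B := B) _ _ (hz i)) => [x|n //].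
  by rewrite a0 (le_trans (ler_norm _) (ba x)).
have cX := cvg_U oU (integral_L1_cvg_bnd (fun n => cper_itg (ap_u AP n)) iu0 ma ba (ld_uL1 LD)).
have cY := cvg_U oU (integral_L1_cvg_bnd (fun n => cper_itg (cW n)) itg_W0 ma ba (ld_WL1 LD)).
set X := (X in _ --> X) in cX; set Y := (X in _ --> X) in cY.
have lim : \int[mu]_x (along V h (m n) x * tp a x) - \int[mu]_x (u n x * tp a x) - 2^-1 * \sum_i Z n i @[n --> U] -->
    Y - X - 2^-1 * \sum_i z i.
  apply: cvgB; first exact: (cvgB cY cX).
  by apply: cvgM; [exact: cvg_cst|exact: cvg_sumr].
have P0 : 0 <= Y - X - 2^-1 * \sum_i z i.
  apply/ler_addgt0Pl => e e0; rewrite addrC -lerBlDr sub0r.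
  have [N hN] := ap_hj AP a0 e0.
  apply: (cvgr_to_ge lim); apply: oU; exists N => // n Nn /=; apply: le_trans (hN n Nn) _.
  have i1 := cper_itg (cperM (cW n) ca); have i2 := cper_itg (cperM (ap_u AP n) ca).
  rewrite -(integral_sum_R _ (iZ n)) -(integralB_R i1 i2) -(integralZ_R _ (itg_sum _ (iZ n))).
  rewrite -(integralB_R (itgB i1 i2) (itgZ _ (itg_sum _ (iZ n)))).
  rewrite le_eqVlt; apply/orP; left; apply/eqP; apply: eq_Rintegral => x _.
  by rewrite -mulr_sumr; field.
apply: le_trans P0 _.
have i1 := itgMr_bnd ma ba itg_W0; have i2 := itgMr_bnd ma ba iu0.
have i3 i := itgM_bnd ma ba (iG2 i).
have -> : \int[mu]_x (HJ V h m0 u0 x * tp a x) = Y - X - 2^-1 * \sum_i \int[mu]_x (tp a x * G i x ^+ 2).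
  rewrite -(integral_sum_R _ i3) -(integralB_R i1 i2) -(integralZ_R _ (itg_sum _ i3)).
  rewrite -(integralB_R (itgB i1 i2) (itgZ _ (itg_sum _ i3))); apply: eq_Rintegral => x _.
  by rewrite /HJ -mulr_sumr; field.
by rewrite lerD2l lerN2 ler_pM2l//; apply: ler_sum => i _.
Qed.

(* The test is the kernel regularisation of the indicator of the set where the sign fails. *)
Lemma lim_hj_ge0 : {ae mu, forall x, 0 <= HJ V h m0 u0 x}.
Proof.
have iH := itg_HJ; set H := HJ V h m0 u0 in iH *.
pose D := [set x : Rd | H x < 0].
have mD : measurable D.
  have mH : measurable_fun setT H := itg_mf iH.
  have := mH measurableT _ (measurable_itv `]-oo, 0[%R); rewrite setTI.
  by congr measurable; apply/seteqP; split=> x; rewrite /D /= in_itv.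
pose f : Rd -> R := \1_D.
have mf : measurable_fun setT f by exact: measurable_indic.
have bf x : `|f x| <= 1 by rewrite /f indicE; case: (_ \in _); rewrite ?normr1 ?normr0.
have f0 x : 0 <= f x by rewrite /f indicE.
have iff : itg f := itg_indic mD.
have iHf := itgMr_bnd mf bf iH.
have lim := integral_L1_cvg_bnd (fun n => itg_KK n iH) iH mf bf (KK_L1_cvg_itg iH).
have P0 : 0 <= \int[mu]_x (H x * f x).
  apply: (cvgr_to_ge lim); apply: nearW => n.
  rewrite (KK_sym n iH iff) (KK_tp n iff); apply: lim_hj_trig => x.
  by rewrite -(KK_tp n iff); apply: KK_ge0 => //; exact: aeW.
have sg x : 0 <= - (H x * f x).
  rewrite /f indicE; case: (boolP (x \in D)) => [|_]; last by rewrite mulr0 oppr0.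
  by rewrite inE /D /= mulr1 oppr_ge0 => /ltW.
have z : \int[mu]_x (- (H x * f x)) <= 0 by rewrite (integralN_R iHf) oppr_le0.
apply: filterS (integral_eq0_ae (itgN iHf) (aeW _ sg) z) => x.
rewrite /f indicE; case: (boolP (x \in D)) => [|/negP nD _]; last first.
  by rewrite leNgt; apply/negP => lx; apply: nD; rewrite inE.
by rewrite inE /D /= mulr1 => lx /eqP; rewrite oppr_eq0 => /eqP e; rewrite e ltxx in lx.
Qed.

End limit_system.

(** * Minty's inequality in the limit *)

Section minty.
Context {R : realType} {d : nat}.
Local Notation Rd := 'rV[R]_d.
Local Notation mu := (@torus_measure R d).
Local Notation itg f := (mu.-integrable setT (EFin \o f)).

Lemma integral_L1_bdd_cvg (w : nat -> Rd -> R) (w0 : Rd -> R) (c : nat -> Rd -> R) (c0 : Rd -> R) (B : R) :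
  (forall n, itg (w n)) -> itg w0 -> \int[mu]_x `|w n x - w0 x| @[n --> \oo] --> 0 ->
  (forall n, measurable_fun setT (c n)) -> measurable_fun setT c0 -> (forall n x, `|c n x| <= B) ->
  (forall x, c n x @[n --> \oo] --> c0 x) ->
  \int[mu]_x (w n x * c n x) @[n --> \oo] --> \int[mu]_x (w0 x * c0 x).
Proof.
move=> iw iw0 wL mc mc0 bc cc.
have bc0 x : `|c0 x| <= B by apply: (cvgr_to_le (cvg_norm (cc x))); exact: nearW.
have B0 : 0 <= B := le_trans (normr_ge0 _) (bc0 0).
have i1 n := itgMr_bnd (mc n) (bc n) (iw n); have i2 n := itgMr_bnd (mc n) (bc n) iw0.
have i3 := itgMr_bnd mc0 bc0 iw0; have iB := itgZ B (itg_abs iw0).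
have ia n := itg_abs (itgB (iw n) iw0).
have l2 : \int[mu]_x `|w0 x * c n x - w0 x * c0 x| @[n --> \oo] --> 0.
  apply: (dct_R i2 i3 iB).
    by move=> n; apply: aeW => x; rewrite normrM mulrC ler_wpM2r.
  by apply: aeW => x; apply: cvgM; [exact: cvg_cst|exact: cc].
have l1 : B * \int[mu]_x `|w n x - w0 x| + \int[mu]_x `|w0 x * c n x - w0 x * c0 x| @[n --> \oo] --> 0.
  by rewrite -[X in _ --> X]addr0 -[X in _ --> X + _](mulr0 B); apply: cvgD l2; apply: cvgM wL; exact: cvg_cst.
apply: integral_cvg_of_L1 => //.
apply: (squeeze_cvgr _ (cvg_cst 0) l1); apply: nearW => n; apply/andP; split.
  by apply: integral_ge0_R => x; exact: normr_ge0.
have i4 := itg_abs (itgB (i2 n) i3).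
rewrite -(integralZ_R _ (ia n)) -(integralD_R (itgZ _ (ia n)) i4).
apply: (integral_le_R (itg_abs (itgB (i1 n) i3)) (itgD (itgZ _ (ia n)) i4)) => x.
rewrite (_ : w n x * c n x - w0 x * c0 x = (w n x - w0 x) * c n x + (w0 x * c n x - w0 x * c0 x)); last by ring.
by apply: le_trans (ler_normD _ _) _; rewrite lerD2r normrM mulrC ler_wpM2r.
Qed.

(** Apart from the integral of [uu], every term integrates an integrable factor against one built
    from the test; the factors 1 are kept so that one convergence lemma treats the terms alike. *)
Definition minty_form (mm uu : Rd -> R) (gg : 'I_d -> Rd -> R) (W a b : Rd -> R) (bi : 'I_d -> Rd -> R) : R :=
  \int[mu]_x (W x * a x) + \sum_i 2^-1 * \int[mu]_x (1 * (a x * bi i x ^+ 2)) - \int[mu]_x (1 * b x) +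
  \int[mu]_x (mm x * b x) + \sum_i 2^-1 * \int[mu]_x (mm x * bi i x ^+ 2) -
  (\int[mu]_x (uu x * a x) - \int[mu]_x uu x) - \sum_i \int[mu]_x (gg i x * (a x * bi i x)).

Lemma minty_formE mm uu (gg : 'I_d -> Rd -> R) (W a b : Rd -> R) (bi : 'I_d -> Rd -> R) :
  itg mm -> itg uu -> (forall i, itg (gg i)) -> cper W -> cper a -> cper b -> (forall i, cper (bi i)) ->
  \int[mu]_x ((a x - mm x) * (- b x - (\sum_i bi i x ^+ 2) / 2 + W x) +
    ((a x - 1) * (b x - uu x) + \sum_i a x * bi i x * (bi i x - gg i x))) =
  minty_form mm uu gg W a b bi - \int[mu]_x (mm x * W x).
Proof.
move=> im iu ig cW ca cb cbi.
have IB (w f : Rd -> R) : itg w -> cper f -> itg (fun x => w x * f x).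
  by move=> iw cf; have [B _ bf] := cper_bnd cf; exact: (itgMr_bnd (cper_mf cf) bf iw).
have i1 := cper_itg (cperM cW ca).
have i2 i := IB _ _ (itg_cst 1) (cperM ca (cperX 2 (cbi i))).
have i3 := IB _ _ (itg_cst 1) cb; have i4 := IB _ _ im cb.
have i5 i := IB _ _ im (cperX 2 (cbi i)); have i6 := IB _ _ iu ca.
have i7 i := IB _ _ (ig i) (cperM ca (cbi i)); have i8 := IB _ _ im cW.
rewrite /minty_form.
under [\sum_i 2^-1 * \int[mu]_x (1 * _)]eq_bigr do rewrite -(integralZ_R _ (i2 _)).
under [\sum_i 2^-1 * \int[mu]_x (mm x * _)]eq_bigr do rewrite -(integralZ_R _ (i5 _)).
rewrite -(integral_sum_R _ (fun i => itgZ 2^-1 (i2 i))) -(integral_sum_R _ (fun i => itgZ 2^-1 (i5 i))) -(integral_sum_R _ i7).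
have j2 := itg_sum (index_enum 'I_d) (fun i => itgZ 2^-1 (i2 i)).
have j5 := itg_sum (index_enum 'I_d) (fun i => itgZ 2^-1 (i5 i)); have j7 := itg_sum (index_enum 'I_d) i7.
rewrite -(integralD_R i1 j2) -(integralB_R (itgD i1 j2) i3) -(integralD_R (itgB (itgD i1 j2) i3) i4).
rewrite -(integralD_R (itgD (itgB (itgD i1 j2) i3) i4) j5) -(integralB_R i6 iu).
rewrite -(integralB_R (itgD (itgD (itgB (itgD i1 j2) i3) i4) j5) (itgB i6 iu)).
rewrite -(integralB_R (itgB (itgD (itgD (itgB (itgD i1 j2) i3) i4) j5) (itgB i6 iu)) j7).
rewrite -(integralB_R (itgB (itgB (itgD (itgD (itgB (itgD i1 j2) i3) i4) j5) (itgB i6 iu)) j7) i8).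
apply: eq_Rintegral => x _.
have e1 : \sum_i a x * bi i x * (bi i x - gg i x) = a x * \sum_i bi i x ^+ 2 - \sum_i gg i x * (a x * bi i x).
  by rewrite mulr_sumr -sumrB; apply: eq_bigr => i _; ring.
have e2 : \sum_i 2^-1 * (1 * (a x * bi i x ^+ 2)) = 2^-1 * (a x * \sum_i bi i x ^+ 2).
  by rewrite !mulr_sumr; apply: eq_bigr => i _; ring.
have e3 : \sum_i 2^-1 * (mm x * bi i x ^+ 2) = 2^-1 * (mm x * \sum_i bi i x ^+ 2).
  by rewrite !mulr_sumr.
by rewrite e1 e2 e3; field.
Qed.

End minty.

Section limit_minty.
Context {R : realType} {d : nat} {E : set R} {h : ('rV[R]_d -> R) -> 'rV[R]_d -> R}
  {g g1 g2 V : 'rV[R]_d -> R -> R -> R} {al ka : R}.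
Context (A : assumptions E h g g1 g2 V al ka).
Local Notation Rd := 'rV[R]_d.
Local Notation mu := (@torus_measure R d).
Local Notation itg f := (mu.-integrable setT (EFin \o f)).
Context {C : R} {m u : nat -> Rd -> R} {dm du : nat -> 'I_d -> Rd -> R} {m0 u0 : Rd -> R} {sS : R}.
Context (LD : @limit_data R d E h V al C m u dm du m0 u0 sS).
Context (U : set_system nat) (UU : UltraFilter U) (oU : \oo `<=` U).

Let PU : ProperFilter U. Proof. exact: ultra_proper. Qed.
Let AP := ld_ap LD.
Let im0 : itg m0 := (ld_E LD).1.2.
Let iu0 : itg u0 := (ld_u0 LD).2.
Let m0p x : 0 <= m0 x := ltW (ld_m0 LD x).
Local Notation G := (weak_grad u0).
Let iG (i : 'I_d) : itg (G i).
Proof. by have [[_ [_ ?] _] _ _] := lim_grad LD UU oU i. Qed.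

Lemma lim_minty_trig a b (r : R) : 0 < r -> (forall x : Rd, r <= tp a x) ->
  \int[mu]_x (m0 x * along V h (tp a) x) <=
  minty_form m0 u0 G (along V h (tp a)) (tp a) (tp b) (fun i => tp (dtp (basis_vec i) b)).
Proof.
move=> r0 ra; have ca : cper (tp a) by exact: cper_tp.
have cb : cper (tp b) by exact: cper_tp.
have cdb i : cper (tp (dtp (basis_vec i) b)) by exact: cper_tp.
have cW : cper (along V h (tp a)).
  by apply: (along_cper A ca) => x; apply: (E_gt0 A); exact: lt_le_trans (ra x).
have im n := cper_itg (ap_m AP n); have iu n := cper_itg (ap_u AP n).
have LM (f : Rd -> R) : cper f -> \int[mu]_x (m n x * f x) @[n --> U] --> \int[mu]_x (m0 x * f x).
  move=> cf; have [B _ bf] := cper_bnd cf.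
  exact: (cvg_U oU (integral_L1_cvg_bnd im im0 (cper_mf cf) bf (ld_mL1 LD))).
have lim : minty_form (m n) (u n) (du n) (along V h (tp a)) (tp a) (tp b) (fun i => tp (dtp (basis_vec i) b)) -
    \int[mu]_x (m n x * along V h (tp a) x) @[n --> U] -->
  minty_form m0 u0 G (along V h (tp a)) (tp a) (tp b) (fun i => tp (dtp (basis_vec i) b)) -
    \int[mu]_x (m0 x * along V h (tp a) x).
  apply: cvgB; last exact: (LM _ cW).
  apply: cvgB; last first.
    apply: cvg_sumr => i; have [_ wG _] := lim_grad LD UU oU i.
    exact: (wG.2 _ (cper_L2 (cperM ca (cdb i)))).
  apply: cvgB; last first.
    have [B _ ba] := cper_bnd ca.
    apply: cvgB; first exact: (cvg_U oU (integral_L1_cvg_bnd iu iu0 (cper_mf ca) ba (ld_uL1 LD))).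
    exact: (cvg_U oU (integral_cvg_of_L1 iu iu0 (ld_uL1 LD))).
  apply: cvgD; last first.
    by apply: cvg_sumr => i; apply: cvgM; [exact: cvg_cst|exact: (LM _ (cperX 2 (cdb i)))].
  by apply: cvgD; [exact: cvg_cst|exact: (LM _ cb)].
rewrite -subr_ge0; apply: (cvgr_to_ge lim); have [N hN] := ap_minty AP b r0 ra.
apply: oU; exists N => // n Nn /=; have := hN n Nn.
by rewrite (minty_formE (im n) (iu n) (fun i => cper_itg (ap_du AP n i)) cW ca cb cdb).
Qed.

(** The convolutions of the test and its constants give admissible trigonometric tests. The term in
    which the limit density multiplies V at the test is known to converge only a.e., but it stands
    on the smaller side, so Fatou's lemma, after adding the lower bound [CL] of V, is enough. *)
Lemma lim_minty (et v : Rd -> R) (dv : 'I_d -> Rd -> R) : cper et -> (forall x, E (et x)) -> cper v ->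
  (forall i, cper (dv i)) -> (forall i x, is_derive x (basis_vec i) v (dv i x)) ->
  \int[mu]_x (m0 x * along V h et x) <= minty_form m0 u0 G (along V h et) et v dv.
Proof.
move=> ce Ee cv cdv dvD.
(* The added constant keeps the test away from 0, for [et] may vanish when E contains 0. *)
pose a n := (n.+1%:R^-1, (false, 0)) :: KKl n et : seq (R * (bool * 'rV[int]_d)).
have aE n x : tp (a n) x = n.+1%:R^-1 + KK n et x.
  by rewrite /tp /a big_cons md_cos0 mulr1 (KKE n x (cper_itg ce)).
have e0 x : 0 <= et x by exact: (E_ge0 A (Ee x)).
have ra n x : n.+1%:R^-1 <= tp (a n) x.
  by rewrite aE lerDl; apply: KK_ge0; [exact: cper_itg|exact: aeW].
have n0 n : 0 < n.+1%:R^-1 :> R by rewrite invr_gt0.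
have cW : cper (along V h et) by exact: (along_cper A ce Ee).
have ca n : cper (tp (a n)) by exact: cper_tp.
have Ea n x : E (tp (a n) x) by apply: (E_gt0 A); exact: lt_le_trans (ra n x).
have M n : MacE E (tp (a n)) by exact: cper_MacE.
have Me : MacE E et by exact: cper_MacE.
have [Be Be0 be] := cper_bnd ce.
have ba n x : `|tp (a n) x| <= Be + 1.
  rewrite aE addrC; apply: le_trans (ler_normD _ _) _; apply: lerD.
    by apply: KK_sup; [exact: cper_itg|exact: aeW].
  by rewrite (ger0_norm (ltW (n0 n))) invf_le1// ler1n.
have ac x : tp (a n) x @[n --> \oo] --> et x.
  rewrite (_ : (fun n => _) = fun n => n.+1%:R^-1 + KK n et x); last by apply/funext => n; exact: aE.
  by rewrite -[X in _ --> X]add0r; apply: cvgD; [exact: cvg_harmonic|exact: KK_unif_cvg].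
have aL1 := dct_bnd (fun n => cper_mf (ca n)) (cper_mf ce) ba (aeW _ ac).
have al0 := al_gt0 A.
have cpa n := cper_powR (ca n) (fun x => ltW (lt_le_trans (n0 n) (ra n x))) al0.
have cpe := cper_powR ce e0 al0.
have pc x : tp (a n) x `^ al @[n --> \oo] --> et x `^ al.
  by apply: powR_cvg al0 _ (ac x) => n; exact: ltW (lt_le_trans (n0 n) (ra n x)).
have pb n x : `|tp (a n) x `^ al| <= (Be + 1) `^ al.
  have t0 := ltW (lt_le_trans (n0 n) (ra n x)).
  rewrite ger0_norm ?powR_ge0//; apply: ge0_ler_powR; rewrite ?nnegrE ?(ltW al0)// ?addr_ge0//.
  exact: le_trans (ler_norm _) (ba n x).
have pL1 := dct_bnd (fun n => cper_mf (cpa n)) (cper_mf cpe) pb (aeW _ pc).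
have [s [hs Wc WL1]] := along_L1_cvg A M Me (aeW _ ac) (aL1 mu) (fun n => cper_itg (cpa n)) (cper_itg cpe)
  (integral_cvg_of_L1 (fun n => cper_itg (cpa n)) (cper_itg cpe) (pL1 mu)).
have cs := cvg_geid hs.
have cWn n : cper (along V h (tp (a n))) by exact: (along_cper A (ca n) (Ea n)).
pose X k := minty_form m0 u0 G (along V h (tp (a (s k)))) (tp (a (s k))) (KK (s k) v) (fun i => KK (s k) (dv i)).
have key k : \int[mu]_x (m0 x * along V h (tp (a (s k))) x) <= X k.
  have := lim_minty_trig (KKl (s k) v) (n0 (s k)) (ra (s k)).
  rewrite -(KK_tp (s k) (cper_itg cv)) (_ : (fun i => tp (dtp _ _)) = fun i => KK (s k) (dv i))//.
  by apply/funext => i; apply/funext => x; exact: (dtp_KKl (s k) x cv (cdv i) (dvD i)).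
have KKc (f : Rd -> R) x : cper f -> KK (s k) f x @[k --> \oo] --> f x.
  by move=> cf; exact: (cvg_comp _ _ cs (@KK_unif_cvg R d f x cf)).
have acs x : tp (a (s k)) x @[k --> \oo] --> et x by exact: (cvg_comp _ _ cs (ac x)).
have cst0 (w : Rd -> R) : \int[mu]_x `|w x - w x| @[k --> \oo] --> 0.
  by rewrite (_ : \int[mu]_x _ = 0); [exact: cvg_cst|rewrite -[RHS](@integral_cst_R _ _ _ mu 0); apply: eq_Rintegral => x _; rewrite subrr normr0].
have LI (w : Rd -> R) (c : nat -> Rd -> R) (c0 : Rd -> R) B : itg w -> (forall k, cper (c k)) -> cper c0 ->
    (forall k x, `|c k x| <= B) -> (forall x, c k x @[k --> \oo] --> c0 x) ->
    \int[mu]_x (w x * c k x) @[k --> \oo] --> \int[mu]_x (w x * c0 x).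
  move=> iw cc cc0 bc lc.
  exact: (integral_L1_bdd_cvg (fun=> iw) iw (cst0 w) (fun k => cper_mf (cc k)) (cper_mf cc0) bc lc).
have [Bv _ bv] := cper_bnd cv.
have bKv k x : `|KK (s k) v x| <= Bv by apply: KK_sup; [exact: cper_itg|exact: aeW].
have cKv k : cper (KK (s k) v) := cper_KK (s k) (cper_itg cv).
have cKd k i : cper (KK (s k) (dv i)) := cper_KK (s k) (cper_itg (cdv i)).
have /choice[Bd hBd] i : exists B : R, 0 <= B /\ forall k x, `|KK (s k) (dv i) x| <= B.
  have [B B0 bB] := cper_bnd (cdv i); exists B; split=> // k x.
  by apply: KK_sup; [exact: cper_itg|exact: aeW].
have b2 k i x : `|KK (s k) (dv i) x ^+ 2| <= Bd i ^+ 2.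
  by have [B0 hB] := hBd i; rewrite normrX ler_sqr ?nnegrE.
have c2 i x : KK (s k) (dv i) x ^+ 2 @[k --> \oo] --> dv i x ^+ 2.
  by under eq_cvg do rewrite expr2; rewrite expr2; apply: cvgM; exact: KKc.
have Be1 : 0 <= Be + 1 by rewrite addr_ge0.
have limX : X k @[k --> \oo] --> minty_form m0 u0 G (along V h et) et v dv.
  apply: cvgB; last first.
    apply: cvg_sumr => i; have [B0 hB] := hBd i.
    apply: (LI _ _ _ ((Be + 1) * Bd i) (iG i)) => [k||k x|x].
    - exact: (cperM (ca _) (cKd _ _)).
    - exact: (cperM ce (cdv i)).
    - by rewrite normrM ler_pM.
    - by apply: cvgM; [exact: acs|exact: KKc].
  apply: cvgB; last first.
    by apply: cvgB; [exact: (LI _ _ _ (Be + 1) iu0 (fun k => ca (s k)) ce (fun k => ba (s k)) acs)|exact: cvg_cst].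
  apply: cvgD; last first.
    apply: cvg_sumr => i; apply: cvgM; first exact: cvg_cst.
    exact: (LI _ _ _ (Bd i ^+ 2) im0 (fun k => cperX 2 (cKd k i)) (cperX 2 (cdv i)) (fun k x => b2 k i x) (c2 i)).
  apply: cvgD; last exact: (LI _ _ _ Bv im0 cKv cv bKv (fun x => KKc v x cv)).
  apply: cvgB; last exact: (LI _ _ _ Bv (itg_cst 1) cKv cv bKv (fun x => KKc v x cv)).
  apply: cvgD.
    exact: (integral_L1_bdd_cvg (fun k => cper_itg (cWn (s k))) (cper_itg cW) WL1 (fun k => cper_mf (ca (s k))) (cper_mf ce) (fun k => ba (s k)) acs).
  apply: cvg_sumr => i; apply: cvgM; first exact: cvg_cst.
  apply: (LI _ _ _ ((Be + 1) * Bd i ^+ 2) (itg_cst 1)) => [k||k x|x].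
  - exact: (cperM (ca _) (cperX 2 (cKd _ _))).
  - exact: (cperM ce (cperX 2 (cdv i))).
  - by rewrite normrM ler_pM.
  - by apply: cvgM; [exact: acs|exact: c2].
have [cL [CL [cL0 CL0 hlo]]] := along_ge A.
have IB (f : Rd -> R) : cper f -> itg (fun x => m0 x * f x).
  by move=> cf; have [B _ bf] := cper_bnd cf; exact: (itgMr_bnd (cper_mf cf) bf im0).
have cWC k : cper (fun x => along V h (tp (a (s k))) x + CL) := cperD (cWn (s k)) (cper_cst CL).
have cWC0 : cper (fun x => along V h et x + CL) := cperD cW (cper_cst CL).
have mC (W : Rd -> R) : cper W -> \int[mu]_x (m0 x * (W x + CL)) = \int[mu]_x (m0 x * W x) + CL * \int[mu]_x m0 x.
  move=> cW'; rewrite -(integralZ_R _ im0) -(integralD_R (IB _ cW') (itgZ _ im0)).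
  by apply: eq_Rintegral => x _; rewrite mulrDr [m0 x * CL]mulrC.
have [] := @fatou_R _ _ _ mu (fun k x => m0 x * (along V h (tp (a (s k))) x + CL)) (fun x => m0 x * (along V h et x + CL))
  (fun k => X k + CL * \int[mu]_x m0 x) (minty_form m0 u0 G (along V h et) et v dv + CL * \int[mu]_x m0 x).
- by move=> k; exact: (IB _ (cWC k)).
- move=> k; apply: filterS (hlo _ (M (s k))) => x hx; rewrite mulr_ge0// -lerBlDr sub0r.
  by apply: le_trans hx; rewrite lerDr mulr_ge0 ?powR_ge0// ltW.
- exact: itg_mf (IB _ cWC0).
- apply: filterS Wc => x hx; apply: cvgM; first exact: cvg_cst.
  by apply: cvgD; [exact: hx|exact: cvg_cst].
- by move=> k; rewrite (mC _ (cWn (s k))) lerD2r.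
- by apply: cvgD; [exact: limX|exact: cvg_cst].
by rewrite (mC _ cW) lerD2r.
Qed.

Lemma lim_weak_solution : weak_solution E V h (distr_of m0) (distr_of u0).
Proof.
have dI (f : Rd -> R) : itg f -> is_distribution (distr_of f).
  move=> i_f; split.
    move=> c phi ps cphi cps; have [B1 _ b1] := cper_bnd (Cinf_cper cphi); have [B2 _ b2] := cper_bnd (Cinf_cper cps).
    have i1 := itgMr_bnd (cper_mf (Cinf_cper cphi)) b1 i_f; have i2 := itgMr_bnd (cper_mf (Cinf_cper cps)) b2 i_f.
    rewrite /distr_of -(integralZ_R _ i1) -(integralD_R (itgZ _ i1) i2); apply: eq_Rintegral => x _; ring.
  exists 0%N, (\int[mu]_x `|f x|) => phi B cphi hB.
  have bB x : `|phi x| <= B by exact: (hB [::] x).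
  have i1 := itgMr_bnd (cper_mf (Cinf_cper cphi)) bB i_f.
  apply: le_trans (integral_abs_R i1) _; rewrite mulrC -(integralZ_R _ (itg_abs i_f)).
  apply: (integral_le_R (itg_abs i1) (itgZ _ (itg_abs i_f))) => x.
  by rewrite normrM mulrC ler_wpM2r.
split; [exact: dI|exact: dI|by move=> phi _ p0; apply: integral_ge0_R => x; rewrite mulr_ge0|].
move=> et v [cet Eet] cv.
have [ce de] := @Cinf_partial _ _ [::] et cet; have [cv0 dv] := @Cinf_partial _ _ [::] v cv.
have cdv i := (@Cinf_partial _ _ [:: i] v cv).1; have ddv i := (@Cinf_partial _ _ [:: i] v cv).2.
have cde i := (@Cinf_partial _ _ [:: i] et cet).1.
have cvv i : cper (partial [:: i; i] v) := (@Cinf_partial _ _ [:: i; i] v cv).1.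
have cW : cper (along V h et) by exact: (along_cper A ce Eet).
have M := lim_minty ce Eet cv0 cdv dv.
rewrite -subr_ge0 -(minty_formE im0 iu0 iG cW ce cv0 cdv) in M.
pose P i x := partial [:: i] et x * partial [:: i] v x + et x * partial [:: i; i] v x.
have cP i : cper (P i) := cperD (cperM (cde i) (cdv i)) (cperM ce (cvv i)).
have dP i x : is_derive x (basis_vec i) (fun y => et y * partial [:: i] v y) (P i x).
  have D := is_deriveM (de i x) (ddv i i x); apply: (is_derive_eq D).
  by rewrite /GRing.scale/= /P addrC; congr (_ + _); rewrite mulrC.
have cev i : cper (fun x => et x * partial [:: i] v x) := cperM ce (cdv i).
have A2E x : A2 et v x = et x - 1 - \sum_i P i x.
  rewrite /A2 addrAC; congr (_ - _ - _); apply: eq_bigr => i _; exact: derive_val.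
have cA1 : cper (A1 V h et v).
  apply: cperD cW; apply: cperB; first by have := cperB (cper_cst 0) cv0; congr cper; apply/funext => x; rewrite sub0r.
  by apply: cperM (cper_cst _); apply: cper_sum => i; exact: (cperX 2 (cdv i)).
have IB (w f : Rd -> R) : itg w -> cper f -> itg (fun x => w x * f x).
  by move=> iw cf; have [B _ bf] := cper_bnd cf; exact: (itgMr_bnd (cper_mf cf) bf iw).
have ce1 : cper (fun x => et x - 1) := cperB ce (cper_cst 1).
(* The divergence in [A2] is integrated by parts against any w with a gradient in the weak sense; it
   is used for the smooth v and for the limit [u0]. *)
have A2w (w : Rd -> R) (wg : 'I_d -> Rd -> R) : itg w ->
    (forall i, \int[mu]_x (w x * P i x) = - \int[mu]_x (wg i x * (et x * partial [:: i] v x))) ->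
    \int[mu]_x (w x * A2 et v x) = \int[mu]_x (w x * (et x - 1)) + \sum_i \int[mu]_x (wg i x * (et x * partial [:: i] v x)).
  move=> iw hw; have i1 := IB _ _ iw ce1; have i2 i := IB _ _ iw (cP i).
  rewrite (_ : \sum_i _ = - \sum_i \int[mu]_x (w x * P i x)); last first.
    by rewrite -sumrN; apply: eq_bigr => i _; rewrite hw opprK.
  rewrite -(integral_sum_R _ i2) -(integralB_R i1 (itg_sum _ i2)); apply: eq_Rintegral => x _.
  by rewrite A2E mulrBr mulr_sumr.
have hv i : \int[mu]_x (v x * P i x) = - \int[mu]_x (partial [:: i] v x * (et x * partial [:: i] v x)).
  exact: (integration_by_parts_torus cv0 (cev i) (cdv i) (cP i) (dv i) (dP i)).
have hu i : \int[mu]_x (u0 x * P i x) = - \int[mu]_x (G i x * (et x * partial [:: i] v x)).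
  by have [_ _ hG] := lim_grad LD UU oU i; exact: (hG _ _ (cev i) (cP i) (dP i)).
rewrite /distr_of (A2w v _ (cper_itg cv0) hv) (A2w u0 _ iu0 hu).
have i1 := cper_itg (cperM ce cA1); have i2 := IB _ _ im0 cA1.
have i3 := cper_itg (cperM cv0 ce1); have i4 := IB _ _ iu0 ce1.
have i5 i := cper_itg (cperM (cdv i) (cev i)); have i6 i := IB _ _ (iG i) (cev i).
have j5 := itg_sum (index_enum 'I_d) i5; have j6 := itg_sum (index_enum 'I_d) i6.
rewrite -(integral_sum_R _ i5) -(integral_sum_R _ i6) -(integralD_R i3 j5) -(integralD_R i4 j6).
rewrite -(integralB_R (itgD i3 j5) (itgD i4 j6)) -(integralB_R i1 i2).
rewrite -(integralD_R (itgB i1 i2) (itgB (itgD i3 j5) (itgD i4 j6))).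
apply: (le_trans M); rewrite le_eqVlt; apply/orP; left; apply/eqP; apply: eq_Rintegral => x _.
have e1 : \sum_i et x * partial [:: i] v x * (partial [:: i] v x - G i x) =
    \sum_i partial [:: i] v x * (et x * partial [:: i] v x) - \sum_i G i x * (et x * partial [:: i] v x).
  by rewrite -sumrB; apply: eq_bigr => i _; ring.
rewrite -[partial [::] et x]/(et x) -[partial [::] v x]/(v x) e1 /A1; ring.
Qed.

End limit_minty.

Section kernel_inequalities.
Context {R : realType} {d : nat}.
Local Notation Rd := 'rV[R]_d.
Local Notation mu := (@torus_measure R d).
Local Notation itg f := (mu.-integrable setT (EFin \o f)).
Implicit Types (f : Rd -> R) (x : Rd).

Lemma KKZ n (c : R) f x : itg f -> KK n (fun y => c * f y) x = c * KK n f x.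
Proof.
move=> i_f; rewrite /KK -(integralZ_R _ (itg_KernM n x i_f)).
by apply: eq_Rintegral => y _; rewrite mulrCA.
Qed.

(** Convolve the tangent inequality [2 c f - c^2 <= f^2] with c the value of the convolution at
    x. *)
Lemma KK_jensen n f x : L2 mu f -> KK n f x ^+ 2 <= KK n (fun y => f y ^+ 2) x.
Proof.
move=> l2; have i1 := L2_itg l2; have [_ i2] := l2; pose c := KK n f x.
have i3 := itgZ (2 * c) i1; have i4 := itg_cst (c ^+ 2) : itg (fun=> c ^+ 2).
rewrite [leLHS](_ : _ = KK n (fun y => 2 * c * f y - c ^+ 2) x); last first.
  by rewrite (KKB n x i3 i4) (KKZ n _ x i1) KK_cst -/c; ring.
apply: (KK_le n x (itgB i3 i4) i2); apply: aeW => y.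
by have := sqr_ge0 (f y - c); rewrite sqrrB; lra.
Qed.

Lemma powR_young (y t a : R) : 0 <= y -> 0 <= t -> 0 < a ->
  t `^ a * y <= (a + 1)^-1 * y `^ (a + 1) + a / (a + 1) * t `^ (a + 1).
Proof.
move=> y0 t0 a0; have a1 : 0 < a + 1 by rewrite addr_gt0.
have := @conjugate_powR R y (t `^ a) (a + 1) ((a + 1) / a) y0 (powR_ge0 _ _) a1 (divr_gt0 a1 a0).
rewrite -powRrM mulrCA divff ?gt_eqF// mulr1 mulrC => H.
rewrite [leLHS]mulrC; apply: le_trans (H _) _; first by field; rewrite !gt_eqF.
by rewrite le_eqVlt; apply/orP; left; apply/eqP; field; rewrite !gt_eqF.
Qed.

Lemma KK_powR_le n f (a : R) : 0 < a -> itg f -> (forall x, 0 <= f x) -> itg (fun x => f x `^ (a + 1)) ->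
  (forall x, f x `^ a * KK n f x <= (a + 1)^-1 * KK n (fun y => f y `^ (a + 1)) x + a / (a + 1) * f x `^ (a + 1)).
Proof.
move=> a0 i_f f0 ip x.
have i1 := itgZ (a + 1)^-1 ip; have i2 := itg_cst (a / (a + 1) * f x `^ (a + 1)) : itg (fun=> _).
rewrite -(KKZ n _ x i_f) -(KKZ n _ x ip) -[X in _ <= _ + X](KK_cst n _ x) -(KKD n x i1 i2).
by apply: (KK_le n x (itgZ _ i_f) (itgD i1 i2)); apply: aeW => y; exact: powR_young.
Qed.

End kernel_inequalities.

(** * Energy inequality and complementarity *)

Section complementarity.
Context {R : realType} {d : nat} {E : set R} {h : ('rV[R]_d -> R) -> 'rV[R]_d -> R}
  {g g1 g2 V : 'rV[R]_d -> R -> R -> R} {al ka : R}.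
Context (A : assumptions E h g g1 g2 V al ka).
Local Notation Rd := 'rV[R]_d.
Local Notation mu := (@torus_measure R d).
Local Notation itg f := (mu.-integrable setT (EFin \o f)).
Context {C : R} {m u : nat -> Rd -> R} {dm du : nat -> 'I_d -> Rd -> R} {m0 u0 : Rd -> R} {sS : R}.
Context (LD : @limit_data R d E h V al C m u dm du m0 u0 sS).
Context (U : set_system nat) (UU : UltraFilter U) (oU : \oo `<=` U).

Let PU : ProperFilter U. Proof. exact: ultra_proper. Qed.
Let AP := ld_ap LD.
Let al0 := al_gt0 A.
Let im0 : itg m0 := (ld_E LD).1.2.
Let iu0 : itg u0 := (ld_u0 LD).2.
Let m0p x : 0 <= m0 x := ltW (ld_m0 LD x).
Let mp n x : 0 <= m n x := ltW (ap_m0 AP n x).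
Local Notation G := (weak_grad u0).
Let iG (i : 'I_d) : itg (G i).
Proof. by have [[_ [_ ?] _] _ _] := lim_grad LD UU oU i. Qed.
Let lG (i : 'I_d) : L2 mu (G i).
Proof. by have [_ [? _] _] := lim_grad LD UU oU i. Qed.
Let imG2 (i : 'I_d) : itg (fun x => m0 x * G i x ^+ 2) := itg_mG2 LD UU oU i.
Let W0 := along V h m0.
Let iW0 : itg W0 := itg_W0 A LD.

Lemma lim_dissipation : \sum_i \int[mu]_x (m0 x * G i x ^+ 2) <= sS.
Proof.
pose Z n i := \int[mu]_x (m n x * du n i x ^+ 2).
have /choice[z hz] i : exists l : R, Z n i @[n --> U] --> l.
  have [|l hl _] := @ultra_bounded_cvg R _ U (Z ^~ i) C UU; last by exists l.
  move=> n; rewrite ger0_norm; first exact: (bound_mdu LD).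
  by apply: integral_ge0_R => x; rewrite mulr_ge0 ?sqr_ge0.
have -> : sS = \sum_i z i.
  apply: (cvg_uniq_U UU (cvg_U oU (ld_S LD))).
  rewrite (_ : (fun n => _) = fun n => \sum_i Z n i); first exact: cvg_sumr.
  apply/funext => n; rewrite -(integral_sum_R _ (fun i => cper_itg (cperM (ap_m AP n) (cperX 2 (ap_du AP n i))))).
  by apply: eq_Rintegral => x _; rewrite mulr_sumr.
apply: ler_sum => i _; have [wH _] := lim_weighted LD UU oU i.
rewrite (_ : \int[mu]_x _ = \int[mu]_x (1 * (Num.sqrt (m0 x) * G i x) ^+ 2)); last first.
  by apply: eq_Rintegral => x _; rewrite mul1r exprMn sqr_sqrtr.
apply: (wcvg_lsc UU (w := fun=> 1) (B := 1) _ wH (measurable_cst _) _ _ (hz i)) => [n|x|n].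
- apply: cper_L2; apply: (cperM _ (ap_du AP n i)).
  by apply: (@cper_comp _ _ (@Num.sqrt R) _ (ap_m AP n)) => x; exact: sqrt_continuous.
- by rewrite ler01 lexx.
- by rewrite le_eqVlt; apply/orP; left; apply/eqP; apply: eq_Rintegral => x _; rewrite mul1r exprMn sqr_sqrtr.
Qed.

(** V is bounded below by [- CL], so Fatou's lemma applies to [m (V + CL)]. If the Fokker-Planck
    equation could be tested with [u0], this would say that the integral of m times the
    Hamilton-Jacobi expression is at most 0. *)
Lemma lim_energy : itg (fun x => m0 x * W0 x) /\
  \int[mu]_x (m0 x * W0 x) <= \int[mu]_x u0 x - 2^-1 * \sum_i \int[mu]_x (m0 x * G i x ^+ 2).
Proof.
have [cL [CL [cL0 CL0 hlo]]] := along_ge A.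
have Em n x : E (m n x) := E_gt0 A (ap_m0 AP n x).
have cW n : cper (along V h (m n)) := along_cper A (ap_m AP n) (Em n).
have im n := cper_itg (ap_m AP n).
have imW n := cper_itg (cperM (ap_m AP n) (cW n)).
pose b n := \int[mu]_x u n x + C / n.+1%:R - 2^-1 * \int[mu]_x (m n x * \sum_i du n i x ^+ 2) + CL * \int[mu]_x m n x.
have cb : b n @[n --> \oo] --> \int[mu]_x u0 x + 0 - 2^-1 * sS + CL * \int[mu]_x m0 x.
  apply: cvgD; last first.
    by apply: cvgM; [exact: cvg_cst|exact: (integral_cvg_of_L1 im im0 (ld_mL1 LD))].
  apply: cvgB; last by apply: cvgM; [exact: cvg_cst|exact: (ld_S LD)].
  apply: cvgD; last exact: nS_inv_cvg0.
  exact: (integral_cvg_of_L1 (fun n => cper_itg (ap_u AP n)) iu0 (ld_uL1 LD)).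
have [||||//|iF le] := @fatou_R _ _ _ mu (fun n x => m n x * (along V h (m n) x + CL)) (fun x => m0 x * (W0 x + CL)) b _ _ _ _ _ _ cb.
- by move=> n; exact: (cper_itg (cperM (ap_m AP n) (cperD (cW n) (cper_cst CL)))).
- move=> n; apply: filterS (hlo _ (cper_MacE (ap_m AP n) (Em n))) => x hx.
  by rewrite mulr_ge0// -lerBlDr sub0r; apply: le_trans hx; rewrite lerDr mulr_ge0 ?powR_ge0// ltW.
- apply: measurable_funM; first exact: (itg_mf im0).
  exact: (itg_mf (itgD iW0 (itg_cst CL))).
- apply: filterS2 (ld_m LD) (ld_W LD) => x h1 h2; apply: cvgM; first exact: h1.
  by apply: cvgD; [exact: h2|exact: cvg_cst].
- move=> n; rewrite (_ : \int[mu]_x _ = \int[mu]_x (m n x * along V h (m n) x) + CL * \int[mu]_x m n x).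
    by rewrite /b lerD2r lerBrDr; exact: (ap_energy AP n).
  rewrite -(integralZ_R _ (im n)) -(integralD_R (imW n) (itgZ _ (im n))).
  by apply: eq_Rintegral => x _; rewrite mulrDr [m n x * CL]mulrC.
have imW0 : itg (fun x => m0 x * W0 x).
  apply: eq_integrable (itgB iF (itgZ CL im0)) => // x _ /=; congr EFin; ring.
split=> //; move: le.
rewrite (_ : \int[mu]_x _ = \int[mu]_x (m0 x * W0 x) + CL * \int[mu]_x m0 x).
  by have := lim_dissipation; rewrite addr0 lerD2r; lra.
rewrite -(integralZ_R _ im0) -(integralD_R imW0 (itgZ _ im0)).
by apply: eq_Rintegral => x _; rewrite mulrDr [m0 x * CL]mulrC.
Qed.

(** Test the Fokker-Planck equation with [KK n u0]. By symmetry the kernel moves from u to m in the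
    zeroth-order term; in the gradient term Young's and Jensen's inequalities give [m KK (G^2)],
    from which the kernel moves to m again and cancels the quadratic part of the Hamilton-Jacobi
    expression. *)
Lemma lim_KK_test n : \int[mu]_x (KK n m0 x * HJ V h m0 u0 x) <=
  \int[mu]_x (KK n m0 x * W0 x) - \int[mu]_x u0 x + 2^-1 * \sum_i \int[mu]_x (m0 x * G i x ^+ 2).
Proof.
have cKm := cper_KK n im0; have cKu := cper_KK n iu0; have cKG i := cper_KK n (iG i).
have wd i : weak_d i u0 (G i).
  move=> b k; have [_ _ hG] := lim_grad LD UU oU i.
  have cd : cper (fun x : Rd => (msgn b : R) * ang k (basis_vec i) * md (~~ b) k x) := cperM (cper_cst _) (cper_md _ _).
  have := hG _ _ (cper_md b k) cd (fun x => is_derive_md b k x _).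
  rewrite (_ : \int[mu]_x (u0 x * _) = msgn b * ang k (basis_vec i) * \int[mu]_x (md (~~ b) k x * u0 x)).
    move=> ->; rewrite opprK; apply: eq_Rintegral => x _; exact: mulrC.
  rewrite -(integralZ_R _ (itg_md _ _ iu0)); apply: eq_Rintegral => x _; ring.
have FP := lim_fp LD UU oU cKu cKG (fun i x => is_derive_KK n x iu0 (iG i) (wd i)).
have IB (w f : Rd -> R) : itg w -> cper f -> itg (fun x => f x * w x).
  by move=> iw cf; have [B _ bf] := cper_bnd cf; exact: (itgM_bnd (cper_mf cf) bf iw).
have i1 := IB _ _ iu0 cKm; have i2 i := IB _ _ (lG i).2 cKm; have i3 := IB _ _ iW0 cKm.
have j2 := itg_sum (index_enum 'I_d) i2.
have -> : \int[mu]_x (KK n m0 x * HJ V h m0 u0 x) =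
    \int[mu]_x (KK n m0 x * W0 x) - \int[mu]_x (KK n m0 x * u0 x) - 2^-1 * \sum_i \int[mu]_x (KK n m0 x * G i x ^+ 2).
  rewrite -(integral_sum_R _ i2) -(integralB_R i3 i1) -(integralZ_R _ j2) -(integralB_R (itgB i3 i1) (itgZ _ j2)).
  by apply: eq_Rintegral => x _; rewrite -mulr_sumr /HJ -/W0; field.
have e1 : \int[mu]_x ((m0 x - 1) * KK n u0 x) = \int[mu]_x (KK n m0 x * u0 x) - \int[mu]_x u0 x.
  rewrite (KK_sym n im0 iu0) -(integral_KK n iu0).
  have i4 := IB _ _ im0 cKu; have i5 := cper_itg cKu.
  have i4' : itg (fun x => m0 x * KK n u0 x) by apply: eq_integrable i4 => // x _ /=; rewrite mulrC.
  by rewrite -(integralB_R i4' i5); apply: eq_Rintegral => x _; rewrite mulrBl mul1r.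
have e2 i : \int[mu]_x (m0 x * G i x * KK n (G i) x) <=
    2^-1 * \int[mu]_x (m0 x * G i x ^+ 2) + 2^-1 * \int[mu]_x (KK n m0 x * G i x ^+ 2).
  have cK2 := cper_KK n (lG i).2; have i4 := IB _ _ im0 cK2.
  have i4' : itg (fun x => m0 x * KK n (fun y => G i y ^+ 2) x) by apply: eq_integrable i4 => // x _ /=; rewrite mulrC.
  rewrite (KK_sym n im0 (lG i).2) -(integralZ_R _ (imG2 i)) -(integralZ_R _ i4') -(integralD_R (itgZ _ (imG2 i)) (itgZ _ i4')).
  have i5 := IB _ _ (itg_mG LD UU oU i) (cKG i).
  have i5' : itg (fun x => m0 x * G i x * KK n (G i) x) by apply: eq_integrable i5 => // x _ /=; rewrite mulrC.
  apply: (integral_le_R i5' (itgD (itgZ _ (imG2 i)) (itgZ _ i4'))) => x.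
  have := mulr_ge0 (m0p x) (sqr_ge0 (G i x - KK n (G i) x)).
  have := ler_wpM2l (m0p x) (KK_jensen n x (lG i)).
  by rewrite sqrrB; move: (KK n _ x) (KK n _ x) => a b; lra.
have := ler_sum (index_enum 'I_d) (P := xpredT) (fun i _ => e2 i); rewrite big_split/= -!mulr_sumr.
rewrite e1 in FP; move: FP.
set S1 := \sum_i _; set S2 := \sum_i _; set S3 := \sum_i _; lra.
Qed.

(** Fatou's lemma is applied to [KK n m0] times the nonnegative sum of H and the gap in (V3). The
    integral of V against [KK n m0], whose limit is not known, cancels between this gap and
    [lim_KK_test]. In the limit the energy inequality bounds the integral of [H m0] by 0. *)
Lemma lim_complementarity : {ae mu, forall x, HJ V h m0 u0 x * m0 x = 0}.
Proof.
have iH := itg_HJ A LD UU oU; have H0 := lim_hj_ge0 A LD UU oU.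
set H := HJ V h m0 u0 in iH H0 *.
have [imW0 en] := lim_energy; have ip := lim_pow A LD.
have ch := cper_h A (MacE_Mac A (ld_E LD)); have cah := cper_norm ch.
have c1h : cper (fun x => 1 + `|h m0 x|) := cperD (cper_cst 1) cah.
have cKm n := cper_KK n im0.
have ia := itg_m0_al A LD.
have IB (w f : Rd -> R) : itg w -> cper f -> itg (fun x => f x * w x).
  by move=> iw cf; have [B _ bf] := cper_bnd cf; exact: (itgM_bnd (cper_mf cf) bf iw).
pose T := ka * \int[mu]_x m0 x `^ (al + 1) - \int[mu]_x u0 x + 2^-1 * \sum_i \int[mu]_x (m0 x * G i x ^+ 2).
pose b n := ka * \int[mu]_x (KK n m0 x * (1 + `|h m0 x|)) + T.
pose F n x := KK n m0 x * (ka * (1 + m0 x `^ al + `|h m0 x|) - W0 x + H x).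
have ka0 := ka_gt0 A.
have iQ : itg (fun x => ka * (1 + m0 x `^ al + `|h m0 x|) - W0 x + H x).
  exact: (itgD (itgB (itgZ ka (itgD (itgD (itg_cst 1) ia) (cper_itg cah))) iW0) iH).
have Fb n : \int[mu]_x F n x <= b n.
  have k1 := cper_itg (cperM (cKm n) c1h); have k2 := IB _ _ ia (cKm n).
  have k3 := IB _ _ iW0 (cKm n); have k4 := IB _ _ iH (cKm n).
  have -> : \int[mu]_x F n x = ka * \int[mu]_x (KK n m0 x * (1 + `|h m0 x|)) + ka * \int[mu]_x (KK n m0 x * m0 x `^ al) -
      \int[mu]_x (KK n m0 x * W0 x) + \int[mu]_x (KK n m0 x * H x).
    rewrite -(integralZ_R _ k1) -(integralZ_R _ k2) -(integralD_R (itgZ _ k1) (itgZ _ k2)).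
    rewrite -(integralB_R (itgD (itgZ _ k1) (itgZ _ k2)) k3) -(integralD_R (itgB (itgD (itgZ _ k1) (itgZ _ k2)) k3) k4).
    by apply: eq_Rintegral => x _; rewrite /F; ring.
  (* Young's inequality under the kernel, whose mass is 1, bounds the mixed integral by that of the
     full power, uniformly in n. *)
  have young : \int[mu]_x (KK n m0 x * m0 x `^ al) <= \int[mu]_x m0 x `^ (al + 1).
    have iK := itgZ (al + 1)^-1 (itg_KK n ip); have iP := itgZ (al / (al + 1)) ip.
    apply: (@le_trans _ _ (\int[mu]_x ((al + 1)^-1 * KK n (fun y => m0 y `^ (al + 1)) x + al / (al + 1) * m0 x `^ (al + 1)))).
      apply: (integral_le_R k2 (itgD iK iP)) => x; rewrite mulrC; exact: KK_powR_le.
    rewrite (integralD_R iK iP) (integralZ_R _ (itg_KK n ip)) (integralZ_R _ ip) (integral_KK n ip) -mulrDl.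
    rewrite (_ : _ + _ = 1) ?mul1r//; field; by rewrite gt_eqF// addr_gt0.
  have := lim_KK_test n; rewrite -/H; rewrite -(ler_pM2l ka0) in young; rewrite /b /T.
  move: young; set X1 := ka * _; set X2 := ka * _; set X3 := ka * _; lra.
have [s hs sc] : exists2 s : nat -> nat, (forall k, (k <= s k)%N) &
    {ae mu, forall x, `|KK (s k) m0 x - m0 x| @[k --> \oo] --> 0}.
  apply: (@ae_subseq _ _ _ mu (fun n x => `|KK n m0 x - m0 x|)) => //; last exact: KK_L1_cvg_itg.
  by move=> n; exact: (itg_abs (itgB (itg_KK n im0) im0)).
have KK0 n x : 0 <= KK n m0 x by apply: KK_ge0 => //; exact: aeW.
have lim : b (s k) @[k --> \oo] --> ka * \int[mu]_x (m0 x * (1 + `|h m0 x|)) + T.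
  apply: (cvg_comp _ _ (cvg_geid hs)); apply: cvgD; last exact: cvg_cst.
  apply: cvgM; first exact: cvg_cst.
  have [B _ bf] := cper_bnd c1h.
  exact: (integral_L1_cvg_bnd (fun n => itg_KK n im0) im0 (cper_mf c1h) bf (KK_L1_cvg_itg im0)).
pose F0 x := m0 x * (ka * (1 + m0 x `^ al + `|h m0 x|) - W0 x + H x).
have [||||k|iF0 le] := @fatou_R _ _ _ mu (fun k => F (s k)) F0 (fun k => b (s k)) _ _ _ _ _ _ lim.
- by move=> k; exact: (IB _ _ iQ (cKm (s k))).
- move=> k; apply: filterS H0 => x hx; rewrite /F mulr_ge0//; apply: addr_ge0 => //.
  by rewrite subr_ge0; apply: (along_le A); exact: (ld_E LD).
- exact: (measurable_funM (itg_mf im0) (itg_mf iQ)).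
- apply: filterS sc => x hx; apply: cvgM; last exact: cvg_cst.
  by apply: cvg_of_sub0; apply: norm_cvg0.
- exact: Fb.
have k1 : itg (fun x => m0 x * (1 + `|h m0 x|)) by apply: eq_integrable (IB _ _ im0 c1h) => // x _ /=; rewrite mulrC.
have pE x : m0 x `^ (al + 1) = m0 x * m0 x `^ al.
  by rewrite powRD ?powRr1 1?mulrC//; apply/implyP => _; rewrite gt_eqF// (ld_m0 LD).
have iS := itgB (itgD (itgZ ka k1) (itgZ ka ip)) imW0.
have HE x : H x * m0 x = F0 x - (ka * (m0 x * (1 + `|h m0 x|)) + ka * m0 x `^ (al + 1) - m0 x * W0 x).
  by rewrite /F0 pE; ring.
have iHm : itg (fun x => H x * m0 x) by apply: eq_integrable (itgB iF0 iS) => // x _ /=; rewrite HE.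
apply: (integral_eq0_ae iHm); first by apply: filterS H0 => x hx; rewrite mulr_ge0.
rewrite (_ : \int[mu]_x _ = \int[mu]_x F0 x - (ka * \int[mu]_x (m0 x * (1 + `|h m0 x|)) + ka * \int[mu]_x m0 x `^ (al + 1) - \int[mu]_x (m0 x * W0 x))).
  by move: le en; rewrite /T; set X1 := ka * _; set X2 := ka * _; lra.
rewrite -(integralZ_R _ k1) -(integralZ_R _ ip) -(integralD_R (itgZ _ k1) (itgZ _ ip)).
rewrite -(integralB_R (itgD (itgZ _ k1) (itgZ _ ip)) imW0) -(integralB_R iF0 iS).
by apply: eq_Rintegral => x _; rewrite HE.
Qed.

End complementarity.

Theorem corollary6p3 (R : realType) (d : nat) (hd : (1 <= d)%N)
    (E : set R) (hE : E = [set t | 0 < t] \/ E = [set t | 0 <= t])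
    (h : ('rV[R]_d -> R) -> 'rV[R]_d -> R)
    (g g1 g2 V : 'rV[R]_d -> R -> R -> R) (alpha kappa1 : R)
    (hop : is_operator h)
    (hg : continuous3 E g)
    (hV : smooth3 E V)
    (hreg : h_regularity h)
    (hlip : h_lipschitz h)
    (hgs : g_structure E h g g1 g2)
    (hV1 : V1 E h g V)
    (hV2 : V2 alpha kappa1 E h g1 V)
    (hV3 : V3 alpha kappa1 E V)
    (halpha : (8 <= d)%N -> (d%:R - 4) / 2 < alpha) :
  exists m u : 'rV[R]_d -> R,
    [/\ MacE E m, L1 u &
        weak_solution E V h (distr_of m) (distr_of u)] /\
    [/\ sobolev 1 (fun x => m x `^ ((alpha + 1) / 2)),
        sobolev 1 u &
        \int[torus_measure d]_x m x = 1] /\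
    (L1 (HJ V h m u) /\ distr_ge0 (distr_of (HJ V h m u))) /\
    {ae torus_measure d, forall x, HJ V h m u x * m x = 0} /\
    exists2 w : 'rV[R]_d -> R,
      weak_div (fun i x => m x * weak_grad u i x) w &
      {ae torus_measure d, forall x, m x - w x - 1 = 0}.
Proof.
have A : assumptions E h g g1 g2 V alpha kappa1 by split.
have [C [m [u [dm [du [m0 [u0 [sS LD]]]]]]]] := limit_exists A.
have [U UU oU] := @ultra_eventually.
have pG i : periodic (weak_grad u0 i) by have [[_ [? _] _] _ _] := lim_grad LD UU oU i.
have pm : periodic m0 := (ld_E LD).1.1.
have iH := itg_HJ A LD UU oU; have H0 := lim_hj_ge0 A LD UU oU.
have im1 := itgB (ld_E LD).1.2 (itg_cst 1).
exists m0, u0; split; [split|split; [split|split; [split|split]]].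
- exact: (ld_E LD).
- exact: (ld_u0 LD).
- exact: (lim_weak_solution A LD UU oU).
- exact: (sobolev_m0 A LD UU oU).
- exact: (sobolev_u0 LD UU oU).
- exact: (lim_mass LD UU oU).
- split=> // x i; rewrite /HJ (ld_u0 LD).1 (along_periodic A (ld_E LD)).
  by congr (_ - _ / 2 + _); apply: eq_bigr => j _; rewrite pG.
- move=> phi cphi p0; have [B _ bp] := cper_bnd (Cinf_cper cphi).
  apply: integral_aege0; first by apply: filterS H0 => x hx; rewrite mulr_ge0.
  exact: (itgMr_bnd (cper_mf (Cinf_cper cphi)) bp iH).
- exact: (lim_complementarity A LD UU oU).
exists (fun x => m0 x - 1); last by apply: aeW => x; ring.
split.
- by move=> i; split; [move=> x j; rewrite pm pG|exact: (itg_mG LD UU oU)].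
- by split=> // x i; rewrite pm.
move=> phi cphi; have [c0 dp] := @Cinf_partial _ _ [::] phi cphi.
exact: (lim_fp LD UU oU c0 (fun i => (@Cinf_partial _ _ [:: i] phi cphi).1) dp).
Qed.
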